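(* Let $\Omega,d,N,T,\mathcal D,A,\boldsymbol f,s,\boldsymbol u,\gamma,C_f,\boldsymbol\rho_0$ satisfy the structural assumptions listed in the context. Fix $\varepsilon>0$ and a partition $0=t_0<\dots<t_{N_t}=T$ with steps $\tau_n=t_n-t_{n-1}$. Let $\{\mathcal T_{h_m}\}_{m\in\mathbb N}$ be a sequence of meshes as in the context, with $h_m\le1$ decreasing to $0$, and let the abstract Assumption (DG) of the context (with its integer $\ell\in\{1,2\}$) be satisfied. For each $m$, let $\{\boldsymbol w_m^{\varepsilon,n}\}_{n=1}^{N_t}$ be a solution of the fully discrete scheme of the context on $\mathcal T_{h_m}$. Then: I) Setting $\boldsymbol\rho_m^{\varepsilon,0}:=\Pi_p^0\boldsymbol\rho_0$, as $m\to\infty$, $$\int_\Omega(\boldsymbol\rho_0-\boldsymbol\rho_m^{\varepsilon,0})\cdot\boldsymbol w\,d\boldsymbol x\to0\qquad\forall\boldsymbol w\in H^1(\Omega)^N .$$ Moreover, for any $n=1,\dots,N_t$, there exist $\boldsymbol w^{\varepsilon,n}\in H^\ell(\Omega)^N$ with $\boldsymbol u(\boldsymbol w^{\varepsilon,n})\in H^1(\Omega)^N$ and a subsequence of $\{\mathcal T_{h_m}\}_m$ (not relabeled) such that, as $m\to\infty$, $$\boldsymbol\rho_m^{\varepsilon,n}:=\boldsymbol u(\boldsymbol w_m^{\varepsilon,n})\to\boldsymbol\rho^{\varepsilon,n}:=\boldsymbol u(\boldsymbol w^{\varepsilon,n})\quad\text{strongly in }L^r(\Omega)^N\text{ for all }r\in[1,\infty).$$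 II) Set $\boldsymbol\rho^{\varepsilon,0}:=\boldsymbol\rho_0$. For $n=0,\dots,N_t-1$, $\boldsymbol w^{\varepsilon,n+1}$ solves, for all $\boldsymbol\lambda\in H^\ell(\Omega)^N$, $$\varepsilon\tau_{n+1}\int_\Omega\Big(\sum_{|\boldsymbol\alpha|=\ell}D^{\boldsymbol\alpha}\boldsymbol w^{\varepsilon,n+1}\cdot D^{\boldsymbol\alpha}\boldsymbol\lambda+\boldsymbol w^{\varepsilon,n+1}\cdot\boldsymbol\lambda\Big)d\boldsymbol x+\int_\Omega(\boldsymbol u(\boldsymbol w^{\varepsilon,n+1})-\boldsymbol\rho^{\varepsilon,n})\cdot\boldsymbol\lambda\,d\boldsymbol x+\tau_{n+1}\int_\Omega A(\boldsymbol u(\boldsymbol w^{\varepsilon,n+1}))\nabla\boldsymbol u(\boldsymbol w^{\varepsilon,n+1}):\nabla\boldsymbol\lambda\,d\boldsymbol x=\tau_{n+1}\int_\Omega\boldsymbol f(\boldsymbol u(\boldsymbol w^{\varepsilon,n+1}))\cdot\boldsymbol\lambda\,d\boldsymbol x .$$ III) For $n=0,\dots,N_t-1$, $\boldsymbol w^{\varepsilon,n+1}$ satisfies $$\varepsilon\tau_{n+1}\|\boldsymbol w^{\varepsilon,n+1}\|_{H^\ell(\Omega)^N}^2+\int_\Omega s(\boldsymbol u(\boldsymbol w^{\varepsilon,n+1}))\,d\boldsymbol x+\gamma\tau_{n+1}\|\nabla\boldsymbol u(\boldsymbol w^{\varepsilon,n+1})\|_{[L^2(\Omega)^d]^N}^2\le\int_\Omega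 s(\boldsymbol\rho^{\varepsilon,n})\,d\boldsymbol x+C_f\tau_{n+1}|\Omega|,$$ and $$\varepsilon\sum_{n=0}^{N_t-1}\tau_{n+1}\|\boldsymbol w^{\varepsilon,n+1}\|_{H^\ell(\Omega)^N}^2+\int_\Omega s(\boldsymbol u(\boldsymbol w^{\varepsilon,N_t}))\,d\boldsymbol x+\gamma\sum_{n=0}^{N_t-1}\tau_{n+1}\|\nabla\boldsymbol u(\boldsymbol w^{\varepsilon,n+1})\|_{[L^2(\Omega)^d]^N}^2\le\int_\Omega s(\boldsymbol\rho_0)\,d\boldsymbol x+C_fT|\Omega| .$$
   Context: **Structural assumptions.** $d\in\{1,2,3\}$, $N\in\mathbb N$, $T>0$, $\Omega\subset\mathbb R^d$ is a bounded polytopic domain with Lipschitz boundary. $\mathcal D\subset(0,\infty)^N$ is a bounded domain; $A\in C^0(\overline{\mathcal D};\mathbb R^{N\times N})$, $\boldsymbol f\in C^0(\overline{\mathcal D};\mathbb R^N)$. There is a convex function $s\in C^2(\mathcal D;(0,\infty))\cap C^0(\overline{\mathcal D};(0,\infty))$ with $s':\mathcal D\to\mathbb R^N$ invertible and $\boldsymbol u:=(s')^{-1}\in C^1(\mathbb R^N;\mathcal D)$, and constants $\gamma>0$, $C_f\ge0$ with $\boldsymbol z\cdot(s''(\boldsymbol\rho)A(\boldsymbol\rho)\boldsymbol z)\ge\gamma|\boldsymbol z|^2$ for all $\boldsymbol z\in\mathbb R^N$, $\boldsymbol\rho\in\mathcal D$, and $\boldsymbol f(\boldsymbol\rho)\cdot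 s'(\boldsymbol\rho)\le C_f$ for all $\boldsymbol\rho\in\mathcal D$. The initial datum $\boldsymbol\rho_0\in L^\infty(\Omega)^N$ satisfies $\boldsymbol\rho_0(\boldsymbol x)\in\mathcal D$ for a.e. $\boldsymbol x\in\Omega$. For $N\times d$ matrices, $P:Q=\mathrm{tr}(Q^{\sf T}P)$; $\nabla\boldsymbol v$ of an $\mathbb R^N$-valued function is the $N\times d$ matrix whose rows are the gradients of the components. $\|\cdot\|_{H^\ell(\Omega)^N}$ denotes the norm of the Sobolev space $H^\ell(\Omega)^N$. **Meshes and spaces.** $\{\mathcal T_h\}$ (here $h=h_m$) is a family of conforming simplicial meshes of $\Omega$ with mesh size $h=\max_K h_K$, $h_K=\mathrm{diam}\,K$, shape regular for $d=2,3$ ($\Upsilon h_K\le\varrho_K$ for all $K$, $\varrho_K$ the inradius, $\Upsilon>0$ independent of $h$). $\mathcal F_h^{\mathcal I}$ is the set of interior facets. For a fixed polynomial degree $p$, $\mathcal S_p(\mathcal T_h)$ is the space of functions that are polynomials of degree $\le p$ on each $K\in\mathcal T_h$ (no continuity), and $\boldsymbol{\mathcal M}_p(\mathcal T_h)=\mathcal S_p(\mathcal T_h)^d$. For $F=\partial K_1\cap\partial K_2\in\mathcal F_h^{\mathcal I}$ with a fixed unit normal $\underline n_F$ pointing out of $K_1$ and a fixed weight $\alpha_F\in[0,1]$: $[\![\mu]\!]_{\sf N}=(\mu_{|K_1}-\mu_{|K_2})\underline n_F$ (componentwise for vectors), $\{\!\{\underline\theta\}\!\}_{1-\alpha_F}=\alpha_F\underline\theta_{|K_1}+(1-\alpha_F)\underline\theta_{|K_2}$.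 $\mathsf h=\eta^{-1}\min\{h_{K_1},h_{K_2}\}$ on $F$, with a constant $\eta>0$ independent of $h$, and $\eta_F=\mathsf h_{|F}^{-1}\|A\|_{L^\infty(\mathcal D)^{N\times N}}$. $\nabla_h$ is the elementwise gradient. The LDG gradient $\nabla_{\sf DG}:\mathcal S_p(\mathcal T_h)\to\boldsymbol{\mathcal M}_p(\mathcal T_h)$ (componentwise on $\mathcal S_p(\mathcal T_h)^N$) is defined by $$\int_\Omega\nabla_{\sf DG}\lambda\cdot\underline\theta\,d\boldsymbol x=\int_\Omega\nabla_h\lambda\cdot\underline\theta\,d\boldsymbol x-\int_{\mathcal F_h^{\mathcal I}}[\![\lambda]\!]_{\sf N}\cdot\{\!\{\underline\theta\}\!\}_{1-\alpha_F}\,dS\qquad\forall\underline\theta\in\boldsymbol{\mathcal M}_p(\mathcal T_h).$$ For each mesh, $c_h$ is a symmetric, $h$-uniformly positive definite bilinear form on $\mathcal S_p(\mathcal T_h)$ depending only on the space discretization, and $\boldsymbol c_h(\boldsymbol w,\boldsymbol v)=\sum_{i=1}^Nc_h(w_i,v_i)$. **Fully discrete scheme.** Let $\Pi_p^0$ be the $L^2(\Omega)$-orthogonal projection onto $\mathcal S_p(\mathcal T_{h_m})^N$, $\boldsymbol\rho_m^{\varepsilon,0}=\Pi_p^0\boldsymbol\rho_0$ and $\boldsymbol\rho_m^{\varepsilon,n}=\boldsymbol u(\boldsymbol w_m^{\varepsilon,n})$ for $n\ge1$. For $n=0,\dots,N_t-1$, $(\boldsymbol w,\underline{\boldsymbol\sigma})=(\boldsymbol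 w_m^{\varepsilon,n+1},\underline{\boldsymbol\sigma}_m^{\varepsilon,n+1})\in\mathcal S_p(\mathcal T_{h_m})^N\times\boldsymbol{\mathcal M}_p(\mathcal T_{h_m})^N$ satisfies $$\int_\Omega A(\boldsymbol u(\boldsymbol w))^{\sf T}s''(\boldsymbol u(\boldsymbol w))\underline{\boldsymbol\sigma}:\underline{\boldsymbol\varphi}\,d\boldsymbol x=-\int_\Omega A(\boldsymbol u(\boldsymbol w))^{\sf T}\nabla_{\sf DG}\boldsymbol w:\underline{\boldsymbol\varphi}\,d\boldsymbol x\quad\forall\underline{\boldsymbol\varphi}\in\boldsymbol{\mathcal M}_p(\mathcal T_{h_m})^N,$$ $$\varepsilon\tau_{n+1}\boldsymbol c_{h_m}(\boldsymbol w,\boldsymbol\lambda)+\int_\Omega(\boldsymbol u(\boldsymbol w)-\boldsymbol\rho_m^{\varepsilon,n})\cdot\boldsymbol\lambda\,d\boldsymbol x-\tau_{n+1}\int_\Omega A(\boldsymbol u(\boldsymbol w))\underline{\boldsymbol\sigma}:\nabla_{\sf DG}\boldsymbol\lambda\,d\boldsymbol x+\tau_{n+1}\int_{\mathcal F_{h_m}^{\mathcal I}}\eta_F[\![\boldsymbol w]\!]_{\sf N}:[\![\boldsymbol\lambda]\!]_{\sf N}\,dS=\tau_{n+1}\int_\Omega\boldsymbol f(\boldsymbol u(\boldsymbol w))\cdot\boldsymbol\lambda\,d\boldsymbol x\quad\forall\boldsymbol\lambda\in\mathcal S_p(\mathcal T_{h_m})^N.$$ **Assumption (DG).** Set $\ell=1$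 if $d=1$; if $d\in\{2,3\}$, set $\ell=1$ if $s''A\in C^0(\overline{\mathcal D};\mathbb R^{N\times N})$ and $\ell=2$ otherwise. For all $m$, $\mathcal S_\ell^{\sf cont}(\mathcal T_{h_m}):=\mathcal S_\ell(\mathcal T_{h_m})\cap H^1(\Omega)\subset\mathcal S_p(\mathcal T_{h_m})$, and there is a norm $\|\cdot\|_{\sf DG}$ on $\mathcal S_p(\mathcal T_{h_m})^N$ such that: i) there is $C_{\sf DG}>0$ independent of $h_m$ with $\boldsymbol c_{h_m}(\boldsymbol w_m,\boldsymbol w_m)\ge C_{\sf DG}\|\boldsymbol w_m\|_{\sf DG}^2$ for all $\boldsymbol w_m\in\mathcal S_p(\mathcal T_{h_m})^N$; ii) if $d=1$ or $\ell=2$, there is $C_S>0$ independent of $h_m$ with $\|\boldsymbol w_m\|_{L^\infty(\Omega)^N}\le C_S\|\boldsymbol w_m\|_{\sf DG}$ for all $\boldsymbol w_m\in\mathcal S_p(\mathcal T_{h_m})^N$; iii) for any sequence $\boldsymbol w_m\in\mathcal S_p(\mathcal T_{h_m})^N$ uniformly bounded in the DG norm there exist a subsequence (not relabeled) and $\boldsymbol w\in H^\ell(\Omega)^N$ such that, as $m\to\infty$, $\nabla_{\sf DG}\boldsymbol w_m\rightharpoonup\nabla\boldsymbol w$ weakly in $[L^2(\Omega)^d]^N$ and $\boldsymbol w_m\to\boldsymbol w$ strongly in $L^q(\Omega)^N$, with $1\le q<6$ if $d=3$ and $1\le q<\infty$ if $d=1,2$; moreover, for any $\boldsymbol\lambda\in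 H^\ell(\Omega)^N$ there is a sequence $\boldsymbol\lambda_m\in\mathcal S_\ell^{\sf cont}(\mathcal T_{h_m})^N$ converging strongly in $H^1(\Omega)^N$ to $\boldsymbol\lambda$ with $\boldsymbol c_{h_m}(\boldsymbol w_m,\boldsymbol\lambda_m)\to\int_\Omega(\sum_{|\boldsymbol\alpha|=\ell}D^{\boldsymbol\alpha}\boldsymbol w\cdot D^{\boldsymbol\alpha}\boldsymbol\lambda+\boldsymbol w\cdot\boldsymbol\lambda)\,d\boldsymbol x$.
   Formalization: In III, for ℓ=2, the H^ℓ norm is the equivalent one induced by the form in II (no first-order terms), since III fails with the usual full H² norm; Assumption (DG) iii is read as applying along every subsequence of the meshes. *)

(* Defs.v *)
(* Vectors of R^n are column vectors 'cV[R]_n, gradients are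
   rows, so the gradient of an R^N-valued function is an N x d matrix. *)
From HB Require Import structures.
From mathcomp Require Import all_boot all_order all_algebra.
From mathcomp Require Import all_classical all_reals all_analysis.

Set Implicit Arguments.
Unset Strict Implicit.
Unset Printing Implicit Defensive.
Import Order.TTheory GRing.Theory Num.Theory.
Import numFieldNormedType.Exports.

Local Open Scope classical_set_scope.
Local Open Scope ring_scope.

(* Product sigma-algebra on matrices (generated by the entries); it coincides
   with the Borel sigma-algebra of the topology of 'M[R]_(m, n). *)
Definition matrix_display : measure_display.
Proof. exact: default_measure_display. Qed.

Section matrix_measurable.
Context {R : realType} {m n : nat}.

Definition mx_cylinders : set (set 'M[R]_(m, n)) :=
  [set C | exists (i : 'I_m) (j : 'I_n) (B : set R),
    measurable B /\ C = [set M : 'M[R]_(m, n) | B (M i j)]].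

Let mxm0 : <<s mx_cylinders >> set0.
Proof. exact: sigma_algebra0. Qed.

Let mxmC A : <<s mx_cylinders >> A -> <<s mx_cylinders >> (~` A).
Proof. exact: sigma_algebraC. Qed.

Let mxmU (F : (set 'M[R]_(m, n))^nat) : (forall i, <<s mx_cylinders >> (F i)) ->
  <<s mx_cylinders >> (\bigcup_i F i).
Proof. exact: sigma_algebra_bigcup. Qed.

HB.instance Definition _ := @isMeasurable.Build matrix_display
  'M[R]_(m, n) <<s mx_cylinders >> mxm0 mxmC mxmU.

Lemma measurable_entry (i : 'I_m) (j : 'I_n) :
  measurable_fun [set: 'M[R]_(m, n)] (fun M => M i j).
Proof.
move=> _ Y mY; rewrite setTI; apply: sub_sigma_algebra.
by exists i, j, Y.
Qed.

Lemma measurable_fun_matrix d (T : measurableType d) (D : set T)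
    (f : T -> 'M[R]_(m, n)) : measurable D ->
  (forall i j, measurable_fun D (fun x => f x i j)) -> measurable_fun D f.
Proof.
move=> mD mf; apply: (@measurability _ _ _ _ _ _ mx_cylinders) => //.
by move=> _ [_ [i [j [B [mB ->]]]] <-]; exact: mf.
Qed.

End matrix_measurable.

Lemma sigma_finite_prod {R : realType} d1 d2 (T1 : measurableType d1)
    (T2 : measurableType d2) (m1 : {sigma_finite_measure set T1 -> \bar R})
    (m2 : {sigma_finite_measure set T2 -> \bar R}) :
  sigma_finite setT (m1 \x m2)%E.
Proof.
have /sigma_finiteP[F [TF ndF Foo]] := sigma_finiteT m1.
have /sigma_finiteP[G [TG ndG Goo]] := sigma_finiteT m2.
exists (fun n => F n `*` G n).
  rewrite -setXTT TF TG predeqE => -[x y]; split.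
    move=> [/= [n _ Fnx] [k _ Gky]]; exists (maxn n k) => //; split.
    - by move: x Fnx; exact/subsetPset/ndF/leq_maxl.
    - by move: y Gky; exact/subsetPset/ndG/leq_maxr.
  by move=> [n _ []/= ? ?]; split; exists n.
move=> k; have [? ?] := Foo k; have [? ?] := Goo k.
split; first exact: measurableX.
by rewrite product_measure1E// lte_mul_pinfty// ge0_fin_numE.
Qed.

Section lebesgue_step.
Context {R : realType} {n : nat}.
Variable mu : {sigma_finite_measure set 'cV[R]_n -> \bar R}.

Definition cv_cons (p : R * 'cV[R]_n) : 'cV[R]_n.+1 :=
  \col_i (if unlift ord0 i is Some j then p.2 j 0 else p.1).

Definition cv_uncons (v : 'cV[R]_n.+1) : R * 'cV[R]_n :=
  (v ord0 0, \col_j v (lift ord0 j) 0).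

Lemma cv_unconsK : cancel cv_uncons cv_cons.
Proof.
move=> v; apply/colP => i; rewrite mxE.
by case: unliftP => [j ->|->] //=; rewrite mxE.
Qed.

Lemma cv_consK : cancel cv_cons cv_uncons.
Proof.
case=> a v; congr pair; first by rewrite mxE unlift_none.
by apply/colP => j; rewrite !mxE liftK.
Qed.

Lemma measurable_cv_cons : measurable_fun setT cv_cons.
Proof.
apply: measurable_fun_matrix => // i j; rewrite /cv_cons.
under eq_fun do rewrite mxE.
case: unliftP => [k _|_] /=; last exact: measurable_fst.
by apply: (measurableT_comp (measurable_entry k 0)); exact: measurable_snd.
Qed.

Lemma measurable_cv_uncons : measurable_fun setT cv_uncons.
Proof.
apply/measurable_fun_pairP; split; first exact: measurable_entry.
apply: measurable_fun_matrix => // i j.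
rewrite (_ : (fun _ => _) = (fun v : 'cV[R]_n.+1 => v (lift ord0 i) 0)).
  exact: measurable_entry.
by apply/funext => v /=; rewrite mxE.
Qed.

Definition leb_step : set 'cV[R]_n.+1 -> \bar R :=
  pushforward (lebesgue_measure \x mu)%E cv_cons.

Let mcons A : measurable A -> measurable (cv_cons @^-1` A).
Proof. by move=> mA; rewrite -[X in measurable X]setTI; exact: measurable_cv_cons. Qed.

Let leb_step0 : leb_step set0 = 0%E.
Proof. by rewrite /leb_step /pushforward preimage_set0 measure0. Qed.

Let leb_step_ge0 A : (0 <= leb_step A)%E.
Proof. by rewrite /leb_step /pushforward; exact: measure_ge0. Qed.

Let leb_step_additive : semi_sigma_additive leb_step.
Proof.
move=> F mF tF mUF; rewrite /leb_step /pushforward preimage_bigcup.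
apply: measure_semi_sigma_additive => [k||]; first exact: mcons.
- apply/trivIsetP => /= i j _ _ ij; rewrite -preimage_setI.
  by move/trivIsetP : tF => /(_ _ _ _ _ ij) ->//; rewrite preimage_set0.
- by rewrite -preimage_bigcup; exact: mcons.
Qed.

HB.instance Definition _ := isMeasure.Build _ _ _ leb_step
  leb_step0 leb_step_ge0 leb_step_additive.

Let leb_step_sigma_finite : sigma_finite setT leb_step.
Proof.
have [F FT Ffin] := sigma_finite_prod (@lebesgue_measure R) mu.
exists (fun k => cv_uncons @^-1` F k) => [|k].
  by rewrite -preimage_bigcup -FT preimage_setT.
have [mFk Fkfin] := Ffin k; split.
  by rewrite -[X in measurable X]setTI; exact: measurable_cv_uncons.
rewrite /leb_step /pushforward -comp_preimage.
rewrite (_ : cv_uncons \o cv_cons = id) //.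
by apply/funext => p /=; rewrite cv_consK.
Qed.

HB.instance Definition _ := Measure_isSigmaFinite.Build _ _ _ leb_step
  leb_step_sigma_finite.

End lebesgue_step.

(* Unit mass on the one-point space R^0, then products with the measure of R. *)
Fixpoint leb {R : realType} (n : nat) :
    {sigma_finite_measure set 'cV[R]_n -> \bar R} :=
  match n with
  | 0 => \d_(0 : 'cV[R]_0)
  | n'.+1 => leb_step (leb n')
  end.

Section calculus.
Context {R : realType}.

Definition ip m n (P Q : 'M[R]_(m, n)) : R := \tr (Q^T *m P).

(* Euclidean / Frobenius norm; the library norm `| _ | is the maximum norm. *)
Definition enorm m n (P : 'M[R]_(m, n)) : R := Num.sqrt (ip P P).

Definition basis_vec n (i : 'I_n) : 'cV[R]_n := delta_mx i 0.

Definition partial n (i : 'I_n) (g : 'cV[R]_n -> R) : 'cV[R]_n -> R :=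
  fun x => 'D_(basis_vec i) g x.

Definition grad n (g : 'cV[R]_n -> R) (x : 'cV[R]_n) : 'cV[R]_n :=
  \col_i partial i g x.

Definition hess n (g : 'cV[R]_n -> R) (x : 'cV[R]_n) : 'M[R]_n :=
  \matrix_(i, j) partial j (partial i g) x.

Definition C1_on n (V : normedModType R) (D : set 'cV[R]_n) (g : 'cV[R]_n -> V) :=
  forall x, D x ->
    differentiable g x /\ forall v, {for x, continuous ('D_v g)}.

Definition C2_on n (D : set 'cV[R]_n) (g : 'cV[R]_n -> R) :=
  C1_on D g /\ C1_on D (grad g).

(* Convexity along every segment contained in D (D itself is not assumed to be
   convex). *)
Definition convex_on n (D : set 'cV[R]_n) (g : 'cV[R]_n -> R) :=
  forall x y : 'cV[R]_n,
    (forall t : R, 0 <= t <= 1 -> D (t *: x + (1 - t) *: y)) ->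
    forall t : R, 0 <= t <= 1 ->
      g (t *: x + (1 - t) *: y) <= t * g x + (1 - t) * g y.

Definition continuous_on_closure n (V : topologicalType) (D : set 'cV[R]_n)
    (g : 'cV[R]_n -> V) := {within closure D, continuous g}.

Definition iter_partial n (s : seq 'I_n) (g : 'cV[R]_n -> R) : 'cV[R]_n -> R :=
  foldr (@partial n) g s.

Definition smooth n (g : 'cV[R]_n -> R) :=
  forall (s : seq 'I_n) x, differentiable (iter_partial s g) x.

Definition multi_partial n (a : 'I_n -> nat) : ('cV[R]_n -> R) -> 'cV[R]_n -> R :=
  iter_partial (flatten [seq nseq (a i) i | i <- enum 'I_n]).

End calculus.

Section function_spaces.
Context {R : realType} {d : nat}.
Variable Omega : set 'cV[R]_d.
Implicit Types (g : 'cV[R]_d -> R) (a : 'I_d -> nat).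

(* Functions are considered on Omega only, hence the indicator function. *)
Definition Lpnorm (p : \bar R) m n (v : 'cV[R]_d -> 'M[R]_(m, n)) : \bar R :=
  Lnorm (leb d) p (fun x => (enorm (v x) * \1_Omega x)%:E).

Definition Lp (p : \bar R) m n (v : 'cV[R]_d -> 'M[R]_(m, n)) :=
  measurable_fun Omega v /\ (Lpnorm p v < +oo)%E.

Definition Lp_cvg (p : \bar R) m n (v_ : nat -> 'cV[R]_d -> 'M[R]_(m, n))
    (v : 'cV[R]_d -> 'M[R]_(m, n)) :=
  (fun k => Lpnorm p (fun x => v_ k x - v x)) @ \oo --> 0%E.

Definition test_function g :=
  [/\ smooth g, compact (closure [set x | g x != 0])
    & closure [set x | g x != 0] `<=` Omega].

Definition weak_derivative a g h := forall phi, test_function phi ->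
  \int[leb d]_(x in Omega) (g x * multi_partial a phi x) =
  (-1) ^+ (\sum_i a i)%N * \int[leb d]_(x in Omega) (h x * phi x).

Definition sL2 g := Lp 2%:E (fun x => (g x)%:M : 'M[R]_1).

Definition sobolev_scalar (k : nat) g :=
  sL2 g /\ forall a, (\sum_i a i <= k)%N -> exists2 h, sL2 h & weak_derivative a g h.

(* A representative of the (almost everywhere unique) weak derivative D^a g in
   L^2(Omega), and the zero function if there is none. *)
Definition wD a g : 'cV[R]_d -> R :=
  xget (fun=> 0) [set h | sL2 h /\ weak_derivative a g h].

Definition unit_index (j : 'I_d) : 'I_d -> nat := fun i => (i == j) : nat.

Section vector_valued.
Context {N : nat}.
Implicit Types v w : 'cV[R]_d -> 'cV[R]_N.

Definition component (i : 'I_N) v : 'cV[R]_d -> R := fun x => v x i 0.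

Definition sobolev (k : nat) v := forall i, sobolev_scalar k (component i v).

Definition wDv a v (x : 'cV[R]_d) : 'cV[R]_N := \col_i wD a (component i v) x.

Definition wgrad v (x : 'cV[R]_d) : 'M[R]_(N, d) :=
  \matrix_(i, j) wD (unit_index j) (component i v) x.

(* int_Omega (sum_(|a| = l) D^a v . D^a w + v . w).  For l = 1 this is the usual
   inner product of H^1(Omega)^N; for l = 2 there are no first-order terms, which
   gives an equivalent inner product of H^2(Omega)^N on a bounded Lipschitz Omega. *)
Definition sobolev_form (l : nat) v w : R :=
  \int[leb d]_(x in Omega)
    (\sum_(a : {ffun 'I_d -> 'I_l.+1} | (\sum_i a i == l)%N)
       ip (wDv (fun i => a i : nat) v x) (wDv (fun i => a i : nat) w x)
     + ip (v x) (w x)).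

Definition sobolev_norm (l : nat) v : R := Num.sqrt (sobolev_form l v v).

End vector_valued.
End function_spaces.

Section domains.
Context {R : realType} {d : nat}.
Implicit Types Omega : set 'cV[R]_d.

Definition domain (n : nat) (D : set 'cV[R]_n) :=
  [/\ open D, connected D & D !=set0].

Definition hull (n : nat) (a : 'I_n -> 'cV[R]_d) (I : set 'I_n) : set 'cV[R]_d :=
  [set x | exists t : 'I_n -> R,
    [/\ forall i, 0 <= t i, forall i, ~ I i -> t i = 0,
        \sum_i t i = 1 & x = \sum_i t i *: a i]].

Definition polytopic Omega :=
  exists (n k : nat) (a : 'I_n -> 'I_k -> 'cV[R]_d),
    closure Omega = \bigcup_i hull (a i) setT.

(* Near each boundary point Omega is the strict hypograph, in some direction e, of
   a Lipschitz function of the component orthogonal to e. *)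
Definition lipschitz_boundary Omega :=
  forall z, closure Omega z -> ~ Omega z ->
  exists (e : 'cV[R]_d) (g : 'cV[R]_d -> R) (L : R) (U : set 'cV[R]_d),
    [/\ enorm e = 1,
        forall x (t : R), g (x + t *: e) = g x,
        forall x y, `|g x - g y| <= L * enorm (x - y),
        open U /\ U z &
        forall x, U x -> Omega x <-> ip x e < g x].

End domains.

(* Element k of the mesh is the simplex with vertices vtx k 0, ..., vtx k d. *)
Record mesh (R : realType) (d : nat) := Mesh {
  nelt : nat;
  vtx : 'I_nelt -> 'I_d.+1 -> 'cV[R]_d
}.

Section meshes.
Context {R : realType} {d : nat}.
Variable M : mesh R d.

Definition elt (k : 'I_(nelt M)) : set 'cV[R]_d := hull (vtx k) setT.

Definition conforming_mesh_of (Omega : set 'cV[R]_d) :=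
  [/\ forall k : 'I_(nelt M),
        \matrix_(i < d, j < d) (vtx k (lift ord0 j) - vtx k ord0) i 0 \in unitmx,
      closure Omega = \bigcup_k elt k &
      forall k1 k2 : 'I_(nelt M), k1 != k2 ->
        exists I1 I2 : set 'I_d.+1,
          [/\ I1 != setT, I2 != setT,
              elt k1 `&` elt k2 = hull (vtx k1) I1 &
              elt k1 `&` elt k2 = hull (vtx k2) I2]].

Definition diam (k : 'I_(nelt M)) : R :=
  sup [set r | exists x y, [/\ elt k x, elt k y & r = enorm (x - y)]].

Definition inradius (k : 'I_(nelt M)) : R :=
  sup [set r | 0 <= r /\ exists c, [set x | enorm (x - c) <= r] `<=` elt k].

Definition mesh_size : R := \big[Num.max/0]_(k < nelt M) diam k.

(* An interior facet is listed once, as a triple (k1, i, k2) with k1 < k2: it is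
   the common facet of elements k1 and k2, opposite to vertex i in k1. *)
Definition is_interior_facet (k1 : 'I_(nelt M)) (i : 'I_d.+1) (k2 : 'I_(nelt M)) :=
  (k1 < k2)%N /\ elt k1 `&` elt k2 = hull (vtx k1) [set j | j != i].

Definition facet_vtx (k : 'I_(nelt M)) (i : 'I_d.+1) : nat -> 'cV[R]_d :=
  nth 0 [seq vtx k j | j <- enum 'I_d.+1 & j != i].

End meshes.

Section surface_integral.
Context {R : realType} {d : nat}.

Definition ref_simplex (n : nat) : set 'cV[R]_n :=
  [set y | (forall i, 0 <= y i 0) /\ \sum_i y i 0 <= 1].

(* n-dimensional surface integral over the simplex with vertices a 0, ..., a n,
   through its affine parametrization (sqrt of the Gram determinant). *)
Definition simplex_integral (n : nat) (a : nat -> 'cV[R]_d) (g : 'cV[R]_d -> R) : R :=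
  let J : 'M[R]_(d, n) := \matrix_(i, j) (a j.+1 - a 0%N) i 0 in
  Num.sqrt (\det (J^T *m J)) *
  \int[leb n]_(y in @ref_simplex n) g (a 0%N + J *m y).

(* The integrand may depend on the two elements k1, k2 adjacent to the facet. *)
Definition facets_integral (M : mesh R d)
    (g : 'I_(nelt M) -> 'I_(nelt M) -> 'cV[R]_d -> R) : R :=
  \sum_(k1 < nelt M) \sum_(i < d.+1)
    \sum_(k2 < nelt M | `[< is_interior_facet k1 i k2 >])
      simplex_integral d.-1 (facet_vtx k1 i) (g k1 k2).

End surface_integral.

Section broken_spaces.
Context {R : realType} {d : nat}.

(* A function that is polynomial on each element is given by the family of its
   polynomial expressions on the elements; this provides the traces on facets. *)
Definition broken (M : mesh R d) (V : Type) := 'I_(nelt M) -> 'cV[R]_d -> V.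

(* The function on Omega, defined up to the Lebesgue-null set of the facets. *)
Definition broken_fun (M : mesh R d) (V : nmodType) (v : broken M V) : 'cV[R]_d -> V :=
  fun x => if [pick k | `[< elt k x >]] is Some k then v k x else 0.

Definition polynomial_fun (p : nat) (g : 'cV[R]_d -> R) :=
  exists c : {ffun 'I_d -> 'I_p.+1} -> R, forall x,
    g x = \sum_(a : {ffun 'I_d -> 'I_p.+1} | (\sum_i a i <= p)%N)
            c a * \prod_i x i 0 ^+ a i.

Variable M : mesh R d.

Definition Sp (p : nat) (v : broken M R) := forall k, polynomial_fun p (v k).

Definition Sp_mx (p : nat) m n (v : broken M 'M[R]_(m, n)) :=
  forall i j, Sp p (fun k x => v k x i j).

Definition Sp_cont (Omega : set 'cV[R]_d) (p : nat) (v : broken M R) :=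
  Sp p v /\ sobolev_scalar Omega 1 (broken_fun v).

Definition bcomp N (i : 'I_N) (v : broken M 'cV[R]_N) : broken M R :=
  fun k x => v k x i 0.

Definition broken_grad (v : broken M R) : broken M 'rV[R]_d :=
  fun k x => (grad (v k) x)^T.

Definition is_L2_projection N (Omega : set 'cV[R]_d) (p : nat)
    (g : 'cV[R]_d -> 'cV[R]_N) (v : broken M 'cV[R]_N) :=
  Sp_mx p v /\ forall lam : broken M 'cV[R]_N, Sp_mx p lam ->
    \int[leb d]_(x in Omega) ip (broken_fun v x) (broken_fun lam x) =
    \int[leb d]_(x in Omega) ip (g x) (broken_fun lam x).

End broken_spaces.

(* A mesh with, for each interior facet of elements k1 < k2, the unit normal
   pointing out of k1 and the weight alpha_F, the LDG gradient, and c_h. *)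
Record discretization (R : realType) (d : nat) := Discretization {
  dmesh :> mesh R d;
  normal : 'I_(nelt dmesh) -> 'I_(nelt dmesh) -> 'rV[R]_d;
  alpha : 'I_(nelt dmesh) -> 'I_(nelt dmesh) -> R;
  ldg_grad : broken dmesh R -> broken dmesh 'rV[R]_d;
  c_form : broken dmesh R -> broken dmesh R -> R
}.

Section discretizations.
Context {R : realType} {d : nat}.
Variables (Omega : set 'cV[R]_d) (p : nat) (S : discretization R d).

Definition is_outer_normal := forall (k1 k2 : 'I_(nelt S)) (i : 'I_d.+1),
  is_interior_facet k1 i k2 ->
  [/\ enorm (normal k1 k2) = 1,
      forall j1 j2, j1 != i -> j2 != i ->
        normal k1 k2 *m (vtx k1 j1 - vtx k1 j2) = 0 &
      forall j, j != i -> (normal k1 k2 *m (vtx k1 i - vtx k1 j)) 0 0 < 0].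

Definition is_ldg_grad := forall lam : broken S R, Sp p lam ->
  Sp_mx p (ldg_grad lam) /\
  forall theta : broken S 'rV[R]_d, Sp_mx p theta ->
    \int[leb d]_(x in Omega) ip (broken_fun (ldg_grad lam) x) (broken_fun theta x) =
    \int[leb d]_(x in Omega) ip (broken_fun (broken_grad lam) x) (broken_fun theta x) -
    facets_integral (fun (k1 k2 : 'I_(nelt S)) x =>
      ip ((lam k1 x - lam k2 x) *: normal k1 k2)
         (alpha k1 k2 *: theta k1 x + (1 - alpha k1 k2) *: theta k2 x)).

Definition bilinear_on_Sp (c : broken S R -> broken S R -> R) :=
  forall (b : R) (u v w : broken S R), Sp p u -> Sp p v -> Sp p w ->
    c (fun k x => b * u k x + v k x) w = b * c u w + c v w /\
    c w (fun k x => b * u k x + v k x) = b * c w u + c w v.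

Definition symmetric_on_Sp (c : broken S R -> broken S R -> R) :=
  forall u v : broken S R, Sp p u -> Sp p v -> c u v = c v u.

Record discretization_of : Prop := {
  disc_mesh : conforming_mesh_of S Omega;
  disc_normal : is_outer_normal;
  disc_alpha : forall k1 k2 : 'I_(nelt S), 0 <= alpha k1 k2 <= 1;
  disc_ldg : is_ldg_grad;
  disc_bilinear : bilinear_on_Sp (@c_form _ _ S);
  disc_symmetric : symmetric_on_Sp (@c_form _ _ S)
}.

Context {N : nat}.

Definition ldg_gradv (w : broken S 'cV[R]_N) : broken S 'M[R]_(N, d) :=
  fun k x => \matrix_(i, j) ldg_grad (bcomp i w) k x 0 j.

Definition c_formv (w v : broken S 'cV[R]_N) : R :=
  \sum_i c_form (bcomp i w) (bcomp i v).

Definition jump (w : broken S 'cV[R]_N) (k1 k2 : 'I_(nelt S)) (x : 'cV[R]_d) :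
    'M[R]_(N, d) := (w k1 x - w k2 x) *m normal k1 k2.

Definition norm_on_Sp (nrm : broken S 'cV[R]_N -> R) :=
  [/\ forall v, Sp_mx p v -> 0 <= nrm v,
      forall v, Sp_mx p v -> nrm v = 0 -> v = (fun _ _ => 0),
      forall (b : R) v, Sp_mx p v -> nrm (fun k x => b *: v k x) = `|b| * nrm v &
      forall v w, Sp_mx p v -> Sp_mx p w ->
        nrm (fun k x => v k x + w k x) <= nrm v + nrm w].

End discretizations.

Definition uniformly_positive_definite {R : realType} {d : nat}
    (Omega : set 'cV[R]_d) (p : nat) (S : nat -> discretization R d) :=
  exists2 c0 : R, 0 < c0 & forall m (v : broken (S m) R), Sp p v ->
    c0 * \int[leb d]_(x in Omega) (broken_fun v x ^+ 2) <= c_form v v.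

Record structural_assumptions {R : realType} (d N : nat) (T : R)
    (Omega : set 'cV[R]_d) (D : set 'cV[R]_N) (A : 'cV[R]_N -> 'M[R]_N)
    (f : 'cV[R]_N -> 'cV[R]_N) (s : 'cV[R]_N -> R) (u : 'cV[R]_N -> 'cV[R]_N)
    (gamma Cf : R) (rho0 : 'cV[R]_d -> 'cV[R]_N) : Prop := {
  sa_dim : (1 <= d <= 3)%N;
  sa_species : (0 < N)%N;
  sa_time : 0 < T;
  sa_Omega_domain : domain Omega;
  sa_Omega_bounded : bounded_set Omega;
  sa_Omega_polytopic : polytopic Omega;
  sa_Omega_lipschitz : lipschitz_boundary Omega;
  sa_D_domain : domain D;
  sa_D_bounded : bounded_set D;
  sa_D_positive : forall rho, D rho -> forall i, 0 < rho i 0;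
  sa_A_continuous : continuous_on_closure D A;
  sa_f_continuous : continuous_on_closure D f;
  sa_s_convex : convex_on D s;
  sa_s_C2 : C2_on D s;
  sa_s_continuous : continuous_on_closure D s;
  sa_s_positive : forall rho, closure D rho -> 0 < s rho;
  sa_u_range : forall w, D (u w);
  sa_u_inverse_l : forall w, grad s (u w) = w;
  sa_u_inverse_r : forall rho, D rho -> u (grad s rho) = rho;
  sa_u_C1 : C1_on setT u;
  sa_gamma : 0 < gamma;
  sa_coercive : forall (z rho : 'cV[R]_N), D rho ->
    gamma * enorm z ^+ 2 <= ip z (hess s rho *m A rho *m z);
  sa_Cf : 0 <= Cf;
  sa_reaction : forall rho, D rho -> ip (f rho) (grad s rho) <= Cf;
  sa_rho0_Loo : Lp Omega +oo%E rho0;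
  sa_rho0_range : {ae leb d, forall x, Omega x -> D (rho0 x)}
}.

Definition shape_regular {R : realType} {d : nat} (M : nat -> mesh R d) :=
  (2 <= d)%N -> exists2 Upsilon : R, 0 < Upsilon &
    forall m (k : 'I_(nelt (M m))), Upsilon * diam k <= inradius k.

Record discretization_sequence {R : realType} {d : nat} (Omega : set 'cV[R]_d)
    (p : nat) (S : nat -> discretization R d) : Prop := {
  ds_disc : forall m, discretization_of Omega p (S m);
  ds_c_form : uniformly_positive_definite Omega p S;
  ds_shape_regular : shape_regular S;
  ds_le1 : forall m, mesh_size (S m) <= 1;
  ds_decreasing : forall m, mesh_size (S m.+1) <= mesh_size (S m);
  ds_cvg0 : (fun m => mesh_size (S m)) @ \oo --> (0 : R)
}.

Definition sobolev_index {R : realType} (d : nat) {N : nat} (D : set 'cV[R]_N)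
    (A : 'cV[R]_N -> 'M[R]_N) (s : 'cV[R]_N -> R) : nat :=
  if (d == 1)%N || `[< exists B : 'cV[R]_N -> 'M[R]_N,
       continuous_on_closure D B /\
       forall rho, D rho -> B rho = hess s rho *m A rho >]
  then 1 else 2.

Definition strictly_increasing (sigma : nat -> nat) :=
  forall m, (sigma m < sigma m.+1)%N.

Section DG_assumption.
Context {R : realType} {d N : nat}.
Variables (Omega : set 'cV[R]_d) (p l : nat) (S : nat -> discretization R d).

Definition DG_coercivity (nrm : forall m, broken (S m) 'cV[R]_N -> R) :=
  exists2 CDG : R, 0 < CDG & forall m (w : broken (S m) 'cV[R]_N), Sp_mx p w ->
    CDG * nrm m w ^+ 2 <= c_formv w w.

Definition DG_sup_bound (nrm : forall m, broken (S m) 'cV[R]_N -> R) :=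
  d = 1%N \/ l = 2 ->
  exists2 CS : R, 0 < CS & forall m (w : broken (S m) 'cV[R]_N), Sp_mx p w ->
    (Lpnorm Omega +oo%E (broken_fun w) <= (CS * nrm m w)%:E)%E.

(* The sequence may be indexed by any subsequence sigma of the meshes; the
   extracted subsequence is sigma \o phi. *)
Definition DG_compactness (nrm : forall m, broken (S m) 'cV[R]_N -> R) :=
  forall (sigma : nat -> nat) (w_ : forall m, broken (S (sigma m)) 'cV[R]_N),
  strictly_increasing sigma ->
  (forall m, Sp_mx p (w_ m)) ->
  (exists B : R, forall m, nrm (sigma m) (w_ m) <= B) ->
  exists (phi : nat -> nat) (w : 'cV[R]_d -> 'cV[R]_N),
  [/\ strictly_increasing phi,
      sobolev Omega l w,
      forall psi : 'cV[R]_d -> 'M[R]_(N, d), Lp Omega 2%:E psi ->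
        (fun m => \int[leb d]_(x in Omega)
                    ip (broken_fun (ldg_gradv (w_ (phi m))) x) (psi x)) @ \oo -->
        \int[leb d]_(x in Omega) ip (wgrad Omega w x) (psi x),
      forall q : R, 1 <= q -> (d = 3 -> q < 6) ->
        Lp_cvg Omega q%:E (fun m => broken_fun (w_ (phi m))) w &
      forall lam, sobolev Omega l lam ->
        exists lam_ : forall m, broken (S (sigma (phi m))) 'cV[R]_N,
        [/\ forall m i, Sp_cont Omega l (bcomp i (lam_ m)),
            (fun m => sobolev_norm Omega 1 (fun x => broken_fun (lam_ m) x - lam x))
              @ \oo --> (0 : R) &
            (fun m => c_formv (w_ (phi m)) (lam_ m)) @ \oo -->
              sobolev_form Omega l w lam]].

Definition DG_assumption :=
  (forall m (v : broken (S m) R), Sp_cont Omega l v -> Sp p v) /\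
  exists nrm : forall m, broken (S m) 'cV[R]_N -> R,
    [/\ forall m, norm_on_Sp p (nrm m),
        DG_coercivity nrm, DG_sup_bound nrm & DG_compactness nrm].

End DG_assumption.

Section scheme.
Context {R : realType} {d N : nat}.
Variables (Omega : set 'cV[R]_d) (D : set 'cV[R]_N).
Variables (A : 'cV[R]_N -> 'M[R]_N) (f : 'cV[R]_N -> 'cV[R]_N).
Variables (s : 'cV[R]_N -> R) (u : 'cV[R]_N -> 'cV[R]_N).

(* ||A||_(L^oo(D)), entrywise maximum. *)
Definition normA : R := 
  fine (Lnorm (leb N) +oo%E (fun rho => (`|A rho| * \1_D rho)%:E)).

Definition stab (eta : R) (M : mesh R d) (k1 k2 : 'I_(nelt M)) : R :=
  (eta^-1 * Num.min (diam k1) (diam k2))^-1 * normA.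

(* One time step: rho is the previous density, (w, sig) the new unknowns. *)
Definition dg_step (eta eps tau : R) (p : nat) (S : discretization R d)
    (rho : 'cV[R]_d -> 'cV[R]_N)
    (w : broken S 'cV[R]_N) (sig : broken S 'M[R]_(N, d)) :=
  [/\ Sp_mx p w, Sp_mx p sig,
    forall phi : broken S 'M[R]_(N, d), Sp_mx p phi ->
      \int[leb d]_(x in Omega)
        ip ((A (u (broken_fun w x)))^T *m hess s (u (broken_fun w x)) *m broken_fun sig x)
           (broken_fun phi x) =
      - \int[leb d]_(x in Omega)
          ip ((A (u (broken_fun w x)))^T *m broken_fun (ldg_gradv w) x) (broken_fun phi x) &
    forall lam : broken S 'cV[R]_N, Sp_mx p lam ->
      eps * tau * c_formv w lam
      + \int[leb d]_(x in Omega) ip (u (broken_fun w x) - rho x) (broken_fun lam x)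
      - tau * \int[leb d]_(x in Omega)
                ip (A (u (broken_fun w x)) *m broken_fun sig x) (broken_fun (ldg_gradv lam) x)
      + tau * facets_integral (fun (k1 k2 : 'I_(nelt S)) x =>
                stab eta k1 k2 * ip (jump w k1 k2 x) (jump lam k1 k2 x))
      = tau * \int[leb d]_(x in Omega) ip (f (u (broken_fun w x))) (broken_fun lam x)].

Definition density (rho_init : 'cV[R]_d -> 'cV[R]_N)
    (w : nat -> 'cV[R]_d -> 'cV[R]_N) (n : nat) : 'cV[R]_d -> 'cV[R]_N :=
  if n is 0 then rho_init else u \o w n.

Definition limit_step (eps tau : R) (l : nat)
    (rho w : 'cV[R]_d -> 'cV[R]_N) :=
  forall lam : 'cV[R]_d -> 'cV[R]_N, sobolev Omega l lam ->
    eps * tau * sobolev_form Omega l w lam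
    + \int[leb d]_(x in Omega) ip (u (w x) - rho x) (lam x)
    + tau * \int[leb d]_(x in Omega)
              ip (A (u (w x)) *m wgrad Omega (u \o w) x) (wgrad Omega lam x)
    = tau * \int[leb d]_(x in Omega) ip (f (u (w x))) (lam x).

End scheme.

(* Main.v *)
(** Testing the scheme with the discrete solution bounds the DG norms of the entropy
    variables and the L^2 norms of the fluxes, so compactness yields limits [w n] along one
    subsequence.  The only term in which the limit is not immediate is the flux paired with
    the gradient of a test function: the flux converges weakly at best and its coefficient
    [s'' A] depends on the solution.  It is treated by duality, solving [s'' A phi = A^T grad lam]
    pointwise and approximating [phi] by broken polynomials, which moves the limit onto the
    weakly convergent LDG gradients.  Conforming test functions have no jumps, because a bounded
    weak derivative forces Lipschitz bounds across facets, and the same bounds give the chain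
    rule for [u \o w] by difference quotients.  The entropy inequality is the limit equation
    tested with [w] itself; convexity of [s] enters only along segments of entropy variables,
    since [D] need not be convex. *)

From HB Require Import structures.
From mathcomp Require Import all_boot all_order all_algebra.
From mathcomp Require Import all_classical all_reals all_analysis.
From mathcomp Require Import measurable_realfun ess_sup_inf ring lra.
Require Import Defs.

Set Implicit Arguments.
Unset Strict Implicit.
Unset Printing Implicit Defensive.
Import Order.TTheory GRing.Theory Num.Theory.
Import numFieldNormedType.Exports.

Local Open Scope classical_set_scope.
Local Open Scope ring_scope.

(** * Square-integrable functions *)

(** Nothing bounds [s''] near the boundary of [D], and [s'' A] need not extend there. Coercivity
    bounds [(s'' A)^-1] by [gamma^-1], and [A (s'' A)^-1 = (s'')^-1] is the Jacobian of [u]. This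
    identity bounds the Jacobian, turns the limit flux into the gradient of [u \o w], and shapes the
    duality argument. The duality also needs an upper bound on [s'' A], and the choice of [l]
    secures it: either [s'' A] extends continuously to the compact closure of [D], or the DG norm
    controls the sup norm of the entropy variables, whose densities then stay in a compact part of
    [D]. The projected initial datum may leave [D], where the entropy says nothing; since the scheme
    sees the previous density only through discrete test functions, [rho0] takes its place in the
    energy estimate. Weak convergence of the gradients is known only test function by test function,
    hence the uniform boundedness principle. Traces are values of polynomials, so no trace theorem
    is invoked. *)

Section square_integrable.
Context dT (X : measurableType dT) (R : realType).
Variables (mu : {measure set X -> \bar R}) (D : set X).
Hypotheses (mD : measurable D) (muD : (mu D < +oo)%E).
Implicit Types f g h : X -> R.

Definition intg f := mu.-integrable D (EFin \o f).

Definition sqint f := measurable_fun D f /\ intg (fun x => f x ^+ 2).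

Lemma intg_measurable f : intg f -> measurable_fun D f.
Proof. by move/measurable_int/measurable_EFinP. Qed.

Lemma le_intg f g : measurable_fun D f -> (forall x, D x -> `|f x| <= g x) ->
  intg g -> intg f.
Proof.
move=> mf fg ig; apply: (le_integrable mD _ _ ig); first exact/measurable_EFinP.
move=> x Dx /=; rewrite lee_fin (le_trans (fg _ Dx))//.
by rewrite ler_norm.
Qed.

Lemma intg_cst (c : R) : intg (fun=> c).
Proof. by apply: measurable_bounded_integrable => //; exact: bounded_cst. Qed.

Lemma intg_bounded f (M : R) : measurable_fun D f ->
  (forall x, D x -> `|f x| <= M) -> intg f.
Proof. by move=> mf fM; apply: (le_intg mf fM); exact: intg_cst. Qed.

Lemma intgD f g : intg f -> intg g -> intg (fun x => f x + g x).
Proof.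
move=> fi gi; rewrite /intg (_ : _ \o _ = (EFin \o f) \+ (EFin \o g))%E//.
exact: integrableD.
Qed.

Lemma intgB f g : intg f -> intg g -> intg (fun x => f x - g x).
Proof.
move=> fi gi; rewrite /intg (_ : _ \o _ = (EFin \o f) \- (EFin \o g))%E//.
exact: integrableB.
Qed.

Lemma intgZ (c : R) f : intg f -> intg (fun x => c * f x).
Proof.
move=> fi; rewrite /intg (_ : _ \o _ = (fun x => c%:E * (EFin \o f) x))%E//.
exact: integrableZl.
Qed.

Lemma intgN f : intg f -> intg (fun x => - f x).
Proof.
move=> fi; rewrite /intg (_ : _ \o _ = (fun x => - (EFin \o f) x))%E//.
exact: integrableN.
Qed.

Lemma intg_norm f : intg f -> intg (fun x => `|f x|).
Proof. exact: integrable_norm. Qed.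

Lemma intg_sum (I : Type) (s : seq I) (P : pred I) (F : I -> X -> R) :
  (forall i, P i -> intg (F i)) -> intg (fun x => \sum_(i <- s | P i) F i x).
Proof.
move=> Fi; elim: s => [|i s IH].
  under eq_fun do rewrite big_nil; exact: intg_cst.
case: (boolP (P i)) => Pi; under eq_fun do rewrite big_cons.
  by rewrite Pi; apply: intgD => //; exact: Fi.
by rewrite (negbTE Pi).
Qed.

Lemma Rintegral_sum (I : Type) (s : seq I) (P : pred I) (F : I -> X -> R) :
  (forall i, P i -> intg (F i)) ->
  \int[mu]_(x in D) (\sum_(i <- s | P i) F i x) =
  \sum_(i <- s | P i) \int[mu]_(x in D) F i x.
Proof.
move=> Fi; elim: s => [|i s IH].
  rewrite big_nil; under eq_Rintegral do rewrite big_nil.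
  by rewrite Rintegral_cst// mul0r.
rewrite big_cons; case: (boolP (P i)) => Pi; under eq_Rintegral do rewrite big_cons.
  rewrite Pi RintegralD//; [by rewrite IH|exact: Fi|exact: intg_sum].
by rewrite (negbTE Pi).
Qed.

Lemma RintegralN f : intg f ->
  \int[mu]_(x in D) (- f x) = - \int[mu]_(x in D) f x.
Proof.
move=> fi; under eq_Rintegral do rewrite -mulN1r.
by rewrite RintegralZl// mulN1r.
Qed.

Lemma ae_eq_Rintegral f g : measurable_fun D f -> measurable_fun D g ->
  {ae mu, forall x, D x -> f x = g x} ->
  \int[mu]_(x in D) f x = \int[mu]_(x in D) g x.
Proof.
move=> mf mg fg; congr fine; apply: ae_eq_integral => //; try exact/measurable_EFinP.
by apply: filterS fg => x /[apply] /= ->.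
Qed.

Lemma ae_intg f g : measurable_fun D f -> measurable_fun D g ->
  {ae mu, forall x, D x -> f x = g x} -> intg f -> intg g.
Proof.
move=> mf mg fg /integrableP[_ fi]; apply/integrableP; split.
  exact/measurable_EFinP.
rewrite (_ : (\int[mu]_(x in D) `|(EFin \o g) x|)%E = \int[mu]_(x in D) `|(EFin \o f) x|)%E//.
apply: ae_eq_integral => //; try by apply: measurableT_comp => //; exact/measurable_EFinP.
by apply: filterS fg => x /[apply] /= ->.
Qed.

(** The bound holds only almost everywhere: truncating [f] to the band between [- |g|] and [|g|]
    makes it hold everywhere and changes [f] on a null set only. *)
Lemma ae_le_intg f g : measurable_fun D f ->
  {ae mu, forall x, D x -> `|f x| <= g x} -> intg g -> intg f.
Proof.
move=> mf fg ig.
have mg := intg_measurable ig.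
pose f' x := Num.max (- `|g x|) (Num.min (f x) `|g x|).
have mng : measurable_fun D (fun x => `|g x|) by exact: measurableT_comp.
have mf' : measurable_fun D f'.
  apply: measurable_maxr; first exact: measurableT_comp.
  exact: measurable_minr.
have f'g x : D x -> `|f' x| <= `|g x|.
  by move=> _; rewrite /f'; rewrite ler_norml !le_max lexx/= ge_max ge_min lexx orbT andbT (@le_trans _ _ 0)// oppr_le0.
apply: (@ae_intg f' f) => //; last exact: (le_intg mf' f'g (intg_norm ig)).
apply: filterS fg => x H Dx; move: (H Dx) => {}H.
have {}H : `|f x| <= `|g x| by rewrite (le_trans H)// ler_norm.
move: H; rewrite ler_norml => /andP[H1 H2].
by rewrite /f' (min_idPl H2) (max_idPr H1).
Qed.

Lemma ae_le_Rintegral f g : intg f -> intg g ->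
  {ae mu, forall x, D x -> f x <= g x} ->
  \int[mu]_(x in D) f x <= \int[mu]_(x in D) g x.
Proof.
move=> fi gi fg.
have mf := intg_measurable fi; have mg := intg_measurable gi.
rewrite (@ae_eq_Rintegral f (fun x => Num.min (f x) (g x)))//.
- apply: le_Rintegral => //; last by move=> x _; rewrite ge_min lexx orbT.
  apply: (@ae_intg f) => //; first exact: measurable_minr.
  by apply: filterS fg => x /[apply] H; rewrite (min_idPl H).
- exact: measurable_minr.
- by apply: filterS fg => x /[apply] H; rewrite (min_idPl H).
Qed.

Lemma le_Rintegral_bound f (M : R) : intg f ->
  {ae mu, forall x, D x -> f x <= M} -> \int[mu]_(x in D) f x <= M * fine (mu D).
Proof.
move=> fi fM; rewrite -Rintegral_cst//; apply: ae_le_Rintegral => //.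
exact: intg_cst.
Qed.

Lemma sqint_intgM f g : sqint f -> sqint g -> intg (fun x => f x * g x).
Proof.
move=> [mf fi] [mg gi].
apply: (@le_intg _ (fun x => f x ^+ 2 + g x ^+ 2)); last exact: intgD.
  exact: measurable_funM.
move=> x _; rewrite normrM.
have := sqr_ge0 (`|f x| - `|g x|); rewrite -(real_normK (num_real (f x))) -(real_normK (num_real (g x))).
have := mulr_ge0 (normr_ge0 (f x)) (normr_ge0 (g x)); nra.
Qed.

Lemma sqint_bounded f (M : R) : measurable_fun D f ->
  (forall x, D x -> `|f x| <= M) -> sqint f.
Proof.
move=> mf fM; split => //; apply: (@intg_bounded _ (M ^+ 2)).
  exact: measurable_funX.
by move=> x Dx; rewrite normrX lerXn2r ?nnegrE// ?fM// (le_trans _ (fM _ Dx)).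
Qed.

Lemma sqint_cst (c : R) : sqint (fun=> c).
Proof. by apply: (@sqint_bounded _ `|c|). Qed.

Lemma sqint_intg f : sqint f -> intg f.
Proof.
move=> fi; have := sqint_intgM fi (sqint_cst 1).
by under eq_fun do rewrite mulr1.
Qed.

Lemma sqint_mulb f g (M : R) : measurable_fun D f ->
  (forall x, D x -> `|f x| <= M) -> sqint g -> sqint (fun x => f x * g x).
Proof.
move=> mf fM [mg gi]; split; first exact: measurable_funM.
apply: (@le_intg _ (fun x => M ^+ 2 * g x ^+ 2)); last exact: intgZ.
  by apply/measurable_funX/measurable_funM.
move=> x Dx; rewrite ger0_norm ?sqr_ge0// exprMn ler_pM ?sqr_ge0// -(real_normK (num_real (f x))).
by rewrite ler_sqr ?nnegrE ?fM// (le_trans _ (fM _ Dx)).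
Qed.

Lemma sqint_mulb_ae f g (M : R) : measurable_fun D f ->
  {ae mu, forall x, D x -> `|f x| <= M} -> sqint g -> sqint (fun x => f x * g x).
Proof.
move=> mf fM [mg gi]; split; first exact: measurable_funM.
apply: (@ae_le_intg _ (fun x => M ^+ 2 * g x ^+ 2)); last exact: intgZ.
  by apply/measurable_funX/measurable_funM.
apply: filterS fM => x H Dx; move: (H Dx) => {}H.
rewrite ger0_norm ?sqr_ge0// exprMn ler_pM ?sqr_ge0// -(real_normK (num_real (f x))).
by rewrite ler_sqr ?nnegrE// (le_trans _ H).
Qed.

Lemma sqintZ (c : R) f : sqint f -> sqint (fun x => c * f x).
Proof. by move=> fi; apply: (@sqint_mulb _ _ `|c|). Qed.

Lemma sqintD f g : sqint f -> sqint g -> sqint (fun x => f x + g x).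
Proof.
move=> fi gi; split; first exact: measurable_funD fi.1 gi.1.
under eq_fun do rewrite sqrrD.
apply: intgD; last exact: gi.2.
apply: intgD; first exact: fi.2.
rewrite (_ : (fun _ => _) = (fun x => 2 * (f x * g x))); last first.
  by apply/funext => x; rewrite mulr_natl.
exact/intgZ/sqint_intgM.
Qed.

Lemma sqintN f : sqint f -> sqint (fun x => - f x).
Proof. by move=> fi; under eq_fun do rewrite -mulN1r; exact: sqintZ. Qed.

Lemma sqintB f g : sqint f -> sqint g -> sqint (fun x => f x - g x).
Proof. by move=> fi gi; apply: sqintD => //; exact: sqintN. Qed.

Lemma sqint_sum (I : Type) (s : seq I) (P : pred I) (F : I -> X -> R) :
  (forall i, P i -> sqint (F i)) -> sqint (fun x => \sum_(i <- s | P i) F i x).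
Proof.
move=> Fi; elim: s => [|i s IH].
  under eq_fun do rewrite big_nil; exact: sqint_cst.
case: (boolP (P i)) => Pi; under eq_fun do rewrite big_cons.
  by rewrite Pi; apply: sqintD => //; exact: Fi.
by rewrite (negbTE Pi).
Qed.

(** The quadratic polynomial [t -> int (f + t g)^2] is nonnegative; its discriminant gives the
    inequality. *)
Lemma cauchy_schwarz_Rintegral f g : sqint f -> sqint g ->
  (\int[mu]_(x in D) (f x * g x)) ^+ 2 <=
  \int[mu]_(x in D) (f x ^+ 2) * \int[mu]_(x in D) (g x ^+ 2).
Proof.
move=> fi gi; set a := \int[mu]_(x in D) (g x ^+ 2); set b := \int[mu]_(x in D) (f x * g x).
set c := \int[mu]_(x in D) (f x ^+ 2).
have P (t : R) : 0 <= c + 2 * t * b + t ^+ 2 * a.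
  have -> : c + 2 * t * b + t ^+ 2 * a = \int[mu]_(x in D) ((f x + t * g x) ^+ 2).
    transitivity (\int[mu]_(x in D) (f x ^+ 2 + 2 * t * (f x * g x) + t ^+ 2 * g x ^+ 2)).
      have i1 := fi.2; have i2 := sqint_intgM fi gi; have i3 := gi.2.
      rewrite RintegralD//; [|exact/intgD/intgZ|exact: intgZ].
      rewrite RintegralD//; last exact: intgZ.
      by rewrite RintegralZl// RintegralZl.
    by apply: eq_Rintegral => x _; ring.
  by apply: Rintegral_ge0 => x _; exact: sqr_ge0.
have a0 : 0 <= a by apply: Rintegral_ge0 => x _; exact: sqr_ge0.
have c0 : 0 <= c by apply: Rintegral_ge0 => x _; exact: sqr_ge0.
have [a00|ap] : a = 0 \/ 0 < a by move: a0; rewrite le_eqVlt => /predU1P[|]; auto.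
  rewrite a00 mulr0; have [->|bn] := eqVneq b 0; first by rewrite expr0n.
  (* With [a = 0] the polynomial is affine in [t], and this [t] would give it the value [-1]. *)
  have := P (- (c + 1) / (2 * b)); rewrite a00 mulr0 addr0.
  have -> : 2 * (- (c + 1) / (2 * b)) * b = - (c + 1) by field.
  lra.
(* The minimiser of the polynomial. *)
have := P (- b / a).
have -> : c + 2 * (- b / a) * b + (- b / a) ^+ 2 * a = (c * a - b ^+ 2) / a.
  by field; rewrite gt_eqF.
by rewrite pmulr_lge0 ?invr_gt0// subr_ge0.
Qed.

End square_integrable.

(** * Convergence in the mean square and almost everywhere *)

Section square_integrable_limits.
Context dT (X : measurableType dT) (R : realType).
Variables (mu : {measure set X -> \bar R}) (D : set X).
Hypotheses (mD : measurable D) (muD : (mu D < +oo)%E).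
Implicit Types f g h : X -> R.
Local Notation intg := (intg mu D).
Local Notation sqint := (sqint mu D).

Definition cvg_sq (F : nat -> X -> R) f :=
  (fun m => \int[mu]_(x in D) (F m x - f x) ^+ 2) @ \oo --> (0 : R).

Lemma cvg0_sqr (a : R ^nat) :
  (fun m => a m ^+ 2) @ \oo --> (0 : R) -> a @ \oo --> (0 : R).
Proof.
move=> a2; apply: norm_cvg0.
rewrite (_ : (fun x => `|a x|) = Num.sqrt \o (fun m => a m ^+ 2)); last first.
  by apply/funext => m /=; rewrite sqrtr_sqr.
rewrite -(@sqrtr0 R); apply: continuous_cvg => //; exact: sqrt_continuous.
Qed.

(** Cauchy-Schwarz, in the form in which strong convergence of one factor absorbs a merely bounded
    one. *)
Lemma Rintegral_mul_cvg0 (S P : nat -> X -> R) (C : R) :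
  (forall m, sqint (S m)) -> (forall m, sqint (P m)) ->
  (forall m, \int[mu]_(x in D) (S m x ^+ 2) <= C) ->
  (fun m => \int[mu]_(x in D) (P m x ^+ 2)) @ \oo --> (0 : R) ->
  (fun m => \int[mu]_(x in D) (S m x * P m x)) @ \oo --> (0 : R).
Proof.
move=> Si Pi SC P0; apply: cvg0_sqr.
apply: (@squeeze_cvgr _ _ _ _ (fun=> 0) (fun m => C * \int[mu]_(x in D) (P m x ^+ 2))).
- apply: nearW => m; rewrite sqr_ge0 (le_trans (cauchy_schwarz_Rintegral mD (Si m) (Pi m)))//.
  by rewrite ler_wpM2r// Rintegral_ge0// => x _; exact: sqr_ge0.
- exact: cvg_cst.
- by rewrite -[X in _ --> X](mulr0 C); apply: cvgM => //; exact: cvg_cst.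
Qed.

Lemma cvg_sq_bounded F f : (forall m, sqint (F m)) -> sqint f -> cvg_sq F f ->
  exists C, forall m, \int[mu]_(x in D) (F m x ^+ 2) <= C.
Proof.
move=> Fi fi Ff; have [M [_ HM]] := cvg_seq_bounded (cvgP _ Ff).
exists (2 * (M + 1) + 2 * \int[mu]_(x in D) (f x ^+ 2)) => m.
have i1 := (sqintB mD (Fi m) fi).2; have i2 := fi.2.
apply: (@le_trans _ _ (\int[mu]_(x in D) (2 * (F m x - f x) ^+ 2 + 2 * f x ^+ 2))).
  apply: le_Rintegral => //; [exact: (Fi m).2|by apply: intgD => //; exact: intgZ|].
  by move=> x _; have := sqr_ge0 (F m x - 2 * f x); nra.
rewrite RintegralD//; [|exact: intgZ|exact: intgZ].
rewrite !RintegralZl// lerD2r ler_pM2l//.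
rewrite (le_trans (ler_norm _))//; apply: HM => //; by rewrite ltrDl.
Qed.

Lemma cvg_sq_mul F f G g : (forall m, sqint (F m)) -> sqint f ->
  (forall m, sqint (G m)) -> sqint g -> cvg_sq F f -> cvg_sq G g ->
  (fun m => \int[mu]_(x in D) (F m x * G m x)) @ \oo -->
    \int[mu]_(x in D) (f x * g x).
Proof.
move=> Fi fi Gi gi Ff Gg.
have [C HC] := cvg_sq_bounded Fi fi Ff.
apply/subr_cvg0.
rewrite (_ : (fun m => _) = (fun m => \int[mu]_(x in D) (F m x * (G m x - g x)) +
    \int[mu]_(x in D) (g x * (F m x - f x)))); last first.
  apply/funext => m.
  rewrite -RintegralB//; [|exact: sqint_intgM|exact: sqint_intgM].
  rewrite -RintegralD//; [|by apply: sqint_intgM => //; exact: sqintB..].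
  by apply: eq_Rintegral => x _; ring.
rewrite -[X in _ --> X](addr0 0); apply: cvgD.
  by apply: (Rintegral_mul_cvg0 _ _ HC) => // m; exact: sqintB.
by apply: (@Rintegral_mul_cvg0 (fun=> g) _ (\int[mu]_(x in D) (g x ^+ 2))) => // m; exact: sqintB.
Qed.

Lemma cvg_sq_cst f : cvg_sq (fun=> f) f.
Proof.
rewrite /cvg_sq (_ : (fun _ => _) = (fun=> 0)); first exact: cvg_cst.
apply/funext => m; under eq_Rintegral do rewrite subrr expr0n.
by rewrite Rintegral_cst// mul0r.
Qed.

Lemma cvg_sqD F f G g : (forall m, sqint (F m)) -> sqint f ->
  (forall m, sqint (G m)) -> sqint g -> cvg_sq F f -> cvg_sq G g ->
  cvg_sq (fun m x => F m x + G m x) (fun x => f x + g x).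
Proof.
move=> Fi fi Gi gi Ff Gg; rewrite /cvg_sq.
apply: (@squeeze_cvgr _ _ _ _ (fun=> 0) (fun m =>
   2 * \int[mu]_(x in D) (F m x - f x) ^+ 2 + 2 * \int[mu]_(x in D) (G m x - g x) ^+ 2)).
- apply: nearW => m; apply/andP; split; first by apply: Rintegral_ge0 => x _; exact: sqr_ge0.
  have i1 := (sqintB mD (Fi m) fi); have i2 := (sqintB mD (Gi m) gi).
  rewrite -!RintegralZl//; [|exact: i2.2|exact: i1.2].
  rewrite -RintegralD//; [|exact: intgZ i1.2|exact: intgZ i2.2].
  apply: le_Rintegral => //.
  + exact: (sqintB mD (sqintD mD (Fi m) (Gi m)) (sqintD mD fi gi)).2.
  + exact: (intgD mD (intgZ mD _ i1.2) (intgZ mD _ i2.2)).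
  + by move=> x _; have := sqr_ge0 ((F m x - f x) - (G m x - g x)); nra.
- exact: cvg_cst.
- rewrite -[X in _ --> X](addr0 0) -[X in X + _](mulr0 2) -[X in _ + X](mulr0 2).
  by apply: cvgD; apply: cvgM => //; exact: cvg_cst.
Qed.

Lemma cvg_sqZ (c : R) F f : (forall m, sqint (F m)) -> sqint f ->
  cvg_sq F f -> cvg_sq (fun m x => c * F m x) (fun x => c * f x).
Proof.
move=> Fi fi Ff; rewrite /cvg_sq.
rewrite (_ : (fun m => _) = (fun m => c ^+ 2 * \int[mu]_(x in D) (F m x - f x) ^+ 2)).
  by rewrite -[X in _ --> X](mulr0 (c ^+ 2)); apply: cvgM => //; exact: cvg_cst.
apply/funext => m; rewrite -RintegralZl//; last exact: (sqintB mD (Fi m) fi).2.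
by apply: eq_Rintegral => x _; ring.
Qed.

Lemma cvg_sq_sum (I : Type) (s : seq I) (F : I -> nat -> X -> R) (f : I -> X -> R) :
  (forall i m, sqint (F i m)) -> (forall i, sqint (f i)) ->
  (forall i, cvg_sq (F i) (f i)) ->
  cvg_sq (fun m x => \sum_(i <- s) F i m x) (fun x => \sum_(i <- s) f i x).
Proof.
move=> Fi fi Ff; elim: s => [|i s IH].
  rewrite (_ : (fun m => _) = (fun m => (fun=> 0))).
    rewrite (_ : (fun x => _) = (fun=> 0)); first exact: cvg_sq_cst.
    by apply/funext => x; rewrite big_nil.
  by apply/funext => m; apply/funext => x; rewrite big_nil.
rewrite (_ : (fun m => _) = (fun m x => F i m x + \sum_(j <- s) F j m x)); last first.
  by apply/funext => m; apply/funext => x; rewrite big_cons.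
rewrite (_ : (fun x => \sum_(i <- _) _) = (fun x => f i x + \sum_(j <- s) f j x)); last first.
  by apply/funext => x; rewrite big_cons.
by apply: cvg_sqD => // *; exact: sqint_sum.
Qed.

Lemma dominated_Rintegral (F : nat -> X -> R) f g :
  (forall m, measurable_fun D (F m)) -> measurable_fun D f -> intg g ->
  {ae mu, forall x, D x -> F m x @[m --> \oo] --> f x} ->
  {ae mu, forall x m, D x -> `|F m x| <= g x} ->
  (fun m => \int[mu]_(x in D) F m x) @ \oo --> \int[mu]_(x in D) f x.
Proof.
move=> mF mf ig Ff Fg; apply: fine_cvg.
have [|||||fi _ H] := @dominated_convergence _ _ _ mu D mD (fun m => EFin \o F m) (EFin \o f) (EFin \o g).
- by move=> m; exact/measurable_EFinP.
- exact/measurable_EFinP.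
- apply: filterS Ff => x H Dx; apply: cvg_EFin; first exact: nearW.
  exact: H.
- exact: ig.
- by apply: filterS Fg => x H m Dx; rewrite lee_fin; exact: H.
by rewrite fineK//; exact: integrable_fin_num.
Qed.

(** The difference splits as [b_m (F_m - f) + (b_m - b) f]. The uniform bound settles the first
    part; in the second the factor [f] is fixed, so dominated convergence needs only pointwise
    convergence of the coefficients. *)
Lemma cvg_sq_mulb (b_ : nat -> X -> R) (b : X -> R) (M : R) F f :
  (forall m, measurable_fun D (b_ m)) -> measurable_fun D b ->
  {ae mu, forall x m, D x -> `|b_ m x| <= M} ->
  {ae mu, forall x, D x -> b_ m x @[m --> \oo] --> b x} ->
  (forall m, sqint (F m)) -> sqint f -> cvg_sq F f ->
  cvg_sq (fun m x => b_ m x * F m x) (fun x => b x * f x).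
Proof.
move=> mb_ mb bM b_b Fi fi Ff.
have bM' : {ae mu, forall x, D x -> `|b x| <= M}.
  apply: filterS2 bM b_b => x bM b_b Dx.
  have h : (fun m => `|b_ m x|) @ \oo --> `|b x| by exact: cvg_norm (b_b Dx).
  rewrite -(cvg_lim (@Rhausdorff R) h); apply: limr_le; first exact: cvgP h.
  by apply: nearW => m; exact: bM.
have bMm m : {ae mu, forall x, D x -> `|b_ m x| <= M}.
  by apply: filterS bM => x H; exact: H.
have s1 m : sqint (fun x => b_ m x * (F m x - f x)).
  by apply: (sqint_mulb_ae mD (mb_ m) (bMm m)); exact: sqintB.
have s2 m : sqint (fun x => (b_ m x - b x) * f x).
  apply: (@sqint_mulb_ae _ _ _ _ _ mD _ _ (M + M)) => //; first exact: measurable_funB.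
  apply: filterS2 (bMm m) bM' => x H1 H2 Dx.
  by rewrite (le_trans (ler_normB _ _))// lerD// ?H1// H2.
have := @cvg_sqD (fun m x => b_ m x * (F m x - f x)) (fun=> 0)
   (fun m x => (b_ m x - b x) * f x) (fun=> 0) s1 (sqint_cst mD muD 0) s2 (sqint_cst mD muD 0).
rewrite {3}/cvg_sq (_ : (fun m => \int[mu]_(x in D) (_ + _ - _) ^+ 2) =
  (fun m => \int[mu]_(x in D) (b_ m x * F m x - b x * f x) ^+ 2)); last first.
  by apply/funext => m; apply: eq_Rintegral => x _; ring.
apply; rewrite /cvg_sq; under eq_fun do under eq_Rintegral do rewrite subr0.
  apply: (@squeeze_cvgr _ _ _ _ (fun=> 0) (fun m => M ^+ 2 * \int[mu]_(x in D) (F m x - f x) ^+ 2)).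
  - apply: nearW => m; apply/andP; split; first by apply: Rintegral_ge0 => x _; exact: sqr_ge0.
    have i := (sqintB mD (Fi m) fi).2.
    rewrite -RintegralZl//; apply: ae_le_Rintegral => //; first exact: (s1 m).2.
      exact: intgZ.
    apply: filterS (bMm m) => x H Dx; move: (H Dx) => {}H.
    rewrite exprMn ler_pM ?sqr_ge0// -(real_normK (num_real (b_ m x))).
    by rewrite ler_sqr ?nnegrE// (le_trans _ H).
  - exact: cvg_cst.
  - by rewrite -[X in _ --> X](mulr0 (M ^+ 2)); apply: cvgM => //; exact: cvg_cst.
rewrite (_ : 0 = \int[mu]_(x in D) (fun=> 0) x); last by rewrite Rintegral_cst// mul0r.
apply: (@dominated_Rintegral _ _ (fun x => (M + M) ^+ 2 * f x ^+ 2)).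
- move=> m; apply/measurable_funX/measurable_funM; last exact: fi.1.
  exact: measurable_funB.
- exact: measurable_cst.
- by apply: intgZ => //; exact: fi.2.
- apply: filterS b_b => x H Dx.
  have h : (b_ m x - b x) * f x @[m --> \oo] --> (0 : R).
    rewrite -[X in _ --> X](mul0r (f x)); apply: cvgMl.
    by apply/subr_cvg0; exact: H.
  by rewrite -[X in _ --> X](mulr0 0); exact: (cvgM h h).
- apply: filterS2 bM bM' => x H1 H2 m Dx.
  rewrite ger0_norm ?sqr_ge0// exprMn ler_pM ?sqr_ge0//.
  rewrite -(real_normK (num_real (_ - _))) ler_sqr ?nnegrE//.
    by rewrite (le_trans (ler_normB _ _))// lerD// ?H1// H2.
  by rewrite addr_ge0// (le_trans _ (H2 Dx)).
Qed.

Lemma cvg_sq_bounded_ae (F : nat -> X -> R) f (M : R) :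
  (forall m, measurable_fun D (F m)) -> measurable_fun D f ->
  {ae mu, forall x m, D x -> `|F m x| <= M} ->
  {ae mu, forall x, D x -> F m x @[m --> \oo] --> f x} -> cvg_sq F f.
Proof.
move=> mF mf FM Ff.
have := cvg_sq_mulb mF mf FM Ff (fun=> sqint_cst mD muD 1) (sqint_cst mD muD 1) (@cvg_sq_cst (fun=> 1)).
by rewrite /cvg_sq; under eq_fun do under eq_Rintegral do rewrite !mulr1.
Qed.

(** Monotone convergence: the sum of the series has integral at most [2 c], so it is finite almost
    everywhere. *)
Lemma ae_cvg_series (G : nat -> X -> R) (c : R) :
  (forall k, intg (G k)) -> (forall k x, 0 <= G k x) ->
  (forall k, \int[mu]_(x in D) G k x <= c * 2^-1 ^+ k) ->
  {ae mu, forall x, D x -> cvgn (series (fun k => G k x))}.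
Proof.
move=> Gi G0 Gc.
have c0 : 0 <= c.
  by have := Gc 0%N; rewrite expr0 mulr1; apply: le_trans; apply: Rintegral_ge0.
pose S x := (\sum_(k <oo) (G k x)%:E)%E.
have mS : measurable_fun D S.
  apply: ge0_emeasurable_sum => k; first by move=> x _ _; rewrite lee_fin.
  by move=> _; apply/measurable_EFinP; exact: intg_measurable (Gi k).
have iS : mu.-integrable D S.
  apply/integrableP; split => //.
  rewrite (eq_integral S); last first.
    by move=> x _; rewrite gee0_abs// nneseries_ge0// => k _ _; rewrite lee_fin.
  rewrite /S integral_nneseries//; last first.
    by move=> k x _; rewrite lee_fin.
    by move=> k; apply/measurable_EFinP; exact: intg_measurable (Gi k).
  apply: (@le_lt_trans _ _ (\sum_(k <oo) (c * 2^-1 ^+ k)%:E)%E).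
    apply: lee_nneseries => [k _ _|k _]; first by apply: integral_ge0 => x _; rewrite lee_fin.
    rewrite -[X in (X <= _)%E]fineK ?lee_fin; first exact: Gc.
    by apply: integrable_fin_num => //; exact: Gi.
  rewrite (@cvg_lim _ _ _ _ _ _ (2 * c)%:E) ?ltry//.
  rewrite (_ : (fun n => _) = EFin \o series (geometric c 2^-1)); last first.
    by apply/funext => n; rewrite /= /series/= -sumEFin.
  apply: cvg_EFin; first exact: nearW.
  rewrite (_ : 2 * c = c * (1 - 2^-1)^-1); last by field.
  by apply: cvg_geometric_series; rewrite ger0_norm// invf_lt1// ltr1n.
apply: filterS (integrable_ae mD iS) => x H Dx; move: (H Dx) => {}H.
apply: nondecreasing_is_cvgn.
  by apply: nondecreasing_series => k _ _; exact: G0.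
exists (fine (S x)) => _ [n _ <-].
rewrite -lee_fin fineK// /series/= -sumEFin /S.
apply: (@nneseries_lim_ge _ (fun k => (G k x)%:E)) => k _; by rewrite lee_fin.
Qed.

(** Along [phi] the squared distances have integrals below [2^-k]; they are therefore summable at
    almost every point and tend to zero there. *)
Lemma cvg_sq_ae_subsequence F f : (forall m, sqint (F m)) -> sqint f -> cvg_sq F f ->
  exists2 phi : nat -> nat, strictly_increasing phi &
    {ae mu, forall x, D x -> F (phi m) x @[m --> \oo] --> f x}.
Proof.
move=> Fi fi Ff.
have H k : exists n, forall m, (n <= m)%N ->
    \int[mu]_(x in D) (F m x - f x) ^+ 2 <= 2^-1 ^+ k.
  have : \forall m \near \oo, \int[mu]_(x in D) (F m x - f x) ^+ 2 < 2^-1 ^+ k.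
    by apply: (cvgr_lt (0 : R)) => //; rewrite exprn_gt0// invr_gt0.
  by move=> [n _ Hn]; exists n => m nm; apply/ltW/Hn.
have [N HN] := choice H.
pose phi := fix phi k := if k is k'.+1 then maxn (phi k').+1 (N k) else N 0%N.
exists phi; first by move=> m /=; rewrite leq_max leqnn.
have phiN k : (N k <= phi k)%N by case: k => [|k] //=; rewrite leq_max leqnn orbT.
have Hphi k : \int[mu]_(x in D) (F (phi k) x - f x) ^+ 2 <= 1 * 2^-1 ^+ k.
  by rewrite mul1r; exact: HN.
have := ae_cvg_series (fun k => (sqintB mD (Fi (phi k)) fi).2) (fun k x => sqr_ge0 _) Hphi.
apply: filterS => x /[apply] /cvg_series_cvg_0 H0.
by apply/subr_cvg0/cvg0_sqr.
Qed.

End square_integrable_limits.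

(** * Norms, uniform boundedness and weak-strong pairings *)

Section square_integrable_duality.
Context dT (X : measurableType dT) (R : realType).
Variables (mu : {measure set X -> \bar R}) (D : set X).
Hypotheses (mD : measurable D) (muD : (mu D < +oo)%E).
Implicit Types f g h : X -> R.
Local Notation intg := (intg mu D).
Local Notation sqint := (sqint mu D).
Local Notation cvg_sq := (cvg_sq mu D).

Definition norm2 f : R := Num.sqrt (\int[mu]_(x in D) f x ^+ 2).

Lemma norm2_ge0 f : 0 <= norm2 f. Proof. exact: sqrtr_ge0. Qed.

Lemma norm2_sqr f : norm2 f ^+ 2 = \int[mu]_(x in D) f x ^+ 2.
Proof. by rewrite sqr_sqrtr// Rintegral_ge0// => x _; exact: sqr_ge0. Qed.

Lemma norm2_le f (c : R) : 0 <= c ->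
  (norm2 f <= c) = (\int[mu]_(x in D) f x ^+ 2 <= c ^+ 2).
Proof. by move=> c0; rewrite -norm2_sqr ler_sqr// nnegrE// norm2_ge0. Qed.

Lemma ler_norm2M f g : sqint f -> sqint g ->
  `|\int[mu]_(x in D) (f x * g x)| <= norm2 f * norm2 g.
Proof.
move=> fi gi; rewrite -ler_sqr ?nnegrE ?mulr_ge0 ?norm2_ge0//.
rewrite real_normK ?num_real// exprMn !norm2_sqr.
exact: cauchy_schwarz_Rintegral.
Qed.

Lemma ler_norm2D f g : sqint f -> sqint g ->
  norm2 (fun x => f x + g x) <= norm2 f + norm2 g.
Proof.
move=> fi gi; rewrite norm2_le ?addr_ge0 ?norm2_ge0// sqrrD !norm2_sqr.
rewrite (_ : \int[mu]_(x in D) _ = \int[mu]_(x in D) (f x ^+ 2 + 2 * (f x * g x) + g x ^+ 2)); last first.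
  by apply: eq_Rintegral => x _; ring.
have i2 := sqint_intgM mD fi gi; have i1 := fi.2; have i3 := gi.2.
rewrite RintegralD//; [|exact/intgD/intgZ].
rewrite RintegralD//; [|exact/intgZ].
rewrite RintegralZl// lerD2r lerD2l.
have := le_trans (ler_norm _) (ler_norm2M fi gi); rewrite mulr2n; lra.
Qed.

Lemma norm2Z (c : R) f : sqint f -> norm2 (fun x => c * f x) = `|c| * norm2 f.
Proof.
move=> fi; rewrite /norm2; under eq_Rintegral do rewrite exprMn.
rewrite RintegralZl//; last exact: fi.2.
by rewrite sqrtrM ?sqr_ge0// sqrtr_sqr.
Qed.

(** Fatou's lemma bounds the integral in the extended reals first, so the square integrability of
    the limit comes out together with the bound. *)
Lemma fatou_sq (F : nat -> X -> R) f (C : R) : (forall m, sqint (F m)) ->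
  measurable_fun D f -> (forall m, \int[mu]_(x in D) F m x ^+ 2 <= C) ->
  {ae mu, forall x, D x -> F m x @[m --> \oo] --> f x} ->
  sqint f /\ \int[mu]_(x in D) f x ^+ 2 <= C.
Proof.
move=> Fi mf FC Ff.
have mF m : measurable_fun D (fun x => (F m x ^+ 2)%:E).
  by apply/measurable_EFinP; apply: measurable_funX; exact: (Fi m).1.
have C0 : 0 <= C by apply: le_trans (FC 0%N); apply: Rintegral_ge0 => x _; exact: sqr_ge0.
have H : (\int[mu]_(x in D) (f x ^+ 2)%:E <= C%:E)%E.
  rewrite (@ae_eq_integral _ _ _ mu D (fun x => limn_einf (fun m => (F m x ^+ 2)%:E))).
  - apply: le_trans; first apply: fatou => //.
      by move=> n x _; rewrite lee_fin sqr_ge0.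
    rewrite limn_einf_lim; apply: lime_le; first exact: is_cvg_einfs.
    apply: nearW => n; apply: (@le_trans _ _ (\int[mu]_(x in D) (F n x ^+ 2)%:E)%E).
      by apply: ereal_inf_lbound; exists n => //=.
    rewrite -[leLHS]fineK ?lee_fin; first exact: FC.
    by apply: integrable_fin_num => //; exact: (Fi n).2.
  - exact: mD.
  - exact/measurable_EFinP/measurable_funX.
  - rewrite /limn_einf; apply: measurableT_comp => //.
    by apply: measurable_fun_limn_esup => n; apply: measurableT_comp => //; exact: mF.
  - apply: filterS Ff => x H Dx; apply/esym/(cvg_limn_einf_sup _).1.
    apply: cvg_EFin; first exact: nearW.
    by rewrite expr2; under eq_fun do rewrite expr2 /=; apply: cvgM; exact: H.
have fi : sqint f.
  split => //; apply/integrableP; split; first exact/measurable_EFinP/measurable_funX.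
  rewrite (eq_integral (fun x => (f x ^+ 2)%:E)) ?(le_lt_trans H) ?ltry// => x _.
  by rewrite gee0_abs// lee_fin sqr_ge0.
split => //; rewrite -lee_fin /Rintegral fineK//.
by apply: integrable_fin_num => //; exact: fi.2.
Qed.

(* Gliding hump: each step adds a multiple of [g k] small in norm, with the sign that
   keeps the pairing with [g k] at least [3^-k] times its norm. *)
Section uniform_boundedness.
Variable g : nat -> X -> R.
Hypotheses (gi : forall k, sqint (g k)) (g0 : forall k, 0 < norm2 (g k)).

Definition hump_coef (k : nat) (y : X -> R) : R :=
  (-1) ^+ (\int[mu]_(x in D) (g k x * y x) < 0)%R * (3^-1 ^+ k / norm2 (g k)).

Fixpoint hump (k : nat) : X -> R :=
  if k is k'.+1 then fun x => hump k' x + hump_coef k' (hump k') * g k' x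
  else fun=> 0.

Lemma hump_sqint k : sqint (hump k).
Proof.
elim: k => [|k IH] /=; first exact: sqint_cst.
by apply: sqintD => //; exact: sqintZ.
Qed.

Lemma norm_hump_coef k y : `|hump_coef k y| = 3^-1 ^+ k / norm2 (g k).
Proof.
rewrite /hump_coef normrM normrX normrN1 expr1n mul1r ger0_norm//.
by rewrite divr_ge0 ?ltW// exprn_gt0.
Qed.

(** The increments added after [hump k.+1] have norms [3^-j] with [k < j <= k + n], and the
    right-hand side is their sum. It stays below [3^-k / 2], half of what the pairing with [g k]
    gains: this is why the ratio is 3 and not 2. *)
Lemma norm2_humpB n k : norm2 (fun x => hump (k + n).+1 x - hump k.+1 x) <=
  (3^-1 ^+ k - 3^-1 ^+ (k + n)) / 2.
Proof.
elim: n => [|n IH].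
  rewrite addn0 subrr mul0r norm2_le// expr0n.
  by under eq_Rintegral do rewrite subrr expr0n; rewrite Rintegral_cst// mul0r.
rewrite addnS (_ : (fun x => _) = (fun x => (hump (k + n).+1 x - hump k.+1 x) +
   hump_coef (k + n).+1 (hump (k + n).+1) * g (k + n).+1 x)); last first.
  by apply/funext => x; rewrite [in LHS]/= /=; ring.
rewrite (le_trans (ler_norm2D _ _))//.
- by apply: sqintB => //; exact: hump_sqint.
- exact: sqintZ.
rewrite norm2Z// norm_hump_coef divfK ?gt_eqF// (le_trans (lerD IH (lexx _)))//.
by rewrite exprS; lra.
Qed.

Lemma hump_pairing k :
  3^-1 ^+ k * norm2 (g k) <= `|\int[mu]_(x in D) (g k x * hump k.+1 x)|.
Proof.
rewrite /=; set c := hump_coef _ _; set b := \int[mu]_(x in D) (g k x * hump k x).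
have -> : \int[mu]_(x in D) (g k x * (hump k x + c * g k x)) = b + c * norm2 (g k) ^+ 2.
  rewrite norm2_sqr -RintegralZl//; last exact: (gi k).2.
  rewrite -RintegralD//; last first.
    by apply: intgZ => //; exact: (gi k).2.
    by apply: sqint_intgM => //; exact: hump_sqint.
  by apply: eq_Rintegral => x _; ring.
have -> : c * norm2 (g k) ^+ 2 = (-1) ^+ (b < 0)%R * (3^-1 ^+ k * norm2 (g k)).
  by rewrite /c /hump_coef -/b -mulrA; congr (_ * _); rewrite expr2 mulrA divfK ?gt_eqF.
have p : 0 <= 3^-1 ^+ k * norm2 (g k) by rewrite mulr_ge0 ?norm2_ge0// exprn_ge0.
have [b0|b0] := ltP b 0.
  by rewrite expr1 mulN1r ler0_norm; lra.
by rewrite expr0 mul1r ger0_norm; lra.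
Qed.

(** The increments have summable norms, hence the humps converge almost everywhere; Fatou's lemma
    carries the bound on the tails over to the limit, so completeness of the space of
    square-integrable functions is not invoked. *)
Lemma hump_limit : exists2 psi, sqint psi &
  forall k, norm2 (fun x => psi x - hump k.+1 x) <= 3^-1 ^+ k / 2.
Proof.
(* An upper limit is measurable before convergence is known, and it agrees with the limit wherever
   that exists. *)
pose psi x := fine (limn_esup (fun k => (hump k x)%:E)).
have mpsi : measurable_fun D psi.
  apply: measurableT_comp; first exact: fine_measurable.
  apply: measurable_fun_limn_esup => k; apply/measurable_EFinP.
  exact: (hump_sqint k).1.
have hpsi : {ae mu, forall x, D x -> hump k x @[k --> \oo] --> psi x}.
  have di k : sqint (fun x => hump k.+1 x - hump k x).
    by apply: sqintB => //; exact: hump_sqint.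
  have := @ae_cvg_series _ _ _ mu _ mD (fun k x => `|hump k.+1 x - hump k x|) (norm2 (fun=> 1)).
  move=> /(_ (fun k => intg_norm (sqint_intg mD muD (di k)))) /(_ (fun k x => normr_ge0 _)).
  have H k : \int[mu]_(x in D) `|hump k.+1 x - hump k x| <= norm2 (fun=> 1) * 2^-1 ^+ k.
    have ni : sqint (fun x => `|hump k.+1 x - hump k x|).
      split; first by apply: measurableT_comp => //; exact: (di k).1.
      by under eq_fun do rewrite real_normK ?num_real//; exact: (di k).2.
    have := ler_norm2M (sqint_cst mD muD 1) ni.
    under [X in `|X|]eq_Rintegral do rewrite mul1r.
    move=> /(le_trans (ler_norm _)) /le_trans; apply.
    rewrite ler_wpM2l ?norm2_ge0//.
    rewrite (_ : norm2 _ = norm2 (fun x => hump_coef k (hump k) * g k x)); last first.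
      congr Num.sqrt; apply: eq_Rintegral => x _.
      by rewrite real_normK ?num_real//= [hump k x + _]addrC addrK.
    rewrite norm2Z// norm_hump_coef divfK ?gt_eqF//.
    by rewrite lerXn2r ?nnegrE// lef_pV2 ?posrE// ler_nat.
  move=> /(_ H); apply: filterS => x /[apply] cv.
  have {}cv : cvgn (hump^~ x).
    have : cvgn (series (fun k => hump k.+1 x - hump k x)) by exact: normed_cvg.
    rewrite /series/= (_ : (fun n => _) = (hump^~ x)) //.
    by apply/funext => n; rewrite telescope_sumr//= subr0.
  have cvE : (fun k => (hump k x)%:E) @ \oo --> (limn (hump^~ x))%:E.
    by apply: cvg_EFin; [exact: nearW|exact: cv].
  by rewrite /psi (cvg_limn_einf_sup cvE).2.
have F k : sqint (fun x => psi x - hump k.+1 x) /\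
    \int[mu]_(x in D) (psi x - hump k.+1 x) ^+ 2 <= (3^-1 ^+ k / 2) ^+ 2.
  apply: (@fatou_sq (fun n x => hump (k + n).+1 x - hump k.+1 x)).
  - by move=> m; apply: sqintB => //; exact: hump_sqint.
  - by apply: measurable_funB => //; exact: (hump_sqint _).1.
  - move=> m; rewrite -norm2_le ?divr_ge0 ?exprn_ge0//.
    rewrite (le_trans (norm2_humpB _ _))// ler_pM2r ?invr_gt0//.
    by rewrite gerBl exprn_ge0.
  - apply: filterS hpsi => x H Dx; apply: cvgB; last exact: cvg_cst.
    have := H Dx; rewrite -(cvg_shiftn k.+1) => {}H.
    by rewrite (_ : (fun n => _) = (fun n => hump (n + k.+1)%N x))//; apply/funext => n; rewrite addnS addnC.
exists psi; last by move=> k; rewrite norm2_le ?divr_ge0 ?exprn_ge0//; exact: (F k).2.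
have := sqintD mD (F 0%N).1 (hump_sqint 1).
by under eq_fun do rewrite subrK.
Qed.

End uniform_boundedness.

(** The uniform boundedness principle. If the norms were unbounded, some [g k] would have norm above
    [2 (k + 1) 3^k]. The limit of the humps pairs with [g k] to at least [3^-k - 3^-k / 2] times
    that norm, which exceeds [k + 1]. *)
Lemma weakly_bounded (G : nat -> X -> R) : (forall m, sqint (G m)) ->
  (forall psi, sqint psi ->
    exists C, forall m, `|\int[mu]_(x in D) (G m x * psi x)| <= C) ->
  exists C, forall m, \int[mu]_(x in D) (G m x ^+ 2) <= C.
Proof.
move=> Gi GC; apply: contrapT => /forallNP nC.
have H k : exists m, 2 * (k.+1%:R * 3 ^+ k) < norm2 (G m).
  have := nC ((2 * (k.+1%:R * 3 ^+ k)) ^+ 2) => /existsNP[m /negP].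
  rewrite -norm2_le ?mulr_ge0 ?exprn_ge0// -ltNge => ?; by exists m.
have [M HM] := choice H.
pose g k := G (M k).
have gi k : sqint (g k) by exact: Gi.
have g0 k : 0 < norm2 (g k).
  by apply: le_lt_trans (HM k); rewrite !mulr_ge0// exprn_ge0.
have [psi psii Hpsi] := hump_limit gi g0.
have [C HC] := GC _ psii.
(* At this index [C < k + 1], so the pairing already exceeds the assumed bound. *)
have := HC (M (Num.truncn C)); rewrite -/(g _); set k := Num.truncn C.
apply/negP; rewrite -ltNge; apply: (@lt_le_trans _ _ k.+1%:R).
  exact: truncnS_gt.
have e : \int[mu]_(x in D) (g k x * psi x) = \int[mu]_(x in D) (g k x * hump g k.+1 x) +
    \int[mu]_(x in D) (g k x * (psi x - hump g k.+1 x)).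
  have hi := hump_sqint gi k.+1.
  rewrite -RintegralD//; last first.
  - by apply: sqint_intgM => //; exact: sqintB.
  - exact: sqint_intgM.
  by apply: eq_Rintegral => x _; ring.
rewrite e.
have h1 := hump_pairing gi g0 k.
have h2 : `|\int[mu]_(x in D) (g k x * (psi x - hump g k.+1 x))| <= norm2 (g k) * (3^-1 ^+ k / 2).
  apply: le_trans (ler_norm2M (gi k) (sqintB mD psii (hump_sqint gi k.+1))) _.
  by rewrite ler_wpM2l ?norm2_ge0.
have h3 : k.+1%:R <= norm2 (g k) * (3^-1 ^+ k / 2).
  rewrite exprVn mulrA ler_pdivlMr// ler_pdivlMr ?exprn_gt0//.
  by rewrite mulrAC mulrC; exact/ltW/HM.
have := lerB_normD (\int[mu]_(x in D) (g k x * hump g k.+1 x)) (\int[mu]_(x in D) (g k x * (psi x - hump g k.+1 x))).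
by move: h1 h2 h3; lra.
Qed.

(** Replacing [P m] by its limit costs the norm of [G m], which is bounded by [weakly_bounded]; what
    remains is a fixed test function. *)
Lemma cvg_weak_sq (G P : nat -> X -> R) g p : (forall m, sqint (G m)) -> sqint g ->
  (forall m, sqint (P m)) -> sqint p ->
  (forall psi, sqint psi -> (fun m => \int[mu]_(x in D) (G m x * psi x)) @ \oo -->
     \int[mu]_(x in D) (g x * psi x)) ->
  cvg_sq P p ->
  (fun m => \int[mu]_(x in D) (G m x * P m x)) @ \oo --> \int[mu]_(x in D) (g x * p x).
Proof.
move=> Gi gi Pi pi Gg Pp.
have [|C HC] := weakly_bounded Gi.
  move=> psi /Gg /cvgP /cvg_seq_bounded [M [_ HM]].
  by exists (M + 1) => m; apply: HM => //; rewrite ltrDl.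
rewrite (_ : (fun m => _) = (fun m => \int[mu]_(x in D) (G m x * (P m x - p x)) +
    \int[mu]_(x in D) (G m x * p x))).
  rewrite -[X in _ --> X]add0r; apply: cvgD; last exact: Gg.
  by apply: (Rintegral_mul_cvg0 mD Gi _ HC) => // m; exact: sqintB.
apply/funext => m; rewrite -RintegralD//; last first.
- exact: sqint_intgM.
- by apply: sqint_intgM => //; exact: sqintB.
by apply: eq_Rintegral => x _; ring.
Qed.

End square_integrable_duality.

(** * Lebesgue measure on column vectors *)

Section matrix_topology.
Context {R : realType} {m n : nat}.
Implicit Types M P : 'M[R]_(m, n).

Lemma ler_coord_mx_norm M i j : `|M i j| <= `|M|.
Proof.
rewrite /Num.norm/= mx_normrE.
exact: (@le_bigmax _ _ _ 0 (fun k : 'I_m * 'I_n => `|M k.1 k.2|) (i, j)).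
Qed.

Lemma ler_mx_norm M (c : R) : 0 <= c -> (forall i j, `|M i j| <= c) -> `|M| <= c.
Proof.
move=> c0 Mc; rewrite /Num.norm/= mx_normrE; exact: bigmax_le.
Qed.

Lemma cvg_mx (T : Type) (F : set_system T) {FF : ProperFilter F} (f : T -> 'M[R]_(m, n)) M :
  (forall i j, f x i j @[x --> F] --> M i j) -> f x @[x --> F] --> M.
Proof.
move=> fM; apply/cvgrPdist_le => e e0.
have H : \forall x \near F, forall k : 'I_m * 'I_n, `|M k.1 k.2 - f x k.1 k.2| <= e.
  apply: filter_forall => -[i j] /=.
  by move: (fM i j) => /cvgrPdist_le /(_ e e0).
apply: filterS H => x H; apply: ler_mx_norm; first exact: ltW.
by move=> i j; rewrite !mxE; exact: (H (i, j)).
Qed.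

Lemma cvg_mx_coord (T : Type) (F : set_system T) {FF : Filter F} (f : T -> 'M[R]_(m, n)) M i j :
  f x @[x --> F] --> M -> f x i j @[x --> F] --> M i j.
Proof. move=> fM; exact: (cvg_comp _ _ fM (@coord_continuous R m n i j M)). Qed.

Lemma rat_mx_approx M (e : R) : 0 < e ->
  exists Q : 'M[rat]_(m, n), forall i j, `|M i j - ratr (Q i j)| < e.
Proof.
move=> e0.
have H (i : 'I_m) (j : 'I_n) : exists q : rat, `|M i j - ratr q| < e.
  have lt_itv : M i j - e < M i j + e by rewrite ltrD2l gtrN.
  have [q] := rat_in_itvoo lt_itv.
  rewrite in_itv/= => /andP[q1 q2]; exists q.
  by rewrite ltr_distlC q1 q2.
have [g Hg] := choice (fun k : 'I_m * 'I_n => H k.1 k.2).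
by exists (\matrix_(i, j) g (i, j)) => i j; rewrite mxE; exact: Hg (i, j).
Qed.

Lemma ex_invn_lt (e : R) : 0 < e -> exists k : nat, k.+1%:R^-1 < e.
Proof.
move=> e0; exists (Num.truncn e^-1); rewrite invf_plt ?posrE//.
exact: truncnS_gt.
Qed.

(** The sigma-algebra is generated by the entries, so an open set has to be exhibited as a countable
    union of cubes: those with rational centre and radius [1 / (k + 1)] that it contains. *)
Lemma open_measurable_mx (O : set 'M[R]_(m, n)) : open O -> measurable O.
Proof.
move=> oO.
pose rbox (q : 'M[rat]_(m, n) * nat) : set 'M[R]_(m, n) :=
  \bigcap_(k : 'I_m * 'I_n)
    [set M | `|M k.1 k.2 - ratr (q.1 k.1 k.2)| < q.2.+1%:R^-1].
have mbox q : measurable (rbox q).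
  rewrite /rbox -[X in measurable X]setCK setC_bigcap; apply: measurableC.
  apply: countable_bigcupT_measurable; first exact: countableP.
  move=> -[i j] /=; apply: measurableC.
  have := @measurable_entry R m n i j measurableT _ (measurable_ball (ratr (q.1 i j) : R) q.2.+1%:R^-1).
  rewrite setTI => mq; rewrite (_ : (fun _ => _) = (fun M : 'M[R]_(m, n) => M i j) @^-1` ball (ratr (q.1 i j) : R) q.2.+1%:R^-1) //.
  by apply/seteqP; split => M /=; rewrite /ball/= distrC.
rewrite (_ : O = \bigcup_q (if `[< rbox q `<=` O >] then rbox q else set0)).
  apply: countable_bigcupT_measurable; first exact: countableP.
  by move=> q; case: ifP.
apply/seteqP; split => [M OM|M [q _]]; last by case: asboolP => // qO /qO.
have /nbhs_ballP[e /= e0 eO] := open_nbhs_nbhs (conj oO OM).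
have [k ke] := ex_invn_lt (divr_gt0 e0 (ltr0Sn R 1)).
have k0 : (0 : R) < k.+1%:R^-1 by rewrite invr_gt0.
have [Q HQ] := rat_mx_approx M k0.
exists (Q, k) => //; case: asboolP => [_|[]]; first by move=> -[i j] _ /=.
move=> P HP; apply: eO; rewrite /ball/= /mx_ball/=; split => // i j.
rewrite /ball/=; have := HP (i, j) I => /= h1; have := HQ i j => h2.
rewrite (_ : _ - _ = (M i j - ratr (Q i j)) - (P i j - ratr (Q i j))); last by ring.
rewrite (le_lt_trans (ler_normB _ _))//.
by rewrite (lt_le_trans (ltrD h2 h1))// (splitr e) lerD// ltW.
Qed.

Lemma continuous_on_measurable (O : set 'M[R]_(m, n)) (f : 'M[R]_(m, n) -> R) :
  open O -> (forall x, O x -> {for x, continuous f}) -> measurable_fun O f.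
Proof.
move=> oO cf; apply: (measurability _ (RGenOpens.measurableE R)).
move=> _ [_ [a [b ->]] <-]; apply: open_measurable_mx.
rewrite openE => x [Ox Ux]; apply: filterI; first exact: open_nbhs_nbhs.
by apply: (cf x Ox); apply: open_nbhs_nbhs; split => //; exact: interval_open.
Qed.

Lemma continuous_measurable_mx (f : 'M[R]_(m, n) -> R) :
  continuous f -> measurable_fun setT f.
Proof. by move=> cf; apply: continuous_on_measurable => [|x _]; [exact: openT|exact: cf]. Qed.

End matrix_topology.

Lemma measurable_mxM {R : realType} d (X : measurableType d) (D : set X) m n p
    (f : X -> 'M[R]_(m, n)) (g : X -> 'M[R]_(n, p)) : measurable D ->
  measurable_fun D f -> measurable_fun D g -> measurable_fun D (fun x => f x *m g x).
Proof.
move=> mD mf mg; apply: measurable_fun_matrix => // i j.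
under eq_fun do rewrite mxE.
apply: measurable_sum => k; apply: measurable_funM.
  exact: (measurableT_comp (measurable_entry i k) mf).
exact: (measurableT_comp (measurable_entry k j) mg).
Qed.

Lemma measurable_mx_coord {R : realType} d (X : measurableType d) (D : set X) m n
    (f : X -> 'M[R]_(m, n)) i j :
  measurable_fun D f -> measurable_fun D (fun x => f x i j).
Proof. exact: (measurableT_comp (measurable_entry i j)). Qed.

Section boxes.
Context {R : realType} {n : nat}.
Implicit Types a b x v : 'cV[R]_n.

Definition box a b : set 'cV[R]_n := [set x | forall i, a i 0 < x i 0 < b i 0].

Lemma boxI a b a' b' : box a b `&` box a' b' =
  box (\col_i Num.max (a i 0) (a' i 0)) (\col_i Num.min (b i 0) (b' i 0)).
Proof.
apply/seteqP; split => x /=.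
  move=> [h1 h2] i; rewrite !mxE gt_max lt_min.
  by have /andP[-> ->] := h1 i; have /andP[-> ->] := h2 i.
by move=> h; split => i; have := h i; rewrite !mxE gt_max lt_min => /andP[/andP[h1 h2] /andP[h3 h4]]; apply/andP.
Qed.

Lemma open_box a b : open (box a b).
Proof.
rewrite openE => x xab.
have H : \forall y \near x, forall i, a i 0 < (y : 'cV[R]_n) i 0 < b i 0.
  apply: (@filter_forall _ _ (fun i (y : 'cV[R]_n) => a i 0 < y i 0 < b i 0) (nbhs x)) => i; have /andP[h1 h2] := xab i.
  have c : ((y : 'cV[R]_n) i 0) @[y --> x] --> x i 0 by exact: (@coord_continuous R n 1 i 0 x).
  near=> y; apply/andP; split; near: y.
    exact: (cvgr_gt _ c).
  exact: (cvgr_lt _ c).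
exact: H.
Unshelve. all: by end_near. Qed.

Lemma measurable_box a b : measurable (box a b).
Proof. by apply: open_measurable_mx; exact: open_box. Qed.

(** Boxes are stable under intersection by [boxI]; this generator opens Dynkin induction over the
    measurable sets. *)
Lemma sigma_algebra_box : @measurable _ 'cV[R]_n = <<s [set B | exists a b, B = box a b] >>.
Proof.
apply/seteqP; split; last first.
  apply: smallest_sub; first exact: smallest_sigma_algebra.
  move=> _ [a [b ->]]; exact: measurable_box.
set G := [set B | _].
pose Y := g_sigma_algebraType G.
have mcoord i : measurable_fun setT ((fun x : 'cV[R]_n => x i 0) : Y -> R).
  apply: (measurability _ (RGenOInfty.measurableE R)).
  move=> _ [_ [y ->] <-]; rewrite setTI.
  (* A half-space is a countable union of boxes: only the lower face in direction [i] is fixed, all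
     other faces recede with [k]. *)
  rewrite (_ : _ @^-1` _ = \bigcup_(k : nat) box (\col_j if j == i then y else - k%:R) (\col__ k%:R)).
    by apply: bigcupT_measurable => k; apply: sub_sigma_algebra; eexists; eexists.
  apply/seteqP; split => x /=.
    rewrite in_itv/= andbT => yx; exists (Num.truncn `|x|).+1 => // j; rewrite !mxE.
    have h : `|x j 0| < (Num.truncn `|x|).+1%:R.
      by rewrite (le_lt_trans (ler_coord_mx_norm _ _ _))// truncnS_gt.
    case: (eqVneq j i) h => [->|_]; rewrite ltr_norml => /andP[h1 h2]; first by rewrite yx.
    by rewrite h1.
  move=> [k _ /(_ i)]; rewrite !mxE eqxx => /andP[yx _].
  by rewrite in_itv/= yx.
apply: smallest_sub; first exact: smallest_sigma_algebra.
move=> _ [i [j [B [mB ->]]]]; rewrite ord1.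
by have := mcoord i measurableT B mB; rewrite setTI.
Qed.

End boxes.

Section lebesgue_measure_cV.
Context {R : realType}.

Lemma measurable_shift n (v : 'cV[R]_n) : measurable_fun setT (fun x : 'cV[R]_n => x + v).
Proof.
apply: measurable_fun_matrix => // i j; under eq_fun do rewrite mxE.
by apply: measurable_funD => //; exact: measurable_entry.
Qed.

Lemma lebesgue_measure_shift (c : R) (A : set R) : measurable A ->
  lebesgue_measure ((fun x => x + c) @^-1` A) = lebesgue_measure A.
Proof.
move=> mA.
have mc : measurable_fun setT ((fun x : R => x + c) : measurableTypeR R -> measurableTypeR R).
  by apply: measurable_funD.
pose mcm := isMeasurableFun.Build _ _ _ _ _ mc.
pose mcp : {mfun measurableTypeR R >-> measurableTypeR R} := HB.pack (fun x : R => x + c) mcm.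
have := @lebesgue_measure_unique R (pushforward lebesgue_measure mcp) _ A mA.
rewrite /pushforward/= => -> // _ [[a b]] _ <-.
rewrite /pushforward/=.
rewrite (_ : (fun x => x + c) @^-1` `]a, b] = `]a - c, b - c]%classic).
  rewrite !lebesgue_measure_itv/= !lte_fin ltrD2r; case: ifP => // _.
  by rewrite -!EFinB; congr EFin; ring.
by apply/seteqP; split => x /=; rewrite !in_itv/= ltrBlDr lerBrDr.
Qed.

Lemma leb0 : leb 0 = \d_(0 : 'cV[R]_0) :> (set 'cV[R]_0 -> \bar R).
Proof. by []. Qed.

Lemma lebS n (A : set 'cV[R]_n.+1) :
  leb n.+1 A = (\int[lebesgue_measure]_x leb n (xsection (@cv_cons R n @^-1` A) x))%E.
Proof. by []. Qed.

Lemma measurable_preimage_cv_cons n (A : set 'cV[R]_n.+1) : measurable A ->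
  measurable (@cv_cons R n @^-1` A).
Proof. by move=> mA; rewrite -[X in measurable X]setTI; exact: measurable_cv_cons. Qed.

Lemma xsection_cv_cons n (A : set 'cV[R]_n.+1) (a : R) :
  xsection (@cv_cons R n @^-1` A) a = [set y | A (cv_cons (a, y))].
Proof. by apply/seteqP; split => y /=; rewrite /xsection/= inE. Qed.

(** Induction on the dimension: sections of a translated set are translated sections, and the
    remaining integral over the first coordinate is shifted on the line. *)
Lemma leb_shift n (v : 'cV[R]_n) (A : set 'cV[R]_n) : measurable A ->
  leb n ((fun x => x + v) @^-1` A) = leb n A.
Proof.
elim: n v A => [|n IH] v A mA.
  rewrite (_ : _ @^-1` A = A)//.
  by apply/seteqP; split => x /=; rewrite [x + v](_ : _ = x)//; apply/colP; case.
rewrite !lebS.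
have mcA := measurable_preimage_cv_cons mA.
pose c := v ord0 0; pose w : 'cV[R]_n := \col_j v (lift ord0 j) 0.
have cvD (a : R) (y : 'cV[R]_n) : cv_cons (a, y) + v = cv_cons (a + c, y + w).
  apply/colP => i; rewrite !mxE; case: unliftP => [j ->|->] //=.
  by rewrite !mxE.
pose g (a : R) := leb n (xsection (@cv_cons R n @^-1` A) a).
transitivity (integral (@lebesgue_measure R) setT (fun a : R => g (a + c))).
  apply: eq_integral => a _; rewrite /g -[RHS](IH w).
    congr (leb n _); rewrite !xsection_cv_cons; apply/seteqP; split => y /=.
      by rewrite cvD.
    by rewrite -cvD.
  exact: measurable_xsection.
have mc : measurable_fun setT ((fun x : R => x + c) : measurableTypeR R -> measurableTypeR R).
  by apply: measurable_funD.
have mg : measurable_fun setT (g : measurableTypeR R -> \bar R).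
  exact: measurable_fun_xsection.
rewrite -(@ge0_integral_pushforward _ _ _ _ _ _ mc lebesgue_measure setT g)//.
apply: eq_measure_integral => B mB _; exact: lebesgue_measure_shift.
Qed.

Lemma ge0_integral_shift n (v : 'cV[R]_n) (f : 'cV[R]_n -> \bar R) :
  measurable_fun setT f -> (forall x, 0 <= f x)%E ->
  integral (leb n) setT (fun x : 'cV[R]_n => f (x + v)) = integral (leb n) setT f.
Proof.
move=> mf f0.
rewrite -(@ge0_integral_pushforward _ _ _ _ _ _ (measurable_shift v) (leb n) setT f)//.
apply: eq_measure_integral => [|mv B mB _]; [exact: measurable_shift|exact: leb_shift].
Qed.

Lemma integral_shift n (v : 'cV[R]_n) (f : 'cV[R]_n -> \bar R) :
  measurable_fun setT f ->
  integral (leb n) setT (fun x : 'cV[R]_n => f (x + v)) = integral (leb n) setT f.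
Proof.
move=> mf; rewrite [LHS]integralE [RHS]integralE; congr (_ - _)%E.
  rewrite -[RHS](ge0_integral_shift v (measurable_funepos mf)); last by move=> x; exact: funepos_ge0.
  by apply: eq_integral => x _; rewrite !funeposE.
rewrite -[RHS](ge0_integral_shift v (measurable_funeneg mf)); last by move=> x; exact: funeneg_ge0.
by apply: eq_integral => x _; rewrite !funenegE.
Qed.

(** The norm is the maximum norm, so balls are cubes of side [2 r]. *)
Lemma leb_ball n (c : 'cV[R]_n) (r : R) : 0 < r -> leb n (ball c r) = ((2 * r) ^+ n)%:E.
Proof.
move=> r0; elim: n c => [|n IH] c.
  rewrite (_ : ball c r = setT) ?expr0 ?leb0 ?diracT//.
  by apply/seteqP; split => x //= _; split => // -[].
rewrite (_ : leb n.+1 _ = (lebesgue_measure \x leb n)%E (@cv_cons R n @^-1` ball c r))//.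
rewrite (_ : _ @^-1` _ = ball (c ord0 0) r `*` ball (\col_j c (lift ord0 j) 0 : 'cV[R]_n) r).
  rewrite product_measure1E//; [|exact: measurable_ball|].
    transitivity ((r *+ 2)%:E * ((2 * r) ^+ n)%:E)%E.
      by congr (_ * _)%E; [exact: (lebesgue_measure_ball (c ord0 0) (ltW r0))|exact: IH].
    by rewrite -EFinM exprS mulr_natl.
  by apply: open_measurable_mx; exact: ball_open.
apply/seteqP; split => -[a y] /=.
  move=> [_ h]; split; first by have := h ord0 0; rewrite mxE unlift_none.
  by split => // i j; have := h (lift ord0 i) 0; rewrite !mxE liftK/= ord1.
move=> [h1 [_ h2]]; split => // i j; rewrite mxE ord1; case: unliftP => [k ->|->] //=.
by have := h2 k 0; rewrite !mxE.
Qed.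

Lemma leb_bounded n (A : set 'cV[R]_n) : measurable A -> bounded_set A ->
  (leb n A < +oo)%E.
Proof.
move=> mA [M [_ HM]].
have M0 : 0 < `|M| + 2 by rewrite ltr_wpDl.
apply: (@le_lt_trans _ _ (leb n (ball 0 (`|M| + 2)))); last by rewrite leb_ball// ltry.
apply: le_measure; rewrite ?inE//; first by apply: open_measurable_mx; exact: ball_open.
move=> x Ax; rewrite -ball_normE/= sub0r normrN.
apply: le_lt_trans (HM (`|M| + 1) _ x Ax) _; last by rewrite ltrD2l ltr1n.
by rewrite (le_lt_trans (ler_norm _))// ltrDl.
Qed.

Lemma leb_open_gt0 n (O : set 'cV[R]_n) : open O -> O !=set0 -> (0 < leb n O)%E.
Proof.
move=> oO [x Ox].
have /nbhs_ballP[e /= e0 eO] := open_nbhs_nbhs (conj oO Ox).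
apply: (@lt_le_trans _ _ (leb n (ball x e))).
  by rewrite leb_ball// lte_fin exprn_gt0// mulr_gt0.
apply: le_measure; rewrite ?inE//; apply: open_measurable_mx => //; exact: ball_open.
Qed.

(* Peeling off the first coordinate: if some later coefficient is nonzero every
   section is a hyperplane of lower dimension; otherwise only the section over one point is nonempty. *)
Lemma leb_hyperplane n (a : 'rV[R]_n) (b : R) : a != 0 ->
  leb n [set x | (a *m x) 0 0 = b] = 0%E.
Proof.
have mH k (a' : 'rV[R]_k) (b' : R) : measurable [set x : 'cV[R]_k | (a' *m x) 0 0 = b'].
  have m1 : measurable_fun setT (fun x : 'cV[R]_k => (a' *m x) 0 0).
    apply: measurable_mx_coord; apply: measurable_mxM => //.
  by have := m1 measurableT [set b'] (measurable_set1 b'); rewrite setTI.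
elim: n a b => [|n IH] a b a0; first by move: a0; rewrite (_ : a = 0) ?eqxx//; apply/rowP; case.
rewrite lebS.
pose a' : 'rV[R]_n := \row_j a 0 (lift ord0 j).
have aE (t : R) (y : 'cV[R]_n) : (a *m cv_cons (t, y)) 0 0 = a 0 ord0 * t + (a' *m y) 0 0.
  rewrite !mxE big_ord_recl mxE unlift_none/=; congr (_ + _).
  by apply: eq_bigr => j _; rewrite !mxE liftK/=.
have [a'0|a'0] := eqVneq a' 0; last first.
  apply: integral0_eq => t _; rewrite xsection_cv_cons -(IH a' (b - a 0 ord0 * t) a'0).
  congr (leb n _); apply/seteqP; split => y /=; rewrite aE; first by move=> <-; ring.
  by move=> ->; ring.
have a00 : a 0 ord0 != 0.
  apply: contra a0 => /eqP a00; apply/eqP/rowP => j; rewrite mxE.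
  case: (unliftP ord0 j) => [k ->|->] //.
  by have /rowP/(_ k) := a'0; rewrite !mxE.
pose t0 := b / a 0 ord0.
rewrite (@ae_eq_integral _ _ _ lebesgue_measure setT (fun=> 0%E))//.
- by rewrite integral0.
- by apply: measurable_fun_xsection; exact: measurable_preimage_cv_cons.
exists [set t0]; split => //; first exact: lebesgue_measure_set1.
move=> t /=; apply: contra_notP => tt0 _.
rewrite xsection_cv_cons (_ : [set _ | _] = set0) ?measure0//.
apply/seteqP; split => y //=; rewrite aE a'0 mul0mx mxE addr0 => h.
by apply: tt0; rewrite /t0 -h mulrC mulKf.
Qed.

End lebesgue_measure_cV.

(** * Test functions and weak derivatives *)

Section flat_function.
Context {R : realType}.

(** The classical function [exp (- 1 / x)], flat at 0, with a polynomial factor in [1 / x] that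
    makes the family closed under differentiation. *)
Definition flat (P : {poly R}) (x : R) : R :=
  if 0 < x then P.[x^-1] * expR (- x^-1) else 0.

(** For a monomial, [exp y] is the [k]-th power of [exp (y / k)], which is at least [y / k]; hence
    the explicit bound [k^k]. *)
Lemma poly_expR_bounded (P : {poly R}) :
  exists C, forall y, 0 <= y -> `|P.[y] * expR (- y)| <= C.
Proof.
have mon k (y : R) : 0 <= y -> y ^+ k * expR (- y) <= k%:R ^+ k.
  move=> y0; rewrite expRN ler_pdivrMr ?expR_gt0//.
  case: k => [|k]; first by rewrite !expr0 mul1r -expR0 ler_expR.
  have -> : expR y = expR (y / k.+1%:R) ^+ k.+1.
    by rewrite -expRM_natl -mulr_natl mulrCA mulfV ?mulr1// pnatr_eq0.
  rewrite -exprMn lerXn2r ?nnegrE ?mulr_ge0 ?expR_ge0//.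
  rewrite mulrC -ler_pdivrMr ?ltr0n//.
  by apply: le_trans (expR_ge1Dx _); rewrite lerDr.
exists (\sum_(i < size P) `|P`_i| * i%:R ^+ i) => y y0.
rewrite horner_coef mulr_suml (le_trans (ler_norm_sum _ _ _))//.
apply: ler_sum => i _; rewrite -mulrA normrM ler_wpM2l//.
by rewrite ger0_norm ?mon// mulr_ge0 ?exprn_ge0// expR_ge0.
Qed.

(** Away from 0 this is the chain rule, with [X^2] coming from the derivative of [1 / x]. At 0 the
    derivative has to be found from the difference quotient. *)
Lemma is_derive_flat (P : {poly R}) (x : R) :
  is_derive x 1 (flat P) (flat ('X^2 * (P - P^`())) x).
Proof.
have [x0|x0|->] := ltgtP x 0.
- rewrite {2}/flat ltNge ltW//=; apply: (@near_eq_is_derive _ _ _ (cst 0)).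
  near=> y; rewrite /flat; case: ifPn => // y0.
  suff : y < 0 by rewrite ltNge ltW.
  by near: y; exact: lt_nbhsl.
- rewrite {2}/flat x0.
  apply: (@near_eq_is_derive _ _ _ (fun y : R => P.[y^-1] * expR (- y^-1))).
    by near=> y; rewrite /flat ifT//; near: y; exact: lt_nbhsr.
  have xn : x != 0 by rewrite gt_eqF.
  have dV : is_derive x 1 (fun y : R => y^-1) (- x ^- 2).
    have := @is_deriveV R id x 1 1 xn (is_derive_id _ _).
    by rewrite /GRing.scale/= mulr1.
  have dP : is_derive x 1 (fun y : R => P.[y^-1]) (P^`().[x^-1] * - x ^- 2).
    exact: (@is_derive1_comp R (horner P) (fun y : R => y^-1) x _ _ (is_derive_poly P x^-1) dV).
  have dE : is_derive x 1 (fun y : R => expR (- y^-1)) (expR (- x^-1) * x ^- 2).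
    have dN : is_derive x 1 (fun y : R => - y^-1) (x ^- 2) by have := is_deriveN dV; rewrite opprK.
    exact: (@is_derive1_comp R expR (fun y : R => - y^-1) x _ _ (is_derive_expR _) dN).
  apply: (is_derive_eq (is_deriveM dP dE)).
  by rewrite /GRing.scale/= !hornerE/= exprVn; ring.
- rewrite {2}/flat ltxx.
  have [C HC] := poly_expR_bounded ('X^2 * P).
  have H : h^-1 *: (flat P (h *: 1 + 0) - flat P 0) @[h --> 0^'] --> (0 : R).
    apply/cvgrPdist_le => e e0; near=> h.
    have hn : h != 0 by near: h; exact: nbhs_dnbhs_neq.
    rewrite sub0r normrN /GRing.scale/= mulr1 addr0 [X in _ - X]/flat ltxx subr0 /flat.
    case: ifPn => h0; last by rewrite mulr0 normr0 ltW.
    (* The difference quotient is [h] times a bounded function of the same family. *)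
    have -> : h^-1 * (P.[h^-1] * expR (- h^-1)) = h * (('X^2 * P).[h^-1] * expR (- h^-1)).
      by rewrite !hornerE/=; field.
    rewrite normrM; apply: (@le_trans _ _ (`|h| * (`|C| + 1))).
      apply: ler_wpM2l => //; apply: le_trans (HC _ _) _; first by rewrite invr_ge0 ltW.
      by rewrite (le_trans (ler_norm _))// lerDl.
    rewrite -ler_pdivlMr ?ltr_wpDl//.
    by near: h; apply: dnbhs0_le; rewrite divr_gt0// ltr_wpDl.
  by apply: DeriveDef; [exact: cvgP H|exact: cvg_lim H].
Unshelve. all: by end_near. Qed.

Lemma flat_ge0 x : 0 <= flat 1 x.
Proof. by rewrite /flat; case: ifP => // _; rewrite hornerC mul1r expR_ge0. Qed.

Lemma flat_le1 x : flat 1 x <= 1.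
Proof.
rewrite /flat; case: ifP => // x0; rewrite hornerC mul1r -expR0 ler_expR.
by rewrite oppr_le0 invr_ge0 ltW.
Qed.

Lemma flat_eq0 x : (flat 1 x == 0) = (x <= 0).
Proof.
rewrite /flat leNgt; case: ifP => // x0; last by rewrite eqxx.
by rewrite hornerC mul1r gt_eqF ?expR_gt0.
Qed.

Lemma cvg_flat (x : R) : (fun n => flat 1 (n.+1%:R * x)) @ \oo --> ((0 < x)%R%:R : R).
Proof.
case: ltP => x0; last first.
  rewrite (_ : (fun _ => _) = (fun=> 0)); first exact: cvg_cst.
  by apply/funext => n; apply/eqP; rewrite flat_eq0 pmulr_rle0.
rewrite (_ : (fun _ => _) = (fun n => expR (- (x^-1 * n.+1%:R^-1)))); last first.
  by apply/funext => n; rewrite /flat pmulr_rgt0// x0 hornerC mul1r invfM mulrC.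
rewrite -[X in _ --> X]expR0; apply: continuous_cvg; first exact: continuous_expR.
rewrite -[X in _ --> X]oppr0; apply: cvgN.
by rewrite -[X in _ --> X](mulr0 x^-1); apply: cvgMr; exact: cvg_harmonic.
Qed.

End flat_function.

Lemma is_derive_line (R : realType) (V W : normedModType R) (g : V -> W) (x v : V) (t : R) (dg : W) :
  is_derive (x + t *: v) v g dg <-> is_derive t 1 (fun h : R => g (x + h *: v)) dg.
Proof.
have E : (fun h : R => h^-1 *: ((fun h : R => g (x + h *: v)) (h *: 1 + t) - (fun h : R => g (x + h *: v)) t)) =
         (fun h : R => h^-1 *: (g (h *: v + (x + t *: v)) - g (x + t *: v))).
  have e (h : R) : h *: (1 : R) = h by rewrite /GRing.scale/= mulr1.
  by apply/funext => h /=; rewrite e scalerDl addrCA.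
by split => -[dl <-]; apply: DeriveDef => //; rewrite /derivable /derive ?E//; move: dl; rewrite /derivable E.
Qed.

Lemma derive_line (R : realType) (V W : normedModType R) (g : V -> W) (x v : V) (t : R) :
  derivable g (x + t *: v) v ->
  is_derive t 1 (fun h : R => g (x + h *: v)) ('D_v g (x + t *: v)).
Proof. move=> dg; exact: ((is_derive_line g x v t _).1 (derivableP dg)). Qed.

Lemma closure_subset_closed (T : topologicalType) (A C : set T) : closed C ->
  A `<=` C -> closure A `<=` C.
Proof. by move=> /closure_id {2}-> AC; exact: closureS. Qed.

Section test_functions.
Context {R : realType} {d : nat}.
Implicit Types (g f : 'cV[R]_d -> R) (x : 'cV[R]_d).

(* A class of functions that contains the bumps below and is stable under
   partial derivatives. *)
Inductive flat_algebra : ('cV[R]_d -> R) -> Prop :=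
| flat_algebra_cst c : flat_algebra (fun=> c)
| flat_algebra_flat P (i : 'I_d) (a b : R) : flat_algebra (fun x => flat P (a * x i 0 + b))
| flat_algebraD f g : flat_algebra f -> flat_algebra g -> flat_algebra (fun x => f x + g x)
| flat_algebraM f g : flat_algebra f -> flat_algebra g -> flat_algebra (fun x => f x * g x).

Lemma coord_basis_vec (i j : 'I_d) : (basis_vec i : 'cV[R]_d) j 0 = (j == i)%:R.
Proof. by rewrite /basis_vec mxE eqxx andbT. Qed.

Lemma flatZ (c : R) (P : {poly R}) (x : R) : flat (c *: P) x = c * flat P x.
Proof. by rewrite /flat; case: ifP => _; rewrite ?mulr0// hornerZ mulrA. Qed.

Lemma flat_algebra_partial g : flat_algebra g ->
  (forall x, differentiable g x) /\ forall i, flat_algebra (partial i g).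
Proof.
elim=> {g} [c|P i a b|f g sf [df IHf] sg [dg IHg]|f g sf [df IHf] sg [dg IHg]].
- split => [x|i]; first exact: differentiable_cst.
  rewrite (_ : partial i _ = fun=> 0); first exact: flat_algebra_cst.
  by apply/funext => x; rewrite /partial derive_cst.
- have dfl y : differentiable (flat P) y.
    by apply/derivable1_diffP; case: (is_derive_flat P y).
  split => [x|k].
    apply: (@differentiable_comp _ _ _ _ (fun x : 'cV[R]_d => a * x i 0 + b) (flat P)) => //.
    apply: differentiableD => //; apply: differentiableZ; exact: differentiable_coord.
  rewrite (_ : partial k _ = fun x => flat ((a * (i == k)%:R) *: ('X^2 * (P - P^`()))) (a * x i 0 + b)).
    exact: flat_algebra_flat.
  apply/funext => x; rewrite /partial flatZ -[x in LHS]addr0 -(scale0r (basis_vec k)).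
  set c := a * (i == k)%:R.
  have dl : is_derive (0 : R) 1 (fun h : R => a * (x + h *: basis_vec k) i 0 + b) c.
    rewrite (_ : (fun h : R => _) = (fun h : R => c *: h + (a * x i 0 + b))); last first.
      by apply/funext => h; rewrite !mxE andbT /c /GRing.scale/=; ring.
    have := is_deriveD (is_deriveZ c (is_derive_id (0 : R) 1)) (is_derive_cst (a * x i 0 + b) (0 : R) 1).
    by rewrite addr0 /GRing.scale/= mulr1.
  have dfx : is_derive (a * (x + 0 *: basis_vec k) i 0 + b) 1 (flat P)
      (flat ('X^2 * (P - P^`())) (a * x i 0 + b)).
    by rewrite scale0r addr0; exact: is_derive_flat.
  have dc := @is_derive1_comp R (flat P) _ 0 _ _ dfx dl.
  have [_ ->] := (is_derive_line (fun y : 'cV[R]_d => flat P (a * y i 0 + b)) x (basis_vec k) 0 _).2 dc.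
  by rewrite mulrC.
- split => [x|i]; first exact: (differentiableD (df x) (dg x)).
  rewrite (_ : partial i _ = fun x => partial i f x + partial i g x); last first.
    by apply/funext => x; rewrite /partial deriveD//; exact: diff_derivable.
  exact: flat_algebraD.
- split => [x|i]; first exact: (differentiableM (df x) (dg x)).
  rewrite (_ : partial i _ = fun x => f x * partial i g x + g x * partial i f x); last first.
    by apply/funext => x; rewrite /partial deriveM//; exact: diff_derivable.
  by apply: flat_algebraD; apply: flat_algebraM.
Qed.

Lemma flat_algebra_smooth g : flat_algebra g -> smooth g.
Proof.
move=> sg s x.
suff : flat_algebra (iter_partial s g) by move/flat_algebra_partial => [].
by elim: s => //= i s IH; exact: (flat_algebra_partial IH).2.
Qed.

(** Smooth, between 0 and 1, and positive exactly on the open box. As [n] grows the bumps tend to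
    the indicator of the box; for [n = 0] they serve as averaging kernels. *)
Definition bump (n : nat) (a b : 'cV[R]_d) : 'cV[R]_d -> R := fun x =>
  \prod_(i < d) (flat 1 (n.+1%:R * (x i 0 - a i 0)) * flat 1 (n.+1%:R * (b i 0 - x i 0))).

Definition closed_box (a b : 'cV[R]_d) : set 'cV[R]_d :=
  [set x | forall i, a i 0 <= x i 0 <= b i 0].

Lemma bump_smooth n a b : smooth (bump n a b).
Proof.
apply: flat_algebra_smooth; rewrite /bump; elim: (index_enum _) => [|i s IH].
  rewrite (_ : (fun x => _) = fun=> 1); first exact: flat_algebra_cst.
  by apply/funext => x; rewrite big_nil.
rewrite (_ : (fun x => _) = (fun x =>
    (flat 1 (n.+1%:R * x i 0 + - (n.+1%:R * a i 0)) * flat 1 (- n.+1%:R * x i 0 + n.+1%:R * b i 0)) *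
    \prod_(i <- s) (flat 1 (n.+1%:R * (x i 0 - a i 0)) * flat 1 (n.+1%:R * (b i 0 - x i 0))))).
  apply: flat_algebraM => //; apply: flat_algebraM; exact: flat_algebra_flat.
by apply/funext => x; rewrite big_cons; congr (flat 1 _ * flat 1 _ * _); ring.
Qed.

Lemma bump_ge0 n a b x : 0 <= bump n a b x.
Proof. by apply: prodr_ge0 => i _; rewrite mulr_ge0 ?flat_ge0. Qed.

Lemma bump_le1 n a b x : bump n a b x <= 1.
Proof.
by apply: prodr_ile1 => i _; rewrite mulr_ge0 ?flat_ge0//= mulr_ile1 ?flat_ge0 ?flat_le1.
Qed.

Lemma bump_neq0 n a b x : (bump n a b x != 0) = `[< box a b x >].
Proof.
apply/idP/asboolP => [/prodf_neq0 H i|H].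
  have := H i isT; rewrite mulf_eq0 !flat_eq0 !pmulr_rle0// !subr_le0 negb_or -!ltNge.
  by move=> /andP[-> ->].
apply/prodf_neq0 => i _; have := H i => /andP[h1 h2].
by rewrite mulf_eq0 !flat_eq0 !pmulr_rle0// !subr_le0 negb_or -!ltNge h1 h2.
Qed.

Lemma cvg_bump a b x : (fun n => bump n a b x) @ \oo --> (\1_(box a b) x : R).
Proof.
have -> : \1_(box a b) x = \prod_(i < d) (((0 < x i 0 - a i 0)%R%:R : R) * (0 < b i 0 - x i 0)%R%:R).
  rewrite indicE; have [xab|xab] := boolP (x \in box a b).
    rewrite big1// => i _; have := set_mem xab i.
    by rewrite !subr_gt0 => /andP[-> ->]; rewrite mulr1.
  apply/esym/eqP; apply/prodf_eq0.
  move: xab; rewrite notin_setE => /existsNP[i /negP ni].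
  exists i => //; rewrite !subr_gt0; move: ni.
  by rewrite negb_and => /orP[/negbTE ->|/negbTE ->]; rewrite ?mul0r ?mulr0.
apply: cvg_big => // [|i _]; last by apply: cvgM; exact: cvg_flat.
exact: mul_continuous.
Qed.

Lemma closed_boxP a b : closed (closed_box a b).
Proof.
rewrite (_ : closed_box a b = \bigcap_(i : 'I_d) ([set x : 'cV[R]_d | a i 0 <= x i 0] `&` [set x | x i 0 <= b i 0])).
  apply: closed_bigI => i _; apply: closedI.
    apply: (@preimage_closed _ _ (fun x : 'cV[R]_d => x i 0) (fun y => a i 0 <= y)); last exact: closed_ge.
    by move=> x _; exact: (@coord_continuous R d 1 i 0 x).
  apply: (@preimage_closed _ _ (fun x : 'cV[R]_d => x i 0) (fun y => y <= b i 0)); last exact: closed_le.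
  by move=> x _; exact: (@coord_continuous R d 1 i 0 x).
apply/seteqP; split => [x H i _|x H i]; first by have /andP[] := H i.
by have [h1 h2] := H i I; rewrite h1 h2.
Qed.

Lemma bounded_closed_compact_cV (A : set 'cV[R]_d) : bounded_set A -> closed A -> compact A.
Proof.
move=> bA cA.
pose tr (x : 'rV[R]_d) : 'cV[R]_d := x^T.
have ctr : continuous tr.
  move=> x; apply: (@cvg_mx R d 1 _ (nbhs x)) => i j.
  rewrite /tr mxE; under eq_fun do rewrite mxE.
  exact: (@coord_continuous R 1 d j i x).
rewrite (_ : A = tr @` (tr @^-1` A)); last first.
  apply/seteqP; split => [x Ax|_ [y Ay <-]//].
  by exists x^T; rewrite /preimage/tr/= trmxK.
apply: continuous_compact; first exact: continuous_subspaceT.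
apply: bounded_closed_compact; last first.
  by apply: closed_comp => // x _; exact: ctr.
have [M [Mr HM]] := bA; exists M; split => // N MN x /= Ax.
have N0 : 0 <= N by rewrite (le_trans (normr_ge0 _) (HM _ MN _ Ax)).
apply: ler_mx_norm => // i j.
rewrite -[x]trmxK mxE; apply: le_trans (HM _ MN _ Ax).
exact: ler_coord_mx_norm.
Qed.

Lemma closed_box_compact a b : compact (closed_box a b).
Proof.
apply: bounded_closed_compact_cV; last exact: closed_boxP.
exists (`|a| + `|b|); split => // M HM x xab.
apply: ler_mx_norm; first by apply: le_trans (ltW HM); rewrite addr_ge0.
move=> i j; rewrite ord1; apply: le_trans (ltW HM).
have /andP[h1 h2] := xab i.
have := ler_coord_mx_norm a i 0; have := ler_coord_mx_norm b i 0.
rewrite !ler_norml => /andP[b1 b2] /andP[a1 a2].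
have := normr_ge0 a; have := normr_ge0 b => *.
by apply/andP; split; lra.
Qed.

Lemma bump_support n a b : closure [set x | bump n a b x != 0] `<=` closed_box a b.
Proof.
move=> x; apply: closure_subset_closed; first exact: closed_boxP.
by move=> y; rewrite /= bump_neq0 => /asboolP H i; have /andP[h1 h2] := H i; rewrite !ltW.
Qed.

Lemma bump_test_function (Omega : set 'cV[R]_d) n a b :
  closed_box a b `<=` Omega -> test_function Omega (bump n a b).
Proof.
move=> abO; split; first exact: bump_smooth.
- apply: (subclosed_compact _ (@closed_box_compact a b)); first exact: closed_closure.
  exact: bump_support.
- by apply: subset_trans abO; exact: bump_support.
Qed.

Lemma bump_shift n a b v x : bump n a b (x - v) = bump n (a + v) (b + v) x.
Proof.
by rewrite /bump; apply: eq_bigr => i _; rewrite !mxE; congr (flat 1 _ * flat 1 _); ring.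
Qed.

Lemma smooth_partial g i : smooth g -> smooth (partial i g).
Proof. by move=> sg s x; have := sg (rcons s i) x; rewrite /iter_partial foldr_rcons. Qed.

Lemma smooth_differentiable g x : smooth g -> differentiable g x.
Proof. by move=> sg; exact: (sg [::] x). Qed.

Lemma smooth_continuous g : smooth g -> continuous g.
Proof. by move=> sg x; apply: differentiable_continuous; exact: smooth_differentiable. Qed.

Lemma test_function_partial (Omega : set 'cV[R]_d) g i :
  test_function Omega g -> test_function Omega (partial i g).
Proof.
move=> [sg cg gO].
have H : closure [set x | partial i g x != 0] `<=` closure [set x | g x != 0].
  apply: closure_subset_closed; first exact: closed_closure.
  move=> x /=; apply: contraPP => nx; apply/negP; rewrite negbK.
  have nearx : \forall y \near x, g y = 0.
    have : open_nbhs x (~` closure [set x | g x != 0]).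
      by split => //; apply: closed_openC; exact: closed_closure.
    move/open_nbhs_nbhs; apply: filterS => y ny; apply/eqP; apply: contrapT => /negP gy.
    by apply: ny; apply: subset_closure.
  by apply/eqP; rewrite /partial (@near_eq_derive _ _ _ g (cst 0)) ?derive_cst.
split; first exact: smooth_partial.
- by apply: (subclosed_compact _ cg) => //; exact: closed_closure.
- by apply: subset_trans gO.
Qed.

Lemma test_function_bounded (Omega : set 'cV[R]_d) g :
  test_function Omega g -> exists M, forall x, `|g x| <= M.
Proof.
move=> [sg cg gO].
have := compact_bounded (continuous_compact (continuous_subspaceT (smooth_continuous sg)) cg).
move=> [M [_ HM]]; exists (`|M| + 1) => x.
have [->|gx] := eqVneq (g x) 0; first by rewrite normr0 addr_ge0.
apply: HM; first by rewrite (le_lt_trans (ler_norm _))// ltrDl.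
by exists x => //; apply: subset_closure.
Qed.

Lemma test_function_measurable (Omega D : set 'cV[R]_d) g : measurable D ->
  test_function Omega g -> measurable_fun D g.
Proof.
by move=> mD [/smooth_continuous sg _ _]; apply: measurable_funTS; exact: continuous_measurable_mx.
Qed.

Lemma test_function_eq0 (Omega : set 'cV[R]_d) g x : test_function Omega g ->
  ~ Omega x -> g x = 0.
Proof.
move=> [_ _ gO] nx; apply/eqP; apply: contrapT => /negP gx.
by apply/nx/gO; apply: subset_closure.
Qed.

End test_functions.

Section box_covering.
Context {R : realType} {n : nat}.

Definition rbox_lo (q : 'cV[rat]_n * nat) : 'cV[R]_n := \col_i (ratr (q.1 i 0) - q.2.+1%:R^-1).
Definition rbox_hi (q : 'cV[rat]_n * nat) : 'cV[R]_n := \col_i (ratr (q.1 i 0) + q.2.+1%:R^-1).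

Lemma open_covering (O : set 'cV[R]_n) (x : 'cV[R]_n) : open O -> O x ->
  exists2 q, closed_box (rbox_lo q) (rbox_hi q) `<=` O & box (rbox_lo q) (rbox_hi q) x.
Proof.
move=> oO Ox.
have /nbhs_ballP[e /= e0 eO] := open_nbhs_nbhs (conj oO Ox).
have [k ke] := ex_invn_lt (divr_gt0 e0 (ltr0Sn R 2)).
have k0 : (0 : R) < k.+1%:R^-1 by rewrite invr_gt0.
have [Q HQ] := rat_mx_approx x k0.
exists (Q, k) => [y Hy|i]; last first.
  by rewrite !mxE/= -ltr_distl; exact: HQ.
apply: eO; split => // i j; rewrite ord1 /ball/=.
have := Hy i; rewrite !mxE/= -ler_distl => h4.
have h3 := HQ i 0.
rewrite (_ : _ - _ = (x i 0 - ratr (Q i 0)) - (y i 0 - ratr (Q i 0))); last by ring.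
rewrite (le_lt_trans (ler_normB _ _))//.
move: (k.+1%:R^-1) ke h3 h4 => r ke h3 h4.
by rewrite (lt_le_trans (ltr_leD h3 h4))// ltW//; move: ke; lra.
Qed.

End box_covering.

Section du_bois_reymond.
Context {R : realType} {d : nat}.
Variable Omega : set 'cV[R]_d.
Hypotheses (oO : open Omega) (bO : bounded_set Omega).
Let mO : measurable Omega := open_measurable_mx oO.
Let muO : (leb d Omega < +oo)%E := leb_bounded mO bO.
Notation intg := (intg (leb d) Omega).
Notation sqint := (sqint (leb d) Omega).
Implicit Types (g h : 'cV[R]_d -> R) (x : 'cV[R]_d).

Lemma intg_test g phi : intg g -> test_function Omega phi -> intg (fun x => g x * phi x).
Proof.
move=> gi tphi; have [M HM] := test_function_bounded tphi.
apply: (@le_intg _ _ _ _ _ mO _ (fun x => M * `|g x|)).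
- by apply: measurable_funM; [exact: intg_measurable gi|exact: test_function_measurable tphi].
- by move=> x _; rewrite normrM mulrC ler_wpM2r.
- by apply: intgZ => //; exact: intg_norm.
Qed.

Lemma closed_boxI (a b a' b' : 'cV[R]_d) :
  closed_box (\col_i Num.max (a i 0) (a' i 0)) (\col_i Num.min (b i 0) (b' i 0)) `<=` closed_box a b.
Proof.
move=> x H i; have := H i; rewrite !mxE ge_max le_min.
by move=> /andP[/andP[-> _] /andP[-> _]].
Qed.

Lemma box_closed_box (a b : 'cV[R]_d) : box a b `<=` closed_box a b.
Proof. by move=> x H i; have /andP[h1 h2] := H i; rewrite !ltW. Qed.

(** Bumps converge boundedly to indicators, so [g] integrates to zero over every box whose closed
    version lies in [Omega]. Dynkin induction extends this to all measurable subsets of such a box,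
    hence [g] vanishes almost everywhere in it, and countably many of them cover [Omega]. *)
Lemma du_bois_reymond g : intg g ->
  (forall phi, test_function Omega phi -> \int[leb d]_(x in Omega) (g x * phi x) = 0) ->
  {ae leb d, forall x, Omega x -> g x = 0}.
Proof.
move=> gi Hg.
have box0 a b : closed_box a b `<=` Omega -> \int[leb d]_(x in box a b) g x = 0.
  move=> abO.
  rewrite Rintegral_mkcond.
  have -> : \int[leb d]_x (g \_ (box a b)) x = \int[leb d]_(x in Omega) (g x * \1_(box a b) x).
    rewrite [RHS]Rintegral_mkcond; apply: eq_Rintegral => x _.
    rewrite /patch indicE; have [xb|xb] := boolP (x \in box a b); last by rewrite mulr0 if_same.
    by rewrite mulr1 ifT//; apply/mem_set/abO/box_closed_box/set_mem.
  have := @dominated_Rintegral _ _ _ (leb d) Omega mO (fun n x => g x * bump n a b x)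
    (fun x => g x * \1_(box a b) x) (fun x => `|g x|).
  rewrite (_ : (fun m => \int[leb d]_(x in Omega) (g x * bump m a b x)) = fun=> 0); last first.
    by apply/funext => m; apply: Hg; exact: bump_test_function.
  move=> H; have {}H : (fun _ : nat => 0 : R) @ \oo --> \int[leb d]_(x in Omega) (g x * \1_(box a b) x).
    apply: H.
    - move=> m; apply: measurable_funM; first exact: intg_measurable gi.
      by apply: (test_function_measurable mO); exact: bump_test_function abO.
    - apply: measurable_funM; first exact: intg_measurable gi.
      exact: measurable_indic (measurable_box _ _).
    - exact: intg_norm.
    - by apply: aeW => x _; apply: cvgMr; exact: cvg_bump.
    - apply: aeW => x m _; rewrite normrM ler_piMr// ger0_norm ?bump_ge0//.
      exact: bump_le1.
  by rewrite -(cvg_lim (@Rhausdorff R) H) lim_cst.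
have boxae a b : closed_box a b `<=` Omega -> {ae leb d, forall x, box a b x -> g x = 0}.
  move=> abO; have mab := measurable_box a b.
  have abO' : box a b `<=` Omega by apply: subset_trans abO; exact: box_closed_box.
  have gab : (leb d).-integrable (box a b) (EFin \o g) by exact: (integrableS mO).
  have P E : measurable E -> \int[leb d]_(x in E `&` box a b) g x = 0.
    rewrite sigma_algebra_box; move: E.
    apply: dynkin_induction.
    - exact: sigma_algebra_box.
    - by move=> _ _ [a1 [b1 ->]] [a2 [b2 ->]]; rewrite boxI; eexists; eexists.
    - by rewrite setTI; exact: box0.
    - move=> _ [a1 [b1 ->]]; rewrite setIC boxI; apply: box0.
      by apply: subset_trans abO; exact: closed_boxI.
    - move=> E mE E0.
      have := @Rintegral_setU _ _ _ (leb d) (E `&` box a b) (~` E `&` box a b) g.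
      rewrite -setIUl setUv setTI box0// E0 add0r => <- //.
      + exact: measurableI.
      + by apply: measurableI => //; exact: measurableC.
      + by apply/disj_setPS => x [[Ex _] [nEx _]].
    - move=> F mF tF F0; rewrite setI_bigcupl /Rintegral integral_bigcup//.
      + rewrite eseries0// => k _ _; rewrite -[LHS]fineK; first by rewrite [X in X%:E]F0.
        apply: integrable_fin_num; first exact: measurableI.
        by apply: integrableS gab => //; exact: measurableI.
      + by apply: trivIset_setIr.
      + by move=> k; exact: measurableI.
      + apply: integrableS gab => //; first by apply: bigcup_measurable => k _; exact: measurableI.
        by apply: bigcup_sub => k _ x [].
  have := @integral_ae_eq _ _ _ (leb d) _ mab (cst 0%E) (EFin \o g) gab (measurable_cst _).
  move=> H; have {}H : ae_eq (leb d) (box a b) (EFin \o g) (cst 0%E).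
    apply: H => E Eab mE; rewrite integral0.
    rewrite -[LHS]fineK; last by apply: integrable_fin_num => //; exact: integrableS gab.
    have := P E mE; rewrite (setIidl Eab) => h.
    by rewrite [X in X%:E]h.
  by apply: filterS H => x H /H [].
(* The covering boxes are indexed by rational data, hence countable, and the exceptional sets add up
   to a null set. *)
have H : (leb d).-negligible (\bigcup_(k : nat) (if unpickle k is Some q then
    if `[< closed_box (rbox_lo q) (rbox_hi q) `<=` Omega >] then
      [set x | ~ (box (rbox_lo q) (rbox_hi q) x -> g x = 0)] else set0 else set0)).
  apply: negligible_bigcup => k.
  case: (unpickle k) => [q|]; last exact: negligible_set0.
  by case: asboolP => [/boxae|_]; last exact: negligible_set0.
apply: negligibleS H => x /= /not_implyP[Ox gx].
have [q qO xq] := open_covering oO Ox.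
exists (pickle q) => //; rewrite pickleK; case: asboolP => // _ /=.
by apply/not_implyP.
Qed.

Lemma weak_derivative_unique a g h1 h2 : sqint h1 -> sqint h2 ->
  weak_derivative Omega a g h1 -> weak_derivative Omega a g h2 ->
  {ae leb d, forall x, Omega x -> h1 x = h2 x}.
Proof.
move=> i1 i2 w1 w2.
have j1 := sqint_intg mO muO i1; have j2 := sqint_intg mO muO i2.
have : {ae leb d, forall x, Omega x -> h1 x - h2 x = 0}.
  apply: du_bois_reymond; first exact: intgB.
  move=> phi tphi; under eq_Rintegral do rewrite mulrBl.
  rewrite RintegralB//; [|exact: intg_test|exact: intg_test].
  have := w1 _ tphi; rewrite (w2 _ tphi) => /(congr1 (fun t => (-1) ^+ (\sum_i a i)%N * t)).
  by rewrite !mulrA -!expr2 sqrr_sign !mul1r => ->; rewrite subrr.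
by apply: filterS => x /[apply] /eqP; rewrite subr_eq0 => /eqP.
Qed.

Lemma multi_partial0 (a : 'I_d -> nat) (phi : 'cV[R]_d -> R) : (\sum_i a i = 0)%N -> multi_partial a phi = phi.
Proof.
move=> a0; rewrite /multi_partial (_ : flatten _ = [::])//.
elim: (enum 'I_d) => //= i s ->; rewrite cats0.
by have /eqP := a0; rewrite sum_nat_eq0 => /forallP/(_ i)/eqP ->.
Qed.

Lemma multi_partial_unit j (phi : 'cV[R]_d -> R) : multi_partial (unit_index j) phi = partial j phi.
Proof.
rewrite /multi_partial (_ : flatten _ = [:: j])//.
rewrite (_ : flatten _ = [seq i <- enum 'I_d | i == j]).
  by rewrite -(filter_pred1_uniq (enum_uniq 'I_d))// mem_enum.
by elim: (enum 'I_d) => //= i s ->; rewrite /unit_index; case: eqP.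
Qed.

Lemma sum_unit_index (j : 'I_d) : (\sum_i unit_index j i = 1)%N.
Proof. by rewrite (bigD1 j)//= /unit_index eqxx big1 ?addn0// => i /negbTE ->. Qed.

Lemma unit_indexP (a : 'I_d -> nat) : (\sum_i a i = 1)%N -> exists j, a = unit_index j.
Proof.
move=> a1.
have [j aj] : exists j, a j != 0%N.
  apply: contrapT => /forallNP H; move: a1; rewrite big1// => i _.
  by apply/eqP; have := H i => /negP; rewrite negbK.
exists j; apply/funext => i; rewrite /unit_index.
move: a1; rewrite (bigD1 j)//=; have [->|ij] := eqVneq i j.
  by case: (a j) aj => // -[|]// k _; rewrite addSn; case.
rewrite (bigD1 i)//=; case: (a j) aj => // k _; case: (a i) => // l.
by rewrite addSn addnC addSn.
Qed.

End du_bois_reymond.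

Lemma derive_translate (R : realType) (V W : normedModType R) (f : V -> W) (c v x : V) :
  'D_v (fun y => f (y + c)) x = 'D_v f (x + c).
Proof.
rewrite /derive.
have -> // : (fun h : R => h^-1 *: ((f \o shift (x + c)) (h *: v) - f (x + c))) =
  (fun h : R => h^-1 *: (((fun y => f (y + c)) \o shift x) (h *: v) - f (x + c))).
by apply/funext => h /=; rewrite addrA.
Qed.

(** * Translations, integration by parts and Lipschitz bounds from weak derivatives *)

Section shift_derivative.
Context {R : realType} {d : nat}.
Implicit Types (g h chi : 'cV[R]_d -> R) (x e v : 'cV[R]_d).

(** The translation acts on the smooth factor only, so [g] need be no more than integrable: [M |g|]
    dominates both the integrand and its derivative. *)
Lemma is_derive_shift_integral (B : set 'cV[R]_d) g chi e (M : R) (s : R) :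
  measurable B -> intg (leb d) B g -> measurable_fun setT chi ->
  (forall x, derivable chi x e) -> (forall x, `|chi x| <= M) ->
  (forall x, `|'D_e chi x| <= M) ->
  is_derive s 1 (fun s : R => \int[leb d]_(x in B) (g x * chi (x + s *: e)))
    (\int[leb d]_(x in B) (g x * 'D_e chi (x + s *: e))).
Proof.
move=> mB gi mchi dchi chiM dchiM.
pose f (s : R) x := g x * chi (x + s *: e).
have dfE (t : R) x : is_derive t 1 (f^~ x) (g x * 'D_e chi (x + t *: e)).
  have := derive_line (dchi (x + t *: e)) => dl.
  by have := @is_deriveZ R R R _ (g x) t 1 _ dl.
have mg := intg_measurable gi.
have mf t : measurable_fun B (f t).
  apply: measurable_funM => //; apply: measurable_funTS.
  exact: (measurableT_comp mchi (measurable_shift (t *: e))).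
have fi t : intg (leb d) B (f t).
  apply: (@le_intg _ _ _ _ _ mB _ (fun x => M * `|g x|)) => //.
    by move=> x _; rewrite normrM mulrC ler_wpM2r.
  by apply: intgZ => //; exact: intg_norm.
have M0 : 0 <= M by apply: le_trans (chiM 0).
have H := @cvg_differentiation_under_integral R _ _ (leb d) f B mB s (s - 1) (s + 1) _
   (fun t _ => fi t) (fun t x _ _ => let: DeriveDef p _ := dfE t x in p) (fun x => M * `|g x|).
have d1 t x : partial1of2 f t x = g x * 'D_e chi (x + t *: e).
  by rewrite partial1of2E; have [_ ->] := dfE t x.
have {}H : h^-1 *: ((fun s : R => \int[leb d]_(x in B) f s x) (h *: (1 : R) + s) -
   \int[leb d]_(x in B) f s x) @[h --> 0^'] --> \int[leb d]_(x in B) (g x * 'D_e chi (x + s *: e)).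
  under [X in _ --> X]eq_Rintegral do rewrite -d1.
  have -> : (fun h : R => h^-1 *: (\int[leb d]_(x in B) f (h *: (1 : R) + s) x - \int[leb d]_(x in B) f s x)) =
    (fun h : R => h^-1 *: (\int[leb d]_(x in B) f (h + s) x - \int[leb d]_(x in B) f s x)).
    by apply/funext => h; rewrite /GRing.scale/= mulr1.
  apply: H.
  - by rewrite /= in_itv/= ltrBlDr !ltrDl ltr01.
  - by move=> x; rewrite mulr_ge0.
  - by apply: intgZ => //; exact: intg_norm.
  - by move=> t x _ _; rewrite d1 normrM mulrC ler_wpM2r.
by apply: DeriveDef; [exact: cvgP H|exact: cvg_lim H].
Qed.

Lemma Rintegral_support (B : set 'cV[R]_d) chi : (forall x, ~ B x -> chi x = 0) ->
  \int[leb d]_(x in B) chi x = \int[leb d]_x chi x.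
Proof.
move=> H; rewrite Rintegral_mkcond; apply: eq_Rintegral => x _; rewrite /patch.
by case: ifPn => // /negP nx; rewrite H// => Bx; apply: nx; exact: mem_set.
Qed.

Lemma Rintegral_shift chi v : measurable_fun setT chi ->
  \int[leb d]_x chi (x + v) = \int[leb d]_x chi x.
Proof.
move=> mchi; rewrite /Rintegral; congr fine.
by apply: (integral_shift v (f := EFin \o chi)); exact/measurable_EFinP.
Qed.

(** The integral of a translate of [chi] does not depend on the translation, and its derivative at
    the zero translation is the integral of the derivative. *)
Lemma Rintegral_derive0 chi e (M r : R) : measurable_fun setT chi ->
  (forall x, derivable chi x e) -> (forall x, `|chi x| <= M) ->
  (forall x, `|'D_e chi x| <= M) -> (forall x, r <= `|x| -> chi x = 0) ->
  \int[leb d]_x 'D_e chi x = 0.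
Proof.
move=> mchi dchi chiM dchiM chi0.
(* Outside the ball of this radius [chi] vanishes, together with all its translates by [s *: e] with
   [|s| <= 1]. *)
pose q := `|r| + `|e| + 1; pose B := ball (0 : 'cV[R]_d) q.
have q0 : 0 < q by rewrite /q ltr_wpDl// addr_ge0.
have mB : measurable B by apply: open_measurable_mx; exact: ball_open.
have muB : (leb d B < +oo)%E by rewrite leb_ball// ltry.
have out x : ~ B x -> q <= `|x|.
  by rewrite /B -ball_normE/= sub0r normrN => /negP; rewrite -leNgt.
have one : intg (leb d) B (fun=> 1) by exact: intg_cst.
have D := is_derive_shift_integral 0 mB one mchi dchi chiM dchiM.
have De : \int[leb d]_x 'D_e chi x = \int[leb d]_(x in B) (1 * 'D_e chi (x + 0 *: e)).
  rewrite -(@Rintegral_support B).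
    by apply: eq_Rintegral => x _; rewrite mul1r scale0r addr0.
  move=> x /out qx.
  have near0 : \forall y \near x, chi y = 0.
    have rx : `|r| < `|x| by rewrite (lt_le_trans _ qx)// /q -addrA ltrDl ltr_wpDl.
    have : (fun y : 'cV[R]_d => `|y|) y @[y --> x] --> `|x| by exact: norm_continuous.
    move/cvgr_gt => /(_ _ rx); apply: filterS => y ry; apply: chi0.
    by rewrite (le_trans (ler_norm _))// ltW.
  by rewrite (@near_eq_derive _ _ _ _ (cst 0)) ?derive_cst.
have [_ DE] := D; rewrite De -DE.
rewrite (@near_eq_derive _ _ _ _ (cst (\int[leb d]_x chi x))) ?derive_cst//.
have near1 : \forall s \near (0 : R), `|s| <= 1.
  have /(_ 1 ltr01) := @nbhs0_le R R^o; exact.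
near=> s; under eq_Rintegral do rewrite mul1r.
rewrite (@Rintegral_support B) ?(Rintegral_shift (s *: e))// => x /out qx.
apply: chi0; have s1 : `|s| <= 1 by near: s; exact: near1.
have h1 : `|s *: e| <= `|e| by rewrite normrZ ler_piMl.
have := lerB_normD x (s *: e); have := ler_norm r; move: qx h1; rewrite /q; lra.
Unshelve. all: by end_near. Qed.

End shift_derivative.

Section weak_lipschitz.
Context {R : realType} {d : nat}.
Variable Omega : set 'cV[R]_d.
Hypotheses (oO : open Omega) (bO : bounded_set Omega).
Let mO : measurable Omega := open_measurable_mx oO.
Let muO : (leb d Omega < +oo)%E := leb_bounded mO bO.
Notation intg := (intg (leb d) Omega).
Notation sqint := (sqint (leb d) Omega).
Implicit Types (g h : 'cV[R]_d -> R) (x : 'cV[R]_d).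

Lemma bump_derivable n (a b x v : 'cV[R]_d) : derivable (bump n a b) x v.
Proof. by apply/diff_derivable/smooth_differentiable; exact: bump_smooth. Qed.

Lemma bump_partial_bounded n a b (j : 'I_d) :
  exists2 M : R, 1 <= M & forall x, `|'D_(basis_vec j) (bump n a b) x| <= M.
Proof.
have tb : test_function setT (bump n a b) by exact: bump_test_function.
have [M HM] := test_function_bounded (test_function_partial j tb).
by exists (`|M| + 1) => [|x]; rewrite ?lerDr// (le_trans (HM x))// (le_trans (ler_norm _))// lerDl.
Qed.

Lemma bump_measurable n (a b : 'cV[R]_d) : measurable_fun setT (bump n a b).
Proof. by apply: continuous_measurable_mx; apply: smooth_continuous; exact: bump_smooth. Qed.

Lemma bump_norm_le1 n (a b x : 'cV[R]_d) : `|bump n a b x| <= 1.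
Proof. by rewrite ger0_norm ?bump_ge0 ?bump_le1. Qed.

Lemma bump_norm_le n (a b x : 'cV[R]_d) (M : R) : 1 <= M -> `|bump n a b x| <= M.
Proof. exact/le_trans/bump_norm_le1. Qed.

(* Integrating the weak derivative along the translation of a bump; the
   translated bumps stay admissible as long as their supports lie in [Omega]. *)
Lemma weak_lipschitz g h (j : 'I_d) (a b : 'cV[R]_d) (t M : R) : 0 < t ->
  intg g -> intg h -> weak_derivative Omega (unit_index j) g h ->
  {ae leb d, forall x, Omega x -> `|h x| <= M} ->
  (forall s : R, 0 <= s <= t ->
    closed_box (a + s *: basis_vec j) (b + s *: basis_vec j) `<=` Omega) ->
  `|\int[leb d]_(x in Omega) (g x * bump 0 a b (x - t *: basis_vec j)) -
    \int[leb d]_(x in Omega) (g x * bump 0 a b x)| <=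
  t * (M * \int[leb d]_x bump 0 a b x).
Proof.
move=> t0 gi hi wgh hM tube; set e := basis_vec j.
pose phi := bump 0 a b.
have [C C1 HC] := bump_partial_bounded 0 a b j.
pose G (s : R) := \int[leb d]_(x in Omega) (g x * phi (x + s *: (- e))).
pose dG (s : R) := \int[leb d]_(x in Omega) (g x * 'D_(- e) phi (x + s *: (- e))).
have DN x : 'D_(- e) phi x = - 'D_e phi x.
  rewrite !deriveE; try by apply: smooth_differentiable; exact: bump_smooth.
  by rewrite linearN.
have GE (s : R) : is_derive s 1 G (dG s).
  have h3 x : `|'D_(- e) phi x| <= C by rewrite DN normrN; exact: HC.
  exact (is_derive_shift_integral s mO gi (bump_measurable 0 a b)
    (fun x => @bump_derivable 0 a b x (- e)) (fun x => bump_norm_le 0 a b x C1) h3).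
have shiftE (s : R) x : phi (x + s *: (- e)) = bump 0 (a + s *: e) (b + s *: e) x.
  by rewrite /phi scalerN bump_shift.
have shiftDE (s : R) x : 'D_(- e) phi (x + s *: (- e)) = - partial j (bump 0 (a + s *: e) (b + s *: e)) x.
  rewrite DN /partial -/e -derive_translate; congr (- 'D_e _ x).
  by apply/funext => y; rewrite -shiftE.
have dGE (s : R) : 0 <= s <= t -> dG s = \int[leb d]_(x in Omega) (h x * bump 0 (a + s *: e) (b + s *: e) x).
  move=> st.
  have tb : test_function Omega (bump 0 (a + s *: e) (b + s *: e)) by apply: bump_test_function; exact: tube.
  have := wgh _ tb; rewrite sum_unit_index expr1 mulN1r multi_partial_unit => H.
  rewrite -[RHS]opprK -H -RintegralN//; last by apply: intg_test => //; exact: test_function_partial.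
  by apply: eq_Rintegral => x _; rewrite shiftDE mulrN.
have Ishift (s : R) : 0 <= s <= t -> \int[leb d]_(x in Omega) bump 0 (a + s *: e) (b + s *: e) x =
    \int[leb d]_x phi x.
  move=> st; rewrite Rintegral_support; last first.
    move=> x nx; apply: (test_function_eq0 _ nx).
    by apply: bump_test_function; exact: tube.
  rewrite -[RHS](Rintegral_shift (s *: (- e))); last exact: bump_measurable.
  by apply: eq_Rintegral => x _; rewrite shiftE.
have dGM (s : R) : 0 <= s <= t -> `|dG s| <= M * \int[leb d]_x phi x.
  move=> st; rewrite dGE// -(Ishift s st).
  have tb : test_function Omega (bump 0 (a + s *: e) (b + s *: e)) by apply: bump_test_function; exact: tube.
  have hb := intg_test oO hi tb.
  apply: le_trans (le_normr_Rintegral mO hb) _.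
  have bi : intg (bump 0 (a + s *: e) (b + s *: e)).
    apply: (@intg_bounded _ _ _ _ _ mO muO _ 1) => [|x _]; last exact: bump_norm_le1.
    by apply: measurable_funTS; exact: bump_measurable.
  rewrite -RintegralZl//; apply: ae_le_Rintegral => //; [exact: intg_norm|exact: intgZ|].
  apply: filterS hM => x H Ox; rewrite normrM [X in _ * X]ger0_norm ?bump_ge0//.
  by rewrite ler_wpM2r ?bump_ge0// H.
have cG : {within `[0, t], continuous G}.
  apply: continuous_subspaceT => s; apply: differentiable_continuous.
  by apply/derivable1_diffP; have [] := GE s.
have [c ct] := @MVT _ G dG 0 t t0 (fun s _ => GE s) cG.
have -> : \int[leb d]_(x in Omega) (g x * bump 0 a b (x - t *: e)) = G t.
  by apply: eq_Rintegral => x _; rewrite scalerN.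
have -> : \int[leb d]_(x in Omega) (g x * bump 0 a b x) = G 0.
  by apply: eq_Rintegral => x _; rewrite scale0r addr0.
move=> ->; rewrite subr0 normrM mulrC (gtr0_norm t0) ler_pM2l//; apply: dGM.
by move: ct; rewrite in_itv/= => /andP[h1 h2]; rewrite !ltW.
Qed.

End weak_lipschitz.

Section continuous_compact_support.
Context {R : realType} {d : nat}.

Lemma compact_support_bounded (K : set 'cV[R]_d) (f : 'cV[R]_d -> R) : compact K ->
  (forall x, ~ K x -> f x = 0) -> continuous f -> exists M, forall x, `|f x| <= M.
Proof.
move=> cK fK cf.
have [M [_ HM]] := compact_bounded (continuous_compact (continuous_subspaceT cf) cK).
exists (`|M| + 1) => x.
have [Kx|nKx] := pselect (K x); last by rewrite fK// normr0 addr_ge0.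
apply: HM; first by rewrite (le_lt_trans (ler_norm _))// ltrDl.
by exists x.
Qed.

(** The product rule for [P * phi], whose compact support makes the integral of its derivative
    vanish; the set [O] carries no boundary regularity. *)
Lemma Rintegral_by_parts (O : set 'cV[R]_d) (P phi : 'cV[R]_d -> R) (j : 'I_d) :
  open O -> bounded_set O -> (forall x, differentiable P x) -> continuous (partial j P) ->
  test_function O phi ->
  \int[leb d]_(x in O) (P x * partial j phi x) =
  - \int[leb d]_(x in O) (partial j P x * phi x).
Proof.
move=> oO bO dP cdP tphi.
have mO := open_measurable_mx oO; have muO := leb_bounded mO bO.
have [sphi cphi sO] := tphi.
pose K := closure [set x | phi x != 0].
have phiK x : ~ K x -> phi x = 0.
  by move=> nK; apply/eqP; apply: contrapT => /negP nx; apply: nK; exact: subset_closure.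
have tdphi := test_function_partial j tphi.
have dphiK x : ~ K x -> partial j phi x = 0.
  move=> nK; have nearx : \forall y \near x, phi y = 0.
    have : open_nbhs x (~` K) by split => //; apply: closed_openC; exact: closed_closure.
    by move/open_nbhs_nbhs; apply: filterS => y ny; exact: phiK.
  by rewrite /partial (@near_eq_derive _ _ _ phi (cst 0)) ?derive_cst.
have cP : continuous P by move=> x; exact: differentiable_continuous.
have cphi' := smooth_continuous sphi.
have cdphi : continuous (partial j phi) by apply: smooth_continuous; case: tdphi.
have dphi x := smooth_differentiable x sphi.
pose chi x := P x * phi x.
have dchiE x : 'D_(basis_vec j) chi x = P x * partial j phi x + partial j P x * phi x.
  rewrite /chi deriveM; [|exact: diff_derivable|exact: diff_derivable].
  by rewrite /partial /GRing.scale/= [X in _ + X]mulrC.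
have c1 : continuous (fun x => P x * partial j phi x) by move=> x; exact: (cvgM (cP x) (cdphi x)).
have c2 : continuous (fun x => partial j P x * phi x) by move=> x; exact: (cvgM (cdP x) (cphi' x)).
have c3 : continuous chi by move=> x; exact: (cvgM (cP x) (cphi' x)).
have k1 x : ~ K x -> P x * partial j phi x = 0 by move=> /dphiK ->; rewrite mulr0.
have k2 x : ~ K x -> partial j P x * phi x = 0 by move=> /phiK ->; rewrite mulr0.
have k3 x : ~ K x -> chi x = 0 by move=> /phiK h; rewrite /chi h mulr0.
have [M1 H1] := compact_support_bounded cphi k1 c1.
have [M2 H2] := compact_support_bounded cphi k2 c2.
have [M3 H3] := compact_support_bounded cphi k3 c3.
have [r [_ Hr]] := compact_bounded cphi.
have := @Rintegral_derive0 R d chi (basis_vec j) (M1 + M2 + `|M3|) (`|r| + 2).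
have M10 : 0 <= M1 by apply: le_trans (H1 0).
have M20 : 0 <= M2 by apply: le_trans (H2 0).
move=> H; have {H} : \int[leb d]_x 'D_(basis_vec j) chi x = 0.
  apply: H.
  - exact: continuous_measurable_mx.
  - by move=> x; apply: diff_derivable; exact: (differentiableM (dP x) (dphi x)).
  - by move=> x; rewrite (le_trans (H3 x))// (le_trans (ler_norm _))// lerDr addr_ge0.
  - move=> x; rewrite dchiE (le_trans (ler_normD _ _))//.
    by rewrite -[leLHS]addr0 lerD// lerD.
  - move=> x rx; rewrite /chi phiK ?mulr0// => Kx.
    have h : `|x| <= `|r| + 1.
      by apply: (Hr (`|r| + 1)) => //; rewrite (le_lt_trans (ler_norm _))// ltrDl.
    by move: rx h; lra.
rewrite -(@Rintegral_support _ _ O); last first.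
  move=> x nO; rewrite dchiE (test_function_eq0 tphi nO) (test_function_eq0 tdphi nO).
  by rewrite !mulr0 addr0.
under eq_Rintegral do rewrite dchiE.
rewrite RintegralD//; first by move/eqP; rewrite addr_eq0 => /eqP.
  by apply: (@intg_bounded _ _ _ _ _ mO muO _ M1) => //; apply: measurable_funTS; exact: continuous_measurable_mx.
by apply: (@intg_bounded _ _ _ _ _ mO muO _ M2) => //; apply: measurable_funTS; exact: continuous_measurable_mx.
Qed.

Lemma test_functionS (O1 O2 : set 'cV[R]_d) phi : O1 `<=` O2 ->
  test_function O1 phi -> test_function O2 phi.
Proof. by move=> O12 [? ? H]; split => //; exact: subset_trans O12. Qed.

Lemma Rintegral_subset_support (O1 O2 : set 'cV[R]_d) (f : 'cV[R]_d -> R) : O1 `<=` O2 ->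
  (forall x, ~ O1 x -> f x = 0) ->
  \int[leb d]_(x in O2) f x = \int[leb d]_(x in O1) f x.
Proof. by move=> O12 f0; rewrite !Rintegral_support// => x nx; apply: f0 => /O12. Qed.

(** Both derivatives satisfy the same identity against test functions supported in [O]: the weak one
    because these are also test functions on [Omega], the classical one by parts. *)
Lemma weak_derivative_classical (Omega O : set 'cV[R]_d) (g h P : 'cV[R]_d -> R) (j : 'I_d) :
  open Omega -> bounded_set Omega -> open O -> O `<=` Omega ->
  (forall x, O x -> g x = P x) -> (forall x, differentiable P x) ->
  continuous (partial j P) -> (exists M, forall x, O x -> `|partial j P x| <= M) ->
  intg (leb d) Omega h -> weak_derivative Omega (unit_index j) g h ->
  {ae leb d, forall x, O x -> h x = partial j P x}.
Proof.
move=> oOm bOm oO OOm gP dP cdP [M HM] hi wgh.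
have mO := open_measurable_mx oO; have mOm := open_measurable_mx oOm.
have bO : bounded_set O by have [M' [Mr HM']] := bOm; exists M'; split => // N MN x /OOm; exact: HM'.
have muO := leb_bounded mO bO.
have dPi : intg (leb d) O (partial j P).
  apply: (intg_bounded mO muO _ HM).
  by apply: measurable_funTS; exact: continuous_measurable_mx.
have hiO : intg (leb d) O h by exact: (integrableS mOm).
have : {ae leb d, forall x, O x -> h x - partial j P x = 0}.
  apply: (du_bois_reymond oO); first exact: intgB.
  move=> phi tphi; have tphi' := test_functionS OOm tphi.
  have := wgh _ tphi'; rewrite sum_unit_index expr1 mulN1r multi_partial_unit.
  rewrite !(@Rintegral_subset_support O Omega)//; last 2 first.
    by move=> x nO; rewrite (test_function_eq0 tphi nO) mulr0.
    by move=> x nO; rewrite (test_function_eq0 (test_function_partial j tphi) nO) mulr0.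
  rewrite (@eq_Rintegral _ _ _ _ _ (fun x => P x * partial j phi x)); last first.
    by move=> x /set_mem Ox; rewrite gP.
  rewrite Rintegral_by_parts// => /oppr_inj H.
  under eq_Rintegral do rewrite mulrBl.
  by rewrite RintegralB ?H ?subrr//; exact: intg_test.
by apply: filterS => x /[apply] /eqP; rewrite subr_eq0 => /eqP.
Qed.

End continuous_compact_support.

Section pointwise_lipschitz.
Context {R : realType} {d : nat}.
Variable Omega : set 'cV[R]_d.
Hypotheses (oO : open Omega) (bO : bounded_set Omega).
Let mO : measurable Omega := open_measurable_mx oO.
Let muO : (leb d Omega < +oo)%E := leb_bounded mO bO.
Notation intg := (intg (leb d) Omega).
Implicit Types (g h : 'cV[R]_d -> R) (x : 'cV[R]_d).

Lemma bump_intg n (a b : 'cV[R]_d) : intg (bump n a b).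
Proof.
apply: (intg_bounded mO muO (M := 1)) => [|x _]; last exact: bump_norm_le1.
by apply: measurable_funTS; exact: bump_measurable.
Qed.

Lemma bump_integral_gt0 n (a b : 'cV[R]_d) : closed_box a b `<=` Omega ->
  (forall i, a i 0 < b i 0) -> 0 < \int[leb d]_(x in Omega) bump n a b x.
Proof.
move=> abO ab; rewrite lt_neqAle Rintegral_ge0 ?andbT; last by move=> x _; exact: bump_ge0.
apply/eqP => H.
have mb : measurable_fun Omega (EFin \o bump n a b).
  by apply/measurable_EFinP; apply: measurable_funTS; exact: bump_measurable.
have E0 : (\int[leb d]_(x in Omega) `|(EFin \o bump n a b) x|)%E = 0%E.
  rewrite (eq_integral (EFin \o bump n a b)); last by move=> x _; rewrite gee0_abs// lee_fin bump_ge0.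
  rewrite -[LHS]fineK; first by congr EFin; exact: esym H.
  by apply: integrable_fin_num => //; exact: bump_intg.
have [N [mN N0 HN]] := (ae_eq_integral_abs (leb d) mO mb).1 E0.
have bN : box a b `<=` N.
  move=> x xab; apply: HN => /=; apply/not_implyP; split; first exact/abO/box_closed_box.
  by case => /eqP; apply/negP; rewrite bump_neq0; exact/asboolP.
have : (leb d (box a b) <= 0)%E.
  by rewrite -N0; apply: le_measure; rewrite ?inE//; exact: measurable_box.
rewrite leNgt => /negP; apply; apply: leb_open_gt0; first exact: open_box.
exists (\col_i ((a i 0 + b i 0) / 2)) => i; rewrite mxE; have := ab i => *.
by apply/andP; split; lra.
Qed.

Lemma bump_average g (a b : 'cV[R]_d) (c k : R) : intg g -> closed_box a b `<=` Omega ->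
  (forall x, closed_box a b x -> `|g x - c| <= k) ->
  `|\int[leb d]_(x in Omega) (g x * bump 0 a b x) - c * \int[leb d]_(x in Omega) bump 0 a b x| <=
  k * \int[leb d]_(x in Omega) bump 0 a b x.
Proof.
move=> gi abO gc.
have tb : test_function Omega (bump 0 a b) by exact: bump_test_function.
have bi := bump_intg 0 a b; have gbi := intg_test oO gi tb.
rewrite -!RintegralZl// -RintegralB//; last exact: intgZ.
have i1 : intg (fun x => g x * bump 0 a b x - c * bump 0 a b x) by apply: intgB => //; exact: intgZ.
apply: le_trans (le_normr_Rintegral mO i1) _.
apply: le_Rintegral => //; [exact: intg_norm|exact: intgZ|].
move=> x _; rewrite -mulrBl normrM [X in _ * X]ger0_norm ?bump_ge0//.
have [xab|nx] := pselect (closed_box a b x); first by rewrite ler_wpM2r ?bump_ge0 ?gc.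
have -> : bump 0 a b x = 0; last by rewrite !mulr0.
apply/eqP; apply: contrapT => /negP; rewrite bump_neq0 => /asboolP h.
by apply: nx; exact: box_closed_box.
Qed.

(** Averaging against bumps concentrated at the two end points turns the integral estimate into a
    pointwise one; continuity at just these two points controls the averages. *)
Lemma weak_lipschitz_pointwise g h (j : 'I_d) (y x0 : 'cV[R]_d) (r t M : R) : 0 < t ->
  intg g -> intg h -> weak_derivative Omega (unit_index j) g h ->
  {ae leb d, forall x, Omega x -> `|h x| <= M} -> ball y r `<=` Omega ->
  ball y r x0 -> ball y r (x0 + t *: basis_vec j) ->
  {for x0, continuous g} -> {for x0 + t *: basis_vec j, continuous g} ->
  `|g (x0 + t *: basis_vec j) - g x0| <= t * M.
Proof.
move=> t0 gi hi wgh hM yO yx0 yx1 c0 c1; set e := basis_vec j; set x1 := x0 + t *: e.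
apply/ler_addgt0Pr => k k0.
have k20 : 0 < k / 2 by rewrite divr_gt0.
have yr_open : open (ball y r) by exact: ball_open.
have : \forall x \near x0, ball y r x /\ `|g x - g x0| <= k / 2.
  apply: filterI; first by apply: open_nbhs_nbhs; split.
  by move/cvgr_dist_le : c0 => /(_ _ k20); apply: filterS => x; rewrite distrC.
move=> /nbhs_ballP[r0 /= r00 H0].
have : \forall x \near x1, ball y r x /\ `|g x - g x1| <= k / 2.
  apply: filterI; first by apply: open_nbhs_nbhs; split.
  by move/cvgr_dist_le : c1 => /(_ _ k20); apply: filterS => x; rewrite distrC.
move=> /nbhs_ballP[r1 /= r10 H1].
(* Half-width of the averaging boxes: the closed boxes around both end points fit into the
   neighbourhoods where [g] is within [k / 2] of its value. *)
pose q := Num.min r0 r1 / 2.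
have q0 : 0 < q by rewrite divr_gt0// lt_min r00 r10.
have m0 : Num.min r0 r1 <= r0 by rewrite ge_min lexx.
have m1 : Num.min r0 r1 <= r1 by rewrite ge_min lexx orbT.
have qr0 : q < r0 by rewrite /q; lra.
have qr1 : q < r1 by rewrite /q; lra.
pose a : 'cV[R]_d := \col_i (x0 i 0 - q); pose b : 'cV[R]_d := \col_i (x0 i 0 + q).
have cb (v x : 'cV[R]_d) (r' : R) : q < r' -> closed_box (a + v) (b + v) x -> ball (x0 + v) r' x.
  move=> qr' H; split; first by rewrite (lt_trans q0).
  move=> i i'; rewrite ord1 /ball/=; have := H i; rewrite !mxE => /andP[h1 h2].
  by apply: le_lt_trans qr'; rewrite ler_distlC; apply/andP; split; lra.
have yball x : ball y r x <-> 0 < r /\ forall i, `|y i 0 - x i 0| < r.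
  split=> [[h1 h2]|[h1 h2]]; first by split => // i; exact: h2.
  by split => // i i'; rewrite ord1; exact: h2.
(* A point of an intermediate box lies, coordinate by coordinate, between its translates into the
   two end boxes; [ball y r] is a cube and contains everything in between. *)
have tube (s : R) : 0 <= s <= t -> closed_box (a + s *: e) (b + s *: e) `<=` Omega.
  move=> /andP[s0 st] x Hx; apply: yO; apply/yball.
  have /H0[/yball[r_gt0 A0] _] : ball x0 r0 (x - s *: e).
    rewrite -[x0]addr0; apply: cb => // i; rewrite !mxE.
    by have := Hx i; rewrite !mxE; lra.
  have /H1[/yball[_ A1] _] : ball x1 r1 (x - s *: e + t *: e).
    apply: cb => // i; rewrite !mxE.
    by have := Hx i; rewrite !mxE; lra.
  split => // i; have := A0 i; have := A1 i; rewrite !mxE !ltr_distlC.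
  have e0 : 0 <= e i 0 by rewrite /e coord_basis_vec.
  have p1 : 0 <= s * e i 0 by rewrite mulr_ge0.
  have p2 : s * e i 0 <= t * e i 0 by rewrite ler_wpM2r.
  move: p1 p2; rewrite !mxE => p1 p2.
  by move=> /andP[? ?] /andP[? ?]; apply/andP; split; lra.
have abO : closed_box a b `<=` Omega.
  by have := tube 0; rewrite scale0r !addr0 lexx ltW//=; exact.
have ab1O : closed_box (a + t *: e) (b + t *: e) `<=` Omega by apply: tube; rewrite lexx ltW.
have L := weak_lipschitz oO bO t0 gi hi wgh hM tube.
have I0 : 0 < \int[leb d]_(x in Omega) bump 0 a b x.
  by apply: bump_integral_gt0 => // i; rewrite !mxE; lra.
have tb : test_function Omega (bump 0 a b) by exact: bump_test_function.
have IE : \int[leb d]_x bump 0 a b x = \int[leb d]_(x in Omega) bump 0 a b x.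
  by rewrite Rintegral_support// => x nx; exact: (test_function_eq0 tb).
have I1E : \int[leb d]_(x in Omega) bump 0 (a + t *: e) (b + t *: e) x = \int[leb d]_(x in Omega) bump 0 a b x.
  rewrite Rintegral_support; last by move=> x nx; apply: (test_function_eq0 _ nx); exact: bump_test_function.
  rewrite -IE -(Rintegral_shift (- (t *: e)) (bump_measurable 0 a b)).
  by apply: eq_Rintegral => x _; rewrite bump_shift.
have h0 x : closed_box a b x -> `|g x - g x0| <= k / 2.
  move=> xab; apply: (H0 _ _).2.
  by rewrite -[x0]addr0; apply: cb => //; rewrite !addr0.
have h1 x : closed_box (a + t *: e) (b + t *: e) x -> `|g x - g x1| <= k / 2.
  by move=> xab; apply: (H1 _ _).2; exact: cb.
have L0 := bump_average gi abO h0; have L1 := bump_average gi ab1O h1.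
have bE : \int[leb d]_(x in Omega) (g x * bump 0 a b (x - t *: basis_vec j)) =
   \int[leb d]_(x in Omega) (g x * bump 0 (a + t *: e) (b + t *: e) x).
  by apply: eq_Rintegral => x _; rewrite bump_shift.
rewrite I1E in L1; rewrite IE bE in L.
clear - L0 L1 L I0 k0.
move: L0 L1 L I0.
move: (\int[leb d]_(x in Omega) (g x * bump 0 a b x)) => A.
move: (\int[leb d]_(x in Omega) (g x * bump 0 (a + t *: e) (b + t *: e) x)) => B.
move: (\int[leb d]_(x in Omega) bump 0 a b x) (g x0) (g x1) => J c0 c1 L0 L1 L I0.
rewrite -(ler_pM2r I0) -[X in _ * X <= _](gtr0_norm I0) -normrM mulrBl.
have -> : c1 * J - c0 * J = (B - A) - (B - c1 * J) + (A - c0 * J) by ring.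
rewrite (le_trans (ler_normD _ _))// (_ : (t * M + k) * J = (t * (M * J) + k / 2 * J) + k / 2 * J); last by field.
by rewrite lerD// (le_trans (ler_normB _ _))// lerD.
Qed.

End pointwise_lipschitz.

Lemma cvg_sumr (R : realType) (T I : Type) (F : set_system T) {FF : Filter F} (s : seq I)
    (f : I -> T -> R) (l : I -> R) : (forall i, f i x @[x --> F] --> l i) ->
  \sum_(i <- s) f i x @[x --> F] --> \sum_(i <- s) l i.
Proof. by move=> fl; apply: cvg_big => //; exact: add_continuous. Qed.

(** * The Frobenius product and the geometry of a Lipschitz boundary *)

Section frobenius.
Context {R : realType}.

Lemma ipE m n (P Q : 'M[R]_(m, n)) : ip P Q = \sum_i \sum_j P i j * Q i j.
Proof.
rewrite /ip /mxtrace exchange_big/=; apply: eq_bigr => j _.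
by rewrite mxE; apply: eq_bigr => i _; rewrite mxE mulrC.
Qed.

Lemma ip_ge0 m n (P : 'M[R]_(m, n)) : 0 <= ip P P.
Proof. by rewrite ipE; apply: sumr_ge0 => i _; apply: sumr_ge0 => j _; rewrite -expr2 sqr_ge0. Qed.

Lemma enorm_sqr m n (P : 'M[R]_(m, n)) : enorm P ^+ 2 = ip P P.
Proof. by rewrite sqr_sqrtr// ip_ge0. Qed.

Lemma enorm_ge0 m n (P : 'M[R]_(m, n)) : 0 <= enorm P.
Proof. exact: sqrtr_ge0. Qed.

Lemma coord_le_enorm m n (P : 'M[R]_(m, n)) i j : `|P i j| <= enorm P.
Proof.
rewrite -sqrtr_sqr ler_wsqrtr// ipE (bigD1 i)//= (bigD1 j)//= -addrA -expr2 lerDl addr_ge0//.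
  by apply: sumr_ge0 => k _; rewrite -expr2 sqr_ge0.
by apply: sumr_ge0 => k _; apply: sumr_ge0 => k' _; rewrite -expr2 sqr_ge0.
Qed.

Lemma mx_norm_le_enorm m n (P : 'M[R]_(m, n)) : `|P| <= enorm P.
Proof. by apply: ler_mx_norm => [|i j]; [exact: enorm_ge0|exact: coord_le_enorm]. Qed.

Lemma enorm_le_mx_norm m n (P : 'M[R]_(m, n)) : enorm P <= Num.sqrt ((m * n)%:R) * `|P|.
Proof.
rewrite -[`|P|]ger0_norm// -[X in _ * X]sqrtr_sqr -sqrtrM//; apply: ler_wsqrtr.
rewrite ipE; apply: (@le_trans _ _ (\sum_(i < m) \sum_(j < n) `|P| ^+ 2)).
  apply: ler_sum => i _; apply: ler_sum => j _.
  by rewrite -expr2 -(real_normK (num_real (P i j))) lerXn2r ?nnegrE// ler_coord_mx_norm.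
by rewrite !sumr_const !card_ord -mulrnA mulr_natl mulnC.
Qed.

Lemma ipDl m n (P P' Q : 'M[R]_(m, n)) : ip (P + P') Q = ip P Q + ip P' Q.
Proof. by rewrite /ip mulmxDr raddfD. Qed.

Lemma ipZl m n (c : R) (P Q : 'M[R]_(m, n)) : ip (c *: P) Q = c * ip P Q.
Proof. by rewrite /ip -scalemxAr mxtraceZ. Qed.

Lemma ipC m n (P Q : 'M[R]_(m, n)) : ip P Q = ip Q P.
Proof. by rewrite !ipE; apply: eq_bigr => i _; apply: eq_bigr => j _; rewrite mulrC. Qed.

Lemma ipBl m n (P P' Q : 'M[R]_(m, n)) : ip (P - P') Q = ip P Q - ip P' Q.
Proof. by rewrite -scaleN1r ipDl ipZl mulN1r. Qed.

Lemma continuous_ipl n (e : 'cV[R]_n) : continuous (fun x : 'cV[R]_n => ip x e).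
Proof.
rewrite (_ : (fun x => _) = (fun x : 'cV[R]_n => \sum_i \sum_j x i j * e i j)); last first.
  by apply/funext => x; rewrite ipE.
move=> x; apply: (@cvg_sumr _ _ _ (nbhs x)) => i; apply: (@cvg_sumr _ _ _ (nbhs x)) => j; apply: cvgMl.
exact: (@coord_continuous R n 1 i j x).
Qed.

Lemma cvg_enorm0 m n (x : 'M[R]_(m, n)) : enorm (x - y) @[y --> x] --> (0 : R).
Proof.
apply/(@cvgrPdist_le _ _ _ (nbhs x)) => e e0.
have c0 : 0 < Num.sqrt ((m * n)%:R : R) + 1 by rewrite ltr_wpDl ?sqrtr_ge0.
near=> y; rewrite sub0r normrN ger0_norm ?enorm_ge0//.
apply: le_trans (enorm_le_mx_norm _) _.
apply: (@le_trans _ _ ((Num.sqrt ((m * n)%:R : R) + 1) * `|x - y|)).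
  by rewrite ler_wpM2r// lerDl.
rewrite mulrC -ler_pdivlMr//; near: y.
apply: filterS (nbhsx_ballx x _ (divr_gt0 e0 c0)) => y.
by rewrite -ball_normE => /ltW.
Unshelve. all: by end_near. Qed.

(** At a boundary point inside [U], a small step along [e] raises [ip x e] and leaves [g] unchanged.
    The point reached lies strictly above the graph, so it has a neighbourhood free of [Omega],
    although it is still in [U]. The lemma places open simplices and balls made of mesh elements
    inside [Omega]. *)
Lemma lipschitz_boundary_interior d (Omega U : set 'cV[R]_d) : lipschitz_boundary Omega ->
  open U -> U `<=` closure Omega -> U `<=` Omega.
Proof.
move=> lO oU UO x Ux; apply: contrapT => nOx.
have [e [g [L [V [e1 ge gL [oV Vx] HV]]]]] := lO x (UO _ Ux) nOx.
have gx : g x <= ip x e by rewrite leNgt; apply/negP => h; apply/nOx/(HV x Vx).2.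
have ee : ip e e = 1 by rewrite -enorm_sqr e1 expr1n.
have UVx : \forall y \near x, (U `&` V) y.
  exact: (open_nbhs_nbhs (conj (openI oU oV) (conj Ux Vx))).
have cs : (x + s *: e) @[s --> (0 : R)] --> x.
  rewrite -[X in _ --> X]addr0 -(scale0r e); apply: cvgD; first exact: cvg_cst.
  by apply: cvgZl; exact: cvg_id.
have [r /= r0 Hr] : \forall s \near (0 : R), (U `&` V) (x + s *: e).
  exact: cs UVx.
pose s := r / 2; have s0 : 0 < s by rewrite divr_gt0.
have [Uy Vy] : (U `&` V) (x + s *: e).
  by apply: Hr; rewrite /ball/= sub0r normrN gtr0_norm// /s; lra.
pose y := x + s *: e.
have gy : g y < ip y e by rewrite /y ge ipDl ipZl ee mulr1 (le_lt_trans gx)// ltrDl.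
have cg : g z @[z --> y] --> g y.
  apply/(@cvgrPdist_le _ _ _ (nbhs y)) => k k0.
  have L0 : 0 < `|L| + 1 by rewrite ltr_wpDl.
  have := cvg_enorm0 y => /(@cvgrPdist_le _ _ _ (nbhs y)) /(_ _ (divr_gt0 k0 L0)).
  apply: filterS => z; rewrite sub0r normrN ger0_norm ?enorm_ge0// ler_pdivlMr// => h.
  apply: le_trans (gL _ _) _; apply: le_trans h; rewrite mulrC ler_wpM2l ?enorm_ge0//.
  by rewrite (le_trans (ler_norm _))// lerDl.
have : \forall z \near y, V z /\ ~ Omega z.
  have h : (ip z e - g z) @[z --> y] --> ip y e - g y by exact: (cvgB (@continuous_ipl _ e y) cg).
  have h0 : 0 < ip y e - g y by rewrite subr_gt0.
  have Vny : \forall z \near y, V z by apply: open_nbhs_nbhs; split.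
  apply: filterS2 Vny (cvgr_gt _ h _ h0) => z Vz; rewrite subr_gt0 => gz; split => //.
  by move/(HV z Vz).1; rewrite ltNge ltW.
move=> Hy; have [z [Oz [_ nOz]]] := UO _ Uy _ Hy.
exact: nOz.
Qed.

End frobenius.

(** * Simplicial meshes *)

Section barycentric.
Context {R : realType} {d : nat}.
Variable v : 'I_d.+1 -> 'cV[R]_d.

Definition edge_mx : 'M[R]_d := \matrix_(i, j) (v (lift ord0 j) - v ord0) i 0.
Hypothesis vU : edge_mx \in unitmx.

Definition bary (i : 'I_d.+1) (x : 'cV[R]_d) : R :=
  let y := invmx edge_mx *m (x - v ord0) in
  if unlift ord0 i is Some j then y j 0 else 1 - \sum_j y j 0.

Lemma bary_sum x : \sum_i bary i x = 1.
Proof.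
rewrite big_ord_recl /bary unlift_none.
by under [X in _ + X]eq_bigr do rewrite liftK; rewrite subrK.
Qed.

Lemma edge_mxE (y : 'cV[R]_d) : edge_mx *m y = \sum_j y j 0 *: (v (lift ord0 j) - v ord0).
Proof.
apply/colP => i; rewrite mxE summxE; apply: eq_bigr => j _.
by rewrite !mxE mulrC.
Qed.

Lemma bary_comb x : \sum_i bary i x *: v i = x.
Proof.
rewrite big_ord_recl {1}/bary unlift_none.
set y := invmx _ *m _.
under [X in _ + X]eq_bigr do rewrite /bary liftK -/y.
rewrite scalerBl scale1r scaler_suml addrAC -addrA -sumrB.
under eq_bigr do rewrite -scalerBr.
by rewrite -edge_mxE /y mulKVmx// addrC subrK.
Qed.

Lemma bary_unique (t : 'I_d.+1 -> R) : \sum_i t i = 1 ->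
  forall i, bary i (\sum_i t i *: v i) = t i.
Proof.
move=> t1.
have E : \sum_i t i *: v i - v ord0 = edge_mx *m (\col_j t (lift ord0 j)).
  rewrite edge_mxE -{1}[v ord0]scale1r -t1 !big_ord_recl scalerDl scaler_suml.
  rewrite opprD addrACA subrr add0r -sumrB.
  by apply: eq_bigr => j _; rewrite mxE -scalerBr.
move=> i; rewrite /bary E mulKmx//; case: unliftP => [j ->|->]; first by rewrite mxE.
under eq_bigr do rewrite mxE.
by move: t1; rewrite big_ord_recl => <-; rewrite addrK.
Qed.

Lemma bary_vtx i j : bary i (v j) = (i == j)%:R.
Proof.
have H : \sum_k (k == j)%:R *: v k = v j.
  by rewrite (bigD1 j)//= eqxx scale1r big1 ?addr0// => k /negbTE ->; rewrite scale0r.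
rewrite -{1}H (bary_unique (t := fun k => (k == j)%:R))//.
by rewrite (bigD1 j)//= eqxx big1 ?addr0// => k /negbTE ->.
Qed.

Lemma hull_bary (I : set 'I_d.+1) :
  hull v I = [set x | (forall i, 0 <= bary i x) /\ (forall i, ~ I i -> bary i x = 0)].
Proof.
apply/seteqP; split => [x [t [t0 tI t1 ->]]|x [h0 hI]].
  by split => [i|i nI]; rewrite bary_unique ?t0 ?tI.
exists (fun i => bary i x); split => //; first exact: bary_sum.
by rewrite bary_comb.
Qed.

Lemma bary_combination i x y (s : R) :
  bary i ((1 - s) *: x + s *: y) = (1 - s) * bary i x + s * bary i y.
Proof.
have -> : (1 - s) *: x + s *: y = \sum_k ((1 - s) * bary k x + s * bary k y) *: v k.
  rewrite -{1}[x]bary_comb -{1}[y]bary_comb !scaler_sumr -big_split/=.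
  apply: eq_bigr => k _. by rewrite [RHS]scalerDl !scalerA.
rewrite bary_unique// big_split/= -!mulr_sumr !bary_sum; ring.
Qed.

(** The gradient of the affine function [bary i], as a row. *)
Definition bary_row (i : 'I_d.+1) : 'rV[R]_d :=
  if unlift ord0 i is Some j then row j (invmx edge_mx) else - \sum_j row j (invmx edge_mx).

Lemma bary_affine i x : bary i x = (bary_row i *m x) 0 0 + bary i 0.
Proof.
rewrite /bary /bary_row sub0r.
have E j : (invmx edge_mx *m (x - v ord0)) j 0 =
    (row j (invmx edge_mx) *m x) 0 0 + (invmx edge_mx *m - v ord0) j 0.
  by rewrite mulmxDr -row_mul !mxE.
case: (unlift ord0 i) => [j|]; first exact: E.
rewrite mulNmx mulmx_suml [in RHS]mxE summxE (eq_bigr _ (fun j _ => E j)) big_split/=.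
by rewrite opprD addrCA.
Qed.

Lemma bary_shift i x w (s : R) : bary i (x + s *: w) = bary i x + s * (bary_row i *m w) 0 0.
Proof.
by rewrite bary_affine [bary i x]bary_affine mulmxDr -scalemxAr mxE [X in _ + X + _]mxE; ring.
Qed.

Lemma bary_continuous i : continuous (bary i).
Proof.
rewrite (_ : bary i = fun x => \sum_j bary_row i 0 j * x j 0 + bary i 0); last first.
  by apply/funext => x; rewrite [LHS]bary_affine mxE.
move=> x; apply: (@cvgD _ _ _ (nbhs x)); last exact: (@cvg_cst _ _ _ (nbhs x)).
apply: (@cvg_sumr _ _ _ (nbhs x)) => j; apply: cvgMr; exact: (@coord_continuous R d 1 j 0 x).
Qed.

Lemma bary_row_neq0 i : (0 < d)%N -> bary_row i != 0.
Proof.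
move=> d0; apply/eqP => r0.
have H x : bary i x = bary i 0 by rewrite bary_affine r0 mul0mx mxE add0r.
have [j ij] : exists j : 'I_d.+1, i != j.
  case: d d0 i {r0 H} => // d' _ i; have [->|] := eqVneq i ord0; first by exists ord_max.
  by exists ord0.
have := H (v i); rewrite -(H (v j)) !bary_vtx eqxx (negbTE ij) => /eqP.
by rewrite oner_eq0.
Qed.

Definition open_simplex : set 'cV[R]_d := [set x | forall i, 0 < bary i x].

Lemma open_open_simplex : open open_simplex.
Proof.
rewrite openE => x Hx.
have H : \forall y \near x, forall i, 0 < bary i y.
  apply: (@filter_forall _ _ (fun i (y : 'cV[R]_d) => 0 < bary i y) (nbhs x)) => i.
  exact: (cvgr_gt _ (@bary_continuous i x)).
exact: H.
Qed.

Lemma open_simplex_hull : open_simplex `<=` hull v setT.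
Proof. by rewrite hull_bary => x Hx; split => [i|i []//]; exact/ltW/Hx. Qed.

Lemma hull_closed : closed (hull v setT).
Proof.
rewrite hull_bary (_ : [set x | _] = \bigcap_(i : 'I_d.+1) [set x | 0 <= bary i x]).
  apply: closed_bigI => i _.
  apply: (@preimage_closed _ _ (bary i) (fun y => 0 <= y)); last exact: closed_ge.
  by move=> x _; exact: bary_continuous.
by apply/seteqP; split => [x [h _] i _|x h]; [exact: h|split => [i|i []//]; exact: h].
Qed.

(** The boundary is covered by the zero sets of the barycentric coordinates, which are hyperplanes
    because [0 < d]. *)
Lemma hull_boundary_null : (0 < d)%N ->
  (leb d).-negligible (hull v setT `\` open_simplex).
Proof.
move=> d0; apply: (@negligibleS _ _ _ _ (\bigcup_(k : nat)
   (if insub k is Some i then [set x | bary (i : 'I_d.+1) x = 0] else set0))).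
  rewrite hull_bary => x [[h _] /existsNP[i /negP]]; rewrite -leNgt => i0.
  by exists i => //; rewrite insubT//= => lt; rewrite (_ : Sub _ _ = i) ?(le_anti (introT andP (conj i0 (h i))))//; exact: val_inj.
apply: negligible_bigcup => k; case: insubP => [i _ _|_]; last exact: negligible_set0.
apply: (@negligibleS _ _ _ _ [set x | (bary_row i *m x) 0 0 = - bary i 0]).
  by move=> x /=; rewrite bary_affine => /eqP; rewrite addr_eq0 => /eqP.
apply/negligibleP; last exact/leb_hyperplane/bary_row_neq0.
have m1 : measurable_fun setT (fun x : 'cV[R]_d => (bary_row i *m x) 0 0).
  by apply: measurable_mx_coord; exact: measurable_mxM.
by have := m1 measurableT [set - bary i 0] (measurable_set1 _); rewrite setTI.
Qed.

End barycentric.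

Section facet_neighbourhood.
Context {R : realType} {d : nat}.
Hypothesis d0 : (0 < d)%N.

Lemma bary_affine_comb (v w : 'I_d.+1 -> 'cV[R]_d) : edge_mx v \in unitmx ->
  forall a x, bary w a x = \sum_j bary v j x * bary w a (v j).
Proof.
move=> vU a x; rewrite bary_affine -[bary w a 0]mulr1 -(bary_sum v x).
rewrite -{1}(bary_comb vU x) mulmx_sumr summxE mulr_sumr -big_split/=.
apply: eq_bigr => j _; rewrite -scalemxAr mxE (bary_affine w a (v j)); ring.
Qed.

Definition facet_center (v : 'I_d.+1 -> 'cV[R]_d) (i : 'I_d.+1) : 'cV[R]_d :=
  \sum_j (if j == i then 0 else d%:R^-1) *: v j.

Lemma bary_facet_center v i : edge_mx v \in unitmx ->
  forall j, bary v j (facet_center v i) = if j == i then 0 else d%:R^-1.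
Proof.
move=> vU j; rewrite (bary_unique vU (t := fun j => if j == i then 0 else d%:R^-1))//.
rewrite (bigD1 i)//= eqxx add0r (eq_bigr (fun=> d%:R^-1)); last by move=> k /negbTE ->.
rewrite sumr_const (_ : #|_| = d); first by rewrite -[LHS]mulr_natr mulVf// pnatr_eq0 -lt0n.
have := cardC1 i; rewrite card_ord/= => E; rewrite -[RHS]E.
by apply: eq_card => k; rewrite !inE.
Qed.

Lemma facet_center_ge0 v i : edge_mx v \in unitmx -> forall j, 0 <= bary v j (facet_center v i).
Proof. by move=> vU j; rewrite bary_facet_center//; case: ifP. Qed.

Lemma facet_center_gt0 v i : edge_mx v \in unitmx -> forall j, j != i -> 0 < bary v j (facet_center v i).
Proof. by move=> vU j /negbTE ji; rewrite bary_facet_center// ji invr_gt0 ltr0n. Qed.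

(* On the common facet the barycentric coordinates of the two simplices opposite to it
   are proportional with a negative factor. *)
Lemma facet_neighbourhood (v1 v2 : 'I_d.+1 -> 'cV[R]_d) (i : 'I_d.+1) (I2 : set 'I_d.+1) :
  edge_mx v1 \in unitmx -> edge_mx v2 \in unitmx ->
  hull v1 setT `&` hull v2 setT = hull v1 [set j | j != i] ->
  hull v1 setT `&` hull v2 setT = hull v2 I2 -> I2 != setT ->
  forall y (e : R), hull v1 [set j | j != i] y -> 0 < e ->
  exists x0, [/\ ball y e x0, bary v1 i x0 = 0 &
    \forall x \near x0, (0 < bary v1 i x -> open_simplex v1 x) /\
                        (bary v1 i x < 0 -> open_simplex v2 x)].
Proof.
move=> U1 U2 F1 F2 I2T y e Fy e0.
have F12 : hull v1 [set j | j != i] = hull v2 I2 by rewrite -F1.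
have [i2 nI2] : exists i2, ~ I2 i2.
  by apply: contrapT => /forallNP H; move/eqP: I2T; apply; apply/seteqP; split => // j _; apply: contrapT; exact: H.
have Fv1 j : j != i -> hull v1 [set j | j != i] (v1 j).
  rewrite (hull_bary U1) => ji; split => [k|k /= /negP]; rewrite (bary_vtx U1)// negbK => /eqP ->.
  by rewrite eq_sym (negbTE ji).
(* A coordinate missing from [I2] vanishes on the facet, hence at every vertex [v1 j] with [j != i];
   being affine, it is a multiple of [bary v1 i]. *)
have H2 a : ~ I2 a -> forall x, bary v2 a x = bary v1 i x * bary v2 a (v1 i).
  move=> na x; rewrite (bary_affine_comb v2 U1) (bigD1 i)//= big1 ?addr0// => j ji.
  by have := Fv1 j ji; rewrite F12 (hull_bary U2) => -[_ /(_ a na) ->]; rewrite mulr0.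
set c := bary v2 i2 (v1 i).
have c0 : c != 0.
  apply/eqP => c0; have := H2 _ nI2 (v2 i2).
  by rewrite -/c c0 mulr0 (bary_vtx U2) eqxx => /eqP; rewrite oner_eq0.
(* The facet is opposite to a single vertex of the second simplex: two missing coordinates would be
   proportional, while each takes the value 1 at its own vertex, where the other vanishes. *)
have I2E a : ~ I2 a -> a = i2.
  move=> na; apply: contrapT => /eqP ai2.
  have h1 := H2 _ na (v2 i2); have h2 := H2 _ nI2 (v2 i2).
  move: h1 h2; rewrite !(bary_vtx U2) eqxx (negbTE ai2) => /esym/eqP.
  rewrite mulf_eq0 => /orP[/eqP -> /eqP|/eqP ca0 _]; first by rewrite mul0r oner_eq0.
  by have := H2 _ na (v2 a); rewrite ca0 mulr0 (bary_vtx U2) eqxx => /eqP; rewrite oner_eq0.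
have in_F1 x : (forall j, 0 <= bary v1 j x) -> bary v1 i x = 0 -> hull v1 [set j | j != i] x.
  by move=> h0 hi; rewrite (hull_bary U1); split => // j /= /negP; rewrite negbK => /eqP ->.
have in_F2 x : (forall j, 0 <= bary v2 j x) -> bary v2 i2 x = 0 -> hull v1 [set j | j != i] x.
  by move=> h0 hi; rewrite F12 (hull_bary U2); split => // j /I2E ->.
have F_1 x : hull v1 [set j | j != i] x -> (forall j, 0 <= bary v1 j x) /\ bary v1 i x = 0.
  by rewrite (hull_bary U1) => -[h0 h]; split => //; apply: h => /=; rewrite eqxx.
have F_2 x : hull v1 [set j | j != i] x -> (forall j, 0 <= bary v2 j x) /\ bary v2 i2 x = 0.
  by rewrite F12 (hull_bary U2) => -[h0 h]; split => //; apply: h.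
pose c1 := facet_center v1 i; pose c2 := facet_center v2 i2.
have Fc1 : hull v1 [set j | j != i] c1.
  by apply: in_F1; [exact: facet_center_ge0|rewrite bary_facet_center// eqxx].
have Fc2 : hull v1 [set j | j != i] c2.
  by apply: in_F2; [exact: facet_center_ge0|rewrite bary_facet_center// eqxx].
(* Each centre is in the relative interior of the facet for one of the simplices only; their
   midpoint is so for both. *)
pose xs := (1 - 2^-1) *: c1 + 2^-1 *: c2.
have xs1 j : j != i -> 0 < bary v1 j xs.
  move=> ji; rewrite (bary_combination U1); have := facet_center_gt0 U1 ji.
  by have := (F_1 _ Fc2).1 j; rewrite -/c1; lra.
have xs1i : bary v1 i xs = 0 by rewrite (bary_combination U1) (F_1 _ Fc1).2 (F_1 _ Fc2).2 !mulr0 addr0.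
have xs2 j : j != i2 -> 0 < bary v2 j xs.
  move=> ji; rewrite (bary_combination U2); have := facet_center_gt0 U2 ji.
  by have := (F_2 _ Fc1).1 j; rewrite -/c2; lra.
(* If [c] were positive, a small step from [xs] towards [v1 i] would stay in both simplices and
   leave the facet, which is their whole intersection. *)
have cneg : c < 0.
  rewrite lt_neqAle c0/= leNgt; apply/negP => cpos.
  pose z r := (1 - r) *: xs + r *: v1 i.
  have z1i r : bary v1 i (z r) = r.
    by rewrite (bary_combination U1) xs1i (bary_vtx U1) eqxx mulr0 add0r mulr1.
  have [r /= r0 Hr] : \forall r \near (0 : R), forall j, j != i2 -> 0 < bary v2 j (z r).
    apply: (@filter_forall _ _ (fun j (r : R) => j != i2 -> 0 < bary v2 j (z r)) (nbhs (0 : R))) => j.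
    have [ji|ji] := boolP (j != i2); last by apply: nearW => t h.
    have cv : ((1 - r) * bary v2 j xs + r * bary v2 j (v1 i)) @[r --> (0 : R)] -->
        (1 - 0) * bary v2 j xs + 0 * bary v2 j (v1 i).
      have c1r : (1 - r) @[r --> (0 : R)] --> (1 - 0 : R) by apply: cvgB; [exact: cvg_cst|exact: cvg_id].
      exact: (cvgD (cvgMl c1r) (cvgMl (@cvg_id _ (nbhs (0 : R))))).
    rewrite subr0 mul1r mul0r addr0 in cv.
    by apply: filterS (cvgr_gt _ cv _ (xs2 j ji)) => r h _; rewrite /z (bary_combination U2).
  pose t := Num.min r 1 / 2.
  have m1 : Num.min r 1 <= r by rewrite ge_min lexx.
  have m2 : Num.min r 1 <= 1 by rewrite ge_min lexx orbT.
  have m0 : 0 < Num.min r 1 by rewrite lt_min r0 ltr01.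
  have t0 : 0 < t by rewrite /t; lra.
  have t1 : t < 1 by rewrite /t; lra.
  have tr : t < r by rewrite /t; lra.
  have z2 : forall j, 0 <= bary v2 j (z t).
    move=> j; have [->|ji] := eqVneq j i2.
      by rewrite H2// z1i -/c mulr_ge0 ?ltW.
    by apply/ltW/Hr => //; rewrite /ball/= sub0r normrN gtr0_norm.
  have z1 : forall j, 0 <= bary v1 j (z t).
    move=> j; have [->|ji] := eqVneq j i; first by rewrite z1i ltW.
    rewrite (bary_combination U1) (bary_vtx U1) (negbTE ji) mulr0 addr0 mulr_ge0 ?subr_ge0 ?ltW//.
    exact: xs1.
  have : (hull v1 setT `&` hull v2 setT) (z t).
    by rewrite (hull_bary U1) (hull_bary U2); split; split => // j [].
  by rewrite F1 => /F_1[_]; rewrite z1i; move: t0; lra.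
(* A fraction in []0, 1[] with [s |y - xs| < e]: moving [y] this far towards [xs] stays in the ball
   and reaches the relative interior of the facet. *)
pose s := e / (e + `|y - xs| + 1).
have D0 : 0 < e + `|y - xs| + 1 by have := normr_ge0 (y - xs); lra.
have s0 : 0 < s by rewrite divr_gt0.
have s1 : s < 1 by rewrite ltr_pdivrMr// mul1r; have := normr_ge0 (y - xs); lra.
pose x0 := (1 - s) *: y + s *: xs.
have [y1 y1i] := F_1 _ Fy; have [y2 y2i] := F_2 _ Fy.
exists x0; split.
- rewrite -ball_normE/= (_ : y - x0 = s *: (y - xs)); last first.
    by apply/colP => k; rewrite !mxE; ring.
  rewrite normrZ gtr0_norm// /s mulrAC ltr_pdivrMr// ltr_pM2l//.
  by lra.
- by rewrite (bary_combination U1) y1i xs1i !mulr0 addr0.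
have x01 j : j != i -> 0 < bary v1 j x0.
  move=> ji; rewrite (bary_combination U1) ltr_wpDl//; first by rewrite mulr_ge0// subr_ge0 ltW.
  by rewrite mulr_gt0// xs1.
have x02 j : j != i2 -> 0 < bary v2 j x0.
  move=> ji; rewrite (bary_combination U2) ltr_wpDl//; first by rewrite mulr_ge0// subr_ge0 ltW.
  by rewrite mulr_gt0// xs2.
have N1 : \forall x \near x0, forall j, j != i -> 0 < bary v1 j x.
  apply: (@filter_forall _ _ (fun j (x : 'cV[R]_d) => j != i -> 0 < bary v1 j x) (nbhs x0)) => j.
  have [ji|ji] := boolP (j != i); last by apply: nearW => t h.
  by apply: filterS (cvgr_gt _ (@bary_continuous _ _ v1 j x0) _ (x01 j ji)) => x h _.
have N2 : \forall x \near x0, forall j, j != i2 -> 0 < bary v2 j x.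
  apply: (@filter_forall _ _ (fun j (x : 'cV[R]_d) => j != i2 -> 0 < bary v2 j x) (nbhs x0)) => j.
  have [ji|ji] := boolP (j != i2); last by apply: nearW => t h.
  by apply: filterS (cvgr_gt _ (@bary_continuous _ _ v2 j x0) _ (x02 j ji)) => x h _.
apply: filterS2 N1 N2 => x h1 h2; split => hx j.
  by have [->//|ji] := eqVneq j i; exact: h1.
have [->|ji] := eqVneq j i2; last exact: h2.
by rewrite H2// -/c nmulr_lgt0.
Qed.

End facet_neighbourhood.

(** * Polynomials and piecewise polynomial functions on a mesh *)

Section polynomials.
Context {R : realType} {d p : nat}.
Implicit Types (g : 'cV[R]_d -> R).

Definition monomial (a : 'I_d -> nat) (x : 'cV[R]_d) : R := \prod_i x i 0 ^+ a i.

Lemma polynomial_fun_monomial (a : 'I_d -> nat) : (\sum_i a i <= p)%N ->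
  polynomial_fun p (monomial a).
Proof.
move=> ap.
have ai i : (a i < p.+1)%N by rewrite ltnS (leq_trans _ ap)// (bigD1 i)//= leq_addr.
pose a' : {ffun 'I_d -> 'I_p.+1} := [ffun i => Ordinal (ai i)].
exists (fun b => (b == a')%:R) => x.
rewrite (bigD1 a')/=; last by under eq_bigr do rewrite ffunE.
rewrite eqxx mul1r [X in _ + X]big1 ?addr0; last by move=> b /andP[_ /negbTE ->]; rewrite mul0r.
by apply: eq_bigr => i _; rewrite ffunE.
Qed.

Lemma polynomial_funD g h : polynomial_fun p g -> polynomial_fun p h ->
  polynomial_fun p (fun x => g x + h x).
Proof.
move=> [c cE] [c' cE']; exists (fun a => c a + c' a) => x; rewrite cE cE' -big_split/=.
by apply: eq_bigr => a _; rewrite mulrDl.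
Qed.

Lemma polynomial_funZ (k : R) g : polynomial_fun p g -> polynomial_fun p (fun x => k * g x).
Proof.
move=> [c cE]; exists (fun a => k * c a) => x; rewrite cE mulr_sumr.
by apply: eq_bigr => a _; rewrite mulrA.
Qed.

Lemma polynomial_fun0 : polynomial_fun p (fun _ : 'cV[R]_d => 0).
Proof. by exists (fun=> 0) => x; rewrite big1// => a _; rewrite mul0r. Qed.

Lemma polynomial_fun_cst (k : R) : polynomial_fun p (fun _ : 'cV[R]_d => k).
Proof.
have := polynomial_funZ k (@polynomial_fun_monomial (fun=> 0%N) _).
rewrite (_ : (fun x => k * _) = fun=> k); first by apply; rewrite big1.
by apply/funext => x; rewrite /monomial big1 ?mulr1// => i _; rewrite expr0.
Qed.

Lemma differentiable_prod (I : Type) (s : seq I) (F : I -> 'cV[R]_d -> R) x :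
  (forall i, differentiable (F i) x) -> differentiable (fun x => \prod_(i <- s) F i x) x.
Proof.
move=> dF; elim: s => [|i s IH].
  by rewrite (_ : (fun _ => _) = cst 1)//; apply/funext => y; rewrite big_nil.
rewrite (_ : (fun _ => _) = fun y => F i y * \prod_(j <- s) F j y).
  exact: (differentiableM (dF i) IH).
by apply/funext => y; rewrite big_cons.
Qed.

Lemma differentiable_sum_seq (I : Type) (s : seq I) (P : pred I) (F : I -> 'cV[R]_d -> R) x :
  (forall i, differentiable (F i) x) -> differentiable (fun x => \sum_(i <- s | P i) F i x) x.
Proof.
move=> dF; elim: s => [|i s IH].
  by rewrite (_ : (fun _ => _) = cst 0)//; apply/funext => y; rewrite big_nil.
case Pi : (P i).
  rewrite (_ : (fun _ => _) = fun y => F i y + \sum_(j <- s | P j) F j y).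
    exact: (differentiableD (dF i) IH).
  by apply/funext => y; rewrite big_cons Pi.
by rewrite (_ : (fun _ => _) = fun y => \sum_(j <- s | P j) F j y)//; apply/funext => y; rewrite big_cons Pi.
Qed.

Lemma monomial_differentiable a x : differentiable (monomial a) x.
Proof.
apply: differentiable_prod => i.
apply: (@differentiable_comp _ _ _ _ (fun x : 'cV[R]_d => x i 0) (fun y : R => y ^+ a i)).
  exact: differentiable_coord.
by apply/derivable1_diffP; exact: exprn_derivable.
Qed.

Lemma polynomial_fun_differentiable g x : polynomial_fun p g -> differentiable g x.
Proof.
move=> [c cE]; rewrite (_ : g = fun x => \sum_(a : {ffun 'I_d -> 'I_p.+1} | (\sum_i a i <= p)%N) c a * monomial (fun i => a i : nat) x); last first.
  by apply/funext.
apply: differentiable_sum_seq => a.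
exact: (differentiableZ (c a) (monomial_differentiable (fun i => a i : nat) x)).
Qed.

(** If [a j = 0] the subtraction in the exponent is truncated, but then the coefficient [a j]
    vanishes. *)
Lemma partial_monomial a j x :
  partial j (monomial a) x = (a j)%:R * monomial (fun i => a i - (i == j))%N x.
Proof.
rewrite /partial -[x in LHS]addr0 -(scale0r (basis_vec j)).
set K := \prod_(i | i != j) x i 0 ^+ a i.
have H : is_derive (0 : R) 1 (fun h : R => monomial a (x + h *: basis_vec j)) (K * ((a j)%:R * x j 0 ^+ (a j).-1)).
  rewrite (_ : (fun h : R => _) = (fun h : R => K *: ('X^(a j)).[x j 0 + h])); last first.
    apply/funext => h; rewrite /monomial (bigD1 j)//= !mxE eqxx mulr1 hornerXn mulrC.
    congr (_ * _); apply: eq_bigr => i /negbTE ij; by rewrite !mxE ij mulr0 addr0.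
  have dl : is_derive (0 : R) 1 (fun h : R => x j 0 + h) 1.
    by have := is_deriveD (is_derive_cst (x j 0) (0 : R) 1) (is_derive_id (0 : R) 1); rewrite add0r.
  have dX := @is_derive1_comp R (horner 'X^(a j)) (fun h => x j 0 + h) 0 _ _ (is_derive_poly _ _) dl.
  apply: (is_derive_eq (is_deriveZ K dX)).
  by rewrite derivXn hornerMn hornerXn addr0 mulr1 -mulr_natl.
have [_ ->] := (is_derive_line (monomial a) x (basis_vec j) 0 _).2 H.
rewrite mulrCA; congr (_ * _); rewrite /monomial [RHS](bigD1 j)//= eqxx subn1 mulrC; congr (_ * _).
by apply: eq_bigr => i /negbTE ->; rewrite subn0.
Qed.

Lemma polynomial_fun_partial j g : polynomial_fun p g -> polynomial_fun p (partial j g).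
Proof.
move=> [c cE].
rewrite (_ : partial j g = fun x => \sum_(a : {ffun 'I_d -> 'I_p.+1} | (\sum_i a i <= p)%N)
   c a * ((a j)%:R * monomial (fun i => a i - (i == j))%N x)).
  elim: (index_enum _) => [|a s IH].
    by rewrite (_ : (fun _ => _) = fun=> 0); [exact: polynomial_fun0|apply/funext => x; rewrite big_nil].
  case Pa : (\sum_i a i <= p)%N; last first.
    by rewrite (_ : (fun _ => _) = fun x => \sum_(a <- s | (\sum_i a i <= p)%N)
      c a * ((a j)%:R * monomial (fun i => a i - (i == j))%N x))//; apply/funext => x; rewrite big_cons Pa.
  rewrite (_ : (fun _ => _) = fun x => c a * ((a j)%:R * monomial (fun i => a i - (i == j))%N x) +
      \sum_(a <- s | (\sum_i a i <= p)%N) c a * ((a j)%:R * monomial (fun i => a i - (i == j))%N x)).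
    apply: polynomial_funD => //; do 2!apply: polynomial_funZ; apply: polynomial_fun_monomial.
    by apply: leq_trans Pa; apply: leq_sum => i _; exact: leq_subr.
  by apply/funext => x; rewrite big_cons Pa.
apply/funext => x.
rewrite /partial (_ : g = fun x => \sum_(a : {ffun 'I_d -> 'I_p.+1} | (\sum_i a i <= p)%N) c a * monomial (fun i => a i : nat) x); last first.
  by apply/funext.
elim: (index_enum _) => [|a s IH].
  by rewrite big_nil (_ : (fun _ => _) = cst 0) ?derive_cst//; apply/funext => y; rewrite big_nil.
rewrite big_cons; case Pa : (\sum_i a i <= p)%N; last first.
  by rewrite -IH; congr ('D_ _ _ x); apply/funext => y; rewrite big_cons Pa.
rewrite (_ : (fun _ => _) = fun x => c a * monomial (fun i => a i : nat) x + \sum_(a <- s | (\sum_i a i <= p)%N) c a * monomial (fun i => a i : nat) x); last first.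
  by apply/funext => y; rewrite big_cons Pa.
have d1 : differentiable (fun x => c a * monomial (fun i => a i : nat) x) x.
  exact: (differentiableZ (c a) (monomial_differentiable (fun i => a i : nat) x)).
rewrite deriveD; [|exact: diff_derivable|apply: diff_derivable; apply: differentiable_sum_seq => b; exact: (differentiableZ (c b) (monomial_differentiable (fun i => b i : nat) x))].
rewrite IH; congr (_ + _).
have dm := @diff_derivable _ _ _ _ _ (basis_vec j) (monomial_differentiable (fun i => a i : nat) x).
rewrite (deriveZ (c a) dm).
by rewrite -/(partial j _ x) partial_monomial.
Qed.

Lemma polynomial_fun_continuous g : polynomial_fun p g -> continuous g.
Proof. by move=> pg x; apply: differentiable_continuous; exact: polynomial_fun_differentiable. Qed.

End polynomials.

Lemma bounded_closure (R : realType) n (D : set 'cV[R]_n) :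
  bounded_set D -> bounded_set (closure D).
Proof.
move=> [C [Cr HC]]; exists C; split => // M CM.
apply: closure_subset_closed => [|x Ox]; last exact: HC.
apply: (@preimage_closed _ _ (fun x : 'cV[R]_n => `|x|) (fun y => y <= M)); last exact: closed_le.
by move=> x _; exact: norm_continuous.
Qed.

Section meshes_lemmas.
Context {R : realType} {d : nat}.
Variables (Omega : set 'cV[R]_d) (M : mesh R d).
Hypotheses (d0 : (0 < d)%N) (cm : conforming_mesh_of M Omega).
Hypotheses (oO : open Omega) (bO : bounded_set Omega).
Let mO : measurable Omega := open_measurable_mx oO.
Let muO : (leb d Omega < +oo)%E := leb_bounded mO bO.

Lemma mesh_unitmx (k : 'I_(nelt M)) : edge_mx (vtx k) \in unitmx.
Proof. by case: cm => H _ _; exact: H. Qed.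

Lemma Omega_elt x : Omega x -> exists k : 'I_(nelt M), elt k x.
Proof.
move=> Ox; case: cm => _ H _; have : closure Omega x by exact: subset_closure.
by rewrite H => -[k _ kx]; exists k.
Qed.

Lemma elt_norm_bounded (k : 'I_(nelt M)) x : elt k x -> `|x| <= \sum_i `|vtx k i|.
Proof.
move=> [t [t0 _ t1 ->]]; apply: le_trans (ler_norm_sum _ _ _) _.
apply: ler_sum => i _; rewrite normrZ ger0_norm// ler_piMl//.
by rewrite -t1 (bigD1 i)//= lerDl sumr_ge0.
Qed.

Lemma vtx_elt (k : 'I_(nelt M)) i : elt k (vtx k i).
Proof.
rewrite /elt (hull_bary (mesh_unitmx k)); split => [j|j /(_ I)//].
by rewrite (bary_vtx (mesh_unitmx k)).
Qed.

Lemma enorm_le_diam (k : 'I_(nelt M)) x y : elt k x -> elt k y -> enorm (x - y) <= diam k.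
Proof.
move=> kx ky; apply: ub_le_sup; last by exists x, y.
exists (Num.sqrt (d * 1)%:R * (\sum_i `|vtx k i| + \sum_i `|vtx k i|)).
move=> _ [a [b [ka kb ->]]]; apply: le_trans (enorm_le_mx_norm _) _.
rewrite ler_wpM2l ?sqrtr_ge0// (le_trans (ler_normB _ _))//.
by rewrite lerD// elt_norm_bounded.
Qed.

Lemma norm_le_mesh_size (k : 'I_(nelt M)) x y : elt k x -> elt k y -> `|x - y| <= mesh_size M.
Proof.
move=> kx ky; apply: le_trans (mx_norm_le_enorm _) _; apply: le_trans (enorm_le_diam kx ky) _.
exact: (@le_bigmax _ _ _ 0 (fun k : 'I_(nelt M) => diam k) k).
Qed.

Lemma diam_ge0 (k : 'I_(nelt M)) : 0 <= diam k.
Proof.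
apply: le_trans (enorm_le_diam (vtx_elt k ord0) (vtx_elt k ord0)).
exact: enorm_ge0.
Qed.

Lemma measurable_elt (k : 'I_(nelt M)) : measurable (elt k).
Proof.
rewrite -[elt k]setCK; apply: measurableC; apply: open_measurable_mx.
apply: closed_openC; exact: hull_closed (mesh_unitmx k).
Qed.

(** Two distinct elements meet in a proper face, on which some barycentric coordinate vanishes; an
    interior point thus belongs to one element only, and the choice made by [broken_fun] is
    forced. *)
Lemma broken_fun_open (V : nmodType) (v : broken M V) (k : 'I_(nelt M)) x :
  open_simplex (vtx k) x -> broken_fun v x = v k x.
Proof.
move=> kx; have ek : elt k x by exact: (open_simplex_hull (mesh_unitmx k)).
rewrite /broken_fun; case: pickP => [k' /asboolP k'x|/(_ k)/asboolP//].
have [-> //|kk'] := eqVneq k' k.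
case: cm => _ _ /(_ _ _ kk') [I1 [I2 [_ I2T _ E]]].
have : (elt k' `&` elt k) x by [].
rewrite E (hull_bary (mesh_unitmx k)) => -[_ h].
have [i ni] : exists i, ~ I2 i.
  by apply: contrapT => /forallNP H; move/eqP: I2T; apply; apply/seteqP; split => // j _; apply: contrapT; exact: H.
by have := kx i; rewrite h// ltxx.
Qed.

Lemma broken_fun_elt (V : nmodType) (v : broken M V) x : Omega x ->
  exists2 k, elt k x & broken_fun v x = v k x.
Proof.
move=> /Omega_elt[k0 k0x]; rewrite /broken_fun.
by case: pickP => [k /asboolP kx|/(_ k0)/asboolP//]; exists k.
Qed.

Lemma ae_open_simplex : {ae leb d, forall x, Omega x -> exists k : 'I_(nelt M), open_simplex (vtx k) x}.
Proof.
apply: (@negligibleS _ _ _ _ (\bigcup_(j : nat)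
   (if insub j is Some k then elt (k : 'I_(nelt M)) `\` open_simplex (vtx k) else set0))).
  move=> x /= /not_implyP[/Omega_elt[k kx] /forallNP nx].
  exists k => //; case: insubP => [k' _ /val_inj ->|]; first by split => //; exact: nx.
  by rewrite ltn_ord.
apply: negligible_bigcup => j; case: insubP => [k _ _|_]; last exact: negligible_set0.
exact: hull_boundary_null (mesh_unitmx k) d0.
Qed.

Lemma broken_funB (V : zmodType) (v w : broken M V) x :
  broken_fun (fun k x => v k x - w k x) x = broken_fun v x - broken_fun w x.
Proof. by rewrite /broken_fun; case: pickP => // _; rewrite subrr. Qed.

Lemma broken_fun_coord m n (v : broken M 'M[R]_(m, n)) i j x :
  broken_fun v x i j = broken_fun (fun k x => v k x i j) x.
Proof. by rewrite /broken_fun; case: pickP => // _; rewrite mxE. Qed.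

(** The space is cut into finitely many cells according to the set of elements that contain a point;
    on each cell the element picked by [broken_fun] is constant. *)
Lemma broken_fun_measurable (v : broken M R) : (forall k, measurable_fun setT (v k)) ->
  measurable_fun setT (broken_fun v).
Proof.
move=> mv _ Y mY; rewrite setTI.
pose S (A : {set 'I_(nelt M)}) : set 'cV[R]_d := \bigcap_(k : 'I_(nelt M))
  (if k \in A then elt k else ~` elt k).
have mS A : measurable (S A).
  rewrite /S -[X in measurable X]setCK setC_bigcap; apply: measurableC.
  apply: countable_bigcupT_measurable; first exact: countableP.
  move=> k; apply: measurableC; case: ifP => _; first exact: measurable_elt.
  by apply: measurableC; exact: measurable_elt.
pose g (A : {set 'I_(nelt M)}) x : R := if [pick k in A] is Some k then v k x else 0.
have gS A x : S A x -> broken_fun v x = g A x.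
  move=> Sx; rewrite /broken_fun /g (_ : [pick k | `[< elt k x >]] = [pick k in A])//.
  apply: eq_pick => k; have := Sx k I; case: ifP => kA h; first by apply/asboolP.
  by apply/asboolP.
rewrite (_ : _ @^-1` Y = \bigcup_A (S A `&` (g A @^-1` Y))).
  apply: countable_bigcupT_measurable; first exact: countableP.
  move=> A; apply: measurableI => //; rewrite /g.
  case: pickP => [k _|_]; first by have := mv k measurableT Y mY; rewrite setTI.
  by rewrite -[X in measurable X]setTI; exact: (@measurable_cst _ _ _ _ setT (0 : R)).
apply/seteqP; split => [x /= Yx|x [A _ [SAx /= gY]]].
  pose A := [set k : 'I_(nelt M) | `[< elt k x >]]%SET.
  have SAx : S A x by move=> k _; case: ifP; rewrite inE => /asboolP.
  by exists A => //; split => //=; rewrite -gS.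
by rewrite /= (gS A).
Qed.

Lemma continuous_bounded_on (f : 'cV[R]_d -> R) : continuous f ->
  exists C, forall x, Omega x -> `|f x| <= C.
Proof.
move=> cf.
have cO : compact (closure Omega).
  by apply: bounded_closed_compact_cV; [exact: bounded_closure|exact: closed_closure].
have [C [_ HC]] := compact_bounded (continuous_compact (continuous_subspaceT cf) cO).
exists (`|C| + 1) => x Ox; apply: HC; first by rewrite (le_lt_trans (ler_norm _))// ltrDl.
by exists x => //; exact: subset_closure.
Qed.

Lemma broken_fun_bounded (v : broken M R) : (forall k, continuous (v k)) ->
  exists C, forall x, Omega x -> `|broken_fun v x| <= C.
Proof.
move=> cv; have [C HC] := choice (fun k => continuous_bounded_on (cv k)).
exists (\sum_k `|C k|) => x Ox; have [k _ ->] := broken_fun_elt v Ox.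
apply: le_trans (HC k x Ox) _; rewrite (bigD1 k)//= (le_trans (ler_norm _))// lerDl.
exact: sumr_ge0.
Qed.

Lemma broken_fun_measurableO (v : broken M R) : (forall k, continuous (v k)) ->
  measurable_fun Omega (broken_fun v).
Proof.
move=> cv; apply: measurable_funTS; apply: broken_fun_measurable => k.
exact: continuous_measurable_mx.
Qed.

Lemma Sp_continuous p (v : broken M R) : Sp p v -> forall k, continuous (v k).
Proof. by move=> pv k; exact: polynomial_fun_continuous (pv k). Qed.

Lemma broken_fun_sqint (v : broken M R) : (forall k, continuous (v k)) ->
  sqint (leb d) Omega (broken_fun v).
Proof.
move=> cv; have [C HC] := broken_fun_bounded cv.
by apply: (sqint_bounded mO muO _ HC); exact: broken_fun_measurableO.
Qed.

End meshes_lemmas.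

Lemma derive_partial (R : realType) n (g : 'cV[R]_n -> R) x v : differentiable g x ->
  'D_v g x = \sum_j v j 0 * partial j g x.
Proof.
move=> dg; rewrite deriveE//.
have -> : v = \sum_j v j 0 *: basis_vec j.
  apply/colP => i; rewrite summxE (bigD1 i)//= big1 => [|j ji].
    by rewrite addr0 mxE coord_basis_vec eqxx mulr1.
  by rewrite mxE coord_basis_vec eq_sym (negbTE ji) mulr0.
rewrite linear_sum/=; apply: eq_bigr => j _.
rewrite linearZ/= /partial deriveE//; congr (_ * _).
by rewrite summxE (bigD1 j)//= big1 => [|k kj]; rewrite ?addr0 mxE coord_basis_vec ?eqxx ?mulr1// eq_sym (negbTE kj) mulr0.
Qed.

Lemma lipschitz_partial (R : realType) n (g : 'cV[R]_n -> R) (C : R) : (forall x, differentiable g x) ->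
  (forall j x, `|partial j g x| <= C) ->
  forall x y, `|g x - g y| <= n%:R * C * `|x - y|.
Proof.
move=> dg gC x y.
pose G (t : R) := g (y + t *: (x - y)).
have dG (t : R) : is_derive t 1 G ('D_(x - y) g (y + t *: (x - y))).
  by apply: derive_line; exact: diff_derivable.
have cG : {within `[0, 1], continuous G}.
  apply: continuous_subspaceT => s; apply: differentiable_continuous.
  by apply/derivable1_diffP; have [] := dG s.
have [c _] := @MVT R G _ 0 1 ltr01 (fun t _ => dG t) cG.
rewrite subr0 mulr1 /G scale1r scale0r addr0 (addrC y) subrK => ->.
rewrite derive_partial// (le_trans (ler_norm_sum _ _ _))//.
apply: (@le_trans _ _ (\sum_(j < n) C * `|x - y|)).
  apply: ler_sum => j _; rewrite normrM mulrC ler_pM//.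
  exact: ler_coord_mx_norm.
by rewrite sumr_const card_ord -[leLHS]mulr_natl mulrA.
Qed.

Import HBSimple HBNNSimple.

(** * Density of broken polynomials *)

Section density.
Context {R : realType} {d : nat}.
Variables (Omega : set 'cV[R]_d) (p : nat) (S : nat -> mesh R d).
Hypotheses (d0 : (0 < d)%N) (cS : forall m, conforming_mesh_of (S m) Omega).
Hypotheses (oO : open Omega) (bO : bounded_set Omega).
Hypothesis h0 : (fun m => mesh_size (S m)) @ \oo --> (0 : R).
Let mO : measurable Omega := open_measurable_mx oO.
Let muO : (leb d Omega < +oo)%E := leb_bounded mO bO.
Notation sqint := (sqint (leb d) Omega).
Notation dist2 f g := (\int[leb d]_(x in Omega) (f x - g x) ^+ 2).

(** Approximation on all sufficiently fine meshes, not merely on some, so that the property is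
    stable under sums and limits. *)
Definition approximable (f : 'cV[R]_d -> R) := forall e : R, 0 < e ->
  \forall m \near \oo, exists2 F : broken (S m) R, Sp p F & dist2 (broken_fun F) f <= e.

Lemma Sp_sqint m (F : broken (S m) R) : Sp p F -> sqint (broken_fun F).
Proof. by move=> pF; apply: (broken_fun_sqint (cS m) oO bO); exact: Sp_continuous pF. Qed.

Lemma dist2_triangle f g h : sqint f -> sqint g -> sqint h ->
  dist2 f h <= 2 * dist2 f g + 2 * dist2 g h.
Proof.
move=> fi gi hi; have i1 := (sqintB mO fi gi).2; have i2 := (sqintB mO gi hi).2.
rewrite -!RintegralZl// -RintegralD//; [|exact: intgZ|exact: intgZ].
apply: le_Rintegral => //; [exact: (sqintB mO fi hi).2|by apply: intgD => //; exact: intgZ|].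
by move=> x _; have := sqr_ge0 ((f x - g x) - (g x - h x)); nra.
Qed.

Lemma approximable_closed (f_ : nat -> 'cV[R]_d -> R) f : (forall n, sqint (f_ n)) -> sqint f ->
  (forall n, approximable (f_ n)) -> cvg_sq (leb d) Omega f_ f -> approximable f.
Proof.
move=> fi_ fi af_ ff e e0.
have e4 : 0 < e / 4 by rewrite divr_gt0.
have [N _ HN] := cvgr_lt _ ff _ e4.
have := af_ N _ e4; apply: filterS => m [F pF Ff]; exists F => //.
apply: le_trans (dist2_triangle (Sp_sqint pF) (fi_ N) fi) _.
have := HN N (leqnn N) => /= h; lra.
Qed.

Lemma approximableD f g : sqint f -> sqint g -> approximable f -> approximable g ->
  approximable (fun x => f x + g x).
Proof.
move=> fi gi af ag e e0.
have e4 : 0 < e / 4 by rewrite divr_gt0.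
apply: filterS2 (af _ e4) (ag _ e4) => m [F pF Ff] [G pG Gg].
exists (fun k x => F k x + G k x); first by move=> k; exact: polynomial_funD.
have E x : broken_fun (fun k x => F k x + G k x) x = broken_fun F x + broken_fun G x.
  by rewrite /broken_fun; case: pickP => // _; rewrite addr0.
have i1 := (sqintB mO (Sp_sqint pF) fi).2; have i2 := (sqintB mO (Sp_sqint pG) gi).2.
apply: (@le_trans _ _ (2 * dist2 (broken_fun F) f + 2 * dist2 (broken_fun G) g)); last by lra.
rewrite -!RintegralZl// -RintegralD//; [|exact: intgZ|exact: intgZ].
under eq_Rintegral do rewrite E.
apply: le_Rintegral => //.
- exact: (sqintB mO (sqintD mO (Sp_sqint pF) (Sp_sqint pG)) (sqintD mO fi gi)).2.
- by apply: intgD => //; exact: intgZ.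
- by move=> x _; have := sqr_ge0 ((broken_fun F x - f x) - (broken_fun G x - g x)); nra.
Qed.

Lemma approximableZ (c : R) f : sqint f -> approximable f -> approximable (fun x => c * f x).
Proof.
move=> fi af e e0.
have c0 : 0 < c ^+ 2 + 1 by rewrite ltr_wpDl ?sqr_ge0.
apply: filterS (af _ (divr_gt0 e0 c0)) => m [F pF Ff].
exists (fun k x => c * F k x); first by move=> k; exact: polynomial_funZ.
have E x : broken_fun (fun k x => c * F k x) x = c * broken_fun F x.
  by rewrite /broken_fun; case: pickP => // _; rewrite mulr0.
rewrite (_ : \int[leb d]_(x in Omega) _ = c ^+ 2 * dist2 (broken_fun F) f).
  rewrite ler_pdivlMr// in Ff; apply: le_trans Ff; rewrite mulrC ler_wpM2l ?lerDl//.
  by apply: Rintegral_ge0 => x _; exact: sqr_ge0.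
rewrite -RintegralZl//; last exact: (sqintB mO (Sp_sqint pF) fi).2.
by apply: eq_Rintegral => x _; rewrite E; ring.
Qed.

(** The value at one vertex of each element gives an error at most [|C|] times the mesh size.
    Constants suffice, so the degree [p] is arbitrary. *)
Lemma approximable_lipschitz f (C : R) : continuous f ->
  (forall x y, `|f x - f y| <= C * `|x - y|) -> approximable f.
Proof.
move=> cf fC e e0.
have fi : sqint f.
  have [K HK] := continuous_bounded_on bO cf.
  by apply: (sqint_bounded mO muO _ HK); apply: measurable_funTS; exact: continuous_measurable_mx.
have cv : (`|C| * mesh_size (S m)) ^+ 2 * fine (leb d Omega) @[m --> \oo] --> (0 : R).
  rewrite -[X in _ --> X](mul0r (fine (leb d Omega))); apply: cvgMl.
  rewrite -[X in _ --> X](mulr0 0).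
  have h : `|C| * mesh_size (S m) @[m --> \oo] --> (0 : R).
    by rewrite -[X in _ --> X](mulr0 `|C|); exact: cvgMr.
  exact: (cvgM h h).
apply: filterS (cvgr_lt _ cv _ e0) => m hm.
pose F : broken (S m) R := fun k _ => f (vtx k ord0).
have pF : Sp p F by move=> k; exact: polynomial_fun_cst.
exists F => //.
apply: le_trans (ltW hm).
apply: le_Rintegral_bound => //; first exact: (sqintB mO (Sp_sqint pF) fi).2.
apply: aeW => x Ox; have [k kx ->] := broken_fun_elt (cS m) F Ox.
rewrite -(real_normK (num_real (_ - _))) lerXn2r ?nnegrE//.
  by rewrite mulr_ge0// (le_trans _ (norm_le_mesh_size kx kx)).
apply: le_trans (fC _ _) _; apply: (@le_trans _ _ (`|C| * `|vtx k ord0 - x|)).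
  by rewrite ler_wpM2r// ler_norm.
by rewrite ler_wpM2l//; exact: (norm_le_mesh_size (vtx_elt (cS m) k ord0) kx).
Qed.

(** The indicator is a bounded pointwise limit of bumps, and these are Lipschitz because their
    partial derivatives are bounded. *)
Lemma approximable_box a b : approximable (\1_(box a b)).
Proof.
have bi n : sqint (bump n a b).
  apply: (sqint_bounded mO muO (M := 1)) => [|x _]; last exact: bump_norm_le1.
  by apply: measurable_funTS; exact: bump_measurable.
have mb : measurable_fun Omega (\1_(box a b) : 'cV[R]_d -> R).
  exact: measurable_indic (measurable_box _ _).
have i1 : sqint (\1_(box a b)).
  by apply: (sqint_bounded mO muO (M := 1) mb) => x _; rewrite indicE; case: (_ \in _); rewrite ?normr1 ?normr0.
apply: (approximable_closed bi i1).
- move=> n; have H (j : 'I_d) : exists C, forall x, `|partial j (bump n a b) x| <= C.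
    by have [C _ HC] := bump_partial_bounded n a b j; exists C.
  have [C HC] := choice H.
  have HC' j x : `|partial j (bump n a b) x| <= \sum_j `|C j|.
    apply: le_trans (HC j x) _; rewrite (bigD1 j)//= (le_trans (ler_norm _))// lerDl.
    exact: sumr_ge0.
  have db x := @smooth_differentiable _ _ _ x (bump_smooth n a b).
  apply: (approximable_lipschitz (C := d%:R * \sum_j `|C j|)).
    by apply: smooth_continuous; exact: bump_smooth.
  exact: lipschitz_partial.
- apply: (cvg_sq_bounded_ae mO muO (M := 1)) => //.
  + by move=> n; case: (bi n).
  + by apply: aeW => x n _; exact: bump_norm_le1.
  + by apply: aeW => x _; exact: cvg_bump.
Qed.

Lemma indic_sqint (E : set 'cV[R]_d) : measurable E -> sqint (\1_E).
Proof.
move=> mE; apply: (sqint_bounded mO muO (M := 1)); first exact: measurable_indic.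
by move=> x _; rewrite indicE; case: (_ \in _); rewrite ?normr1 ?normr0.
Qed.

Lemma approximable_one : approximable (fun=> 1).
Proof.
by apply: (@approximable_lipschitz _ 0) => [|x y]; [exact: cst_continuous|rewrite subrr normr0 mul0r].
Qed.

(** Dynkin induction from the boxes: complements follow by linearity from the constant 1, and
    countable disjoint unions as limits of their partial sums. *)
Lemma approximable_indic (E : set 'cV[R]_d) : measurable E -> approximable (\1_E).
Proof.
have one := approximable_one.
rewrite sigma_algebra_box; move: E; apply: dynkin_induction.
- exact: sigma_algebra_box.
- by move=> _ _ [a1 [b1 ->]] [a2 [b2 ->]]; rewrite boxI; eexists; eexists.
- by rewrite indicT.
- by move=> _ [a [b ->]]; exact: approximable_box.
- move=> E mE aE.
  rewrite (_ : \1_(~` E) = fun x => 1 + (-1) * \1_E x).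
    by apply: approximableD; [exact: sqint_cst|exact/sqintZ/indic_sqint|exact: one|apply: approximableZ => //; exact: indic_sqint].
  by apply/funext => x; rewrite !indicE in_setC; case: (x \in E) => /=; ring.
- move=> F mF tF aF.
  pose G n x : R := \sum_(k < n) \1_(F k) x.
  have Gi n : sqint (G n) by apply: sqint_sum => // k _; exact: indic_sqint.
  have GE n x : G n x = \1_(\big[setU/set0]_(k < n) F k) x.
    rewrite /G; elim: n => [|n IH]; first by rewrite !big_ord0 indicE in_set0.
    rewrite !big_ord_recr/= IH !indicE in_setU.
    have tF' : trivIset (fun i : nat => predT i) F by apply: sub_trivIset tF.
    have := @trivIset_bigsetUI _ predT F tF' n n isT (leqnn n).
    case: (boolP (x \in F n)) => xn; last by rewrite addr0 orbF.
    move/seteqP => [/(_ x) h _]; case: (boolP (x \in _)) => /= [xU|_]; last by rewrite add0r.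
    by case: h; split; [exact: set_mem|exact: set_mem].
  apply: (approximable_closed Gi) => [|n|].
  + by apply: indic_sqint; exact: bigcup_measurable.
  + rewrite /G; elim: n => [|n IH].
      rewrite (_ : (fun x => _) = fun x => 0 * (fun=> 1 : R) x); first by apply: approximableZ => //; exact: sqint_cst.
      by apply/funext => x; rewrite big_ord0 mul0r.
    rewrite (_ : (fun x => _) = fun x => G n x + \1_(F n) x); first by apply: approximableD => //; exact: indic_sqint.
    by apply/funext => x; rewrite big_ord_recr.
  + apply: (cvg_sq_bounded_ae mO muO (M := 1)).
    * by move=> n; case: (Gi n).
    * by apply: measurable_indic; exact: bigcup_measurable.
    * by apply: aeW => x n _; rewrite GE indicE; case: (_ \in _); rewrite ?normr1 ?normr0.
    * apply: aeW => x _; rewrite indicE; case: (boolP (x \in _)) => [/set_mem[k _ Fkx]|/negP nx].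
        apply: cvg_near_cst; exists k.+1 => // n /= kn; rewrite GE indicE mem_set//.
        by rewrite -bigcup_mkord; exists k.
      apply: cvg_near_cst; apply: nearW => n; rewrite GE indicE memNset//.
      by rewrite -bigcup_mkord => -[k _ Fkx]; apply/nx/mem_set; exists k.
Qed.

Lemma approximable_ge0 f : sqint f -> (forall x, 0 <= f x) -> approximable f.
Proof.
move=> [mf fi] f0; have one := approximable_one.
have mEf : measurable_fun Omega (EFin \o f) by exact/measurable_EFinP.
pose a n := nnsfun_approx mO mEf n.
pose g n (x : 'cV[R]_d) : R := a n x.
have gm n : measurable_fun Omega (g n) by apply: measurable_funTS; exact: (measurable_funPT (a n)).
have gf n x : Omega x -> 0 <= g n x <= f x.
  move=> Ox; apply/andP; split; first by [].
  rewrite -lee_fin /g /a nnsfun_approxE.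
  by apply: (@le_approx _ _ _ Omega (EFin \o f)) => // y _; rewrite lee_fin.
have gi n : sqint (g n).
  split => //; apply: (@le_intg _ _ _ _ _ mO _ (fun x => f x ^+ 2)) => //.
    exact: measurable_funX.
  move=> x Ox; have /andP[h1 h2] := gf n x Ox.
  by rewrite ger0_norm ?sqr_ge0// lerXn2r ?nnegrE.
apply: (@approximable_closed (fun n => g n)) => // [n|].
  rewrite (_ : g n = fun x => \sum_(y \in range (g n)) y * \1_(g n @^-1` [set y]) x); last first.
    by apply/funext => x; rewrite /g {1}fimfunE.
  have fr : finite_set (range (g n)) by exact: (fimfunP (a n)).
  rewrite (_ : (fun x => _) = fun x => \sum_(y <- finmap.enum_fset (fset_set (range (g n)))) y * \1_(g n @^-1` [set y]) x); last first.
    by apply/funext => x; rewrite fsbig_finite.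
  suff H (z : seq R) : sqint (fun x => \sum_(y <- z) y * \1_(g n @^-1` [set y]) x) /\
      approximable (fun x => \sum_(y <- z) y * \1_(g n @^-1` [set y]) x) by exact: (H _).2.
  elim: z => [|y s [IH1 IH2]].
    rewrite (_ : (fun x => _) = fun x => 0 * (fun=> 1 : R) x); last by apply/funext => x; rewrite big_nil mul0r.
    have c1 : sqint (fun=> 1) by exact: sqint_cst.
    by split; [exact: sqintZ|exact: approximableZ].
  have mI : measurable (g n @^-1` [set y]) by exact: (measurable_funPTI (a n)).
  rewrite (_ : (fun x => _) = fun x => y * \1_(g n @^-1` [set y]) x + \sum_(y <- s) y * \1_(g n @^-1` [set y]) x); last first.
    by apply/funext => x; rewrite big_cons.
  have ii := indic_sqint mI.
  split; first by apply: sqintD => //; exact: sqintZ.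
  by apply: approximableD => //; [exact: sqintZ|apply: approximableZ => //; exact: approximable_indic].
have mf2 : measurable_fun Omega (fun x => f x ^+ 2) by exact: measurable_funX.
rewrite /cvg_sq (_ : 0 = \int[leb d]_(x in Omega) (fun=> 0) x); last by rewrite Rintegral_cst// mul0r.
apply: (@dominated_Rintegral _ _ _ _ _ mO _ _ (fun x => f x ^+ 2)) => //.
- by move=> n; apply/measurable_funX/measurable_funB.
- apply: aeW => x Ox.
  have : (g n x)%:E @[n --> \oo] --> (f x)%:E.
    by apply: (@cvg_nnsfun_approx _ _ _ _ mO _ mEf) => // y _; rewrite lee_fin.
  move/fine_cvg => /= h.
  have h0' : (g n x - f x) @[n --> \oo] --> (0 : R) by apply/subr_cvg0.
  by rewrite -[X in _ --> X](mulr0 0); exact: (cvgM h0' h0').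
- apply: aeW => x n Ox; have /andP[h1 h2] := gf n x Ox.
  by rewrite ger0_norm ?sqr_ge0// -sqrrN opprB lerXn2r ?nnegrE ?subr_ge0// lerBlDr lerDl.
Qed.

(** A single sequence has to serve all tolerances: [F m] comes within [1 / (m + 1)] of the infimum
    of the distance on mesh [m], so it is eventually almost as good as any approximation with a
    prescribed tolerance. *)
Lemma Sp_dense f : sqint f -> exists2 F : forall m, broken (S m) R,
  forall m, Sp p (F m) & cvg_sq (leb d) Omega (fun m => broken_fun (F m)) f.
Proof.
move=> fi.
have af : approximable f.
  have mp : measurable_fun Omega (fun x => Num.max (f x) 0) by exact: measurable_maxr fi.1 _.
  have mn : measurable_fun Omega (fun x => Num.max (- f x) 0).
    by apply: measurable_maxr => //; exact: measurableT_comp fi.1.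
  have b1 x : `|Num.max (f x) 0| <= `|f x| by rewrite maxEle; case: ifP => _; rewrite ?normr0 ?normr_ge0 ?lexx.
  have b2 x : `|Num.max (- f x) 0| <= `|f x| by rewrite maxEle; case: ifP => _; rewrite ?normr0 ?normrN ?normr_ge0 ?lexx.
  have pi : sqint (fun x => Num.max (f x) 0).
    split => //; apply: (@le_intg _ _ _ _ _ mO _ (fun x => f x ^+ 2)); [exact: measurable_funX| |exact: fi.2].
    by move=> x _; rewrite normrX -(real_normK (num_real (f x))) lerXn2r ?nnegrE.
  have ni : sqint (fun x => Num.max (- f x) 0).
    split => //; apply: (@le_intg _ _ _ _ _ mO _ (fun x => f x ^+ 2)); [exact: measurable_funX| |exact: fi.2].
    by move=> x _; rewrite normrX -(real_normK (num_real (f x))) lerXn2r ?nnegrE.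
  rewrite (_ : f = fun x => Num.max (f x) 0 + (-1) * Num.max (- f x) 0).
    apply: approximableD => //; [exact: sqintZ|by apply: approximable_ge0 => // x; rewrite le_max lexx orbT|].
    by apply: approximableZ => //; apply: approximable_ge0 => // x; rewrite le_max lexx orbT.
  by apply/funext => x; case: (leP (f x) 0) => h; case: (leP (- f x) 0) => h'; lra.
have H m : exists F : broken (S m) R, Sp p F /\ forall G : broken (S m) R, Sp p G ->
    dist2 (broken_fun F) f <= dist2 (broken_fun G) f + m.+1%:R^-1.
  pose A : set R := [set r | exists2 F : broken (S m) R, Sp p F & r = dist2 (broken_fun F) f].
  have hA : has_inf A.
    split; last by exists 0 => _ [F _ ->]; apply: Rintegral_ge0 => x _; exact: sqr_ge0.
    by eexists; exists (fun _ _ => 0) => //; move=> k; exact: polynomial_fun0.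
  have m0 : 0 < (m.+1%:R^-1 : R) by rewrite invr_gt0.
  have [_ [F pF ->] HF] := inf_adherent m0 hA.
  exists F; split => // G pG; apply/ltW/(lt_le_trans HF); rewrite lerD2r.
  by apply: ge_inf; [case: hA|exists G].
pose F m := projT1 (cid (H m)).
have pF m : Sp p (F m) by rewrite /F; case: (cid (H m)) => ? [].
have HF m (G : broken (S m) R) : Sp p G -> dist2 (broken_fun (F m)) f <= dist2 (broken_fun G) f + m.+1%:R^-1.
  by move=> pG; have [_] := projT2 (cid (H m)); exact.
exists F => //; rewrite /cvg_sq; apply/cvgrPdist_le => e e0.
have e2 : 0 < e / 2 by rewrite divr_gt0.
near=> m; rewrite sub0r normrN ger0_norm; last by apply: Rintegral_ge0 => x _; exact: sqr_ge0.
have [G pG HG] : exists2 G : broken (S m) R, Sp p G & dist2 (broken_fun G) f <= e / 2.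
  by near: m; exact: af.
apply: le_trans (HF m G pG) _; rewrite [leRHS]splitr lerD//.
near: m; apply: filterS (cvgr_lt _ (@cvg_harmonic R) _ e2) => k /= /ltW.
Unshelve. all: by end_near. Qed.

End density.

(** * Entropy variables *)

Lemma norm_basis_vec_le1 (R : realType) n (i : 'I_n) : `|basis_vec i : 'cV[R]_n| <= 1.
Proof.
by apply: ler_mx_norm => // j k; rewrite mxE; case: (_ && _); rewrite ?normr1 ?normr0.
Qed.

Lemma cvg_open_eq (T U : topologicalType) (D : set T) (f g : T -> U) x :
  open D -> D x -> (forall y, D y -> f y = g y) ->
  f y @[y --> x] --> f x -> g y @[y --> x] --> g x.
Proof.
move=> oD Dx fg; rewrite -(fg x Dx); apply: cvg_trans; apply: near_eq_cvg.
by apply: filterS (open_nbhs_nbhs (conj oD Dx)) => y Dy; exact: fg.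
Qed.

Section second_order.
Context {R : realType} {n : nat}.
Implicit Types (g : 'cV[R]_n -> R) (x v y : 'cV[R]_n) (D : set 'cV[R]_n).

Lemma mvt_line g x v (t : R) : 0 < t ->
  (forall r, 0 <= r <= t -> differentiable g (x + r *: v)) ->
  exists2 a, 0 < a < t & g (x + t *: v) - g x = t * 'D_v g (x + a *: v).
Proof.
move=> t0 dg; pose G (r : R) := g (x + r *: v).
have dG (r : R) : 0 <= r <= t -> is_derive r 1 G ('D_v g (x + r *: v)).
  by move=> rt; apply: derive_line; apply: diff_derivable; exact: dg.
have cG : {within `[0, t], continuous G}.
  apply: continuous_in_subspaceT => r; rewrite inE/= in_itv/= => rt.
  by apply: differentiable_continuous; apply/derivable1_diffP; have [] := dG _ rt.
have dG' r : r \in `]0, t[ -> is_derive r 1 G ('D_v g (x + r *: v)).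
  by rewrite in_itv/= => /andP[r0 rt]; apply: dG; rewrite !ltW.
have [a] := MVT t0 dG' cG.
rewrite in_itv/= subr0 /G scale0r addr0 => at0 ->.
by exists a => //; rewrite mulrC.
Qed.

Lemma C2_differentiable D g x : C2_on D g -> D x ->
  differentiable g x /\ forall i, differentiable (partial i g) x.
Proof.
move=> [g1 g2] Dx; split => [|i]; first by have [] := g1 _ Dx.
have [dg _] := g2 _ Dx.
rewrite (_ : partial i g = (fun M : 'cV[R]_n => M i 0) \o grad g).
  by apply: differentiable_comp => //; exact: differentiable_coord.
by apply/funext => y /=; rewrite mxE.
Qed.

Lemma derive_coord m (f : 'cV[R]_n -> 'cV[R]_m) x v i : differentiable f x ->
  ('D_v f x) i 0 = 'D_v (fun y => f y i 0) x.
Proof.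
move=> df; rewrite (_ : (fun y => f y i 0) = (fun M : 'cV[R]_m => M i 0) \o f)//.
by rewrite derive_mx ?mxE//; apply: diff_derivable.
Qed.

Lemma C2_continuous D g x i v : open D -> C2_on D g -> D x ->
  'D_v (partial i g) y @[y --> x] --> 'D_v (partial i g) x.
Proof.
move=> oD [g1 g2] Dx.
have [_ cg] := g2 _ Dx.
have H : 'D_v (grad g) y i 0 @[y --> x] --> ('D_v (grad g) x) i 0.
  exact: (@cvg_mx_coord _ _ _ _ _ _ ('D_v (grad g)) _ i 0 (cg v)).
have E y : D y -> 'D_v (grad g) y i 0 = 'D_v (partial i g) y.
  move=> Dy; rewrite derive_coord; last by have [] := g2 _ Dy.
  by congr ('D_v _ y); apply/funext => z; rewrite mxE.
exact: (@cvg_open_eq _ _ D (fun y => 'D_v (grad g) y i 0) ('D_v (partial i g)) x oD Dx E H).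
Qed.

Definition second_difference g x v w := g (x + v + w) - g (x + v) - (g (x + w) - g x).

Lemma second_differenceC g x v w : second_difference g x v w = second_difference g x w v.
Proof. by rewrite /second_difference (addrAC x v); ring. Qed.

(** The mean value theorem in direction [i] for the increment of [g] in direction [j], and then in
    direction [j] for [partial i g]. *)
Lemma mixed_difference D g x i j (e t : R) : ball x e `<=` D -> C2_on D g ->
  0 < t -> t + t < e -> exists2 z, ball x e z & 
  second_difference g x (t *: basis_vec i) (t *: basis_vec j) = t * (t * partial j (partial i g) z).
Proof.
move=> xD g2 t0 te.
have inb (a b : R) : 0 <= a <= t -> 0 <= b <= t ->
    ball x e (x + a *: basis_vec i + b *: basis_vec j).
  move=> /andP[a0 at0] /andP[b0 bt].
  rewrite -ball_normE /ball_/= -addrA opprD addrA subrr sub0r normrN.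
  apply: le_lt_trans te; apply: le_trans (ler_normD _ _) _.
  rewrite !normrZ !ger0_norm// lerD//.
    by rewrite (le_trans _ at0)// ler_piMr// norm_basis_vec_le1.
  by rewrite (le_trans _ bt)// ler_piMr// norm_basis_vec_le1.
have z0 : 0 <= (0 : R) <= t by rewrite lexx ltW.
have zt : 0 <= t <= t by rewrite lexx andbT ltW.
pose G y := g (y + t *: basis_vec j) - g y.
have dG r : 0 <= r <= t -> differentiable G (x + r *: basis_vec i).
  move=> rt; have H0 := inb _ _ rt z0; rewrite scale0r addr0 in H0.
  have dg1 := (C2_differentiable g2 (xD _ H0)).1.
  have dg2 := (C2_differentiable g2 (xD _ (inb _ _ rt zt))).1.
  apply: differentiableB => //.
  exact: (@differentiable_comp _ _ _ _ (fun y => y + t *: basis_vec j) g).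
have [a /andP[a0 at0] Ea] := mvt_line t0 dG.
have at' : 0 <= a <= t by rewrite !ltW.
have H0 := inb _ _ at' z0; rewrite scale0r addr0 in H0.
have dg1 := (C2_differentiable g2 (xD _ H0)).1.
have dg2 := (C2_differentiable g2 (xD _ (inb _ _ at' zt))).1.
have := Ea; rewrite /G deriveB; last first.
- exact: diff_derivable.
- apply: diff_derivable; apply: (@differentiable_comp _ _ _ _ (fun y => y + t *: basis_vec j) g) => //.
rewrite derive_translate => {}Ea.
have [r rt|b /andP[b0 bt] Eb] := @mvt_line (partial i g) (x + a *: basis_vec i) (basis_vec j) t t0.
  exact: (C2_differentiable g2 (xD _ (inb _ _ at' rt))).2.
exists (x + a *: basis_vec i + b *: basis_vec j).
  by apply: inb => //; rewrite !ltW.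
by rewrite /second_difference Ea; congr (_ * _); exact: Eb.
Qed.

(** Schwarz's theorem: one and the same second difference is [t^2] times either mixed derivative at
    points near [x], and both mixed derivatives are continuous. *)
Lemma partialC D g x i j : open D -> C2_on D g -> D x ->
  partial i (partial j g) x = partial j (partial i g) x.
Proof.
move=> oD g2 Dx; apply/eqP; rewrite -subr_eq0 -normr_le0; apply/ler_addgt0Pr => e e0.
rewrite add0r.
have e2 : 0 < e / 2 by rewrite divr_gt0.
have H1 : \forall z \near x, `|partial i (partial j g) x - partial i (partial j g) z| < e / 2.
  exact: (cvgr_dist_lt _ _ (C2_continuous (v := basis_vec i) (i := j) oD g2 Dx) _ e2).
have H2 : \forall z \near x, `|partial j (partial i g) x - partial j (partial i g) z| < e / 2.
  exact: (cvgr_dist_lt _ _ (C2_continuous (v := basis_vec j) (i := i) oD g2 Dx) _ e2).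
have H3 := open_nbhs_nbhs (conj oD Dx).
have [r /= r0 Hr] := (nbhs_ballP _ _).1 (filterI H3 (filterI H1 H2)).
have rD : ball x r `<=` D by move=> y /Hr [].
have t0 : 0 < r / 3 by rewrite divr_gt0.
have tr : r / 3 + r / 3 < r by lra.
have [z1 bz1 E1] := mixed_difference i j rD g2 t0 tr.
have [z2 bz2 E2] := mixed_difference j i rD g2 t0 tr.
rewrite second_differenceC in E1.
have := etrans (esym E1) E2 => /(mulfI (lt0r_neq0 t0))/(mulfI (lt0r_neq0 t0)).
have [_ [_]] := Hr _ bz1; have [_ [+ _]] := Hr _ bz2.
move: (partial i (partial j g) x) (partial j (partial i g) x).
move: (partial i (partial j g) z2) (partial j (partial i g) z1) => a b c' c H4 H5 E; move: H4 H5; rewrite E.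
move=> /ltW H4 /ltW H5; rewrite [leRHS](splitr e) (_ : c' - c = (c' - a) - (c - a)); last by ring.
exact: le_trans (ler_normB _ _) (lerD H4 H5).
Qed.

Lemma hess_sym D g x : open D -> C2_on D g -> D x -> (hess g x)^T = hess g x.
Proof. by move=> oD g2 Dx; apply/matrixP => i j; rewrite !mxE; exact: (partialC i j oD g2 Dx). Qed.

(** By contradiction on a segment so short that it stays in [D] and in the region where the second
    derivative along [y] is negative. Midpoint convexity says that the mean slope does not decrease
    from the left half to the right half; written as slopes at intermediate points, this forces a
    nonnegative second derivative between them. *)
Lemma convex_hess_ge0 D g x y : open D -> C2_on D g -> convex_on D g -> D x ->
  0 <= ip y (hess g x *m y).
Proof.
move=> oD g2 cg Dx.
pose h z := \sum_j y j 0 * partial j g z.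
have Dh z : D z -> 'D_y g z = h z.
  by move=> Dz; apply: derive_partial; exact: (C2_differentiable g2 Dz).1.
have dh z : D z -> differentiable h z.
  move=> Dz; apply: differentiable_sum_seq => j.
  by apply: differentiableM => //; exact: (C2_differentiable g2 Dz).2.
have DDh z : D z -> 'D_y h z = ip y (hess g z *m y).
  move=> Dz; rewrite (derive_partial _ (dh z Dz)) ipE.
  under [RHS]eq_bigr do rewrite big_ord1 mxE big_distrr/=.
  rewrite exchange_big/=; apply: eq_bigr => j _; rewrite /partial.
  rewrite /h -/(partial j h z).
  have -> : partial j (fun z => \sum_k y k 0 * partial k g z) z = \sum_k y k 0 * partial j (partial k g) z.
    rewrite /partial (_ : (fun z => _) = \sum_k (fun z => y k 0 * partial k g z)); last first.
      by apply/funext => w; rewrite fct_sumE.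
    rewrite derive_sum; last first.
      move=> k; apply: diff_derivable; apply: differentiableM => //; exact: (C2_differentiable g2 Dz).2.
    apply: eq_bigr => k _; rewrite deriveZ//.
    by apply: diff_derivable; exact: (C2_differentiable g2 Dz).2.
  rewrite big_distrr/=; apply: eq_bigr => k _; rewrite mxE.
  by rewrite mulrCA; congr (_ * _); rewrite mulrC.
rewrite -DDh// leNgt; apply/negP => neg.
have ch : 'D_y h z @[z --> x] --> 'D_y h x.
  have H : \sum_j \sum_k y j 0 * y k 0 * 'D_(basis_vec k) (partial j g) z @[z --> x] -->
           \sum_j \sum_k y j 0 * y k 0 * 'D_(basis_vec k) (partial j g) x.
    apply: (@cvg_sumr _ _ _ (nbhs x) (nbhs_filter x)) => j.
    apply: (@cvg_sumr _ _ _ (nbhs x) (nbhs_filter x)) => k.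
    by apply: (@cvgM _ _ (nbhs x) (nbhs_filter x)); [exact: cvg_cst|exact: (C2_continuous oD g2 Dx)].
  have E z : D z -> 'D_y h z = \sum_j \sum_k y j 0 * y k 0 * 'D_(basis_vec k) (partial j g) z.
    move=> Dz; rewrite DDh// ipE; apply: eq_bigr => j _.
    rewrite big_ord1 mxE big_distrr/=; apply: eq_bigr => k _.
    by rewrite mxE -mulrA; congr (_ * _); rewrite mulrC.
  exact: (@cvg_open_eq _ _ D (fun z => \sum_j \sum_k y j 0 * y k 0 * 'D_(basis_vec k) (partial j g) z) ('D_y h) x oD Dx (fun z Dz => esym (E z Dz)) H).
have H1 : \forall z \near x, 'D_y h z < 0 by exact: (cvgr_lt _ ch _ neg).
have H3 := open_nbhs_nbhs (conj oD Dx).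
have [r /= r0 Hr] := (nbhs_ballP _ _).1 (filterI H3 H1).
pose t := r / (`|y| + 1) / 2.
have t0 : 0 < t by rewrite /t !divr_gt0// ltr_wpDl.
have bt (q : R) : `|q| <= t -> ball x r (x + q *: y).
  move=> qt; rewrite -ball_normE /ball_/= opprD addrA subrr sub0r normrN normrZ.
  apply: (@le_lt_trans _ _ (t * (`|y| + 1))); first by rewrite ler_pM// lerDl.
  by rewrite /t mulrAC divfK ?gt_eqF ?ltr_wpDl// ltr_pdivrMr//; lra.
have btD (q : R) : `|q| <= t -> D (x + q *: y) by move=> /bt/Hr [].
have cvx : g x <= 2^-1 * g (x + t *: y) + 2^-1 * g (x - t *: y).
  have := cg (x + t *: y) (x - t *: y); rewrite -scaleNr => cg'.
  have C (q : R) : q *: (x + t *: y) + (1 - q) *: (x + - t *: y) = x + ((2 * q - 1) * t) *: y.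
    by apply/colP => k; rewrite !mxE; ring.
  have /cg' /(_ 2^-1) : forall q, 0 <= q <= 1 -> D (q *: (x + t *: y) + (1 - q) *: (x + - t *: y)).
    move=> q q01; rewrite C; apply: btD; rewrite normrM (gtr0_norm t0).
    by apply: ler_piMl; [exact: ltW|rewrite ler_norml; move: q01 => /andP[? ?]; lra].
  rewrite C mulfV// subrr mul0r scale0r addr0.
  by rewrite (_ : 1 - 2^-1 = 2^-1 :> R); [apply; lra|field].
have [q qt|a /andP[a0 at0] Ea] := @mvt_line g x y t t0.
  by apply: (C2_differentiable g2 (btD _ _)).1; rewrite ger0_norm; lra.
have S (q : R) : x - t *: y + q *: y = x + (q - t) *: y by rewrite scalerBl addrAC -addrA.
have [q qt|b /andP[b0 bt'] Eb] := @mvt_line g (x - t *: y) y t t0.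
  by rewrite S; apply: (C2_differentiable g2 (btD _ _)).1; rewrite ler_norml; lra.
rewrite S subrr scale0r addr0 S Dh in Eb; last by apply: btD; rewrite ler_norml; lra.
rewrite Dh in Ea; last by apply: btD; rewrite ler_norml; lra.
have ab0 : 0 < a + t - b by lra.
have S2 (q : R) : x + (b - t) *: y + q *: y = x + (b - t + q) *: y by rewrite -addrA -scalerDl.
have [q qt|c /andP[c0 ct] Ec] := @mvt_line h (x + (b - t) *: y) y (a + t - b) ab0.
  by rewrite S2; apply: dh; apply: btD; clear -qt ab0 a0 at0 b0 bt'; rewrite ler_norml; lra.
rewrite !S2 (_ : b - t + (a + t - b) = a) in Ec; last by ring.
have [|_] := Hr (x + (b - t + c) *: y).
  by apply: bt; clear -a0 at0 b0 bt' c0 ct t0; rewrite ler_norml; lra.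
have : t * h (x + (b - t) *: y) <= t * h (x + a *: y) 
  by rewrite -Ea -Eb; move: cvx; move: (g (x + t *: y)) (g (x - t *: y)) (g x) => p q r'; clear; lra.
rewrite ler_pM2l// -subr_ge0 Ec pmulr_rge0// => A1 A2.
by have := le_lt_trans A1 A2; rewrite ltxx.
Qed.

End second_order.

Lemma derive_comp_coord (R : realType) n m (g : 'cV[R]_m -> R) (u : 'cV[R]_n -> 'cV[R]_m) x v :
  differentiable u x -> differentiable g (u x) ->
  'D_v (g \o u) x = \sum_k ('D_v u x) k 0 * partial k g (u x).
Proof.
move=> du dg; rewrite deriveE; last exact: differentiable_comp.
by rewrite diff_comp//= -(deriveE v du) -(deriveE _ dg) derive_partial.
Qed.

Lemma coercive_unitmx (R : realType) n (B : 'M[R]_n) (c : R) : 0 < c ->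
  (forall z : 'cV[R]_n, c * enorm z ^+ 2 <= ip z (B *m z)) -> B \in unitmx.
Proof.
move=> c0 Bc; rewrite unitmxE unitfE -det_tr; apply/negP => /det0P[v vn0 vB].
have Bv : B *m v^T = 0 by rewrite -[B]trmxK -trmx_mul vB trmx0.
have := Bc v^T; rewrite Bv [ip _ 0]ipE big1 => [|i _]; last by rewrite big1// => j _; rewrite [X in _ * X]mxE mulr0.
rewrite pmulr_rle0// => e0; move/eqP: vn0; apply; apply/rowP => i; apply/eqP.
have vn : enorm v^T = 0 by apply/eqP; rewrite -sqrf_eq0 eq_le e0 sqr_ge0.
by rewrite [(0 : 'rV_n) _ _]mxE -normr_le0 -vn; have := coord_le_enorm (v^T) i 0; rewrite mxE.
Qed.

Lemma coercive_invmx (R : realType) n (B : 'M[R]_n) (c : R) (z : 'cV[R]_n) : 0 < c ->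
  (forall z : 'cV[R]_n, c * enorm z ^+ 2 <= ip z (B *m z)) ->
  c * enorm (invmx B *m z) <= enorm z.
Proof.
move=> c0 Bc; have BU := coercive_unitmx c0 Bc.
set y := invmx B *m z; have By : B *m y = z by rewrite mulKVmx.
rewrite -ler_sqr ?nnegrE ?mulr_ge0 ?enorm_ge0 ?(ltW c0)// exprMn.
have := Bc y; rewrite By => H1.
(* Expanding [|c y - z|^2 >= 0] and inserting coercivity stands in for Cauchy-Schwarz. *)
have := ip_ge0 (c *: y - z); rewrite ipBl ipZl ![ip _ (_ - _)]ipC !ipBl !ipZl -!enorm_sqr (ipC z y).
by nra.
Qed.

Section entropy_variables.
Context {R : realType} {d N : nat} {T : R} {Omega : set 'cV[R]_d} {D : set 'cV[R]_N}.
Context {A : 'cV[R]_N -> 'M[R]_N} {f : 'cV[R]_N -> 'cV[R]_N} {s : 'cV[R]_N -> R}.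
Context {u : 'cV[R]_N -> 'cV[R]_N} {gamma Cf : R} {rho0 : 'cV[R]_d -> 'cV[R]_N}.
Hypothesis hs : structural_assumptions T Omega D A f s u gamma Cf rho0.
Implicit Types w z : 'cV[R]_N.

Lemma u_differentiable w : differentiable u w.
Proof. by have [] := sa_u_C1 hs (x := w) I. Qed.

Lemma u_continuous : continuous u.
Proof. by move=> w; apply: differentiable_continuous; exact: u_differentiable. Qed.

Lemma D_open : open D. Proof. by have [] := sa_D_domain hs. Qed.

Lemma s_differentiable rho : D rho -> differentiable s rho.
Proof. by move=> Dr; have [] := C2_differentiable (sa_s_C2 hs) Dr. Qed.

(** Continuity relative to the closure is full continuity at the values of [u], because these lie in
    the open set [D]. *)
Lemma comp_u_continuous (V : topologicalType) (g : 'cV[R]_N -> V) :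
  continuous_on_closure D g -> continuous (g \o u).
Proof.
move=> cg w; apply: continuous_comp; first exact: u_continuous.
have : {within D, continuous g} by apply: continuous_subspaceW cg; exact: subset_closure.
rewrite continuous_open_subspace; last exact: D_open.
by apply; rewrite inE; exact: sa_u_range hs _.
Qed.

Lemma D_closure_bounded (V : normedModType R) (g : 'cV[R]_N -> V) :
  continuous_on_closure D g -> exists C, forall rho, closure D rho -> `|g rho| <= C.
Proof.
move=> cg.
have bD := bounded_closure (sa_D_bounded hs).
have cD : compact (closure D) by apply: bounded_closed_compact_cV => //; exact: closed_closure.
have [C [_ HC]] := compact_bounded (continuous_compact cg cD).
exists (C + 1) => rho Dr; apply: (HC (C + 1)); first by rewrite ltrDl.
by exists rho.
Qed.

Definition jac w : 'M[R]_N := \matrix_(i, j) partial j (fun w => u w i 0) w.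

Lemma derive_u w z : 'D_z u w = jac w *m z.
Proof.
apply/colP => i; rewrite derive_coord; last exact: u_differentiable.
rewrite derive_partial; last first.
  apply: (@differentiable_comp _ _ _ _ u (fun M : 'cV[R]_N => M i 0)); first exact: u_differentiable.
  exact: differentiable_coord.
by rewrite mxE; apply: eq_bigr => j _; rewrite mxE mulrC.
Qed.

Lemma jac_continuous i j : continuous (fun w => jac w i j).
Proof.
move=> w; have [_ cD] := sa_u_C1 hs (x := w) I.
have H := @cvg_mx_coord _ _ _ _ _ _ ('D_(basis_vec j) u) _ i 0 (cD (basis_vec j)).
have {}H := H (nbhs_filter w).
have E z : setT z -> ('D_(basis_vec j) u z) i 0 = jac z i j.
  by move=> _; rewrite derive_coord ?mxE//; exact: u_differentiable.
exact: (@cvg_open_eq _ _ setT (fun w => ('D_(basis_vec j) u w) i 0) (fun w => jac w i j) w openT I E H).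
Qed.

(** The derivative of the identity [grad s (u w) = w]. *)
Lemma hess_jac w : hess s (u w) *m jac w = 1%:M.
Proof.
apply/matrixP => i j; rewrite !mxE.
have [ds dps] := C2_differentiable (sa_s_C2 hs) (sa_u_range hs w).
have := derive_comp_coord (basis_vec j) (u_differentiable w) (dps i).
have -> : partial i s \o u = fun w => w i 0.
  by apply/funext => w' /=; rewrite -[w' in RHS](sa_u_inverse_l hs) mxE.
rewrite (_ : 'D_(basis_vec j) (fun w => w i 0) w = (i == j)%:R); last first.
  rewrite -(@derive_coord _ _ _ id)// derive_id -(coord_basis_vec j i)//.
move=> ->; apply: eq_bigr => k _; rewrite !mxE mulrC; congr (_ * _).
by rewrite derive_coord//; exact: u_differentiable.
Qed.

Lemma jac_hess w : jac w *m hess s (u w) = 1%:M.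
Proof. by apply: mulmx1C; exact: hess_jac. Qed.

Lemma hess_u_sym w : (hess s (u w))^T = hess s (u w).
Proof. exact: (hess_sym D_open (sa_s_C2 hs) (sa_u_range hs w)). Qed.

Lemma hess_u_continuous i j : continuous (fun w => hess s (u w) i j).
Proof.
move=> w; apply: (@continuous_comp _ _ _ u (fun r => hess s r i j)).
  exact: u_continuous.
have E r : setT r -> partial j (partial i s) r = hess s r i j by move=> _; rewrite mxE.
have H := C2_continuous (v := basis_vec j) (i := i) D_open (sa_s_C2 hs) (sa_u_range hs w).
exact: (@cvg_open_eq _ _ setT _ (fun r => hess s r i j) (u w) openT I E H).
Qed.

Lemma u_coercive w z : gamma * enorm z ^+ 2 <= ip z (hess s (u w) *m A (u w) *m z).
Proof. exact: (sa_coercive hs z (sa_u_range hs w)). Qed.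

Lemma HA_unit w : hess s (u w) *m A (u w) \in unitmx.
Proof. exact: coercive_unitmx (sa_gamma hs) (u_coercive w). Qed.

(** Since [jac] inverts the Hessian, the Hessian cancels although it admits no uniform bound. The
    identity is what recognises the gradient of the density in the limit flux. *)
Lemma A_inv_HA w : A (u w) *m invmx (hess s (u w) *m A (u w)) = jac w.
Proof.
by rewrite -[LHS]mul1mx -(jac_hess w) -mulmxA (mulmxA (hess _ _)) mulmxV ?mulmx1//; exact: HA_unit.
Qed.

Lemma invmx_HA_bounded w i j : `|invmx (hess s (u w) *m A (u w)) i j| <= gamma^-1.
Proof.
set B := _ *m _.
have -> : invmx B i j = (invmx B *m basis_vec j) i 0.
  rewrite mxE (bigD1 j)//= big1 => [|k kj]; first by rewrite mxE !eqxx mulr1 addr0.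
  by rewrite mxE (negbTE kj) mulr0.
have := coercive_invmx (basis_vec j) (sa_gamma hs) (u_coercive w).
have -> : enorm (basis_vec j : 'cV[R]_N) = 1.
  rewrite /enorm ipE; under eq_bigr do rewrite big_ord1 !coord_basis_vec.
  by rewrite (bigD1 j)//= eqxx mulr1 big1 ?addr0 ?sqrtr1// => k /negbTE ->; rewrite mulr0.
rewrite -ler_pdivlMl ?(sa_gamma hs)// mulr1; apply: le_trans; exact: coord_le_enorm.
Qed.

Lemma A_bounded : exists2 C, 0 <= C & forall w i j, `|A (u w) i j| <= C.
Proof.
have [C HC] := D_closure_bounded (sa_A_continuous hs).
have H w : `|A (u w)| <= C by apply/HC/subset_closure/(sa_u_range hs).
exists C; first exact: le_trans (normr_ge0 _) (H 0).
by move=> w i j; apply: le_trans (ler_coord_mx_norm _ _ _) (H w).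
Qed.

Lemma f_bounded : exists2 C, 0 <= C & forall w i, `|f (u w) i 0| <= C.
Proof.
have [C HC] := D_closure_bounded (sa_f_continuous hs).
have H w : `|f (u w)| <= C by apply/HC/subset_closure/(sa_u_range hs).
exists C; first exact: le_trans (normr_ge0 _) (H 0).
by move=> w i; apply: le_trans (ler_coord_mx_norm _ _ _) (H w).
Qed.

Lemma D_coord_bounded : exists2 C, 0 <= C & forall rho i, D rho -> `|rho i 0| <= C.
Proof.
have [M [_ HM]] := sa_D_bounded hs; exists (`|M + 1|) => // rho i Dr.
apply: le_trans (ler_coord_mx_norm _ _ _) _; apply: HM => //.
by apply: lt_le_trans (ler_norm _); rewrite ltrDl.
Qed.

Lemma s_bounded : exists C, forall rho, D rho -> `|s rho| <= C.
Proof.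
have [C HC] := D_closure_bounded (sa_s_continuous hs).
by exists C => rho Dr; apply/HC/subset_closure.
Qed.

(** The Jacobian is a product of two bounded factors: [A] is continuous on the compact closure of
    [D], and coercivity bounds the inverse of [s'' A] by [gamma^-1]. No bound on [s''] enters. *)
Lemma jac_bounded : exists2 C, 0 <= C & forall w i j, `|jac w i j| <= C.
Proof.
have [C C0 HC] := A_bounded.
exists (\sum_(k < N) C * gamma^-1).
  by apply: sumr_ge0 => k _; rewrite mulr_ge0// invr_ge0 ltW// (sa_gamma hs).
move=> w i j; rewrite -A_inv_HA mxE (le_trans (ler_norm_sum _ _ _))//.
apply: ler_sum => k _; rewrite normrM ler_pM//; exact: invmx_HA_bounded.
Qed.

(* Along the segment of entropy variables, [s \o u] minus the linear form has derivative
   [r * (jac z, z) >= 0]; the segment of densities need not stay in [D]. *)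
Lemma entropy_le w1 w2 : ip (u w1 - u w2) w2 <= s (u w1) - s (u w2).
Proof.
pose g w := s (u w) - ip (u w) w2; set z := w1 - w2.
have dip : (fun w => ip (u w) w2) = (fun r => ip r w2) \o u by [].
have ipF : (fun r : 'cV[R]_N => ip r w2) = fun r : 'cV[R]_N => \sum_i w2 i 0 * r i 0.
  by apply/funext => r; rewrite ipE; apply: eq_bigr => i _; rewrite big_ord1 mulrC.
have dipr (r : 'cV[R]_N) : differentiable (fun r => ip r w2) r.
  rewrite ipF; apply: differentiable_sum_seq => i; apply: differentiableM => //.
  exact: differentiable_coord.
have pip k (r : 'cV[R]_N) : partial k (fun r => ip r w2) r = w2 k 0.
  rewrite /partial ipF (_ : (fun r => _) = \sum_i (fun r : 'cV[R]_N => w2 i 0 * r i 0)); last first.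
    by apply/funext => x; rewrite fct_sumE.
  have dc i : derivable (fun r : 'cV[R]_N => r i 0) r (basis_vec k).
    by apply: diff_derivable; exact: differentiable_coord.
  rewrite derive_sum => [|i]; last by apply: derivableZ.
  rewrite (bigD1 k)//= big1 => [|i ik].
    by rewrite deriveZ// -(@derive_coord _ _ _ id)// derive_id mxE !eqxx addr0 /GRing.scale/= mulr1.
  by rewrite deriveZ// -(@derive_coord _ _ _ id)// derive_id mxE (negbTE ik) scaler0.
have dsu w : differentiable (s \o u) w.
  by apply: differentiable_comp; [exact: u_differentiable|exact/s_differentiable/(sa_u_range hs)].
have diu w : differentiable ((fun r : 'cV[R]_N => ip r w2) \o u) w.
  by apply: differentiable_comp; [exact: u_differentiable|exact: dipr].
have dg w : differentiable g w by exact: (differentiableB (dsu w) (diu w)).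
have Dg w : 'D_z g w = ip (jac w *m z) (w - w2).
  rewrite (deriveB (f := s \o u) (g := (fun r : 'cV[R]_N => ip r w2) \o u)); [|exact: diff_derivable..].
  rewrite derive_comp_coord; [|exact: u_differentiable|exact/s_differentiable/(sa_u_range hs)].
  rewrite derive_comp_coord; [|exact: u_differentiable|exact: dipr].
  rewrite -sumrB ipE; apply: eq_bigr => k _; rewrite big_ord1 -mulrBr derive_u; congr (_ * _).
  rewrite pip mxE [(- w2) k 0]mxE; congr (_ - _).
  by rewrite -[w in RHS](sa_u_inverse_l hs) mxE.
have [//|a /andP[a0 a1]] := @mvt_line R N g w2 z 1 ltr01.
rewrite scale1r mul1r Dg (_ : w2 + z = w1); last by rewrite addrC subrK.
rewrite (_ : w2 + a *: z - w2 = a *: z); last by rewrite addrAC subrr add0r.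
move=> E.
suff : 0 <= g w1 - g w2 by rewrite /g ipBl; lra.
rewrite E ipC ipZl; apply: mulr_ge0; first exact: ltW.
have := convex_hess_ge0 (jac (w2 + a *: z) *m z) D_open (sa_s_C2 hs) (sa_s_convex hs) (sa_u_range hs (w2 + a *: z)).
by rewrite mulmxA hess_jac mul1mx ipC.
Qed.

End entropy_variables.

(** * Lebesgue and Sobolev spaces *)

Lemma powR_cvg0_seq (R : realType) (a : R ^nat) (r : R) : 0 < r -> (forall k, 0 <= a k) ->
  a @ \oo --> (0 : R) -> (fun k => a k `^ r) @ \oo --> (0 : R).
Proof.
move=> r0 a0 ca; apply/cvgrPdist_le => e e0.
have H := cvgr_lt _ ca _ (powR_gt0 r^-1 e0); near=> k.
rewrite sub0r normrN ger0_norm ?powR_ge0//.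
have -> : e = (e `^ r^-1) `^ r by rewrite -powRrM mulVf ?gt_eqF// powRr1// ltW.
apply: ge0_ler_powR; rewrite ?nnegrE ?powR_ge0 ?a0//; first exact: ltW.
by apply: ltW; near: k; exact: H.
Unshelve. all: by end_near. Qed.

Section Lebesgue_spaces.
Context {R : realType} {d : nat}.
Variable Omega : set 'cV[R]_d.
Hypotheses (oO : open Omega) (bO : bounded_set Omega).
Let mO : measurable Omega := open_measurable_mx oO.
Let muO : (leb d Omega < +oo)%E := leb_bounded mO bO.
Notation intg := (intg (leb d) Omega).
Notation sqint := (sqint (leb d) Omega).
Notation cvg_sq := (cvg_sq (leb d) Omega).

Lemma Lpnorm_poweR m n (r : R) (v : 'cV[R]_d -> 'M[R]_(m, n)) : 0 < r ->
  (Lpnorm Omega r%:E v `^ r = \int[leb d]_(x in Omega) (enorm (v x) `^ r)%:E)%E.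
Proof.
move=> r0; rewrite integral_mkcond /Lpnorm.
have rn : r != 0 by rewrite gt_eqF.
rewrite (powR_Lnorm _ _ rn).
apply: eq_integral => x _; rewrite patchE indicE /=.
have [xO|xO] := boolP (x \in Omega); first by rewrite mulr1 ger0_norm ?enorm_ge0.
by rewrite mulr0 normr0 powR0// gt_eqF.
Qed.

Lemma LpnormE m n (r : R) (v : 'cV[R]_d -> 'M[R]_(m, n)) : 0 < r ->
  intg (fun x => enorm (v x) `^ r) ->
  Lpnorm Omega r%:E v = ((\int[leb d]_(x in Omega) (enorm (v x) `^ r)) `^ r^-1)%:E.
Proof.
move=> r0 ir; have E := Lpnorm_poweR v r0.
have fi : (\int[leb d]_(x in Omega) (enorm (v x) `^ r)%:E \is a fin_num)%E.
  exact: (integrable_fin_num mO ir).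
have n0 : (0 <= Lpnorm Omega r%:E v)%E by exact: Lnorm_ge0.
have -> : Lpnorm Omega r%:E v = ((Lpnorm Omega r%:E v `^ r) `^ r^-1)%E.
  by rewrite -poweRrM mulfV ?gt_eqF// poweRe1.
by rewrite E -[X in (X `^ _)%E](fineK fi) poweR_EFin.
Qed.

Lemma enorm_measurable m n (v : 'cV[R]_d -> 'M[R]_(m, n)) :
  (forall i j, measurable_fun Omega (fun x => v x i j)) ->
  measurable_fun Omega (fun x => enorm (v x)).
Proof.
move=> mv.
have mip : measurable_fun Omega (fun x => ip (v x) (v x)).
  rewrite (_ : (fun x => ip _ _) = (fun x => \sum_i \sum_j v x i j * v x i j)); last first.
    by apply/funext => x; rewrite ipE.
  by apply: measurable_sum => i; apply: measurable_sum => j; exact: measurable_funM.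
have ms : measurable_fun setT (@Num.sqrt R).
  by apply: continuous_measurable_fun; exact: sqrt_continuous.
exact: (measurableT_comp ms mip).
Qed.

Lemma enorm_powR2 m n (P : 'M[R]_(m, n)) : enorm P `^ 2 = ip P P.
Proof. by rewrite -enorm_sqr powR_mulrn ?enorm_ge0. Qed.

Lemma sqint_ip m n (v w : 'cV[R]_d -> 'M[R]_(m, n)) :
  (forall i j, sqint (fun x => v x i j)) -> (forall i j, sqint (fun x => w x i j)) ->
  intg (fun x => ip (v x) (w x)).
Proof.
move=> sv sw; under eq_fun do rewrite ipE.
by apply: intg_sum => // i _; apply: intg_sum => // j _; exact: sqint_intgM.
Qed.

Lemma Rintegral_ip m n (v w : 'cV[R]_d -> 'M[R]_(m, n)) :
  (forall i j, sqint (fun x => v x i j)) -> (forall i j, sqint (fun x => w x i j)) ->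
  \int[leb d]_(x in Omega) ip (v x) (w x) =
  \sum_i \sum_j \int[leb d]_(x in Omega) (v x i j * w x i j).
Proof.
move=> sv sw; under eq_Rintegral do rewrite ipE.
rewrite Rintegral_sum// => [|i _].
  by apply: eq_bigr => i _; rewrite Rintegral_sum// => j _; exact: sqint_intgM.
by apply: intg_sum => // j _; exact: sqint_intgM.
Qed.

Lemma Lp2P m n (v : 'cV[R]_d -> 'M[R]_(m, n)) :
  Lp Omega 2%:E v <-> forall i j, sqint (fun x => v x i j).
Proof.
split => [[mv fv] i j|sv].
  have mc i' j' := measurable_mx_coord i' j' mv.
  have E := Lpnorm_poweR v (ltr0n R 2 : (0:R) < 2).
  have fi : intg (fun x => enorm (v x) `^ 2).
    apply/integrableP; split.
      apply/measurable_EFinP; apply: (@measurableT_comp _ _ _ _ _ _ (fun y => y `^ 2)).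
        exact: measurable_powR.
      exact: enorm_measurable.
    under eq_integral do rewrite /= ger0_norm ?powR_ge0//.
    rewrite -E; exact: poweR_lty.
  split => //; apply: (le_intg mO _ _ fi); first exact: measurable_funX.
  move=> x _; rewrite enorm_powR2 -enorm_sqr ger0_norm ?sqr_ge0//.
  by rewrite -(real_normK (num_real _)) lerXn2r ?nnegrE ?enorm_ge0 ?coord_le_enorm.
split; first by apply: measurable_fun_matrix => // i j; exact: (sv i j).1.
rewrite LpnormE ?ltry//; under eq_fun do rewrite enorm_powR2.
exact: sqint_ip.
Qed.

Lemma Lpnorm2_sqr m n (v : 'cV[R]_d -> 'M[R]_(m, n)) : (forall i j, sqint (fun x => v x i j)) ->
  fine (Lpnorm Omega 2%:E v) ^+ 2 = \int[leb d]_(x in Omega) ip (v x) (v x).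
Proof.
move=> sv; rewrite LpnormE//=; last by under eq_fun do rewrite enorm_powR2; exact: sqint_ip.
under eq_Rintegral do rewrite enorm_powR2.
have I0 : 0 <= \int[leb d]_(x in Omega) ip (v x) (v x).
  by apply: Rintegral_ge0 => x _; exact: ip_ge0.
by rewrite -powR_mulrn ?powR_ge0// -powRrM mulVf ?powRr1.
Qed.

Lemma sL2P (g : 'cV[R]_d -> R) : sL2 Omega g <-> sqint g.
Proof.
rewrite /sL2; split => [/Lp2P/(_ 0 0)|gi]; first by under eq_fun do rewrite mxE eqxx mulr1n.
by apply/Lp2P => i j; under eq_fun do rewrite !ord1 mxE eqxx mulr1n.
Qed.

Lemma Lp_cvg2 m n (v_ : nat -> 'cV[R]_d -> 'M[R]_(m, n)) (v : 'cV[R]_d -> 'M[R]_(m, n)) i j :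
  (forall k i j, sqint (fun x => v_ k x i j)) -> (forall i j, sqint (fun x => v x i j)) ->
  Lp_cvg Omega 2%:E v_ v -> cvg_sq (fun k x => v_ k x i j) (fun x => v x i j).
Proof.
move=> sv_ sv vv.
pose I k := \int[leb d]_(x in Omega) ip (v_ k x - v x) (v_ k x - v x).
have sB k i' j' : sqint (fun x => (v_ k x - v x) i' j').
  by under eq_fun do rewrite mxE [X in _ + X]mxE; exact: sqintB.
have I0 : I @ \oo --> (0 : R).
  rewrite (_ : I = fun k => fine (Lpnorm Omega 2%:E (fun x => v_ k x - v x)) ^+ 2); last first.
    by apply/funext => k; rewrite Lpnorm2_sqr.
  under eq_fun do rewrite expr2.
  have F0 : fine (Lpnorm Omega 2%:E (fun x => v_ k x - v x)) @[k --> \oo] --> (0 : R).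
    exact: fine_cvg vv.
  have := cvgM F0 F0; rewrite mulr0; exact.
apply: (@squeeze_cvgr _ _ _ _ (fun=> 0) I) => //; last exact: cvg_cst.
apply: nearW => k; apply/andP; split; first by apply: Rintegral_ge0 => x _; exact: sqr_ge0.
apply: le_Rintegral => //.
- exact: (sqintB mO (sv_ k i j) (sv i j)).2.
- exact: sqint_ip.
- move=> x _; have := coord_le_enorm (v_ k x - v x) i j; rewrite mxE [X in `|_ + X|]mxE => H.
  by rewrite -enorm_sqr -(real_normK (num_real _)) lerXn2r ?nnegrE ?enorm_ge0.
Qed.

(** Dominated convergence for the [r]-th powers; constants are integrable because [Omega] has finite
    measure. *)
Lemma Lp_cvg_bounded m n (r M : R) (v_ : nat -> 'cV[R]_d -> 'M[R]_(m, n)) (v : 'cV[R]_d -> 'M[R]_(m, n)) : 0 < r -> 0 <= M ->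
  (forall k i j, measurable_fun Omega (fun x => v_ k x i j)) ->
  (forall i j, measurable_fun Omega (fun x => v x i j)) ->
  {ae leb d, forall x, Omega x -> forall k i j, `|v_ k x i j - v x i j| <= M} ->
  {ae leb d, forall x, Omega x -> forall i j, v_ k x i j @[k --> \oo] --> v x i j} ->
  Lp_cvg Omega r%:E v_ v.
Proof.
move=> r0 M0 mv_ mv bv cv.
pose g k x := enorm (v_ k x - v x) `^ r.
have mg k : measurable_fun Omega (g k).
  apply: (@measurableT_comp _ _ _ _ _ _ (fun y : R => y `^ r)).
    exact: measurable_powR.
  apply: enorm_measurable => i j.
  by under eq_fun do rewrite mxE [X in _ + X]mxE; exact: measurable_funB.
pose C := (Num.sqrt ((m * n)%:R) * M) `^ r.
have gC : {ae leb d, forall x k, Omega x -> `|g k x| <= C}.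
  apply: filterS bv => x H k Ox; rewrite ger0_norm ?powR_ge0//.
  rewrite /g /C; apply: ge0_ler_powR; rewrite ?nnegrE ?enorm_ge0 ?mulr_ge0 ?sqrtr_ge0//.
    exact: ltW.
  apply: le_trans (enorm_le_mx_norm _) _; apply: ler_wpM2l; first exact: sqrtr_ge0.
  by apply: ler_mx_norm => // i j; rewrite mxE [X in _ + X]mxE; exact: H.
have ig k : intg (g k).
  by apply: (ae_le_intg mO _ _ (intg_cst mO muO C)) => //; apply: filterS gC => x H; exact: H.
have g0 : (fun k => \int[leb d]_(x in Omega) g k x) @ \oo --> (0 : R).
  rewrite -[X in _ --> X](_ : \int[leb d]_(x in Omega) 0 = 0); last first.
    by rewrite Rintegral_cst// mul0r.
  apply: (dominated_Rintegral mO mg _ (intg_cst mO muO C) _ gC) => //.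
  apply: filterS cv => x H Ox; rewrite -[X in _ --> X](@powR0 R r) ?gt_eqF//.
  have E0 : enorm (v_ k x - v x) @[k --> \oo] --> (0 : R).
    have D0 i j : (v_ k x - v x) i j @[k --> \oo] --> (0 : R).
      by under eq_fun do rewrite mxE [X in _ + X]mxE; apply/subr_cvg0; exact: H.
    have S0 : \sum_(i < m) \sum_(j < n) (v_ k x - v x) i j * (v_ k x - v x) i j @[k --> \oo] -->
        \sum_(i < m) \sum_(j < n) (0 * 0 : R).
      apply: (@cvg_sumr _ _ _ \oo _) => i; apply: (@cvg_sumr _ _ _ \oo _) => j.
      exact: cvgM (D0 i j) (D0 i j).
    have {}S0 : ip (v_ k x - v x) (v_ k x - v x) @[k --> \oo] --> (0 : R).
      under eq_fun do rewrite ipE; move: S0.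
      by rewrite (_ : \sum_(i < m) _ = 0)// big1// => i _; rewrite big1// => j _; rewrite mulr0.
    by rewrite -[X in _ --> X](@sqrtr0 R); apply: continuous_cvg => //; exact: sqrt_continuous.
  by rewrite (powR0 (lt0r_neq0 r0)); apply: powR_cvg0_seq E0 => // k; exact: enorm_ge0.
rewrite /Lp_cvg (_ : (fun k => _) = fun k => ((\int[leb d]_(x in Omega) g k x) `^ r^-1)%:E); last first.
  by apply/funext => k; rewrite LpnormE//; exact: ig.
apply: cvg_EFin; first exact: nearW.
apply: powR_cvg0_seq g0; first by rewrite invr_gt0.
by move=> k; apply: Rintegral_ge0 => x _; exact: powR_ge0.
Qed.

Lemma Lpnorm_ess_sup m n (C : R) (v : 'cV[R]_d -> 'M[R]_(m, n)) :
  (Lpnorm Omega +oo%E v <= C%:E)%E ->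
  {ae leb d, forall x, Omega x -> forall i j, `|v x i j| <= C}.
Proof.
(* The norm of order [+oo] is the essential supremum provided that the whole space has positive
   measure. *)
rewrite /Lpnorm unlock ifT; last first.
  by apply: leb_open_gt0; [exact: openT|exists 0].
move/ess_supP; apply: filterS => x + Ox i j; rewrite /= indicE mem_set// mulr1 lee_fin.
by rewrite ger0_norm ?enorm_ge0//; apply: le_trans; exact: coord_le_enorm.
Qed.

End Lebesgue_spaces.

Section Sobolev_spaces.
Context {R : realType} {d : nat}.
Variable Omega : set 'cV[R]_d.
Hypotheses (oO : open Omega) (bO : bounded_set Omega).
Let mO : measurable Omega := open_measurable_mx oO.
Let muO : (leb d Omega < +oo)%E := leb_bounded mO bO.
Notation intg := (intg (leb d) Omega).
Notation sqint := (sqint (leb d) Omega).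
Notation cvg_sq := (cvg_sq (leb d) Omega).
Implicit Types (g h : 'cV[R]_d -> R).

Lemma smooth_iter_partial (s : seq 'I_d) (phi : 'cV[R]_d -> R) :
  test_function Omega phi -> test_function Omega (iter_partial s phi).
Proof. by move=> tp; elim: s => //= i s IH; exact: test_function_partial. Qed.

Lemma intg_multi_partial a phi g : sqint g -> test_function Omega phi ->
  intg (fun x => g x * multi_partial a phi x).
Proof.
by move=> gi tp; apply: (intg_test oO (sqint_intg mO muO gi)); exact: smooth_iter_partial.
Qed.

Lemma weak_derivativeD a g1 g2 h1 h2 : sqint g1 -> sqint g2 -> sqint h1 -> sqint h2 ->
  weak_derivative Omega a g1 h1 -> weak_derivative Omega a g2 h2 ->
  weak_derivative Omega a (fun x => g1 x + g2 x) (fun x => h1 x + h2 x).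
Proof.
move=> g1i g2i h1i h2i w1 w2 phi tp.
under eq_Rintegral do rewrite mulrDl.
rewrite RintegralD//; [|exact: intg_multi_partial..].
under [in RHS]eq_Rintegral do rewrite mulrDl.
rewrite [in RHS]RintegralD//; [|exact: (intg_test oO (sqint_intg mO muO _))..].
by rewrite mulrDr w1// w2.
Qed.

Lemma weak_derivativeZ a (c : R) g h : sqint g -> sqint h ->
  weak_derivative Omega a g h -> weak_derivative Omega a (fun x => c * g x) (fun x => c * h x).
Proof.
move=> gi hi w phi tp.
under eq_Rintegral do rewrite -mulrA.
rewrite RintegralZl//; last exact: intg_multi_partial.
under [in RHS]eq_Rintegral do rewrite -mulrA.
rewrite [in RHS]RintegralZl//; last exact: (intg_test oO (sqint_intg mO muO _)).
by rewrite w// mulrCA.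
Qed.

Lemma weak_derivative0 a g : (\sum_i a i = 0)%N -> weak_derivative Omega a g g.
Proof. by move=> a0 phi tp; rewrite a0 expr0 mul1r multi_partial0. Qed.

Lemma wD_spec k a g : sobolev_scalar Omega k g -> (\sum_i a i <= k)%N ->
  sqint (wD Omega a g) /\ weak_derivative Omega a g (wD Omega a g).
Proof.
move=> [_ H] ak; have [h hi wh] := H a ak.
have [/(sL2P oO bO) ? ?] := @xgetPex _ (fun=> 0) [set h | sL2 Omega h /\ weak_derivative Omega a g h] (ex_intro _ h (conj hi wh)).
by split.
Qed.

Lemma wD_sqint k a g : sobolev_scalar Omega k g -> (\sum_i a i <= k)%N -> sqint (wD Omega a g).
Proof. by move=> H1 H2; have [] := wD_spec H1 H2. Qed.

Lemma wD_weak_derivative k a g : sobolev_scalar Omega k g -> (\sum_i a i <= k)%N ->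
  weak_derivative Omega a g (wD Omega a g).
Proof. by move=> H1 H2; have [] := wD_spec H1 H2. Qed.

Lemma wD_ae a g h : sqint h -> weak_derivative Omega a g h ->
  {ae leb d, forall x, Omega x -> wD Omega a g x = h x}.
Proof.
move=> hi wh; have hi' : sL2 Omega h by apply/(sL2P oO bO).
have [/(sL2P oO bO) H1 H2] := @xgetPex _ (fun=> 0) [set h | sL2 Omega h /\ weak_derivative Omega a g h] (ex_intro _ h (conj hi' wh)).
exact: (weak_derivative_unique oO bO H1 hi H2 wh).
Qed.

Lemma sobolev_scalar_sqint k g : sobolev_scalar Omega k g -> sqint g.
Proof. by move=> [/(sL2P oO bO)]. Qed.

Lemma sobolev_scalarW k1 k2 g : (k1 <= k2)%N ->
  sobolev_scalar Omega k2 g -> sobolev_scalar Omega k1 g.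
Proof. by move=> k12 [g2 H]; split => // a ak; apply: H; exact: leq_trans k12. Qed.

Lemma sobolev_scalarD k (c : R) g1 g2 : sobolev_scalar Omega k g1 -> sobolev_scalar Omega k g2 ->
  sobolev_scalar Omega k (fun x => g1 x + c * g2 x).
Proof.
move=> H1 H2; have s1 := sobolev_scalar_sqint H1; have s2 := sobolev_scalar_sqint H2.
split; first by apply/(sL2P oO bO); apply: sqintD => //; exact: sqintZ.
move=> a ak; have [h1i w1] := wD_spec H1 ak; have [h2i w2] := wD_spec H2 ak.
exists (fun x => wD Omega a g1 x + c * wD Omega a g2 x).
  by apply/(sL2P oO bO); apply: sqintD => //; exact: sqintZ.
apply: weak_derivativeD => //; try exact: sqintZ.
exact: weak_derivativeZ.
Qed.

Lemma sobolev_scalar1 g (h : 'I_d -> 'cV[R]_d -> R) : sqint g -> (forall j, sqint (h j)) ->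
  (forall j, weak_derivative Omega (unit_index j) g (h j)) -> sobolev_scalar Omega 1 g.
Proof.
move=> gi hi wh; split; first exact/(sL2P oO bO).
move=> a; rewrite leq_eqVlt ltnS leqn0 => /orP[/eqP/unit_indexP[j ->]|/eqP a0].
  by exists (h j) => //; apply/(sL2P oO bO).
by exists g; [apply/(sL2P oO bO)|exact: weak_derivative0].
Qed.

Section form.
Context {N : nat}.
Implicit Types v w : 'cV[R]_d -> 'cV[R]_N.

Lemma sobolev_sqint l v i j : sobolev Omega l v -> sqint (fun x => v x i j).
Proof. by move=> sv; rewrite ord1; exact: (sobolev_scalar_sqint (sv i)). Qed.

Lemma wDv_sqint l a v i j : sobolev Omega l v -> (\sum_i a i <= l)%N ->
  sqint (fun x => wDv Omega a v x i j).
Proof.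
by move=> sv al; under eq_fun do rewrite mxE; exact: (wD_sqint (sv i)).
Qed.

Lemma wgrad_sqint v i j : sobolev Omega 1 v -> sqint (fun x => wgrad Omega v x i j).
Proof.
move=> sv; under eq_fun do rewrite mxE.
by apply: (wD_sqint (sv i)); rewrite sum_unit_index.
Qed.

Lemma sobolevB l v w : sobolev Omega l v -> sobolev Omega l w ->
  sobolev Omega l (fun x => v x - w x).
Proof.
move=> sv sw i; rewrite /component.
under eq_fun do rewrite mxE [X in _ + X]mxE -mulN1r.
exact: (sobolev_scalarD (-1) (sv i) (sw i)).
Qed.

Lemma sobolevW k1 k2 v : (k1 <= k2)%N -> sobolev Omega k2 v -> sobolev Omega k1 v.
Proof. by move=> k12 sv i; exact: (sobolev_scalarW k12 (sv i)). Qed.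

Lemma sobolev_integrand_intg l v w : sobolev Omega l v -> sobolev Omega l w ->
  intg (fun x => \sum_(a : {ffun 'I_d -> 'I_l.+1} | (\sum_i a i == l)%N)
       ip (wDv Omega (fun i => a i : nat) v x) (wDv Omega (fun i => a i : nat) w x)
     + ip (v x) (w x)).
Proof.
move=> sv sw; apply: intgD => //.
  apply: intg_sum => // a /eqP al; apply: sqint_ip => // i j; apply: wDv_sqint => //; exact: eq_leq.
by apply: sqint_ip => // i j; exact: sobolev_sqint.
Qed.

Lemma sobolev_form_ge0 l v : 0 <= sobolev_form Omega l v v.
Proof.
apply: Rintegral_ge0 => x _; apply: addr_ge0; last exact: ip_ge0.
by apply: sumr_ge0 => a _; exact: ip_ge0.
Qed.

Lemma sobolev_norm_sqr l v : sobolev_norm Omega l v ^+ 2 = sobolev_form Omega l v v.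
Proof. by rewrite sqr_sqrtr// sobolev_form_ge0. Qed.

Lemma sobolev_form_ge_sqr v i : sobolev Omega 1 v ->
  \int[leb d]_(x in Omega) (v x i 0) ^+ 2 <= sobolev_form Omega 1 v v.
Proof.
move=> sv; apply: le_Rintegral => //.
- exact: (sobolev_sqint i 0 sv).2.
- exact: sobolev_integrand_intg.
- move=> x _; apply: (@le_trans _ _ (ip (v x) (v x))).
    by rewrite -enorm_sqr -(real_normK (num_real _)) lerXn2r ?nnegrE ?enorm_ge0// coord_le_enorm.
  by rewrite lerDr; apply: sumr_ge0 => a _; exact: ip_ge0.
Qed.

Lemma sobolev_form_ge_wD v i j : sobolev Omega 1 v ->
  \int[leb d]_(x in Omega) (wD Omega (unit_index j) (component i v) x) ^+ 2 <= sobolev_form Omega 1 v v.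
Proof.
move=> sv; apply: le_Rintegral => //.
- by apply: (wD_sqint (sv i) _).2; rewrite sum_unit_index.
- exact: sobolev_integrand_intg.
- move=> x _; pose a : {ffun 'I_d -> 'I_2} := [ffun i => inord (i == j)].
  have aE : (fun i => a i : nat) = unit_index j.
    by apply/funext => k; rewrite /a ffunE inordK// /unit_index; case: (_ == _).
  have a1 : ((\sum_i a i)%N == 1%N) by apply/eqP; have := sum_unit_index j; rewrite -aE.
  rewrite (bigD1 a)//= aE -addrA.
  apply: (@le_trans _ _ (ip (wDv Omega (unit_index j) v x) (wDv Omega (unit_index j) v x))).
    have := coord_le_enorm (wDv Omega (unit_index j) v x) i 0; rewrite mxE => H.
    by rewrite -enorm_sqr -(real_normK (num_real _)) lerXn2r ?nnegrE ?enorm_ge0.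
  rewrite lerDl; apply: addr_ge0; last exact: ip_ge0.
  by apply: sumr_ge0 => b _; exact: ip_ge0.
Qed.

Lemma sobolev_norm_cvg (v_ : nat -> 'cV[R]_d -> 'cV[R]_N) v : (forall m, sobolev Omega 1 (v_ m)) ->
  sobolev Omega 1 v ->
  (fun m => sobolev_norm Omega 1 (fun x => v_ m x - v x)) @ \oo --> (0 : R) ->
  (forall i, cvg_sq (fun m x => v_ m x i 0) (fun x => v x i 0)) /\
  (forall i j, cvg_sq (fun m => wD Omega (unit_index j) (component i (v_ m)))
                 (wD Omega (unit_index j) (component i v))).
Proof.
move=> sv_ sv c0; have sB m := sobolevB (sv_ m) sv.
have {}c0 : (fun m => sobolev_form Omega 1 (fun x => v_ m x - v x) (fun x => v_ m x - v x)) @ \oo --> (0 : R).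
  rewrite (_ : (fun m => _) = (fun m => sobolev_norm Omega 1 (fun x => v_ m x - v x) *
      sobolev_norm Omega 1 (fun x => v_ m x - v x))); last first.
    by apply/funext => m; rewrite -sobolev_norm_sqr expr2.
  have := cvgM c0 c0; rewrite mulr0; exact.
split => [i|i j].
- apply: (@squeeze_cvgr _ _ _ _ (fun=> 0) (fun m => sobolev_form Omega 1 (fun x => v_ m x - v x) (fun x => v_ m x - v x)));
    [|exact: cvg_cst|exact: c0].
  apply: nearW => m; rewrite Rintegral_ge0/=; last by move=> x _; exact: sqr_ge0.
  have := sobolev_form_ge_sqr i (sB m).
  by under eq_Rintegral do rewrite mxE [X in _ + X]mxE.
- apply: (@squeeze_cvgr _ _ _ _ (fun=> 0) (fun m => sobolev_form Omega 1 (fun x => v_ m x - v x) (fun x => v_ m x - v x)));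
    [|exact: cvg_cst|exact: c0].
  apply: nearW => m; rewrite Rintegral_ge0/=; last by move=> x _; exact: sqr_ge0.
  apply: le_trans (sobolev_form_ge_wD i j (sB m)).
  have u1 : (\sum_i unit_index j i <= 1)%N by rewrite sum_unit_index.
  have [h1 w1] := wD_spec (sv_ m i) u1; have [h2 w2] := wD_spec (sv i) u1.
  have [h3 w3] := wD_spec (sB m i) u1.
  have s1 : sqint (fun x => v_ m x i 0) by exact: (sobolev_scalar_sqint (sv_ m i)).
  have s2 : sqint (fun x => v x i 0) by exact: (sobolev_scalar_sqint (sv i)).
  have w4 := weak_derivativeD s1 (sqintZ mO (-1) s2) h1 (sqintZ mO (-1) h2) w1
     (weak_derivativeZ (-1) s2 h2 w2).
  have E : component i (fun x => v_ m x - v x) = (fun x => v_ m x i 0 + (-1) * v x i 0).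
    by apply/funext => x; rewrite /component mxE [X in _ + X]mxE mulN1r.
  rewrite E in w3 h3 *.
  (* [wD] selects one representative for each function, so it is additive almost everywhere only, by
     uniqueness of weak derivatives. *)
  have ae := weak_derivative_unique oO bO h3 (sqintD mO h1 (sqintZ mO (-1) h2)) w3 w4.
  rewrite le_eqVlt; apply/orP; left; apply/eqP/ae_eq_Rintegral => //.
  + exact: (intg_measurable (sqintB mO h1 h2).2).
  + by apply: measurable_funX; case: h3.
  + by apply: filterS ae => x /[apply] ->; rewrite mulN1r.
Qed.

End form.
End Sobolev_spaces.

(** * Conforming functions and the LDG gradient *)

Section conforming_functions.
Context {R : realType} {d : nat}.
Variables (Omega : set 'cV[R]_d) (M : mesh R d).
Hypotheses (d0 : (0 < d)%N) (cm : conforming_mesh_of M Omega).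
Hypotheses (oO : open Omega) (bO : bounded_set Omega) (lO : lipschitz_boundary Omega).
Let mO : measurable Omega := open_measurable_mx oO.
Let muO : (leb d Omega < +oo)%E := leb_bounded mO bO.
Notation intg := (intg (leb d) Omega).
Notation sqint := (sqint (leb d) Omega).

Lemma open_simplex_sub (k : 'I_(nelt M)) : open_simplex (vtx k) `<=` Omega.
Proof.
apply: (lipschitz_boundary_interior lO); first exact: open_open_simplex.
have [_ -> _] := cm => x xk; exists k => //.
exact: (open_simplex_hull (mesh_unitmx cm k)).
Qed.

Lemma broken_fun_continuous (v : broken M R) (k : 'I_(nelt M)) x : (forall k, continuous (v k)) ->
  open_simplex (vtx k) x -> {for x, continuous (broken_fun v)}.
Proof.
move=> cv xk.
have E y : open_simplex (vtx k) y -> v k y = broken_fun v y.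
  by move=> yk; rewrite (broken_fun_open cm _ yk).
have K := @cvg_open_eq _ _ _ (v k) (broken_fun v) x (@open_open_simplex R d (vtx k)) xk E (cv k x).
exact: K.
Qed.

Definition broken_partial (j : 'I_d) (v : broken M R) : broken M R := fun k => partial j (v k).

Variables (l : nat) (v : broken M R).
Hypothesis pv : Sp l v.

Lemma Sp_broken_partial j : Sp l (broken_partial j v).
Proof. by move=> k; exact: polynomial_fun_partial. Qed.

(** Inside each open simplex the function is a polynomial and the two derivatives agree; what is
    left of [Omega] lies on element boundaries and is a null set. *)
Lemma weak_derivative_broken j h : sqint h -> weak_derivative Omega (unit_index j) (broken_fun v) h ->
  {ae leb d, forall x, Omega x -> h x = broken_fun (broken_partial j v) x}.
Proof.
move=> hi wh.
have H : \forall x \ae leb d, forall k : 'I_(nelt M), open_simplex (vtx k) x -> h x = partial j (v k) x.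
  apply: filter_forall => k.
  apply: (weak_derivative_classical oO bO (@open_open_simplex R d (vtx k)) (@open_simplex_sub k)
     _ _ _ _ _ wh).
  - by move=> x xk; rewrite (broken_fun_open cm _ xk).
  - by move=> x; exact: (polynomial_fun_differentiable _ (pv k)).
  - exact: (polynomial_fun_continuous (polynomial_fun_partial j (pv k))).
  - have [C HC] := continuous_bounded_on bO (polynomial_fun_continuous (polynomial_fun_partial j (pv k))).
    by exists C => x xk; apply: HC; move: xk; exact: open_simplex_sub.
  - exact: sqint_intg.
apply: filterS2 H (ae_open_simplex d0 cm) => x H1 H2 /H2[k xk].
by rewrite (H1 k xk) (broken_fun_open cm _ xk).
Qed.

Hypothesis sv : sobolev_scalar Omega 1 (broken_fun v).

Lemma wD_broken j : {ae leb d, forall x, Omega x ->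
  wD Omega (unit_index j) (broken_fun v) x = broken_fun (broken_partial j v) x}.
Proof.
have u1 : (\sum_i unit_index j i <= 1)%N by rewrite sum_unit_index.
by apply: weak_derivative_broken; [exact: (wD_sqint oO bO sv u1)|exact: (wD_weak_derivative oO bO sv u1)].
Qed.

Lemma broken_partial_bounded : exists2 C, 0 <= C & forall j x, Omega x -> `|broken_fun (broken_partial j v) x| <= C.
Proof.
pose C j := projT1 (cid (broken_fun_bounded cm bO (Sp_continuous (@Sp_broken_partial j)))).
have HC j x : Omega x -> `|broken_fun (broken_partial j v) x| <= C j.
  by rewrite /C; case: cid => ? /= H; exact: H.
exists (\sum_j `|C j|) => [|j x Ox]; first by apply: sumr_ge0.
rewrite (bigD1 j)//= (le_trans (HC j x Ox))// (le_trans (ler_norm _))// lerDl.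
by apply: sumr_ge0.
Qed.

(** The bound compares points of different elements: the weak derivative does not see the facets
    between them and is bounded by the elementwise derivatives. The end points are taken inside
    elements, where the function is continuous, and [C] depends neither on the ball nor on the
    points. *)
Lemma conforming_lipschitz : exists2 C, 0 <= C & forall j y r x t, ball y r `<=` Omega -> 0 < t ->
  ball y r x -> ball y r (x + t *: basis_vec j) ->
  (exists k : 'I_(nelt M), open_simplex (vtx k) x) ->
  (exists k : 'I_(nelt M), open_simplex (vtx k) (x + t *: basis_vec j)) ->
  `|broken_fun v (x + t *: basis_vec j) - broken_fun v x| <= t * C.
Proof.
have [C C0 HC] := broken_partial_bounded.
exists C => // j y r x t bO' t0 bx bxt [k xk] [k' xk'].
have u1 : (\sum_i unit_index j i <= 1)%N by rewrite sum_unit_index.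
apply: (@weak_lipschitz_pointwise _ _ Omega oO bO (broken_fun v) (wD Omega (unit_index j) (broken_fun v)) j y x r t C) => //.
- exact: (sqint_intg mO muO (sobolev_scalar_sqint oO bO sv)).
- exact: (sqint_intg mO muO (wD_sqint oO bO sv u1)).
- exact: (wD_weak_derivative oO bO sv u1).
- by apply: filterS (wD_broken j) => z H Oz; rewrite H//; exact: HC.
- exact: (broken_fun_continuous (Sp_continuous pv) xk).
- exact: (broken_fun_continuous (Sp_continuous pv) xk').
Qed.

(** The two traces at [x0] are compared with the values at [x0 - t e_j] and [x0 + t e_j], which
    differ by at most [2 t C]; each polynomial is continuous up to [x0], and [t] tends to 0. *)
Lemma facet_continuity x0 r j (ka kb : 'I_(nelt M)) : 0 < r -> ball x0 r `<=` Omega ->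
  (forall t, 0 < t < r -> open_simplex (vtx ka) (x0 - t *: basis_vec j)) ->
  (forall t, 0 < t < r -> open_simplex (vtx kb) (x0 + t *: basis_vec j)) ->
  v ka x0 = v kb x0.
Proof.
move=> r0 bO' Ha Hb; have [C C0 HC] := conforming_lipschitz.
apply/eqP; rewrite -subr_eq0 -normr_le0; apply/ler_addgt0Pr => e e0; rewrite add0r.
have e3 : 0 < e / 3 by rewrite divr_gt0.
have cl (k : 'I_(nelt M)) (c : R) : \forall t \near (0 : R)^'+, `|v k x0 - v k (x0 + (c * t) *: basis_vec j)| <= e / 3.
  have ct : (fun t : R => x0 + (c * t) *: basis_vec j) @ (0 : R)^'+ --> x0.
    apply: cvg_at_right_filter.
    have -> : x0 = x0 + (c * 0) *: basis_vec j by rewrite mulr0 scale0r addr0.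
    apply: cvgD; first by rewrite mulr0 scale0r addr0; exact: cvg_cst.
    apply: cvgZl; apply: cvgMr; exact: cvg_id.
  have cv : (fun t : R => v k (x0 + (c * t) *: basis_vec j)) @ (0 : R)^'+ --> v k x0.
    by apply: continuous_cvg ct; exact: (polynomial_fun_continuous (pv k)).
  by apply: filterS (cvgr_dist_le _ _ cv _ e3) => t.
have Ca := cl ka (-1); have Cb := cl kb 1.
have C1 : 0 < 2 * C + 1 by rewrite ltr_wpDl ?mulr_ge0.
have q0 : 0 < e / 3 / (2 * C + 1) by rewrite divr_gt0.
near (0 : R)^'+ => t.
have t0 : 0 < t by near: t; exact: nbhs_right_gt.
have tr : t < r by near: t; exact: nbhs_right_lt.
have tC : (t + t) * C <= e / 3.
  have -> : (t + t) * C = t * (2 * C) by ring.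
  apply: (@le_trans _ _ (t * (2 * C + 1))); first by rewrite ler_pM2l// lerDl.
  rewrite -ler_pdivlMr//; apply: ltW; near: t; exact: nbhs_right_lt.
have ht : 0 < t < r by rewrite t0.
have := HC j x0 r (x0 - t *: basis_vec j) (t + t) bO'.
rewrite scalerDl addrA subrK.
rewrite (broken_fun_open cm _ (Ha t ht)) (broken_fun_open cm _ (Hb t ht)).
move=> /(_ (addr_gt0 t0 t0)).
have A1 : `|v ka x0 - v ka (x0 - t *: basis_vec j)| <= e / 3.
  by rewrite -[t in x0 - t *: _]mul1r -scaleNr -mulNr; near: t; exact: Ca.
have B1 : `|v kb x0 - v kb (x0 + t *: basis_vec j)| <= e / 3.
  by rewrite -[t in x0 + t *: _]mul1r; near: t; exact: Cb.
move=> H0.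
have Bx : ball x0 r (x0 - t *: basis_vec j) /\ ball x0 r (x0 + t *: basis_vec j).
  have nb : `|t *: basis_vec j : 'cV[R]_d| < r.
    rewrite normrZ gtr0_norm//; apply: le_lt_trans tr; apply: ler_piMr; first exact: ltW.
    exact: norm_basis_vec_le1.
  rewrite -ball_normE /ball_/= !opprD !addrA !subrr !sub0r opprK normrN.
  by [].
have := H0 Bx.1 Bx.2 (ex_intro _ ka (Ha t ht)) (ex_intro _ kb (Hb t ht)).
move: A1 B1 tC; rewrite !ler_norml.
move: (v ka x0) (v kb x0) (v ka _) (v kb _) => a b a' b'.
clear; move: ((t + t) * C) => q; move=> /andP[? ?] /andP[? ?] ? /andP[? ?].
by apply/andP; split; lra.
Unshelve. all: by end_near. Qed.

(** It suffices to argue at points [x0] arbitrarily close to [y], in the relative interior of the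
    facet, where the two elements fill a neighbourhood up to the hyperplane of the facet. A
    coordinate direction transversal to that hyperplane then leads into one element forwards and
    into the other backwards. *)
Lemma interior_facet_eq (k1 k2 : 'I_(nelt M)) i y : is_interior_facet k1 i k2 ->
  hull (vtx k1) [set j | j != i] y -> v k1 y = v k2 y.
Proof.
move=> [k12 E] hy.
have [_ clO mI] := cm.
have k12' : k1 != k2 by apply/eqP => k; rewrite k ltnn in k12.
have [I1 [I2 [_ I2n _ E2]]] := mI _ _ k12'.
have U1 := mesh_unitmx cm k1; have U2 := mesh_unitmx cm k2.
apply/eqP; rewrite -subr_eq0 -normr_le0; apply/ler_addgt0Pr => e e0; rewrite add0r.
have cB : v k1 z - v k2 z @[z --> y] --> v k1 y - v k2 y.
  have c1 := polynomial_fun_continuous (pv k1); have c2 := polynomial_fun_continuous (pv k2).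
  exact: (cvgB (c1 y) (c2 y)).
have : \forall z \near y, `|(v k1 y - v k2 y) - (v k1 z - v k2 z)| <= e.
  exact: (cvgr_dist_le _ _ cB _ e0).
move=> /nbhs_ballP[r /= r0 Hr].
have [x0 [bx0 b0 /nbhs_ballP[r' /= r'0 Hr']]] := facet_neighbourhood d0 U1 U2 E E2 I2n hy r0.
suff : v k1 x0 = v k2 x0 by move=> Ex; have := Hr _ bx0; rewrite Ex subrr subr0.
(* The gradient of the coordinate that vanishes on the facet is nonzero, so some coordinate
   direction is transversal. *)
have [j cj] : exists j, bary_row (vtx k1) i 0 j != 0.
  apply: contrapT => nj; have := bary_row_neq0 U1 i d0; apply/negP/negPn/eqP/rowP => j.
  by rewrite mxE; apply/eqP/negPn/negP => H; apply: nj; exists j.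
set c := bary_row _ _ _ _ in cj.
have bs z t : bary (vtx k1) i (z + t *: basis_vec j) = bary (vtx k1) i z + t * c.
  rewrite bary_shift; congr (_ + _ * _); rewrite mxE (bigD1 j)//= big1 => [|k kj].
    by rewrite addr0 coord_basis_vec eqxx mulr1.
  by rewrite coord_basis_vec (negbTE kj) mulr0.
(* Points off the hyperplane lie in one of the two open simplices; points on it are limits of such
   points, hence in the closure, and an open subset of the closure lies in [Omega]. *)
have bO' : ball x0 r' `<=` Omega.
  apply: (lipschitz_boundary_interior lO); first exact: ball_open.
  move=> z bz.
  have HO z' : ball x0 r' z' -> bary (vtx k1) i z' != 0 -> Omega z'.
    move=> /Hr'[H1 H2]; rewrite neq_lt => /orP[/H2|/H1]; exact: open_simplex_sub.
  have [bz0|bz0] := eqVneq (bary (vtx k1) i z) 0; last by apply: subset_closure; exact: HO.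
  move=> B nB.
  have cz : (fun t : R => z + t *: basis_vec j) @ (0 : R)^' --> z.
    apply: cvg_within_filter.
    have H0 : (fun t : R => z + t *: basis_vec j) @ (0 : R) --> z + (0 : R) *: basis_vec j.
      by apply: cvgD; [exact: cvg_cst|apply: cvgZl; exact: cvg_id].
    by rewrite scale0r addr0 in H0.
  have nb : nbhs z (ball x0 r') by apply: open_nbhs_nbhs; split => //; exact: ball_open.
  have C1 := cz _ nB; have C2 := cz _ nb.
  near (0 : R)^' => t.
  have t0 : t != 0 by near: t; exact: nbhs_dnbhs_neq.
  exists (z + t *: basis_vec j); split; last by near: t; exact: C1.
  apply: HO; first by near: t; exact: C2.
  by rewrite bs bz0 add0r mulf_neq0.
have bt t : `|t| < r' -> ball x0 r' (x0 + t *: basis_vec j).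
  move=> tr; rewrite -ball_normE /ball_/= opprD addrA subrr sub0r normrN normrZ.
  apply: le_lt_trans tr; apply: ler_piMr => //.
  exact: norm_basis_vec_le1.
have btp t : 0 < t < r' -> ball x0 r' (x0 + t *: basis_vec j) /\ ball x0 r' (x0 - t *: basis_vec j).
  by move=> /andP[t0 tr]; rewrite -scaleNr; split; apply: bt; rewrite ?normrN gtr0_norm.
(* The sign of [c] tells whether [k1] is reached by moving forwards or backwards along
   [basis_vec j]. *)
move: cj; rewrite neq_lt => /orP[c0|c0].
- apply: (@facet_continuity x0 r' j k1 k2 r'0 bO') => t ht; have [/Hr'[A1 A2] /Hr'[B1 B2]] := btp _ ht.
    by apply: B1; rewrite -scaleNr bs b0 add0r nmulr_rgt0 ?oppr_lt0; case/andP: ht.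
  by apply: A2; rewrite bs b0 add0r nmulr_llt0; case/andP: ht.
- apply/esym; apply: (@facet_continuity x0 r' j k2 k1 r'0 bO') => t ht; have [/Hr'[A1 A2] /Hr'[B1 B2]] := btp _ ht.
    by apply: B2; rewrite -scaleNr bs b0 add0r pmulr_llt0 ?oppr_lt0; case/andP: ht.
  by apply: A1; rewrite bs b0 add0r pmulr_lgt0; case/andP: ht.
Unshelve. all: by end_near. Qed.

End conforming_functions.

(** * Facet integrals and the LDG gradient of conforming functions *)

Section facets.
Context {R : realType} {d : nat}.
Hypothesis d0 : (0 < d)%N.
Variable M : mesh R d.

Lemma facet_point (k : 'I_(nelt M)) (i : 'I_d.+1) (y : 'cV[R]_d.-1) : ref_simplex y ->
  hull (vtx k) [set j | j != i]
    (facet_vtx k i 0%N + (\matrix_(i', j) (facet_vtx k i j.+1 - facet_vtx k i 0%N) i' 0) *m y).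
Proof.
move=> [y0 y1].
pose L := [seq j <- enum 'I_d.+1 | j != i].
have uL : uniq L by rewrite filter_uniq// enum_uniq.
have sL : size L = d.
  rewrite size_filter; have := count_predC (pred1 i) (enum 'I_d.+1).
  by rewrite count_uniq_mem ?enum_uniq// mem_enum size_enum_ord add1n => -[].
(* Weight of the vertex in position [q] of the facet: the complement for position 0, a coordinate of
   [y] from position 1 on. The value 0 out of range only keeps [c] total. *)
pose c (q : nat) : R := if q is q'.+1 then
  (if insub q' is Some o then y o 0 else 0) else 1 - \sum_o y o 0.
have c0 q : 0 <= c q.
  case: q => [|q] /=; first by rewrite subr_ge0.
  by case: insubP => // o _ _; exact: y0.
have cS (o : 'I_d.-1) : c o.+1 = y o 0 by rewrite /= valK.
have sumL (V : nmodType) (F : nat -> 'I_d.+1 -> V) : \sum_(j | j != i) F (index j L) j =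
    F 0%N (nth ord0 L 0%N) + \sum_(q < d.-1) F q.+1 (nth ord0 L q.+1).
  transitivity (\sum_(j <- L) F (index j L) j).
    by rewrite /L big_filter big_enum_cond; apply: eq_bigl => j; rewrite inE.
  rewrite (big_nth ord0) sL.
  transitivity (\sum_(0 <= q < d.-1.+1) F q (nth ord0 L q)).
    rewrite prednK//; apply: eq_big_nat => q qd.
    by rewrite index_uniq// sL.
  by rewrite big_nat_recl// big_mkord.
have nthL q : (q < d)%N -> facet_vtx k i q = vtx k (nth ord0 L q).
  by move=> qd; rewrite /facet_vtx (nth_map ord0)// -/L sL.
have sumI (V : nmodType) (F : 'I_d.+1 -> V) : F i = 0 -> \sum_j F j = \sum_(j | j != i) F j.
  by move=> Fi; rewrite (bigD1 i)//= Fi add0r.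
exists (fun j => if j == i then 0 else c (index j L)); split.
- by move=> j; case: ifP.
- by move=> j /negP/negPn/eqP ->; rewrite eqxx.
- rewrite sumI ?eqxx//; under eq_bigr => j /negbTE -> do [].
  rewrite (sumL _ (fun q _ => c q)); under eq_bigr do rewrite cS.
  by rewrite subrK.
- rewrite sumI ?eqxx ?scale0r//; under eq_bigr => j /negbTE -> do [].
  rewrite (sumL _ (fun q j => c q *: vtx k j)); under eq_bigr do rewrite cS.
  rewrite -nthL// scalerBl scale1r -addrA; congr (_ + _).
  rewrite scaler_suml -sumrN -big_split/=; apply/colP => r; rewrite mxE summxE.
  apply: eq_bigr => o _; rewrite -nthL; last by rewrite -ltn_predRL.
  by rewrite !mxE; ring.
Qed.

Lemma facets_integral_eq0 (g : 'I_(nelt M) -> 'I_(nelt M) -> 'cV[R]_d -> R) :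
  (forall k1 i k2, is_interior_facet k1 i k2 ->
     forall y, hull (vtx k1) [set j | j != i] y -> g k1 k2 y = 0) ->
  facets_integral g = 0.
Proof.
move=> g0; rewrite /facets_integral big1// => k1 _; rewrite big1// => i _.
rewrite big1// => k2 /asboolP k12; rewrite /simplex_integral.
rewrite (_ : Rintegral _ _ _ = 0) ?mulr0//.
under eq_Rintegral => y yS.
  rewrite (g0 _ _ _ k12); last by apply: facet_point; move: yS; rewrite inE.
  over.
by rewrite /Rintegral integral0.
Qed.

Lemma facets_integral_ge0 (g : 'I_(nelt M) -> 'I_(nelt M) -> 'cV[R]_d -> R) :
  (forall k1 k2 y, 0 <= g k1 k2 y) -> 0 <= facets_integral g.
Proof.
move=> g0; apply: sumr_ge0 => k1 _; apply: sumr_ge0 => i _; apply: sumr_ge0 => k2 _.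
by rewrite mulr_ge0 ?sqrtr_ge0//; apply: Rintegral_ge0.
Qed.

End facets.

Lemma Rintegral_sqr_eq0 dT (X : measurableType dT) (R : realType)
    (mu : {measure set X -> \bar R}) (D : set X) (f : X -> R) : measurable D ->
  intg mu D f -> (forall x, D x -> 0 <= f x) -> \int[mu]_(x in D) f x = 0 ->
  {ae mu, forall x, D x -> f x = 0}.
Proof.
move=> mD fi f0 I0.
have mf := measurable_int mu fi.
have E : (\int[mu]_(x in D) `|(EFin \o f) x| = \int[mu]_(x in D) (f x)%:E)%E.
  by apply: eq_integral => x xD; rewrite /= ger0_norm//; apply: f0; move: xD; rewrite inE.
have Z : (\int[mu]_(x in D) `|(EFin \o f) x| = 0)%E.
  have := fineK (integrable_fin_num mD fi); rewrite E => <-.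
  by move: I0; rewrite /Rintegral => ->.
have [H _] := ae_eq_integral_abs mu mD mf.
by apply: filterS (H Z) => x /[apply] -[].
Qed.

Section LDG_gradient.
Context {R : realType} {d : nat}.
Variables (Omega : set 'cV[R]_d) (p : nat) (S : discretization R d).
Hypotheses (d0 : (0 < d)%N) (hS : discretization_of Omega p S).
Hypotheses (oO : open Omega) (bO : bounded_set Omega) (lO : lipschitz_boundary Omega).
Let mO : measurable Omega := open_measurable_mx oO.
Let muO : (leb d Omega < +oo)%E := leb_bounded mO bO.
Let cm := disc_mesh hS.
Notation intg := (intg (leb d) Omega).
Notation sqint := (sqint (leb d) Omega).

Lemma Sp_mx_sqint m n (v : broken S 'M[R]_(m, n)) i j : Sp_mx p v ->
  sqint (fun x => broken_fun v x i j).
Proof.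
move=> pv; under eq_fun do rewrite broken_fun_coord.
exact: (broken_fun_sqint cm oO bO (Sp_continuous (pv i j))).
Qed.

Lemma polynomial_funB g h : polynomial_fun p g -> polynomial_fun p h ->
  polynomial_fun p (fun x : 'cV[R]_d => g x - h x).
Proof.
move=> pg ph; under eq_fun do rewrite -mulN1r.
by apply: polynomial_funD => //; exact: polynomial_funZ.
Qed.

(** Without jumps the facet term vanishes. The elementwise gradient belongs to the discrete space,
    so the difference of the two gradients is an admissible test function, and its norm comes out as
    zero. *)
Lemma ldg_gradE (lam : broken S R) : Sp p lam ->
  (forall k1 i k2, is_interior_facet k1 i k2 ->
     forall y, hull (vtx k1) [set j | j != i] y -> lam k1 y = lam k2 y) ->
  {ae leb d, forall x, Omega x ->
    forall j, broken_fun (ldg_grad lam) x 0 j = broken_fun (broken_grad lam) x 0 j}.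
Proof.
move=> pl jl; have [pG EG] := disc_ldg hS pl.
pose th : broken S 'rV[R]_d := fun k x => ldg_grad lam k x - broken_grad lam k x.
have pB : Sp_mx p (broken_grad lam).
  move=> i j k; rewrite /broken_grad.
  rewrite (_ : (fun x => _) = partial j (lam k)); last by apply/funext => x; rewrite !mxE.
  exact: polynomial_fun_partial.
have pth : Sp_mx p th.
  move=> i j k; rewrite /th.
  rewrite (_ : (fun x => _) = fun x => ldg_grad lam k x i j - broken_grad lam k x i j).
    by apply: polynomial_funB; [exact: pG|exact: pB].
  by apply/funext => x; rewrite mxE [X in _ + X]mxE.
have E := EG th pth.
rewrite facets_integral_eq0 ?subr0 in E; last first.
- by move=> k1 i k2 k12 y yf; rewrite (jl _ _ _ k12 _ yf) subrr scale0r ipE big1// => a _; rewrite big1// => b _; rewrite mxE mul0r.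
- exact: d0.
have sG i j := Sp_mx_sqint i j pG; have sB i j := Sp_mx_sqint i j pB.
have sth i j := Sp_mx_sqint i j pth.
have I0 : \int[leb d]_(x in Omega) ip (broken_fun th x) (broken_fun th x) = 0.
  rewrite -[RHS](subrr (\int[leb d]_(x in Omega) ip (broken_fun (ldg_grad lam) x) (broken_fun th x))).
  rewrite [in X in _ - X]E -RintegralB//; [|exact: sqint_ip..].
  by apply: eq_Rintegral => x _; rewrite -ipBl -broken_funB.
have := Rintegral_sqr_eq0 mO (sqint_ip oO bO sth sth) (fun x _ => ip_ge0 _) I0.
apply: filterS => x /[apply] I1 j.
have : enorm (broken_fun th x) = 0 by rewrite /enorm I1 sqrtr0.
have := coord_le_enorm (broken_fun th x) 0 j => + e0; rewrite e0 normr_le0.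
by rewrite /th broken_funB mxE [X in _ + X]mxE subr_eq0 => /eqP.
Qed.

Lemma ldg_conforming l (lam : broken S R) : Sp p lam -> Sp_cont Omega l lam ->
  {ae leb d, forall x, Omega x ->
    forall j, broken_fun (ldg_grad lam) x 0 j = wD Omega (unit_index j) (broken_fun lam) x}.
Proof.
move=> pl [ll sl].
have H1 := ldg_gradE pl (fun k1 i k2 k12 y => @interior_facet_eq _ _ _ _ d0 cm oO bO lO l lam ll sl k1 k2 i y k12).
have H2 : \forall x \ae leb d, forall j, Omega x -> wD Omega (unit_index j) (broken_fun lam) x = broken_fun (broken_partial j lam) x.
  by apply: filter_forall => j; exact: (wD_broken d0 cm oO bO lO ll sl j).
apply: filterS2 H1 H2 => x h1 h2 Ox j; rewrite h1// h2// broken_fun_coord.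
congr (broken_fun _ x); apply/funext => k; apply/funext => y.
by rewrite /broken_grad !mxE.
Qed.

Lemma conforming_jump_integral N l (w lam : broken S 'cV[R]_N) (c : 'I_(nelt S) -> 'I_(nelt S) -> R) :
  (forall i, Sp_cont Omega l (bcomp i lam)) ->
  facets_integral (fun (k1 k2 : 'I_(nelt S)) x => c k1 k2 * ip (jump w k1 k2 x) (jump lam k1 k2 x)) = 0.
Proof.
move=> cl; apply: facets_integral_eq0 => // k1 i k2 k12 y yf.
have -> : jump lam k1 k2 y = 0.
  rewrite /jump (_ : lam k1 y = lam k2 y) ?subrr ?mul0mx//.
  apply/colP => a; have [la sa] := cl a.
  exact: (@interior_facet_eq _ _ _ _ d0 cm oO bO lO l _ la sa k1 k2 i y k12 yf).
by rewrite ipE big1 ?mulr0// => a _; rewrite big1// => b _; rewrite [X in _ * X]mxE mulr0.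
Qed.

End LDG_gradient.

(** * Chain rule *)

Lemma derive_cvg_seq (R : realType) (V W : normedModType R) (f : V -> W) (x v : V) (a : R ^nat) :
  derivable f x v -> (forall n, a n != 0) -> a @ \oo --> (0 : R) ->
  (fun n => (a n)^-1 *: (f (x + a n *: v) - f x)) @ \oo --> 'D_v f x.
Proof.
move=> df a0 ca.
have cd : a @ \oo --> (0 : R)^'.
  move=> P /= H; have K : \forall n \near \oo, a n != 0 -> P (a n) by exact: (ca _ H).
  by apply: filterS K => n; apply; exact: a0.
have H := cvg_comp _ _ cd df; rewrite /derive.
apply: cvg_trans H; apply: near_eq_cvg; near=> n.
by rewrite /= [_ *: v + x]addrC.
Unshelve. all: by end_near. Qed.

(** A Lebesgue number for the compact set. *)
Lemma compact_ball_subset (R : realType) n (K O : set 'cV[R]_n) : compact K -> open O -> K `<=` O ->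
  exists2 r : R, 0 < r & forall x, K x -> ball x r `<=` O.
Proof.
move=> cK oO KO.
have H : \forall r \near (0 : R)^'+, forall x, K x -> ball x r `<=` O.
  move/compact_near_coveringP : cK => /(_ _ (0 : R)^'+ (fun r x => ball x r `<=` O)); apply => x Kx.
  have [e /= e0 xe] := (nbhs_ballP _ _).1 (open_nbhs_nbhs (conj oO (KO _ Kx))).
  have e2 : 0 < e / 2 by rewrite divr_gt0.
  exists (ball x (e / 2), [set r : R | r < e / 2]).
    by split; [exact: nbhsx_ballx|exact: nbhs_right_lt].
  move=> [y r] /= [xy re] z yz; apply: xe; rewrite [e]splitr.
  by apply: ball_triangle xy _; apply: le_ball yz; exact: ltW.
near (0 : R)^'+ => r; exists r; first by near: r; exact: nbhs_right_gt.
by near: r.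
Unshelve. all: by end_near. Qed.

Lemma ae_shift (R : realType) n (P : set 'cV[R]_n) (v : 'cV[R]_n) :
  {ae leb n, forall x, P x} -> {ae leb n, forall x, P (x + v)}.
Proof.
move=> [B [mB B0 PB]]; exists ((fun x => x + v) @^-1` B); split.
- by rewrite -[X in measurable X]setTI; exact: measurable_shift.
- by rewrite leb_shift.
- by move=> x nP; apply: PB.
Qed.

Section difference_quotients.
Context {R : realType} {d : nat}.
Variable Omega : set 'cV[R]_d.
Hypotheses (oO : open Omega) (bO : bounded_set Omega).
Let mO : measurable Omega := open_measurable_mx oO.
Let muO : (leb d Omega < +oo)%E := leb_bounded mO bO.
Notation intg := (intg (leb d) Omega).
Variables (g h : 'cV[R]_d -> R) (j : 'I_d) (B C : R).
Hypotheses (C0 : 0 <= C) (mg : measurable_fun setT g) (gB : forall x, `|g x| <= B).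
Hypothesis ih : intg h.
Let mh : measurable_fun Omega h := intg_measurable ih.
Local Notation e := (basis_vec j : 'cV[R]_d).
Hypothesis gh : {ae leb d, forall x, Omega x -> derivable g x e /\ 'D_e g x = h x}.
Hypothesis gC : forall t, 0 < t ->
  {ae leb d, forall x, forall r, t < r -> ball x r `<=` Omega -> `|g (x + t *: e) - g x| <= t * C}.

(** Summation by parts: translation invariance moves the difference quotient from [phi] to [g] with
    opposite sign. Both sides converge by dominated convergence, on the left because [phi] is
    smooth, on the right because the Lipschitz bound dominates the quotients of [g]. *)
Lemma weak_derivative_difference_quotient : weak_derivative Omega (unit_index j) g h.
Proof.
move=> phi tp; rewrite multi_partial_unit sum_unit_index expr1 mulN1r.
have [sphi cphi sO] := tp.
have [r r0 Kr] := compact_ball_subset cphi oO sO.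
(* Steps below [r], so that translating the support of [phi] by them stays in [Omega]. *)
pose a n : R := r / 2 * n.+1%:R^-1.
have r2 : 0 < r / 2 by rewrite divr_gt0.
have a0 n : 0 < a n by rewrite divr_gt0.
have an0 n : a n != 0 by rewrite gt_eqF.
have ar n : a n < r.
  apply: (@le_lt_trans _ _ (r / 2)); last by rewrite ltr_pdivrMr// ltr_pMr// ltr1n.
  by rewrite ler_piMr ?invf_le1 ?ler1n ?ltr0n// ltW.
have ca : a @ \oo --> (0 : R).
  by rewrite -[X in _ --> X](mulr0 (r / 2)); apply: cvgMr; exact: cvg_harmonic.
have [M HM] := test_function_bounded (test_function_partial j tp).
have [M0 HM0] := test_function_bounded tp.
have mphi : measurable_fun setT phi by apply: continuous_measurable_mx; exact: smooth_continuous.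
have mgO : measurable_fun Omega g by apply: measurable_funTS.
pose q n (x : 'cV[R]_d) := (phi x - phi (x - a n *: e)) / a n.
have mphiS (v : 'cV[R]_d) : measurable_fun setT (fun x : 'cV[R]_d => phi (x + v)).
  by apply: (measurableT_comp mphi); exact: measurable_shift.
have mq n : measurable_fun Omega (q n).
  apply: measurable_funM => //; apply: measurable_funB; first exact: measurable_funTS.
  by apply: measurable_funTS; exact: mphiS.
have qM n x : `|q n x| <= M.
  have [s _|b _] := @mvt_line R d phi (x - a n *: e) e (a n) (a0 n).
    exact: smooth_differentiable.
  by rewrite subrK /q => ->; rewrite mulrAC mulfV// mul1r; exact: HM.
have qc x : q n x @[n --> \oo] --> partial j phi x.
  have nan n : - a n != 0 by rewrite oppr_eq0.
  have cna : (fun n => - a n) @ \oo --> (0 : R) by rewrite -oppr0; apply: cvgN.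
  have dphi : derivable phi x e by apply: diff_derivable; exact: smooth_differentiable.
  have H := derive_cvg_seq dphi nan cna.
  rewrite (_ : (fun n => q n x) = (fun n => (- a n)^-1 *: (phi (x + - a n *: e) - phi x)))//.
  apply/funext => n; by rewrite /q invrN scaleNr -scalerN opprB (scaleNr (a n)) [RHS]mulrC.
have L1 : (fun n => \int[leb d]_(x in Omega) (g x * q n x)) @ \oo -->
    \int[leb d]_(x in Omega) (g x * partial j phi x).
  apply: (@dominated_Rintegral _ _ _ _ _ mO _ _ (fun=> B * M)).
  - by move=> n; exact: measurable_funM.
  - apply: measurable_funM => //; apply: test_function_measurable => //; exact: test_function_partial tp.
  - exact: intg_cst.
  - by apply: nearW => x Ox; apply: cvgMr; exact: qc.
  - by apply: nearW => x n Ox; rewrite normrM ler_pM.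
pose p n (x : 'cV[R]_d) := (g x - g (x + a n *: e)) / a n * phi x.
have supp n x : phi x != 0 -> Omega (x + a n *: e).
  move=> px; apply: (Kr x); first exact: subset_closure.
  rewrite -ball_normE /ball_/= opprD addrA subrr sub0r normrN normrZ gtr0_norm//.
  apply: le_lt_trans (ar n); apply: ler_piMr; first exact: ltW.
  exact: norm_basis_vec_le1.
have E n : \int[leb d]_(x in Omega) (g x * q n x) = \int[leb d]_(x in Omega) p n x.
  have mgS : measurable_fun setT (fun x : 'cV[R]_d => g (x + a n *: e)).
    by apply: (measurableT_comp mg); exact: measurable_shift.
  have i1 : intg (fun x => g x * phi x).
    apply: (intg_bounded mO muO (M := B * M0)); first by apply: measurable_funM => //; exact: measurable_funTS.
    by move=> x _; rewrite normrM ler_pM.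
  have i2 : intg (fun x => g x * phi (x - a n *: e)).
    apply: (intg_bounded mO muO (M := B * M0)).
      by apply: measurable_funM => //; apply: measurable_funTS; exact: mphiS.
    by move=> x _; rewrite normrM ler_pM.
  have i3 : intg (fun x => g (x + a n *: e) * phi x).
    apply: (intg_bounded mO muO (M := B * M0)).
      by apply: measurable_funTS; exact: measurable_funM.
    by move=> x _; rewrite normrM ler_pM.
  transitivity ((a n)^-1 * (\int[leb d]_(x in Omega) (g x * phi x) - \int[leb d]_(x in Omega) (g x * phi (x - a n *: e)))).
    rewrite -RintegralB// -RintegralZl//; last exact: intgB.
    by apply: eq_Rintegral => x _; rewrite /q; ring.
  have -> : \int[leb d]_(x in Omega) (g x * phi (x - a n *: e)) = \int[leb d]_(x in Omega) (g (x + a n *: e) * phi x).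
    rewrite (@Rintegral_support _ _ Omega); last first.
      move=> x nO; apply/eqP; rewrite mulf_eq0 orbC; apply/orP; left; apply: contrapT => /negP/(supp n).
      by rewrite subrK.
    rewrite (@Rintegral_support _ _ Omega) => [|x nO]; last by rewrite (test_function_eq0 tp nO) mulr0.
    rewrite -(Rintegral_shift (a n *: e)).
      by apply: eq_Rintegral => x _; rewrite addrK.
    by apply: measurable_funM => //; exact: mphiS.
  rewrite -RintegralB// -RintegralZl//; last exact: intgB.
  by apply: eq_Rintegral => x _; rewrite /p; ring.
have L2 : (fun n => \int[leb d]_(x in Omega) p n x) @ \oo -->
    \int[leb d]_(x in Omega) (- (h x * phi x)).
  apply: (@dominated_Rintegral _ _ _ _ _ mO _ _ (fun=> C * M0)).
  - move=> n; apply: measurable_funTS; apply: measurable_funM => //; apply: measurable_funM => //.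
    apply: measurable_funB => //; apply: (measurableT_comp mg); exact: measurable_shift.
  - apply: measurableT_comp => //; apply: measurable_funM => //; exact: measurable_funTS.
  - exact: intg_cst.
  - apply: filterS gh => x H Ox; have [dg <-] := H Ox.
    have H2 := derive_cvg_seq dg an0 ca; rewrite -mulNr; apply: cvgMl.
    rewrite (_ : (fun n => _) = - (fun n => (a n)^-1 *: (g (x + a n *: e) - g x))); first exact: cvgN.
    by apply/funext => n; rewrite /GRing.scale/= -[RHS]mulrN opprB mulrC.
  (* The null set excluded by the Lipschitz bound depends on the step; only countably many steps
     [a n] occur. *)
  - have : \forall x \ae leb d, forall n r, a n < r -> ball x r `<=` Omega -> `|g (x + a n *: e) - g x| <= a n * C.
      by apply: ae_foralln => n; exact: gC.
    apply: filterS => x H n Ox.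
    have [px|px] := eqVneq (phi x) 0.
      by rewrite /p px mulr0 normr0 mulr_ge0// (le_trans (normr_ge0 _) (HM0 0)).
    rewrite /p normrM; apply: ler_pM => //.
    rewrite normrM normfV (gtr0_norm (a0 n)) ler_pdivrMr// distrC mulrC.
    by apply: (H n r) => //; apply: Kr; exact: subset_closure.
have L3 : (fun n => \int[leb d]_(x in Omega) p n x) @ \oo --> \int[leb d]_(x in Omega) (g x * partial j phi x).
  by rewrite -(_ : (fun n => \int[leb d]_(x in Omega) (g x * q n x)) = (fun n => \int[leb d]_(x in Omega) p n x))//; apply/funext.
rewrite (cvg_unique _ L3 L2)//.
by apply: RintegralN => //; exact: intg_test.
Qed.

End difference_quotients.

Lemma strictly_increasing_ltn phi : strictly_increasing phi -> {homo phi : m n / (m < n)%N}.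
Proof.
move=> hp m n; elim: n => // n IH; rewrite ltnS leq_eqVlt => /orP[/eqP->//|/IH/ltn_trans]; exact.
Qed.

Lemma strictly_increasing_ge phi m : strictly_increasing phi -> (m <= phi m)%N.
Proof. by move=> hp; elim: m => // m /leq_ltn_trans; apply. Qed.

Lemma strictly_increasing_cvg phi : strictly_increasing phi -> phi @ \oo --> \oo.
Proof.
move=> hp A [N _ NA]; exists N => // m /= Nm; apply: NA => /=.
exact: leq_trans Nm (strictly_increasing_ge m hp).
Qed.

Lemma cvg_subsequence (T : topologicalType) (u : nat -> T) (l : T) phi :
  strictly_increasing phi -> u @ \oo --> l -> (fun m => u (phi m)) @ \oo --> l.
Proof. by move=> hp; apply: cvg_comp; exact: strictly_increasing_cvg. Qed.

Lemma strictly_increasing_comp phi psi : strictly_increasing phi -> strictly_increasing psi ->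
  strictly_increasing (fun m => phi (psi m)).
Proof. by move=> hp hq m; exact/(strictly_increasing_ltn hp)/hq. Qed.

(** One index after the other; later extractions preserve the convergences already obtained. *)
Lemma cvg_sq_ae_subsequence_fin dT (X : measurableType dT) (R : realType)
    (mu : {measure set X -> \bar R}) (D : set X) (I : finType) (F : I -> nat -> X -> R) (f : I -> X -> R) :
  measurable D -> (forall i m, sqint mu D (F i m)) -> (forall i, sqint mu D (f i)) ->
  (forall i, cvg_sq mu D (F i) (f i)) ->
  exists2 phi : nat -> nat, strictly_increasing phi &
    {ae mu, forall x, D x -> forall i, F i (phi m) x @[m --> \oo] --> f i x}.
Proof.
move=> mD Fi fi Ff.
suff [phi hp H] : exists2 phi : nat -> nat, strictly_increasing phi &
    {ae mu, forall x, D x -> forall i, i \in enum I -> F i (phi m) x @[m --> \oo] --> f i x}.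
  by exists phi => //; apply: filterS H => x H Dx i; apply: H => //; rewrite mem_enum.
elim: (enum I) => [|i s [phi hp H]]; first by exists id => //; apply: nearW.
have [psi hq H'] := @cvg_sq_ae_subsequence _ _ _ mu D mD (fun m => F i (phi m)) (f i)
  (fun m => Fi i _) (fi i) (cvg_subsequence hp (Ff i)).
exists (fun m => phi (psi m)); first exact: strictly_increasing_comp.
apply: filterS2 H H' => x H H' Dx k; rewrite inE => /orP[/eqP ->|ks]; first exact: H'.
exact: (cvg_subsequence hq (H Dx k ks)).
Qed.

Section chain_rule.
Context {R : realType} {d N : nat}.
Variables (Omega : set 'cV[R]_d).
Hypotheses (d0 : (0 < d)%N).
Hypotheses (oO : open Omega) (bO : bounded_set Omega) (lO : lipschitz_boundary Omega).
Let mO : measurable Omega := open_measurable_mx oO.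
Let muO : (leb d Omega < +oo)%E := leb_bounded mO bO.
Notation intg := (intg (leb d) Omega).
Notation sqint := (sqint (leb d) Omega).
Variables (F : 'cV[R]_N -> R) (B CF : R).
Hypotheses (dF : forall w, differentiable F w) (cF : forall k, continuous (partial k F)).
Hypothesis CF0 : 0 <= CF.
Hypotheses (FB : forall w, `|F w| <= B) (FC : forall k w, `|partial k F w| <= CF).

(** On each open element the composition is classically differentiable. Across facets it inherits a
    Lipschitz bound from [conforming_lipschitz] and the bounded gradient of [F], which is all that
    difference quotients need. *)
Lemma chain_rule_conforming (M : mesh R d) (l : nat) (lam : broken M 'cV[R]_N) (j : 'I_d) :
  conforming_mesh_of M Omega -> (forall k, Sp_cont Omega l (bcomp k lam)) ->
  weak_derivative Omega (unit_index j) (fun x => F (broken_fun lam x))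
    (fun x => \sum_k partial k F (broken_fun lam x) * broken_fun (broken_partial j (bcomp k lam)) x).
Proof.
move=> cm cl.
have pl k := (cl k).1.
have mb : measurable_fun setT (broken_fun lam).
  apply: measurable_fun_matrix => // i i0; rewrite ord1.
  under eq_fun do rewrite broken_fun_coord.
  apply: (broken_fun_measurable cm) => k; apply: continuous_measurable_mx.
  exact: (Sp_continuous (pl i)).
have cFF : continuous F by move=> w; exact: differentiable_continuous.
pose K k := cid2 (conforming_lipschitz d0 cm oO bO lO (pl k) (cl k).2).
pose C k := s2val (K k).
have C0 k : 0 <= C k := s2valP (K k).
have HC k := s2valP' (K k).
apply: (@weak_derivative_difference_quotient R d Omega oO bO _ _ j B (N%:R * CF * \sum_k C k)).
- by apply: mulr_ge0; [exact: mulr_ge0|exact: sumr_ge0].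
- apply: (measurableT_comp (f := F)) => //; exact: continuous_measurable_mx.
- by move=> x; exact: FB.
- apply: intg_sum => // k _; apply: sqint_intg => //; apply: (@sqint_mulb _ _ _ _ _ mO _ _ CF).
  + apply: measurable_funTS; apply: (measurableT_comp (f := partial k F)) => //.
    by apply: continuous_measurable_mx; exact: cF.
  + by move=> x _; exact: FC.
  + exact: (broken_fun_sqint cm oO bO (Sp_continuous (Sp_broken_partial (pl k) j))).
- apply: filterS (ae_open_simplex d0 cm) => x H Ox; have [k xk] := H Ox.
  have dl : differentiable (lam k) x.
    rewrite (_ : lam k = fun y => \sum_i (bcomp i lam k y) *: (basis_vec i : 'cV[R]_N)); last first.
      by apply/funext => y; rewrite [LHS]matrix_sum_delta; apply: eq_bigr => i _; rewrite big_ord1.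
    have -> : (fun y => \sum_i bcomp i lam k y *: (basis_vec i : 'cV[R]_N)) = \sum_i (fun y => bcomp i lam k y *: (basis_vec i : 'cV[R]_N)).
      by apply/funext => y; rewrite fct_sumE.
    apply: differentiable_sum => i; apply: differentiableZl.
    exact: (polynomial_fun_differentiable _ (pl i k)).
  have H1 : is_derive x (basis_vec j) (F \o lam k)
     (\sum_i partial i F (lam k x) * partial j (bcomp i lam k) x).
    apply: DeriveDef; first by apply: diff_derivable; apply: differentiable_comp.
    rewrite derive_comp_coord//; apply: eq_bigr => i _.
    by rewrite derive_coord// mulrC.
  have H2 : is_derive x (basis_vec j) (fun y => F (broken_fun lam y))
     (\sum_i partial i F (lam k x) * partial j (bcomp i lam k) x).
    apply: near_eq_is_derive H1.
    apply: filterS (open_nbhs_nbhs (conj (@open_open_simplex R d (vtx k)) xk)) => y yk.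
    by rewrite /= (broken_fun_open cm _ yk).
  have [? ->] := H2; split => //; apply: eq_bigr => i _.
  by rewrite !(broken_fun_open cm _ xk).
- move=> t t0; apply: filterS2 (ae_open_simplex d0 cm) (ae_shift (t *: basis_vec j) (ae_open_simplex d0 cm)).
  move=> x H1 H2 r tr xr.
  have r0 : 0 < r by exact: lt_trans tr.
  have bt : ball x r (x + t *: basis_vec j).
    rewrite -ball_normE /ball_/= opprD addrA subrr sub0r normrN normrZ gtr0_norm//.
    apply: le_lt_trans tr; apply: ler_piMr; first exact: ltW.
    exact: norm_basis_vec_le1.
  have bx : ball x r x by exact: ballxx.
  apply: (le_trans (lipschitz_partial dF FC _ _)).
  rewrite [leRHS]mulrCA.
  apply: ler_wpM2l; first exact: mulr_ge0.
  apply: ler_mx_norm => [|k k0]; first by rewrite mulr_ge0 ?sumr_ge0// ltW.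
  rewrite ord1 mxE [X in _ + X]mxE !broken_fun_coord.
  apply: le_trans (HC k j x r x t xr t0 bx bt (H1 (xr _ bx)) (H2 (xr _ bt))) _.
  apply: ler_wpM2l; first exact: ltW.
  by rewrite (bigD1 k)//= lerDl; apply: sumr_ge0.
Qed.

Lemma component_broken_fun (M : mesh R d) (lam : broken M 'cV[R]_N) k :
  component k (broken_fun lam) = broken_fun (bcomp k lam).
Proof. by apply/funext => x; rewrite /component broken_fun_coord. Qed.

(** Conforming functions play the part of mollifications. Strong convergence of values and
    gradients, together with almost everywhere convergence of the values for the nonlinear
    coefficients, carries the identity of [chain_rule_conforming] to the limit. *)
Lemma chain_rule_weak_derivative (M_ : nat -> mesh R d) (l : nat) (lam_ : forall m, broken (M_ m) 'cV[R]_N)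
    (w : 'cV[R]_d -> 'cV[R]_N) (j : 'I_d) :
  (forall m, conforming_mesh_of (M_ m) Omega) ->
  (forall m k, Sp_cont Omega l (bcomp k (lam_ m))) -> sobolev Omega 1 w ->
  (fun m => sobolev_norm Omega 1 (fun x => broken_fun (lam_ m) x - w x)) @ \oo --> (0 : R) ->
  weak_derivative Omega (unit_index j) (fun x => F (w x))
    (fun x => \sum_k partial k F (w x) * wD Omega (unit_index j) (component k w) x).
Proof.
move=> cm cl sw lw.
have sl m : sobolev Omega 1 (broken_fun (lam_ m)).
  by move=> k; rewrite component_broken_fun; exact: (cl m k).2.
have [lw0 lw1] := sobolev_norm_cvg oO bO sl sw lw.
have s0 k m : sqint (fun x => broken_fun (lam_ m) x k 0) by exact: (sobolev_scalar_sqint oO bO (sl m k)).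
have s0' k : sqint (fun x => w x k 0) by exact: (sobolev_scalar_sqint oO bO (sw k)).
have u1 : (\sum_i unit_index j i <= 1)%N by rewrite sum_unit_index.
have s1 k m : sqint (wD Omega (unit_index j) (component k (broken_fun (lam_ m)))) by exact: (wD_sqint oO bO (sl m k) u1).
have s1' k : sqint (wD Omega (unit_index j) (component k w)) by exact: (wD_sqint oO bO (sw k) u1).
have [phi hp H] := cvg_sq_ae_subsequence_fin mO s0 s0' lw0.
have ml m : measurable_fun Omega (broken_fun (lam_ m)).
  by apply: measurable_fun_matrix => // k i0; rewrite ord1; exact: (s0 k m).1.
have mw : measurable_fun Omega w.
  by apply: measurable_fun_matrix => // k i0; rewrite ord1; exact: (s0' k).1.
have cFF : continuous F by move=> z; exact: differentiable_continuous.
have mFF : measurable_fun setT F by exact: continuous_measurable_mx.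
have mF k : measurable_fun setT (partial k F) by apply: continuous_measurable_mx; exact: cF.
have cw : {ae leb d, forall x, Omega x -> broken_fun (lam_ (phi m)) x @[m --> \oo] --> w x}.
  by apply: filterS H => x H Ox; apply: cvg_mx => k i0; rewrite ord1; exact: H.
move=> test tt; rewrite multi_partial_unit sum_unit_index expr1 mulN1r.
have mt : measurable_fun Omega (partial j test).
  by apply: test_function_measurable => //; exact: test_function_partial tt.
have [Mt HMt] := test_function_bounded (test_function_partial j tt).
have L1 : (fun m => \int[leb d]_(x in Omega) (F (broken_fun (lam_ (phi m)) x) * partial j test x)) @ \oo -->
    \int[leb d]_(x in Omega) (F (w x) * partial j test x).
  apply: (@dominated_Rintegral _ _ _ _ _ mO _ _ (fun=> B * Mt)).
  - by move=> m; apply: measurable_funM => //; exact: (measurableT_comp mFF).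
  - by apply: measurable_funM => //; exact: (measurableT_comp mFF).
  - exact: intg_cst.
  - apply: filterS cw => x cx Ox; apply: cvgMl; apply: continuous_cvg; first exact: cFF.
    exact: cx.
  - by apply: nearW => x m Ox; rewrite normrM ler_pM.
pose h m x := \sum_k partial k F (broken_fun (lam_ (phi m)) x) *
  wD Omega (unit_index j) (component k (broken_fun (lam_ (phi m)))) x.
have sk k m : sqint (fun x => partial k F (broken_fun (lam_ (phi m)) x) *
    wD Omega (unit_index j) (component k (broken_fun (lam_ (phi m)))) x).
  apply: (@sqint_mulb _ _ _ _ _ mO _ _ CF) => //; exact: (measurableT_comp (mF k)).
have sk' k : sqint (fun x => partial k F (w x) * wD Omega (unit_index j) (component k w) x).
  apply: (@sqint_mulb _ _ _ _ _ mO _ _ CF) => //; exact: (measurableT_comp (mF k)).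
have ch : cvg_sq (leb d) Omega h (fun x => \sum_k partial k F (w x) * wD Omega (unit_index j) (component k w) x).
  apply: (cvg_sq_sum mO muO (index_enum _) sk sk') => k.
  apply: (cvg_sq_mulb mO muO (M := CF)) => //.
  - by move=> m; exact: (measurableT_comp (mF k)).
  - exact: (measurableT_comp (mF k)).
  - by apply: nearW => x m _; exact: FC.
  - apply: filterS cw => x cx Ox; apply: continuous_cvg; first exact: cF.
    exact: cx.
  - exact: (cvg_subsequence hp (lw1 k j)).
have st : sqint test.
  have [M0 HM0] := test_function_bounded tt.
  by apply: (sqint_bounded mO muO (M := M0)) => [|x _]; [exact: test_function_measurable tt|exact: HM0].
have sh m : sqint (h m) by apply: sqint_sum => // k _; exact: sk.
have sh' : sqint (fun x => \sum_k partial k F (w x) * wD Omega (unit_index j) (component k w) x).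
  by apply: sqint_sum => // k _; exact: sk'.
have L2 := cvg_sq_mul mO sh sh' (fun=> st) st ch (cvg_sq_cst (leb d) mO test).
have E m : \int[leb d]_(x in Omega) (F (broken_fun (lam_ (phi m)) x) * partial j test x) =
    - \int[leb d]_(x in Omega) (h m x * test x).
  have := chain_rule_conforming j (cm (phi m)) (cl (phi m)) tt.
  rewrite multi_partial_unit sum_unit_index expr1 mulN1r => ->; congr (- _).
  apply: ae_eq_Rintegral => //.
  - apply: measurable_funM; last exact: st.1.
    apply: measurable_sum => k; apply: measurable_funM; first exact: (measurableT_comp (mF k)).
    apply: broken_fun_measurableO (cm (phi m)) _ _ => k0.
    exact: (polynomial_fun_continuous (polynomial_fun_partial j ((cl (phi m) k).1 k0))).
  - by apply: measurable_funM; [exact: (sh m).1|exact: st.1].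
  - have H' : \forall x \ae leb d, forall k, Omega x -> wD Omega (unit_index j) (broken_fun (bcomp k (lam_ (phi m)))) x = broken_fun (broken_partial j (bcomp k (lam_ (phi m)))) x.
      apply: filter_forall => k.
      exact: (wD_broken d0 (cm _) oO bO lO (cl (phi m) k).1 (cl (phi m) k).2 j).
    apply: filterS H' => x H' Ox; congr (_ * _); apply: eq_bigr => k _.
    by rewrite component_broken_fun H'.
have L3 : (fun m => \int[leb d]_(x in Omega) (F (broken_fun (lam_ (phi m)) x) * partial j test x)) @ \oo -->
    - \int[leb d]_(x in Omega) ((\sum_k partial k F (w x) * wD Omega (unit_index j) (component k w) x) * test x).
  by rewrite (funext E); apply: cvgN.
exact: (cvg_unique _ L1 L3).
Qed.

End chain_rule.

(** * The fully discrete scheme *)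

Section matrix_products.
Context {R : realType}.

Lemma ip_mulmxl m n q (P : 'M[R]_(m, n)) (Q : 'M[R]_(n, q)) (S : 'M[R]_(m, q)) :
  ip (P *m Q) S = ip Q (P^T *m S).
Proof. by rewrite /ip trmx_mul trmxK mulmxA. Qed.

Lemma ipBr m n (P Q Q' : 'M[R]_(m, n)) : ip P (Q - Q') = ip P Q - ip P Q'.
Proof. by rewrite ipC ipBl (ipC Q) (ipC Q'). Qed.

Lemma ip_col m n (P Q : 'M[R]_(m, n)) : ip P Q = \sum_j ip (col j P) (col j Q).
Proof.
rewrite ipE exchange_big/=; apply: eq_bigr => j _; rewrite ipE; apply: eq_bigr => i _.
by rewrite big_ord1 !mxE.
Qed.

Lemma ip_enorm2 m n (c : R) (P : 'M[R]_(m, n)) (B : 'M[R]_m) :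
  (forall z : 'cV[R]_m, c * enorm z ^+ 2 <= ip z (B *m z)) -> c * ip P P <= ip P (B *m P).
Proof.
move=> Bc; rewrite !ip_col big_distrr/=; apply: ler_sum => j _.
by rewrite -enorm_sqr [col j (B *m P)]colE -mulmxA -colE.
Qed.

End matrix_products.

Section coefficient_functions.
Context {R : realType} {d : nat}.
Variable Omega : set 'cV[R]_d.
Hypotheses (oO : open Omega) (bO : bounded_set Omega).
Let mO : measurable Omega := open_measurable_mx oO.
Let muO : (leb d Omega < +oo)%E := leb_bounded mO bO.
Notation intg := (intg (leb d) Omega).
Notation sqint := (sqint (leb d) Omega).
Notation cvg_sq := (cvg_sq (leb d) Omega).

Lemma sqint_mulmx m n q (C : R) (P : 'cV[R]_d -> 'M[R]_(m, n)) (V : 'cV[R]_d -> 'M[R]_(n, q)) :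
  (forall i j, measurable_fun Omega (fun x => P x i j)) ->
  {ae leb d, forall x, Omega x -> forall i j, `|P x i j| <= C} ->
  (forall i j, sqint (fun x => V x i j)) -> forall i j, sqint (fun x => (P x *m V x) i j).
Proof.
move=> mP bP sV i j; under eq_fun do rewrite mxE.
apply: sqint_sum => // k _; apply: (sqint_mulb_ae mO (mP i k) _ (sV k j)).
by apply: filterS bP => x H Ox; exact: H.
Qed.

Lemma cvg_sq_mulmx m n q (C : R) (P_ : nat -> 'cV[R]_d -> 'M[R]_(m, n))
    (P : 'cV[R]_d -> 'M[R]_(m, n)) (V_ : nat -> 'cV[R]_d -> 'M[R]_(n, q)) (V : 'cV[R]_d -> 'M[R]_(n, q)) :
  (forall k i j, measurable_fun Omega (fun x => P_ k x i j)) ->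
  (forall i j, measurable_fun Omega (fun x => P x i j)) ->
  {ae leb d, forall x, Omega x -> forall k i j, `|P_ k x i j| <= C} ->
  {ae leb d, forall x, Omega x -> forall i j, P_ k x i j @[k --> \oo] --> P x i j} ->
  (forall k i j, sqint (fun x => V_ k x i j)) -> (forall i j, sqint (fun x => V x i j)) ->
  (forall i j, cvg_sq (fun k x => V_ k x i j) (fun x => V x i j)) ->
  forall i j, cvg_sq (fun k x => (P_ k x *m V_ k x) i j) (fun x => (P x *m V x) i j).
Proof.
move=> mP_ mP bP cP sV_ sV cV i j.
have bPm k : {ae leb d, forall x, Omega x -> forall i j, `|P_ k x i j| <= C}.
  by apply: filterS bP => x H Ox i' j'; exact: H.
have bP' : {ae leb d, forall x, Omega x -> forall i j, `|P x i j| <= C}.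
  apply: filterS2 bP cP => x b c Ox i' j'.
  have h : (fun m => `|P_ m x i' j'|) @ \oo --> `|P x i' j'| by exact: cvg_norm (c Ox i' j').
  rewrite -(cvg_lim (@Rhausdorff R) h); apply: limr_le; first exact: cvgP h.
  by apply: nearW => k; exact: b.
rewrite (_ : (fun k x => _) = (fun k x => \sum_l P_ k x i l * V_ k x l j)); last first.
  by apply/funext => k; apply/funext => x; rewrite mxE.
rewrite (_ : (fun x => (_ *m _) _ _) = (fun x => \sum_l P x i l * V x l j)); last first.
  by apply/funext => x; rewrite mxE.
apply: (cvg_sq_sum mO muO (index_enum _) (F := fun l k x => P_ k x i l * V_ k x l j)
  (f := fun l x => P x i l * V x l j)) => [l k|l|l].
- apply: (sqint_mulb_ae mO (mP_ k i l) _ (sV_ k l j)).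
  by apply: filterS (bPm k) => x H Ox; exact: H.
- apply: (sqint_mulb_ae mO (mP i l) _ (sV l j)).
  by apply: filterS bP' => x H Ox; exact: H.
- apply: (cvg_sq_mulb mO muO (M := C)) => //.
  + by apply: filterS bP => x H k Ox; exact: H.
  + by apply: filterS cP => x H Ox; exact: H.
Qed.

Lemma cvg_Rintegral_ip m n (P_ Q_ : nat -> 'cV[R]_d -> 'M[R]_(m, n)) (P Q : 'cV[R]_d -> 'M[R]_(m, n)) :
  (forall k i j, sqint (fun x => P_ k x i j)) -> (forall i j, sqint (fun x => P x i j)) ->
  (forall k i j, sqint (fun x => Q_ k x i j)) -> (forall i j, sqint (fun x => Q x i j)) ->
  (forall i j, cvg_sq (fun k x => P_ k x i j) (fun x => P x i j)) ->
  (forall i j, cvg_sq (fun k x => Q_ k x i j) (fun x => Q x i j)) ->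
  (fun k => \int[leb d]_(x in Omega) ip (P_ k x) (Q_ k x)) @ \oo -->
    \int[leb d]_(x in Omega) ip (P x) (Q x).
Proof.
move=> sP_ sP sQ_ sQ cP cQ.
rewrite (Rintegral_ip oO bO)//.
rewrite (_ : (fun k => _) = (fun k => \sum_i \sum_j \int[leb d]_(x in Omega) (P_ k x i j * Q_ k x i j))); last first.
  by apply/funext => k; rewrite (Rintegral_ip oO bO).
apply: (@cvg_sumr _ _ _ \oo _) => i; apply: (@cvg_sumr _ _ _ \oo _) => j.
by apply: cvg_sq_mul => //.
Qed.

End coefficient_functions.

(** * The projection of the initial datum *)

Section initial_projection.
Context {R : realType} {d N : nat}.
Variables (Omega : set 'cV[R]_d) (p : nat) (S : nat -> discretization R d).
Hypotheses (oO : open Omega) (bO : bounded_set Omega).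
Hypothesis hS : forall m, discretization_of Omega p (S m).
Hypothesis h0 : (fun m => mesh_size (S m)) @ \oo --> (0 : R).
Let mO : measurable Omega := open_measurable_mx oO.
Let muO : (leb d Omega < +oo)%E := leb_bounded mO bO.
Notation intg := (intg (leb d) Omega).
Notation sqint := (sqint (leb d) Omega).
Notation cvg_sq := (cvg_sq (leb d) Omega).

Lemma Sp_mx_dense m n (v : 'cV[R]_d -> 'M[R]_(m, n)) : (forall i j, sqint (fun x => v x i j)) ->
  exists2 F : forall k, broken (S k) 'M[R]_(m, n), forall k, Sp_mx p (F k) &
    forall i j, cvg_sq (fun k x => broken_fun (F k) x i j) (fun x => v x i j).
Proof.
move=> sv.
pose K i j := cid2 (@Sp_dense R d Omega p (fun m => dmesh (S m)) (fun m => disc_mesh (hS m)) oO bO h0 _ (sv i j)).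
exists (fun k a x => \matrix_(i, j) s2val (K i j) k a x) => [k i j a|i j].
  rewrite (_ : (fun x => _) = s2val (K i j) k a); last by apply/funext => x; rewrite mxE.
  exact: (s2valP (K i j)).
rewrite (_ : (fun k x => _) = (fun k => broken_fun (s2val (K i j) k))); last first.
  apply/funext => k; apply/funext => x; rewrite broken_fun_coord; congr (broken_fun _ x).
  by apply/funext => a; apply/funext => y; rewrite mxE.
exact: (s2valP' (K i j)).
Qed.

Lemma coord_sqr_le_ip m n (P : 'M[R]_(m, n)) i j : P i j ^+ 2 <= ip P P.
Proof.
by rewrite -enorm_sqr -(real_normK (num_real _)) lerXn2r ?nnegrE ?enorm_ge0 ?coord_le_enorm.
Qed.

(** The error is orthogonal to the discrete space, so [v] may be replaced by [v] minus an
    approximation that converges to it; the error itself is bounded in norm by [g]. *)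
Lemma L2_projection_cvg (g v : 'cV[R]_d -> 'cV[R]_N) (r : forall m, broken (S m) 'cV[R]_N) :
  (forall i j, sqint (fun x => g x i j)) -> (forall i j, sqint (fun x => v x i j)) ->
  (forall m, is_L2_projection Omega p g (r m)) ->
  (fun m => \int[leb d]_(x in Omega) ip (g x - broken_fun (r m) x) (v x)) @ \oo --> (0 : R).
Proof.
move=> sg sv hr; have [F pF cF] := Sp_mx_dense sv.
have pr m := (hr m).1.
have sr m i j := Sp_mx_sqint (hS m) oO bO i j (pr m).
have sF m i j := Sp_mx_sqint (hS m) oO bO i j (pF m).
have sB m i j : sqint (fun x => (g x - broken_fun (r m) x) i j).
  by under eq_fun do rewrite mxE [X in _ + X]mxE; exact: sqintB.
have sD m i j : sqint (fun x => (v x - broken_fun (F m) x) i j).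
  by under eq_fun do rewrite mxE [X in _ + X]mxE; exact: sqintB.
have orth m (lam : broken (S m) 'cV[R]_N) : Sp_mx p lam ->
    \int[leb d]_(x in Omega) ip (g x - broken_fun (r m) x) (broken_fun lam x) = 0.
  move=> pl; have sl i j := Sp_mx_sqint (hS m) oO bO i j pl.
  under eq_Rintegral do rewrite ipBl.
  by rewrite RintegralB//; [rewrite (hr m).2// subrr|exact: sqint_ip..].
have bd m i j : \int[leb d]_(x in Omega) ((g x - broken_fun (r m) x) i j) ^+ 2 <=
    \int[leb d]_(x in Omega) ip (g x) (g x).
  apply: (@le_trans _ _ (\int[leb d]_(x in Omega) ip (g x - broken_fun (r m) x) (g x - broken_fun (r m) x))).
    apply: le_Rintegral => //; [exact: (sB m i j).2|exact: sqint_ip|].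
    by move=> x _; exact: coord_sqr_le_ip.
  have -> : \int[leb d]_(x in Omega) ip (g x - broken_fun (r m) x) (g x - broken_fun (r m) x) =
      \int[leb d]_(x in Omega) ip (g x - broken_fun (r m) x) (g x).
    rewrite -[RHS]subr0 -(orth m (r m))// -RintegralB//; [|exact: sqint_ip..].
    by apply: eq_Rintegral => x _; rewrite -ipBr.
  have -> : \int[leb d]_(x in Omega) ip (g x - broken_fun (r m) x) (g x) =
      \int[leb d]_(x in Omega) ip (g x) (g x) - \int[leb d]_(x in Omega) ip (broken_fun (r m) x) (g x).
    by rewrite -RintegralB//; [apply: eq_Rintegral => x _; rewrite ipBl|exact: sqint_ip..].
  rewrite gerBl; under eq_Rintegral do rewrite ipC.
  by rewrite -(hr m).2//; apply: Rintegral_ge0 => x _; exact: ip_ge0.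
rewrite (_ : (fun m => _) = (fun m => \sum_i \sum_j \int[leb d]_(x in Omega)
  ((g x - broken_fun (r m) x) i j * (v x - broken_fun (F m) x) i j))); last first.
  apply/funext => m; rewrite -(Rintegral_ip oO bO)// -[LHS]subr0 -(orth m (F m))// -RintegralB//; [|exact: sqint_ip..].
  by apply: eq_Rintegral => x _; rewrite -ipBr.
have Z : \sum_(i < N) \sum_(j < 1) (0 : R) = 0 by rewrite big1// => i _; rewrite big1.
rewrite -[X in _ --> X]Z.
apply: (@cvg_sumr _ _ _ \oo _) => i; apply: (@cvg_sumr _ _ _ \oo _) => j.
apply: (Rintegral_mul_cvg0 mO (fun m => sB m i j) (fun m => sD m i j) (fun m => bd m i j)).
have := cF i j; rewrite /cvg_sq.
under [X in X @ _ --> _ -> _]eq_fun => m do under eq_Rintegral => x _ do rewrite -sqrrN opprB.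
by under [X in _ -> X @ _ --> _]eq_fun => m do under eq_Rintegral => x _ do rewrite mxE [X in _ + X]mxE.
Qed.

End initial_projection.

(** * Coercivity, entropy and the discrete energy estimate *)

Section discrete_energy.
Context {R : realType} {d N : nat} {T : R} {Omega : set 'cV[R]_d} {D : set 'cV[R]_N}.
Context {A : 'cV[R]_N -> 'M[R]_N} {f : 'cV[R]_N -> 'cV[R]_N} {s : 'cV[R]_N -> R}.
Context {u : 'cV[R]_N -> 'cV[R]_N} {gamma Cf : R} {rho0 : 'cV[R]_d -> 'cV[R]_N}.
Hypothesis hs : structural_assumptions T Omega D A f s u gamma Cf rho0.

Lemma sa_open : open Omega. Proof. by have [] := sa_Omega_domain hs. Qed.
Lemma sa_dim_gt0 : (0 < d)%N. Proof. by have /andP[] := sa_dim hs. Qed.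
Let oO := sa_open.
Let bO := sa_Omega_bounded hs.
Let lO := sa_Omega_lipschitz hs.
Let d0 := sa_dim_gt0.
Let mO : measurable Omega := open_measurable_mx oO.
Let muO : (leb d Omega < +oo)%E := leb_bounded mO bO.
Notation intg := (intg (leb d) Omega).
Notation sqint := (sqint (leb d) Omega).

Lemma A_u_continuous i j : continuous (fun w => A (u w) i j).
Proof.
move=> w; have := @cvg_mx_coord _ _ _ _ (nbhs w) _ (A \o u) _ i j.
by apply; exact: (comp_u_continuous hs (sa_A_continuous hs) (x := w)).
Qed.

Lemma f_u_continuous i : continuous (fun w => f (u w) i 0).
Proof.
move=> w; have := @cvg_mx_coord _ _ _ _ (nbhs w) _ (f \o u) _ i 0.
by apply; exact: (comp_u_continuous hs (sa_f_continuous hs) (x := w)).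
Qed.

Lemma u_coord_continuous i : continuous (fun w => u w i 0).
Proof.
move=> w; have := @cvg_mx_coord _ _ _ _ (nbhs w) _ u _ i 0.
by apply; exact: (u_continuous hs (x := w)).
Qed.

Lemma s_u_continuous : continuous (s \o u).
Proof. exact: (comp_u_continuous hs (sa_s_continuous hs)). Qed.

(** The Hessian is symmetric, so [A^T s''] is the transpose of [s'' A] and has the same quadratic
    form; the columns of [Z] are treated one by one. *)
Lemma matrix_coercive w (Z : 'M[R]_(N, d)) :
  gamma * ip Z Z <= ip ((A (u w))^T *m hess s (u w) *m Z) Z.
Proof.
rewrite [leRHS]ipC; apply: ip_enorm2 => z; apply: le_trans (u_coercive hs w z) _.
rewrite -mulmxA -[X in _ <= ip z X]mulmxA -(ip_mulmxl (A (u w)) z) [leLHS]ipC ip_mulmxl.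
by rewrite (hess_u_sym hs).
Qed.

(** A density [rho] in [D] is the value of [u] at the entropy variable [grad s rho], so the
    inequality along segments of entropy variables applies. *)
Lemma entropy_difference w rho : D rho -> s (u w) - s rho <= ip (u w - rho) w.
Proof.
move=> Dr; have := entropy_le hs (grad s rho) w; rewrite (sa_u_inverse_r hs Dr) !ipBl; lra.
Qed.

Lemma reaction_le w : ip (f (u w)) w <= Cf.
Proof. by rewrite -{2}[w](sa_u_inverse_l hs); apply: (sa_reaction hs); exact: (sa_u_range hs). Qed.

Section step.
Variables (p : nat) (S : discretization R d).
Hypothesis hS : discretization_of Omega p S.
Let cm := disc_mesh hS.

Lemma ldg_gradv_Sp (w : broken S 'cV[R]_N) : Sp_mx p w -> Sp_mx p (ldg_gradv w).
Proof.
move=> pw i j k.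
have [H _] := disc_ldg hS (pw i 0).
rewrite (_ : (fun x => _) = (fun x => ldg_grad (bcomp i w) k x 0 j)); first exact: H.
by apply/funext => x; rewrite mxE.
Qed.

Lemma broken_fun_mx_bounded m n (w : broken S 'M[R]_(m, n)) : Sp_mx p w ->
  exists C, forall x, Omega x -> `|broken_fun w x| <= C.
Proof.
move=> pw.
pose K i j := cid (broken_fun_bounded cm bO (Sp_continuous (pw i j))).
exists (\sum_i \sum_j `|projT1 (K i j)|) => x Ox.
have C0 i : 0 <= \sum_j `|projT1 (K i j)| by apply: sumr_ge0.
apply: ler_mx_norm => [|i j]; first by apply: sumr_ge0.
rewrite broken_fun_coord (le_trans (projT2 (K i j) x Ox))// (le_trans (ler_norm _))//.
rewrite (bigD1 i)//= (bigD1 j)//= -addrA lerDl.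
by apply: addr_ge0; apply: sumr_ge0 => // k _; exact: sumr_ge0.
Qed.

Lemma comp_bounded (g : 'cV[R]_N -> R) (C : R) : continuous g ->
  exists K, 0 <= K /\ forall z : 'cV[R]_N, `|z| <= C -> `|g z| <= K.
Proof.
move=> cg; have [|K HK] := @continuous_bounded_on R N [set z | `|z| <= C] _ g cg.
  by exists C; split; [exact: num_real|move=> M CM z /= zC; exact: le_trans (ltW CM)].
by exists `|K|; split => // z zC; apply: le_trans (HK z zC) (ler_norm _).
Qed.

Lemma coef_bounded m n (P : 'cV[R]_N -> 'M[R]_(m, n)) (C : R) : (forall i j, continuous (fun w => P w i j)) ->
  exists2 K, 0 <= K & forall z : 'cV[R]_N, `|z| <= C -> forall i j, `|P z i j| <= K.
Proof.
move=> cP; pose K i j := cid (comp_bounded C (cP i j)).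
have C0 i : 0 <= \sum_j projT1 (K i j) by apply: sumr_ge0 => j _; have [] := projT2 (K i j).
exists (\sum_i \sum_j projT1 (K i j)) => [|z zC i j]; first by apply: sumr_ge0.
apply: le_trans ((projT2 (K i j)).2 z zC) _.
rewrite (bigD1 i)//= (bigD1 j)//= -addrA lerDl.
by apply: addr_ge0; [apply: sumr_ge0 => k _; have [] := projT2 (K i k)|apply: sumr_ge0 => k _; exact: C0].
Qed.

Variables (eta eps tau : R) (rho rho' : 'cV[R]_d -> 'cV[R]_N).
Variables (w : broken S 'cV[R]_N) (sig : broken S 'M[R]_(N, d)).
Hypotheses (heta : 0 < eta) (htau : 0 < tau).
Hypothesis hstep : dg_step Omega D A f s u eta eps tau p rho w sig.
Hypothesis srho : forall i j, sqint (fun x => rho x i j).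
(** [rho'] takes values in [D] and cannot be told from [rho] by discrete test functions. For the
    first step [rho] is the projected datum, which may leave [D], and [rho'] is [rho0]; later both
    are the same density. *)
Hypotheses (srho' : forall i j, sqint (fun x => rho' x i j))
  (Drho' : {ae leb d, forall x, Omega x -> D (rho' x)})
  (rho_eq : forall lam : broken S 'cV[R]_N, Sp_mx p lam ->
    \int[leb d]_(x in Omega) ip (rho x) (broken_fun lam x) =
    \int[leb d]_(x in Omega) ip (rho' x) (broken_fun lam x)).

Lemma normA_ge0 : 0 <= normA D A.
Proof. by apply: fine_ge0; exact: Lnorm_ge0. Qed.

Lemma stab_ge0 (k1 k2 : 'I_(nelt S)) : 0 <= stab D A eta k1 k2.
Proof.
rewrite /stab; apply: mulr_ge0 normA_ge0; rewrite invr_ge0; apply: mulr_ge0.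
  by rewrite invr_ge0 ltW.
by rewrite le_min !(diam_ge0 cm).
Qed.

Lemma measurable_W : measurable_fun Omega (broken_fun w).
Proof.
have [pw _ _ _] := hstep.
by apply: measurable_fun_matrix => // i j; exact: (Sp_mx_sqint hS oO bO i j pw).1.
Qed.

Lemma sqint_comp_bounded (g : 'cV[R]_N -> R) (W : 'cV[R]_d -> 'cV[R]_N) (C : R) : continuous g ->
  measurable_fun Omega W -> (forall z, `|g z| <= C) -> sqint (fun x => g (W x)).
Proof.
move=> cg mW gC; apply: (sqint_bounded mO muO (M := C)) => [|x _]; last exact: gC.
by apply: (measurableT_comp (f := g)) => //; exact: continuous_measurable_mx.
Qed.

Lemma sqint_u (W : 'cV[R]_d -> 'cV[R]_N) i j : measurable_fun Omega W ->
  sqint (fun x => u (W x) i j).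
Proof.
move=> mW; rewrite ord1; have [C _ HC] := D_coord_bounded hs.
apply: (sqint_comp_bounded (g := fun w => u w i 0)) mW _; first exact: u_coord_continuous.
by move=> z; apply: HC; exact: (sa_u_range hs).
Qed.

Lemma sqint_f (W : 'cV[R]_d -> 'cV[R]_N) i j : measurable_fun Omega W ->
  sqint (fun x => f (u (W x)) i j).
Proof.
move=> mW; rewrite ord1; have [C _ HC] := f_bounded hs.
by apply: (sqint_comp_bounded (g := fun w => f (u w) i 0)) mW _; first exact: f_u_continuous.
Qed.

Lemma measurable_A (W : 'cV[R]_d -> 'cV[R]_N) i j : measurable_fun Omega W ->
  measurable_fun Omega (fun x => A (u (W x)) i j).
Proof.
move=> mW; apply: (measurableT_comp (f := fun w => A (u w) i j)) => //.
by apply: continuous_measurable_mx; exact: A_u_continuous.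
Qed.

Lemma measurable_H (W : 'cV[R]_d -> 'cV[R]_N) i j : measurable_fun Omega W ->
  measurable_fun Omega (fun x => hess s (u (W x)) i j).
Proof.
move=> mW; apply: (measurableT_comp (f := fun w => hess s (u w) i j)) => //.
by apply: continuous_measurable_mx; exact: (hess_u_continuous hs).
Qed.

(** The flux itself is the test function in the first equation: the pairing with the LDG gradient
    becomes a coercive quadratic form in the flux. *)
Lemma flux_dissipation :
  gamma * \int[leb d]_(x in Omega) ip (broken_fun sig x) (broken_fun sig x) <=
  - \int[leb d]_(x in Omega) ip (A (u (broken_fun w x)) *m broken_fun sig x) (broken_fun (ldg_gradv w) x).
Proof.
have [pw psig E1 _] := hstep; have mW := measurable_W.
have ss i j := Sp_mx_sqint hS oO bO i j psig.
have [C HC] := broken_fun_mx_bounded pw.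
have [CA CA0 HA] := A_bounded hs.
(* This bound depends on the mesh through [w]; it serves integrability only and does not enter the
   estimate. *)
have [K K0 HK] := @coef_bounded N N (fun w => hess s (u w)) C (fun i j => hess_u_continuous hs (i := i) (j := j)).
have sHs i j : sqint (fun x => (hess s (u (broken_fun w x)) *m broken_fun sig x) i j).
  apply: (sqint_mulmx oO bO (C := K)) => //; first by move=> i' j'; exact: measurable_H.
  by apply: nearW => x Ox i' j'; apply: HK; exact: HC.
have sAHs i j : sqint (fun x => ((A (u (broken_fun w x)))^T *m hess s (u (broken_fun w x)) *m broken_fun sig x) i j).
  under eq_fun do rewrite -mulmxA.
  apply: (sqint_mulmx oO bO (C := CA)) => // [i' j'|].
    by under eq_fun do rewrite mxE; exact: measurable_A.
  by apply: nearW => x Ox i' j'; rewrite mxE.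
have E : \int[leb d]_(x in Omega) ip (A (u (broken_fun w x)) *m broken_fun sig x) (broken_fun (ldg_gradv w) x) =
   \int[leb d]_(x in Omega) ip ((A (u (broken_fun w x)))^T *m broken_fun (ldg_gradv w) x) (broken_fun sig x).
  by apply: eq_Rintegral => x _; rewrite ip_mulmxl ipC.
rewrite E -(E1 _ psig) -RintegralZl//; last exact: sqint_ip.
apply: le_Rintegral => //; [by apply: intgZ => //; exact: sqint_ip|exact: sqint_ip|].
by move=> x _; exact: matrix_coercive.
Qed.

Lemma discrete_energy (Cs : R) : (forall rho, D rho -> `|s rho| <= Cs) ->
  eps * tau * c_formv w w + gamma * tau * \int[leb d]_(x in Omega) ip (broken_fun sig x) (broken_fun sig x)
  <= (tau * Cf + (Cs + Cs)) * fine (leb d Omega).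
Proof.
move=> HCs; have [pw psig E1 E2] := hstep; have mW := measurable_W.
have sW i j := Sp_mx_sqint hS oO bO i j pw.
have su i j := sqint_u i j mW; have sf i j := sqint_f i j mW.
have := E2 _ pw.
set X := c_formv w w; set J := facets_integral _; set I1 := \int[leb d]_(x in Omega) ip (_ - _) _.
set I2 := \int[leb d]_(x in Omega) ip (_ *m _) _; set I3 := \int[leb d]_(x in Omega) ip (f _) _.
have J0 : 0 <= J by apply: facets_integral_ge0 => k1 k2 y; rewrite mulr_ge0 ?stab_ge0// ip_ge0.
have H2 : gamma * \int[leb d]_(x in Omega) ip (broken_fun sig x) (broken_fun sig x) <= - I2 := flux_dissipation.
have H3 : I3 <= Cf * fine (leb d Omega).
  apply: le_Rintegral_bound => //; first exact: sqint_ip.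
  by apply: nearW => x _; exact: reaction_le.
have H1 : - ((Cs + Cs) * fine (leb d Omega)) <= I1.
  have -> : I1 = \int[leb d]_(x in Omega) ip (u (broken_fun w x) - rho' x) (broken_fun w x).
    rewrite /I1; under eq_Rintegral do rewrite ipBl.
    under [in RHS]eq_Rintegral do rewrite ipBl.
    rewrite RintegralB//; [|exact: sqint_ip..].
    by rewrite RintegralB//; [rewrite rho_eq|exact: sqint_ip..].
  have iI : intg (fun x => ip (u (broken_fun w x) - rho' x) (broken_fun w x)).
    apply: sqint_ip => // i j; under eq_fun do rewrite mxE [X in _ + X]mxE.
    exact: sqintB.
  rewrite lerNl -RintegralN//; apply: le_Rintegral_bound => //; first exact: intgN.
  apply: filterS Drho' => x H Ox; have Dx := H Ox.
  rewrite lerNl; apply: le_trans (entropy_difference _ Dx).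
  have := HCs _ Dx; have := HCs _ (sa_u_range hs (broken_fun w x)).
  by rewrite !ler_norml => /andP[? ?] /andP[? ?]; lra.
move=> E; have t2 := ler_wpM2l (ltW htau) H2; have t3 := ler_wpM2l (ltW htau) H3.
have tJ := mulr_ge0 (ltW htau) J0.
move: t2 t3 H1 tJ E; lra.
Qed.

End step.
End discrete_energy.

(** * Passage to the limit *)

Section measurable_inverse.
Context {R : realType} dX (X : measurableType dX) (E : set X).

Lemma measurable_det n (M : X -> 'M[R]_n) : (forall i j, measurable_fun E (fun x => M x i j)) ->
  measurable_fun E (fun x => \det (M x)).
Proof.
move=> mM; rewrite /determinant; apply: measurable_sum => s; apply: measurable_funM => //.
by apply: measurable_prod => i _; exact: mM.
Qed.

(** The inverse is written as [g] times a negative power of [g^2], since real powers are used with a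
    nonnegative base; at zeros of [g] both sides vanish. *)
Lemma measurable_funV (g : X -> R) : measurable_fun E g -> measurable_fun E (fun x => (g x)^-1).
Proof.
move=> mg; rewrite (_ : (fun x => _) = (fun x => g x * (g x ^+ 2) `^ (-1))); last first.
  apply/funext => x; rewrite powR_inv1 ?sqr_ge0//.
  have [->|gn] := eqVneq (g x) 0; first by rewrite invr0 mul0r.
  by rewrite expr2 invfM mulrA mulfV// mul1r.
apply: measurable_funM => //; apply: (measurableT_comp (f := fun y : R => y `^ (-1))).
  exact: measurable_powR.
exact: measurable_funX.
Qed.

Lemma measurable_invmx n (M : X -> 'M[R]_n) : (forall i j, measurable_fun E (fun x => M x i j)) ->
  (forall x, M x \in unitmx) -> forall i j, measurable_fun E (fun x => invmx (M x) i j).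
Proof.
move=> mM uM i j.
rewrite (_ : (fun x => _) = (fun x => (\det (M x))^-1 * ((-1) ^+ (j + i) * \det (row' j (col' i (M x)))))); last first.
  by apply/funext => x; rewrite /invmx uM !mxE.
apply: measurable_funM; first exact/measurable_funV/measurable_det.
apply: measurable_funM => //; apply: measurable_det => i' j'.
under eq_fun do rewrite !mxE; exact: mM.
Qed.

End measurable_inverse.

Section composition.
Context {R : realType} {d N : nat} {T : R} {Omega : set 'cV[R]_d} {D : set 'cV[R]_N}.
Context {A : 'cV[R]_N -> 'M[R]_N} {f : 'cV[R]_N -> 'cV[R]_N} {s : 'cV[R]_N -> R}.
Context {u : 'cV[R]_N -> 'cV[R]_N} {gamma Cf : R} {rho0 : 'cV[R]_d -> 'cV[R]_N}.
Hypothesis hs : structural_assumptions T Omega D A f s u gamma Cf rho0.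
Let oO := sa_open hs.
Let bO := sa_Omega_bounded hs.
Let lO := sa_Omega_lipschitz hs.
Let d0 := sa_dim_gt0 hs.
Let mO : measurable Omega := open_measurable_mx oO.
Let muO : (leb d Omega < +oo)%E := leb_bounded mO bO.
Notation intg := (intg (leb d) Omega).
Notation sqint := (sqint (leb d) Omega).
Notation cvg_sq := (cvg_sq (leb d) Omega).
Notation jac := (jac (u := u)).

Lemma jac_sym w : (jac w)^T = jac w.
Proof.
have H : (jac w)^T *m hess s (u w) = 1%:M.
  by rewrite -(hess_u_sym hs) -trmx_mul (hess_jac hs) trmx1.
by rewrite -[LHS]mulmx1 -(hess_jac hs w) mulmxA H mul1mx.
Qed.

Lemma sqint_jac_wgrad (w : 'cV[R]_d -> 'cV[R]_N) : sobolev Omega 1 w ->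
  forall i j, sqint (fun x => (jac (w x) *m wgrad Omega w x) i j).
Proof.
move=> sw; have [C C0 HC] := jac_bounded hs.
have mw : measurable_fun Omega w.
  by apply: measurable_fun_matrix => // i j; exact: (sobolev_sqint oO bO i j sw).1.
apply: (sqint_mulmx oO bO (C := C)).
- move=> i j; apply: (measurableT_comp (f := fun z => jac z i j)) => //.
  by apply: continuous_measurable_mx; exact: (jac_continuous hs).
- by apply: nearW => x _.
- by move=> i j; exact: wgrad_sqint.
Qed.

Lemma comp_u_weak_derivative (M_ : nat -> mesh R d) l (lam_ : forall m, broken (M_ m) 'cV[R]_N)
    (w : 'cV[R]_d -> 'cV[R]_N) i j :
  (forall m, conforming_mesh_of (M_ m) Omega) ->
  (forall m k, Sp_cont Omega l (bcomp k (lam_ m))) -> sobolev Omega 1 w ->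
  (fun m => sobolev_norm Omega 1 (fun x => broken_fun (lam_ m) x - w x)) @ \oo --> (0 : R) ->
  weak_derivative Omega (unit_index j) (component i (u \o w))
    (fun x => (jac (w x) *m wgrad Omega w x) i j).
Proof.
move=> cm cl sw lw.
have [C C0 HC] := jac_bounded hs; have [B B0 HB] := D_coord_bounded hs.
have pj k : partial k (fun z => u z i 0) = fun z => jac z i k by apply/funext => z; rewrite mxE.
have du z : differentiable (fun z => u z i 0) z.
  apply: (@differentiable_comp _ _ _ _ u (fun M : 'cV[R]_N => M i 0)); first exact: (u_differentiable hs).
  exact: differentiable_coord.
rewrite (_ : (fun x => (_ *m _) i j) = (fun x => \sum_k partial k (fun z => u z i 0) (w x) * wD Omega (unit_index j) (component k w) x)).
  apply: (chain_rule_weak_derivative d0 oO bO lO (B := B) (CF := C) du _ C0 _ _ j cm cl sw lw).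
  - by move=> k; rewrite pj; exact: (jac_continuous hs).
  - by move=> z; apply: HB; exact: (sa_u_range hs).
  - by move=> k z; rewrite pj.
by apply/funext => x; rewrite mxE; apply: eq_bigr => k _; rewrite pj; congr (_ * _); rewrite mxE.
Qed.

Section sobolev_composition.
Variable w : 'cV[R]_d -> 'cV[R]_N.
Hypothesis sw : sobolev Omega 1 w.
Hypothesis ww : forall i j, weak_derivative Omega (unit_index j) (component i (u \o w))
    (fun x => (jac (w x) *m wgrad Omega w x) i j).

Lemma comp_u_sobolev : sobolev Omega 1 (u \o w).
Proof.
move=> i.
have mw : measurable_fun Omega w.
  by apply: measurable_fun_matrix => // i' j'; exact: (sobolev_sqint oO bO i' j' sw).1.
apply: (sobolev_scalar1 oO bO (h := fun j x => (jac (w x) *m wgrad Omega w x) i j)) => //.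
  exact: (sqint_u hs).
by move=> j; exact: sqint_jac_wgrad.
Qed.

Lemma wgrad_comp_u : {ae leb d, forall x, Omega x ->
  wgrad Omega (u \o w) x = jac (w x) *m wgrad Omega w x}.
Proof.
have H : \forall x \ae leb d, forall i j, Omega x ->
    wD Omega (unit_index j) (component i (u \o w)) x = (jac (w x) *m wgrad Omega w x) i j.
  apply: filter_forall => i; apply: filter_forall => j.
  by apply: (wD_ae oO bO _ (ww i j)); exact: sqint_jac_wgrad.
by apply: filterS H => x H Ox; apply/matrixP => i j; rewrite [LHS]mxE H.
Qed.

End sobolev_composition.
End composition.

Lemma cvg_sq_ae_eq dX (X : measurableType dX) (R : realType) (mu : {measure set X -> \bar R})
    (D : set X) (F G : nat -> X -> R) (f : X -> R) : measurable D ->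
  (forall m, measurable_fun D (F m)) -> (forall m, measurable_fun D (G m)) -> measurable_fun D f ->
  (forall m, {ae mu, forall x, D x -> F m x = G m x}) -> cvg_sq mu D G f -> cvg_sq mu D F f.
Proof.
move=> mD mF mG mf FG; rewrite /cvg_sq.
rewrite (_ : (fun m => \int[mu]_(x in D) (G m x - f x) ^+ 2) = (fun m => \int[mu]_(x in D) (F m x - f x) ^+ 2))//.
apply/funext => m; apply: ae_eq_Rintegral => //.
- by apply: measurable_funX; exact: measurable_funB.
- by apply: measurable_funX; exact: measurable_funB.
- by apply: filterS (FG m) => x /[apply] ->.
Qed.

Lemma cvg_comp_continuous (U V : topologicalType) (h : U -> V) (v : nat -> U) (a : U) :
  continuous h -> v @ \oo --> a -> (fun m => h (v m)) @ \oo --> h a.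
Proof. by move=> ch va; apply: continuous_cvg va; exact: ch. Qed.

Section limit_passage.
Context {R : realType} {d N : nat} {T : R} {Omega : set 'cV[R]_d} {D : set 'cV[R]_N}.
Context {A : 'cV[R]_N -> 'M[R]_N} {f : 'cV[R]_N -> 'cV[R]_N} {s : 'cV[R]_N -> R}.
Context {u : 'cV[R]_N -> 'cV[R]_N} {gamma Cf : R} {rho0 : 'cV[R]_d -> 'cV[R]_N}.
Hypothesis hs : structural_assumptions T Omega D A f s u gamma Cf rho0.
Let oO := sa_open hs.
Let bO := sa_Omega_bounded hs.
Let mO : measurable Omega := open_measurable_mx oO.
Let muO : (leb d Omega < +oo)%E := leb_bounded mO bO.
Notation intg := (intg (leb d) Omega).
Notation sqint := (sqint (leb d) Omega).
Notation cvg_sq := (cvg_sq (leb d) Omega).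
Notation jac := (jac (u := u)).

Variables (p : nat) (S : nat -> discretization R d).
Hypothesis hS : forall m, discretization_of Omega p (S m).
Hypothesis h0 : (fun m => mesh_size (S m)) @ \oo --> (0 : R).

Section flux.
Variables (W_ : nat -> 'cV[R]_d -> 'cV[R]_N) (w : 'cV[R]_d -> 'cV[R]_N).
Hypotheses (mW_ : forall m, measurable_fun Omega (W_ m)) (mw : measurable_fun Omega w).
Hypothesis cW : {ae leb d, forall x, Omega x -> W_ m x @[m --> \oo] --> w x}.

Lemma comp_A_cvg i j : {ae leb d, forall x, Omega x -> A (u (W_ m x)) i j @[m --> \oo] --> A (u (w x)) i j}.
Proof.
apply: filterS cW => x c Ox.
exact: (cvg_comp_continuous (h := fun z => A (u z) i j) (A_u_continuous hs (i := i) (j := j)) (c Ox)).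
Qed.

Lemma comp_H_cvg i j : {ae leb d, forall x, Omega x ->
  hess s (u (W_ m x)) i j @[m --> \oo] --> hess s (u (w x)) i j}.
Proof.
apply: filterS cW => x c Ox.
exact: (cvg_comp_continuous (h := fun z => hess s (u z) i j) (hess_u_continuous hs (i := i) (j := j)) (c Ox)).
Qed.

Let HA z := hess s (u z) *m A (u z).

Lemma measurable_HA (V : 'cV[R]_d -> 'cV[R]_N) i j : measurable_fun Omega V ->
  measurable_fun Omega (fun x => HA (V x) i j).
Proof.
move=> mV; under eq_fun do rewrite mxE; apply: measurable_sum => k; apply: measurable_funM.
  exact: (measurable_H hs).
exact: (measurable_A hs).
Qed.

Lemma comp_HA_cvg : {ae leb d, forall x, Omega x -> forall i j, HA (W_ m x) i j @[m --> \oo] --> HA (w x) i j}.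
Proof.
have H1 : \forall x \ae leb d, forall i j, Omega x -> A (u (W_ m x)) i j @[m --> \oo] --> A (u (w x)) i j.
  by apply: filter_forall => i; apply: filter_forall => j; exact: comp_A_cvg.
have H2 : \forall x \ae leb d, forall i j, Omega x -> hess s (u (W_ m x)) i j @[m --> \oo] --> hess s (u (w x)) i j.
  by apply: filter_forall => i; apply: filter_forall => j; exact: comp_H_cvg.
apply: filterS2 H1 H2 => x c1 c2 Ox i j.
have E m : HA (W_ m x) i j = \sum_k hess s (u (W_ m x)) i k * A (u (W_ m x)) k j by rewrite mxE.
rewrite [X in _ --> X]mxE (funext E); apply: (@cvg_sumr _ _ _ \oo _) => k.
by apply: cvgM; [exact: c2|exact: c1].
Qed.

Variables (sig : forall m, broken (S m) 'M[R]_(N, d)) (G : nat -> 'cV[R]_d -> 'M[R]_(N, d)).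
Variables (g : 'cV[R]_d -> 'M[R]_(N, d)) (C K : R).
Hypothesis psig : forall m : nat, Sp_mx p (@sig m).
Hypothesis sigC : forall m : nat, \int[leb d]_(x in Omega) ip (broken_fun (@sig m) x) (broken_fun (@sig m) x) <= C.
Hypotheses (sG : forall m i j, sqint (fun x => G m x i j)) (sg : forall i j, sqint (fun x => g x i j)).
Hypothesis Gg : forall psi : 'cV[R]_d -> 'M[R]_(N, d), Lp Omega 2%:E psi ->
  (fun m => \int[leb d]_(x in Omega) ip (G m x) (psi x)) @ \oo --> \int[leb d]_(x in Omega) ip (g x) (psi x).
Hypothesis HAK : {ae leb d, forall x, Omega x -> forall m i j, `|HA (W_ m x) i j| <= K}.
Hypothesis eqG : forall (m : nat) (phi : broken (S m) 'M[R]_(N, d)), Sp_mx p phi ->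
  \int[leb d]_(x in Omega) ip ((A (u (W_ m x)))^T *m hess s (u (W_ m x)) *m broken_fun (@sig m) x) (broken_fun phi x) =
  - \int[leb d]_(x in Omega) ip ((A (u (W_ m x)))^T *m G m x) (broken_fun phi x).
Variables (L_ : nat -> 'cV[R]_d -> 'M[R]_(N, d)) (L : 'cV[R]_d -> 'M[R]_(N, d)).
Hypotheses (sL_ : forall m i j, sqint (fun x => L_ m x i j)) (sL : forall i j, sqint (fun x => L x i j)).
Hypothesis cL : forall i j, cvg_sq (fun m x => L_ m x i j) (fun x => L x i j).

Lemma weak_componentwise i j (psi : 'cV[R]_d -> R) : sqint psi ->
  (fun m => \int[leb d]_(x in Omega) (G m x i j * psi x)) @ \oo --> \int[leb d]_(x in Omega) (g x i j * psi x).
Proof.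
move=> spsi; pose P x := psi x *: delta_mx i j : 'M[R]_(N, d).
have PE (M : 'M[R]_(N, d)) x : ip M (P x) = M i j * psi x.
  rewrite ipE (bigD1 i)//= (bigD1 j)//= !mxE !eqxx mulr1 big1 => [|k kj]; last first.
    by rewrite !mxE (negbTE kj) andbF !mulr0.
  rewrite addr0 big1 ?addr0// => k ki; rewrite big1// => k' _.
  by rewrite !mxE (negbTE ki) !mulr0.
have LP : Lp Omega 2%:E P.
  apply/(Lp2P oO bO) => i' j'; under eq_fun do rewrite !mxE mulrC; exact: sqintZ.
have := Gg LP; under [X in X @ _ --> _ -> _]eq_fun => m do under eq_Rintegral do rewrite PE.
by under eq_Rintegral do rewrite PE.
Qed.

(* The test function [phi] solves [H A phi = A^T L]; through the discrete flux equation the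
   weakly bounded flux is thereby replaced by the weakly convergent LDG gradient. *)
Lemma flux_limit :
  (fun m => \int[leb d]_(x in Omega) ip (A (u (W_ m x)) *m broken_fun (@sig m) x) (L_ m x)) @ \oo -->
  - \int[leb d]_(x in Omega) ip (g x) (jac (w x) *m ((A (u (w x)))^T *m L x)).
Proof.
have [CA CA0 HCA] := A_bounded hs.
have ssig m i j := Sp_mx_sqint (hS m) oO bO i j (@psig m).
have sigCc m i j : \int[leb d]_(x in Omega) (broken_fun (@sig m) x i j) ^+ 2 <= C.
  apply: le_trans (sigC m); apply: le_Rintegral => //; [exact: (ssig m i j).2|exact: sqint_ip|].
  by move=> x _; exact: coord_sqr_le_ip.
have mA (V : 'cV[R]_d -> 'cV[R]_N) i j (mV : measurable_fun Omega V) := measurable_A hs i j mV.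
have cA : {ae leb d, forall x, Omega x -> forall i j, A (u (W_ m x)) i j @[m --> \oo] --> A (u (w x)) i j}.
  have H1 : \forall x \ae leb d, forall i j, Omega x -> A (u (W_ m x)) i j @[m --> \oo] --> A (u (w x)) i j.
    by apply: filter_forall => i; apply: filter_forall => j; exact: comp_A_cvg.
  by apply: filterS H1 => x H Ox i j; exact: H.
have mAT (V : 'cV[R]_d -> 'cV[R]_N) i j (mV : measurable_fun Omega V) : measurable_fun Omega (fun x => (A (u (V x)))^T i j).
  by under eq_fun do rewrite mxE; exact: mA.
pose P_ m x := (A (u (W_ m x)))^T *m L_ m x.
pose P x := (A (u (w x)))^T *m L x.
have sP_ m : forall i j, sqint (fun x => P_ m x i j).
  apply: (sqint_mulmx oO bO (C := CA)) => //; first by move=> i j; exact: mAT.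
  by apply: nearW => x Ox i j; rewrite mxE.
have sP : forall i j, sqint (fun x => P x i j).
  apply: (sqint_mulmx oO bO (C := CA)) => //; first by move=> i j; exact: mAT.
  by apply: nearW => x Ox i j; rewrite mxE.
have cP i j : cvg_sq (fun m x => P_ m x i j) (fun x => P x i j).
  apply: (cvg_sq_mulmx oO bO (C := CA)) => //.
  - by move=> m i' j'; exact: mAT.
  - by move=> i' j'; exact: mAT.
  - by apply: nearW => x Ox m i' j'; rewrite mxE.
  - apply: filterS cA => x c Ox i' j'; rewrite mxE.
    by under eq_fun do rewrite mxE; exact: c.
pose Q x := invmx (HA (w x)) *m P x.
have sQ : forall i j, sqint (fun x => Q x i j).
  apply: (sqint_mulmx oO bO (C := gamma^-1)) => //.
    apply: measurable_invmx => [i j|x]; first exact: measurable_HA.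
    exact: (HA_unit hs).
  by apply: nearW => x Ox i j; exact: (invmx_HA_bounded hs).
have HAQ x : HA (w x) *m Q x = P x by rewrite mulKVmx//; exact: (HA_unit hs).
have AQ x : A (u (w x)) *m Q x = jac (w x) *m P x by rewrite mulmxA (A_inv_HA hs).
(* [Q] is not a discrete function; its broken approximations are admissible in the flux equation. *)
have [F pF cF] := Sp_mx_dense oO bO hS h0 sQ.
have sF m i j := Sp_mx_sqint (hS m) oO bO i j (pF m).
have sHF m : forall i j, sqint (fun x => (HA (W_ m x) *m broken_fun (F m) x) i j).
  apply: (sqint_mulmx oO bO (C := K)) => //; first by move=> i j; exact: measurable_HA.
  by apply: filterS HAK => x H Ox i j; exact: H.
have sAF m : forall i j, sqint (fun x => (A (u (W_ m x)) *m broken_fun (F m) x) i j).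
  apply: (sqint_mulmx oO bO (C := CA)) => //; first by move=> i j; exact: mA.
  by apply: nearW => x Ox i j.
have sAQ : forall i j, sqint (fun x => (A (u (w x)) *m Q x) i j).
  apply: (sqint_mulmx oO bO (C := CA)) => //; first by move=> i j; exact: mA.
  by apply: nearW => x Ox i j.
(* The uniform bound [K] on [s'' A] enters here: mean-square convergence of [F m] need not survive
   multiplication by unbounded coefficients. *)
have cHF i j : cvg_sq (fun m x => (HA (W_ m x) *m broken_fun (F m) x) i j) (fun x => P x i j).
  rewrite (_ : (fun x => P x i j) = (fun x => (HA (w x) *m Q x) i j)); last first.
    by apply/funext => x; rewrite HAQ.
  apply: (cvg_sq_mulmx oO bO (C := K)) => //.
  - by move=> m i' j'; exact: measurable_HA.
  - by move=> i' j'; exact: measurable_HA.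
  - exact: comp_HA_cvg.
have cAF i j : cvg_sq (fun m x => (A (u (W_ m x)) *m broken_fun (F m) x) i j) (fun x => (A (u (w x)) *m Q x) i j).
  apply: (cvg_sq_mulmx oO bO (C := CA)) => //.
  - by move=> m i' j'; exact: mA.
  - by move=> i' j'; exact: mA.
  - by apply: nearW => x Ox m i' j'.
(* Moved across the product, [s'' A] becomes [A^T s''] by symmetry of the Hessian, and the flux
   equation applies with test function [F m]. *)
have T2 m : \int[leb d]_(x in Omega) ip (broken_fun (@sig m) x) (HA (W_ m x) *m broken_fun (F m) x) =
    - \int[leb d]_(x in Omega) ip (G m x) (A (u (W_ m x)) *m broken_fun (F m) x).
  transitivity (\int[leb d]_(x in Omega) ip ((A (u (W_ m x)))^T *m hess s (u (W_ m x)) *m broken_fun (@sig m) x) (broken_fun (F m) x)).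
    apply: eq_Rintegral => x _; rewrite ipC ip_mulmxl ipC; congr ip.
    by rewrite trmx_mul (hess_u_sym hs).
  by rewrite eqG//; congr (- _); apply: eq_Rintegral => x _; rewrite ip_mulmxl trmxK.
(* The pairing differs from that of [T2] by the flux against [P_ m - s'' A F m]; this factor tends
   to zero strongly while the flux stays bounded. *)
have T1 m : \int[leb d]_(x in Omega) ip (A (u (W_ m x)) *m broken_fun (@sig m) x) (L_ m x) =
    \sum_i \sum_j \int[leb d]_(x in Omega) (broken_fun (@sig m) x i j * (P_ m x i j - (HA (W_ m x) *m broken_fun (F m) x) i j)) +
    - \int[leb d]_(x in Omega) ip (G m x) (A (u (W_ m x)) *m broken_fun (F m) x).
  rewrite -T2.
  have -> : \sum_i \sum_j \int[leb d]_(x in Omega) (broken_fun (@sig m) x i j * (P_ m x i j - (HA (W_ m x) *m broken_fun (F m) x) i j)) =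
     \int[leb d]_(x in Omega) ip (broken_fun (@sig m) x) (P_ m x - HA (W_ m x) *m broken_fun (F m) x).
    rewrite (Rintegral_ip oO bO)//.
      by apply: eq_bigr => i _; apply: eq_bigr => j _; apply: eq_Rintegral => x _; rewrite [in RHS]mxE [X in _ = _ * (_ + X)]mxE.
    by move=> i j; under eq_fun do rewrite mxE [X in _ + X]mxE; exact: sqintB.
  rewrite -RintegralD//; last first.
  - by apply: sqint_ip.
  - by apply: sqint_ip => // i j; under eq_fun do rewrite mxE [X in _ + X]mxE; exact: sqintB.
  by apply: eq_Rintegral => x _; rewrite ipBr subrK ip_mulmxl.
rewrite (funext T1).
have -> : \int[leb d]_(x in Omega) ip (g x) (jac (w x) *m ((A (u (w x)))^T *m L x)) =
   \int[leb d]_(x in Omega) ip (g x) (A (u (w x)) *m Q x) by apply: eq_Rintegral => x _; rewrite AQ.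
rewrite -[X in _ --> X]add0r; apply: cvgD.
  have Z : \sum_(i < N) \sum_(j < d) (0 : R) = 0 by rewrite big1// => i _; rewrite big1.
  rewrite -[X in _ --> X]Z; apply: (@cvg_sumr _ _ _ \oo _) => i; apply: (@cvg_sumr _ _ _ \oo _) => j.
  apply: (Rintegral_mul_cvg0 mO (fun m => ssig m i j) _ (fun m => sigCc m i j)).
    by move=> m; exact: sqintB.
  have := cvg_sqD mO (fun m => sP_ m i j) (sP i j) (fun m => sqintZ mO (-1) (sHF m i j)) (sqintZ mO (-1) (sP i j)) (cP i j)
    (cvg_sqZ mO (-1) (fun m => sHF m i j) (sP i j) (cHF i j)).
  rewrite /cvg_sq (_ : (fun m => \int[leb d]_(x in Omega) _) = (fun m => \int[leb d]_(x in Omega) (P_ m x i j - (HA (W_ m x) *m broken_fun (F m) x) i j) ^+ 2))//.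
  apply/funext => m; apply: eq_Rintegral => x _; congr (_ ^+ 2); rewrite !mulN1r; ring.
apply: cvgN.
rewrite (Rintegral_ip oO bO)//.
rewrite (_ : (fun m => _) = (fun m => \sum_i \sum_j \int[leb d]_(x in Omega) (G m x i j * (A (u (W_ m x)) *m broken_fun (F m) x) i j))); last first.
  by apply/funext => m; rewrite (Rintegral_ip oO bO).
apply: (@cvg_sumr _ _ _ \oo _) => i; apply: (@cvg_sumr _ _ _ \oo _) => j.
apply: (cvg_weak_sq mO muO) => //.
by move=> psi spsi; exact: weak_componentwise.
Qed.

End flux.
End limit_passage.

(** * The limit equation *)

Section limit_equation.
Context {R : realType} {d N : nat} {T : R} {Omega : set 'cV[R]_d} {D : set 'cV[R]_N}.
Context {A : 'cV[R]_N -> 'M[R]_N} {f : 'cV[R]_N -> 'cV[R]_N} {s : 'cV[R]_N -> R}.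
Context {u : 'cV[R]_N -> 'cV[R]_N} {gamma Cf : R} {rho0 : 'cV[R]_d -> 'cV[R]_N}.
Hypothesis hs : structural_assumptions T Omega D A f s u gamma Cf rho0.
Let oO := sa_open hs.
Let bO := sa_Omega_bounded hs.
Let lO := sa_Omega_lipschitz hs.
Let d0 := sa_dim_gt0 hs.
Let mO : measurable Omega := open_measurable_mx oO.
Let muO : (leb d Omega < +oo)%E := leb_bounded mO bO.
Notation intg := (intg (leb d) Omega).
Notation sqint := (sqint (leb d) Omega).
Notation cvg_sq := (cvg_sq (leb d) Omega).
Notation jac := (jac (u := u)).

Lemma ldg_gradvE (S : discretization R d) (lam : broken S 'cV[R]_N) x i j :
  broken_fun (ldg_gradv lam) x i j = broken_fun (ldg_grad (bcomp i lam)) x 0 j.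
Proof.
rewrite !broken_fun_coord; congr (broken_fun _ x).
by apply/funext => k; apply/funext => y; rewrite mxE.
Qed.

Variables (p l : nat) (S : nat -> discretization R d).
Hypotheses (l1 : (1 <= l)%N) (hS : forall m, discretization_of Omega p (S m)).
Hypothesis h0 : (fun m => mesh_size (S m)) @ \oo --> (0 : R).
Hypothesis hSp : forall m (v : broken (S m) R), Sp_cont Omega l v -> Sp p v.

Lemma conforming_cvg (lam_ : forall m, broken (S m) 'cV[R]_N) (lam : 'cV[R]_d -> 'cV[R]_N) :
  (forall m i, Sp_cont Omega l (bcomp i (lam_ m))) -> sobolev Omega 1 lam ->
  (fun m => sobolev_norm Omega 1 (fun x => broken_fun (lam_ m) x - lam x)) @ \oo --> (0 : R) ->
  (forall i j, cvg_sq (fun m x => broken_fun (lam_ m) x i j) (fun x => lam x i j)) /\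
  (forall i j, cvg_sq (fun m x => broken_fun (ldg_gradv (lam_ m)) x i j) (fun x => wgrad Omega lam x i j)).
Proof.
move=> cl sl lw.
have s_ m : sobolev Omega 1 (broken_fun (lam_ m)).
  by move=> k; rewrite component_broken_fun; exact: (cl m k).2.
have [lw0 lw1] := sobolev_norm_cvg oO bO s_ sl lw.
have pl m : Sp_mx p (lam_ m) by move=> i j; rewrite ord1; apply: hSp; exact: (cl m i).
split => [i j|i j]; first by rewrite ord1; exact: lw0.
have pG m := ldg_gradv_Sp (hS m) (pl m).
rewrite (_ : (fun x => wgrad Omega lam x i j) = wD Omega (unit_index j) (component i lam)); last first.
  by apply/funext => x; rewrite mxE.
have u1 : (\sum_i unit_index j i <= 1)%N by rewrite sum_unit_index.
apply: cvg_sq_ae_eq (lw1 i j) => //.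
- by move=> m; exact: (Sp_mx_sqint (hS m) oO bO i j (pG m)).1.
- by move=> m; exact: (wD_sqint oO bO (s_ m i) u1).1.
- exact: (wD_sqint oO bO (sl i) u1).1.
- move=> m; apply: filterS (ldg_conforming d0 (hS m) oO bO lO (pl m i 0) (cl m i)) => x H Ox.
  by rewrite ldg_gradvE H// component_broken_fun.
Qed.

Variables (eta eps tau : R) (rho_ : nat -> 'cV[R]_d -> 'cV[R]_N) (rho w : 'cV[R]_d -> 'cV[R]_N).
Variables (w_ : forall m, broken (S m) 'cV[R]_N) (sig_ : forall m, broken (S m) 'M[R]_(N, d)) (C K : R).
Hypothesis hstep : forall m : nat, dg_step Omega D A f s u eta eps tau p (rho_ m) (@w_ m) (@sig_ m).
Hypothesis sw : sobolev Omega l w.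
Hypothesis ww : forall i j, weak_derivative Omega (unit_index j) (component i (u \o w))
    (fun x => (jac (w x) *m wgrad Omega w x) i j).
Hypothesis cgrad : forall psi : 'cV[R]_d -> 'M[R]_(N, d), Lp Omega 2%:E psi ->
  (fun m => \int[leb d]_(x in Omega) ip (broken_fun (ldg_gradv (@w_ m)) x) (psi x)) @ \oo -->
    \int[leb d]_(x in Omega) ip (wgrad Omega w x) (psi x).
Hypothesis cw : {ae leb d, forall x, Omega x -> broken_fun (@w_ m) x @[m --> \oo] --> w x}.
Hypothesis ctest : forall lam, sobolev Omega l lam ->
  exists lam_ : forall m, broken (S m) 'cV[R]_N,
    [/\ forall m i, Sp_cont Omega l (bcomp i (lam_ m)),
        (fun m => sobolev_norm Omega 1 (fun x => broken_fun (lam_ m) x - lam x)) @ \oo --> (0 : R) &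
        (fun m => c_formv (@w_ m) (lam_ m)) @ \oo --> sobolev_form Omega l w lam].
Hypothesis sigC : forall m : nat, \int[leb d]_(x in Omega) ip (broken_fun (@sig_ m) x) (broken_fun (@sig_ m) x) <= C.
Hypothesis HAK : {ae leb d, forall x, Omega x -> forall m i j,
  `|(hess s (u (broken_fun (@w_ m) x)) *m A (u (broken_fun (@w_ m) x))) i j| <= K}.
Hypotheses (srho_ : forall m i j, sqint (fun x => rho_ m x i j)) (srho : forall i j, sqint (fun x => rho x i j)).
(** Treats all time levels alike: for the projected datum the pairing passes to the limit by
    orthogonality, for later densities by their strong convergence. *)
Hypothesis crho : forall (lam_ : forall m, broken (S m) 'cV[R]_N) (lam : 'cV[R]_d -> 'cV[R]_N),
  (forall m, Sp_mx p (lam_ m)) -> (forall i j, sqint (fun x => lam x i j)) ->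
  (forall i j, cvg_sq (fun m x => broken_fun (lam_ m) x i j) (fun x => lam x i j)) ->
  (fun m => \int[leb d]_(x in Omega) ip (rho_ m x) (broken_fun (lam_ m) x)) @ \oo -->
    \int[leb d]_(x in Omega) ip (rho x) (lam x).

Lemma comp_bounded_cvg (g : 'cV[R]_N -> 'cV[R]_N) (B : R) : (forall i, continuous (fun z => g z i 0)) ->
  (forall z i, `|g z i 0| <= B) ->
  forall i j, cvg_sq (fun m x => g (broken_fun (@w_ m) x) i j) (fun x => g (w x) i j).
Proof.
move=> cg gB i j; rewrite ord1.
have mg : measurable_fun setT (fun z => g z i 0) by apply: continuous_measurable_mx.
have mw : measurable_fun Omega w.
  by apply: measurable_fun_matrix => // i' j'; exact: (sobolev_sqint oO bO i' j' sw).1.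
apply: (cvg_sq_bounded_ae mO muO (M := B)).
- move=> m; apply: (measurableT_comp (f := fun z => g z i 0)) => //.
  exact: (measurable_W hs (hS m) (@hstep m)).
- exact: (measurableT_comp (f := fun z => g z i 0)).
- by apply: nearW => x m Ox.
- by apply: filterS cw => x c Ox; exact: (cvg_comp_continuous (h := fun z => g z i 0) (cg i) (c Ox)).
Qed.

(** The approximations of the test function are conforming, so the stabilisation term is zero on
    every mesh; the regularising form converges by assumption, and the other terms apart from the
    flux are pairings of strongly convergent sequences. *)
Lemma limit_stepP : limit_step Omega A f u eps tau l rho w.
Proof.
move=> lam slam; have [lam_ [cl lw cc]] := ctest slam.
have sw1 := sobolevW l1 sw; have slam1 := sobolevW l1 slam.
have [cv cG] := conforming_cvg cl slam1 lw.
have pl m : Sp_mx p (lam_ m) by move=> i j; rewrite ord1; apply: hSp; exact: (cl m i).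
have pG m := ldg_gradv_Sp (hS m) (pl m).
have pw m : Sp_mx p (@w_ m) by have [] := @hstep m.
have psig m : Sp_mx p (@sig_ m) by have [] := @hstep m.
have mw : measurable_fun Omega w.
  by apply: measurable_fun_matrix => // i' j'; exact: (sobolev_sqint oO bO i' j' sw).1.
have mW m := measurable_W hs (hS m) (@hstep m).
have slam0 i j : sqint (fun x => lam x i j) by exact: (sobolev_sqint oO bO i j slam).
have sv m i j := Sp_mx_sqint (hS m) oO bO i j (pl m).
have sGl m i j := Sp_mx_sqint (hS m) oO bO i j (pG m).
have sGw m i j := Sp_mx_sqint (hS m) oO bO i j (ldg_gradv_Sp (hS m) (pw m)).
have F := flux_limit hs hS h0 mW mw cw psig sigC sGw (fun i j => wgrad_sqint oO bO i j sw1) cgrad HAK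
  (fun m phi => let: And4 _ _ E _ := @hstep m in E phi) sGl (fun i j => wgrad_sqint oO bO i j slam1) cG.
have [Bf Bf0 HBf] := f_bounded hs; have [Bu Bu0 HBu] := D_coord_bounded hs.
have su m i j := sqint_u hs i j (mW m).
have cF := cvg_Rintegral_ip oO bO (fun m i j => sqint_f hs i j (mW m)) (fun i j => sqint_f hs i j mw) sv slam0
  (comp_bounded_cvg (g := f \o u) (fun i => f_u_continuous hs (i := i)) HBf) cv.
have cU := cvg_Rintegral_ip oO bO su (fun i j => sqint_u hs i j mw) sv slam0
  (comp_bounded_cvg (g := u) (fun i => u_coord_continuous hs (i := i)) (fun z i => HBu _ i (sa_u_range hs z))) cv.
have cR := crho pl slam0 cv.
have E m : eps * tau * c_formv (@w_ m) (lam_ m) +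
   (\int[leb d]_(x in Omega) ip (u (broken_fun (@w_ m) x)) (broken_fun (lam_ m) x) -
    \int[leb d]_(x in Omega) ip (rho_ m x) (broken_fun (lam_ m) x)) -
   tau * \int[leb d]_(x in Omega) ip (A (u (broken_fun (@w_ m) x)) *m broken_fun (@sig_ m) x) (broken_fun (ldg_gradv (lam_ m)) x) =
   tau * \int[leb d]_(x in Omega) ip (f (u (broken_fun (@w_ m) x))) (broken_fun (lam_ m) x).
  have [_ _ _ /(_ _ (pl m))] := @hstep m.
  rewrite (conforming_jump_integral d0 (hS m) oO bO lO (@w_ m) (fun k1 k2 => stab D A eta k1 k2) (cl m)) mulr0 addr0 => <-.
  congr (_ + _ - _); rewrite -RintegralB//; [|exact: sqint_ip..].
  by apply: eq_Rintegral => x _; rewrite ipBl.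
pose J := \int[leb d]_(x in Omega) ip (wgrad Omega w x) (jac (w x) *m ((A (u (w x)))^T *m wgrad Omega lam x)).
pose IU := \int[leb d]_(x in Omega) ip (u (w x)) (lam x).
pose IR := \int[leb d]_(x in Omega) ip (rho x) (lam x).
pose IF := \int[leb d]_(x in Omega) ip (f (u (w x))) (lam x).
have L1 : (fun m => tau * \int[leb d]_(x in Omega) ip (f (u (broken_fun (@w_ m) x))) (broken_fun (lam_ m) x)) @ \oo -->
    eps * tau * sobolev_form Omega l w lam + (IU - IR) - tau * - J.
  rewrite -(funext E); apply: cvgB.
    by apply: cvgD; [apply: cvgM; [exact: cvg_cst|exact: cc]|exact: cvgB].
  by apply: cvgM; [exact: cvg_cst|exact: F].
have L2 : (fun m => tau * \int[leb d]_(x in Omega) ip (f (u (broken_fun (@w_ m) x))) (broken_fun (lam_ m) x)) @ \oo --> tau * IF.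
  by apply: cvgM; [exact: cvg_cst|exact: cF].
have U : eps * tau * sobolev_form Omega l w lam + (IU - IR) - tau * - J = tau * IF.
  exact: (cvg_unique _ L1 L2).
rewrite -/IF -U mulrN opprK; congr (_ + _ + _ * _).
  rewrite /IU /IR -RintegralB//; [|by apply: sqint_ip => // i j; exact: (sqint_u hs)|exact: sqint_ip].
  by apply: eq_Rintegral => x _; rewrite ipBl.
have [CA CA0 HCA] := A_bounded hs.
have mipA (V : 'cV[R]_d -> 'M[R]_(N, d)) : (forall i j, sqint (fun x => V x i j)) ->
    measurable_fun Omega (fun x => ip (A (u (w x)) *m V x) (wgrad Omega lam x)).
  move=> sV; apply: intg_measurable; apply: sqint_ip => //; last by move=> i j; exact: wgrad_sqint.
  apply: (sqint_mulmx oO bO (C := CA)) => //; first by move=> i j; exact: (measurable_A hs).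
  by apply: nearW => x.
(* Symmetry of the Jacobian brings all coefficients back onto the gradient of [w], where the chain
   rule recognises the gradient of [u \o w]. *)
apply: esym; transitivity (\int[leb d]_(x in Omega) ip (A (u (w x)) *m (jac (w x) *m wgrad Omega w x)) (wgrad Omega lam x)).
  by apply: eq_Rintegral => x _; rewrite !ip_mulmxl (jac_sym hs).
apply: ae_eq_Rintegral => //.
- by apply: mipA; exact: (sqint_jac_wgrad hs).
- by apply: mipA => i j; apply: wgrad_sqint => //; exact: (comp_u_sobolev hs).
- by apply: filterS (wgrad_comp_u hs sw1 ww) => x H Ox; rewrite H.
Qed.

End limit_equation.

(** * Entropy inequality *)

Section ae_equality.
Context dX (X : measurableType dX) (R : realType) (mu : {measure set X -> \bar R}).
Local Open Scope ereal_scope.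

(* No measurability: the integral of a nonnegative function is a supremum over the
   simple functions below it, which may be cut off on a null set. *)
Lemma ae_ge0_le_integral_gen (f g : X -> \bar R) : (forall x, 0 <= f x) -> (forall x, 0 <= g x) ->
  {ae mu, forall x, f x = g x} -> \int[mu]_x f x <= \int[mu]_x g x.
Proof.
move=> f0 g0 [B [mB B0 fgB]]; rewrite !ge0_integralTE//.
apply: ge_ereal_sup => _ [h hf <-].
pose h' := proj_nnsfun h (measurableC mB).
have h'E x : h' x = (h x * \1_(~` B) x)%R by [].
apply: ereal_sup_ubound; exists h' => [x|].
  rewrite h'E indicE; have [xB|xB] := boolP (x \in ~` B); last by rewrite mulr0.
  rewrite mulr1 -(_ : f x = g x); first exact: hf.
  by apply: contrapT => /fgB; move: xB; rewrite inE.
rewrite -!integralT_nnsfun; apply: ae_eq_integral => //; try exact/measurable_EFinP.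
exists B; split => // x /= /not_implyP[_ nE]; apply: contrapT => nB; apply: nE.
have hh : h' x = h x by rewrite h'E indicE mem_set// mulr1.
exact: (congr1 EFin hh).
Qed.

Lemma ae_eq_integral_gen (D : set X) (f g : X -> \bar R) :
  {ae mu, forall x, D x -> f x = g x} -> \int[mu]_(x in D) f x = \int[mu]_(x in D) g x.
Proof.
move=> fg; rewrite [LHS]integralE [RHS]integralE.
suff H (F G : X -> \bar R) : (forall x, 0 <= F x) -> (forall x, 0 <= G x) ->
    {ae mu, forall x, D x -> F x = G x} -> \int[mu]_(x in D) F x = \int[mu]_(x in D) G x.
  congr (_ - _); apply: H => [x|x|]; rewrite ?funepos_ge0 ?funeneg_ge0//.
    by apply: filterS fg => x e Dx; rewrite !funeposE e.
  by apply: filterS fg => x e Dx; rewrite !funenegE e.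
move=> F0 G0 FG; rewrite [LHS]integral_mkcond [RHS]integral_mkcond.
have P0 (K : X -> \bar R) x : (forall x, 0 <= K x) -> 0 <= (K \_ D) x.
  by move=> K0; rewrite patchE; case: ifP.
apply/eqP; rewrite eq_le; apply/andP; split; apply: ae_ge0_le_integral_gen => [x|x|];
  try exact: P0.
all: apply: filterS FG => x H; rewrite !patchE; case: ifPn => //; rewrite inE => /H //.
Qed.

Lemma ae_eq_Rintegral_gen (D : set X) (f g : X -> R) :
  {ae mu, forall x, D x -> f x = g x} -> \int[mu]_(x in D) (f x)%:E = \int[mu]_(x in D) (g x)%:E.
Proof. by move=> fg; apply: ae_eq_integral_gen; apply: filterS fg => x /[apply] ->. Qed.

End ae_equality.

Lemma entropy_balance (R : realFieldType) (X I1 I2 I3 Is Ig Z c C V tau : R) :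
  X + I1 + tau * I2 = tau * I3 -> Is - Ig <= I1 -> tau * (c * Z) <= tau * I2 ->
  tau * I3 <= tau * (C * V) -> X + Is + c * tau * Z <= Ig + C * tau * V.
Proof. by move=> ? ? ? ?; lra. Qed.

Section entropy_inequality.
Context {R : realType} {d N : nat} {T : R} {Omega : set 'cV[R]_d} {D : set 'cV[R]_N}.
Context {A : 'cV[R]_N -> 'M[R]_N} {f : 'cV[R]_N -> 'cV[R]_N} {s : 'cV[R]_N -> R}.
Context {u : 'cV[R]_N -> 'cV[R]_N} {gamma Cf : R} {rho0 : 'cV[R]_d -> 'cV[R]_N}.
Hypothesis hs : structural_assumptions T Omega D A f s u gamma Cf rho0.
Let oO := sa_open hs.
Let bO := sa_Omega_bounded hs.
Let mO : measurable Omega := open_measurable_mx oO.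
Let muO : (leb d Omega < +oo)%E := leb_bounded mO bO.
Notation intg := (intg (leb d) Omega).
Notation sqint := (sqint (leb d) Omega).
Notation jac := (jac (u := u)).

(* [s] is arbitrary outside the closure of [D], so [s \o rho] itself may fail to be
   measurable on the null set where [rho] leaves [D]. *)
Lemma entropy_representative (rho : 'cV[R]_d -> 'cV[R]_N) : measurable_fun Omega rho ->
  {ae leb d, forall x, Omega x -> D (rho x)} ->
  exists2 g, intg g & {ae leb d, forall x, Omega x -> s (rho x) = g x}.
Proof.
move=> mrho Drho; have mD := open_measurable_mx (D_open hs).
pose rho' x := if `[< D (rho x) >] then rho x else u 0.
have Drho' x : D (rho' x) by rewrite /rho'; case: asboolP => // _; exact: (sa_u_range hs).
have mE : measurable_fun Omega (fun x => `[< D (rho x) >]).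
  apply: (measurable_fun_bool true).
  rewrite (_ : _ @^-1` _ = rho @^-1` D); first exact: mrho.
  by apply/seteqP; split => x /= /asboolP.
have mrho' : measurable_fun Omega rho'.
  apply: measurable_fun_if => //.
  by apply: measurable_funS mrho => // x [].
have ms : measurable_fun D s.
  apply: continuous_on_measurable; first exact: (D_open hs).
  by move=> r Dr; apply: differentiable_continuous; exact: (s_differentiable hs).
have [C HC] := s_bounded hs.
exists (s \o rho').
  apply: (intg_bounded mO muO (M := C)) => [|x _]; last exact: HC.
  apply: (measurable_comp mD) => // _ [x _ <-]; exact: Drho'.
by apply: filterS Drho => x H Ox; rewrite /= /rho'; case: asboolP => // /(_ (H Ox)).
Qed.

Lemma D_valued_sqint (rho : 'cV[R]_d -> 'cV[R]_N) i j : measurable_fun Omega rho ->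
  {ae leb d, forall x, Omega x -> D (rho x)} -> sqint (fun x => rho x i j).
Proof.
move=> mrho Drho; have [Bu Bu0 HBu] := D_coord_bounded hs.
rewrite ord1; have mr : measurable_fun Omega (fun x => rho x i 0) by exact: measurable_mx_coord.
split => //; apply: (ae_le_intg mO (g := fun=> Bu ^+ 2)); last exact: intg_cst.
  exact: measurable_funX.
apply: filterS Drho => x H Ox; rewrite ger0_norm ?sqr_ge0// -(real_normK (num_real _)).
by rewrite lerXn2r ?nnegrE//; apply: HBu; exact: H.
Qed.

Lemma entropy_step (l : nat) (eps tau : R) (rho w : 'cV[R]_d -> 'cV[R]_N) : 0 < tau ->
  (1 <= l)%N -> measurable_fun Omega rho -> {ae leb d, forall x, Omega x -> D (rho x)} ->
  sobolev Omega l w ->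
  (forall i j, weak_derivative Omega (unit_index j) (component i (u \o w))
    (fun x => (jac (w x) *m wgrad Omega w x) i j)) ->
  limit_step Omega A f u eps tau l rho w ->
  eps * tau * sobolev_norm Omega l w ^+ 2
        + \int[leb d]_(x in Omega) s (u (w x))
        + gamma * tau * fine (Lpnorm Omega 2%:E (wgrad Omega (u \o w))) ^+ 2
        <= \int[leb d]_(x in Omega) s (rho x) + Cf * tau * fine (leb d Omega).
Proof.
move=> t0 l1 mrho Drho sw ww /(_ _ sw); rewrite -sobolev_norm_sqr.
have sw1 := sobolevW l1 sw; have su1 := comp_u_sobolev hs sw1 ww.
have sgw i j := wgrad_sqint oO bO i j sw1; have sgu i j := wgrad_sqint oO bO i j su1.
have sw0 i j := sobolev_sqint oO bO i j sw.
have mw : measurable_fun Omega w.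
  by apply: measurable_fun_matrix => // i' j'; exact: (sw0 i' j').1.
rewrite (Lpnorm2_sqr oO bO sgu).
have [g ig sg] := entropy_representative mrho Drho.
have -> : \int[leb d]_(x in Omega) s (rho x) = \int[leb d]_(x in Omega) g x.
  by congr fine; exact: ae_eq_Rintegral_gen.
have [Cs HCs] := s_bounded hs.
have srho i j := D_valued_sqint i j mrho Drho.
have isu : intg (fun x => s (u (w x))).
  apply: (intg_bounded mO muO (M := Cs)) => [|x _]; last by apply: HCs; exact: (sa_u_range hs).
  apply: (measurableT_comp (f := s \o u)) => //.
  by apply: continuous_measurable_mx; exact: (s_u_continuous hs).
have H1 : \int[leb d]_(x in Omega) s (u (w x)) - \int[leb d]_(x in Omega) g x <=
    \int[leb d]_(x in Omega) ip (u (w x) - rho x) (w x).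
  rewrite -RintegralB//; apply: ae_le_Rintegral => //; first exact: intgB.
    apply: sqint_ip => // i j; under eq_fun do rewrite mxE [X in _ + X]mxE.
    by apply: sqintB => //; exact: (sqint_u hs).
  apply: filterS2 Drho sg => x Dx sgx Ox; rewrite -sgx//.
  by apply: (entropy_difference hs); exact: Dx.
have [CA CA0 HCA] := A_bounded hs.
have H2 : gamma * \int[leb d]_(x in Omega) ip (wgrad Omega (u \o w) x) (wgrad Omega (u \o w) x) <=
    \int[leb d]_(x in Omega) ip (A (u (w x)) *m wgrad Omega (u \o w) x) (wgrad Omega w x).
  rewrite -RintegralZl//; last exact: sqint_ip.
  apply: ae_le_Rintegral => //; first by apply: intgZ => //; exact: sqint_ip.
    apply: sqint_ip => //; apply: (sqint_mulmx oO bO (C := CA)) => //.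
      by move=> i j; exact: (measurable_A hs).
    by apply: nearW => x.
  apply: filterS (wgrad_comp_u hs sw1 ww) => x H Ox.
  (* The chain rule solved for the gradient of [w]: the dissipation becomes the quadratic form of
     [s'' A] in the gradient of the density, to which coercivity applies. *)
  have E : wgrad Omega w x = hess s (u (w x)) *m wgrad Omega (u \o w) x.
    by rewrite H// mulmxA (hess_jac hs) mul1mx.
  apply: le_trans (matrix_coercive hs (w x) _) _.
  by rewrite [in leRHS]E [leRHS]ip_mulmxl mulmxA ipC.
have H3 : \int[leb d]_(x in Omega) ip (f (u (w x))) (w x) <= Cf * fine (leb d Omega).
  apply: le_Rintegral_bound => //; first by apply: sqint_ip => // i j; exact: (sqint_f hs).
  by apply: nearW => x _; exact: (reaction_le hs).
by move=> E; exact: (entropy_balance E H1 (ler_wpM2l (ltW t0) H2) (ler_wpM2l (ltW t0) H3)).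
Qed.

End entropy_inequality.

Lemma le_sqr_add1 (R : realFieldType) (a b : R) : a ^+ 2 <= b -> a <= b + 1.
Proof. by move=> ab; have := sqr_ge0 (a - 1); nra. Qed.

Lemma entropy_telescope (R : realFieldType) (eps gamma Cf V S1 S2 S3 E0 E1 E2 tau q1 q2 : R) :
  eps * S1 + E1 + gamma * S2 <= E0 + Cf * S3 * V ->
  eps * tau * q1 + E2 + gamma * tau * q2 <= E1 + Cf * tau * V ->
  eps * (S1 + tau * q1) + E2 + gamma * (S2 + tau * q2) <= E0 + Cf * (S3 + tau) * V.
Proof. by move=> ? ?; lra. Qed.

(** * Extraction of subsequences and assembly over the time levels *)

Section convergence.
Context {R : realType} {d N : nat} {T : R} {Omega : set 'cV[R]_d} {D : set 'cV[R]_N}.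
Context {A : 'cV[R]_N -> 'M[R]_N} {f : 'cV[R]_N -> 'cV[R]_N} {s : 'cV[R]_N -> R}.
Context {u : 'cV[R]_N -> 'cV[R]_N} {gamma Cf : R} {rho0 : 'cV[R]_d -> 'cV[R]_N}.
Hypothesis hs : structural_assumptions T Omega D A f s u gamma Cf rho0.
Let oO := sa_open hs.
Let bO := sa_Omega_bounded hs.
Let lO := sa_Omega_lipschitz hs.
Let d0 := sa_dim_gt0 hs.
Let mO : measurable Omega := open_measurable_mx oO.
Let muO : (leb d Omega < +oo)%E := leb_bounded mO bO.
Notation intg := (intg (leb d) Omega).
Notation sqint := (sqint (leb d) Omega).
Notation cvg_sq := (cvg_sq (leb d) Omega).
Notation jac := (jac (u := u)).

Lemma rho0_measurable : measurable_fun Omega rho0.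
Proof. by have [] := sa_rho0_Loo hs. Qed.

Lemma rho0_sqint i j : sqint (fun x => rho0 x i j).
Proof. exact: (D_valued_sqint hs i j rho0_measurable (sa_rho0_range hs)). Qed.

Lemma HA_u_continuous i j : continuous (fun z => (hess s (u z) *m A (u z)) i j).
Proof.
move=> z; have E y : setT y -> \sum_k hess s (u y) i k * A (u y) k j = (hess s (u y) *m A (u y)) i j.
  by move=> _; rewrite mxE.
have H : \sum_k hess s (u y) i k * A (u y) k j @[y --> z] --> \sum_k hess s (u z) i k * A (u z) k j.
  apply: (@cvg_sumr _ _ _ (nbhs z) _) => k.
  exact: (cvgM (hess_u_continuous hs (i := i) (j := k) (x := z)) (A_u_continuous hs (i := k) (j := j) (x := z))).
exact: (@cvg_open_eq _ _ setT (fun y => \sum_k hess s (u y) i k * A (u y) k j) (fun y => (hess s (u y) *m A (u y)) i j) z openT I E H).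
Qed.

Variables (p l : nat) (disc : nat -> discretization R d).
Hypothesis hdisc : discretization_sequence Omega p disc.
Hypothesis hl : l = sobolev_index d D A s.
Hypothesis hSp : forall m (v : broken (disc m) R), Sp_cont Omega l v -> Sp p v.
Variable nrm : forall m, broken (disc m) 'cV[R]_N -> R.
Hypotheses (hnrm : forall m : nat, norm_on_Sp p (@nrm m)) (hco : DG_coercivity p nrm)
  (hsup : DG_sup_bound Omega p l nrm) (hcpt : DG_compactness Omega p l nrm).

Lemma l_ge1 : (1 <= l)%N.
Proof. by rewrite hl /sobolev_index; case: ifP. Qed.

Let hS m : discretization_of Omega p (disc m) := ds_disc hdisc m.

Section one_step.
Variables (w_ : forall m, broken (disc m) 'cV[R]_N).
Hypothesis pw_ : forall m : nat, Sp_mx p (@w_ m).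

(* The convergence properties of a subsequence that pass to the limit in the scheme;
   they are stable under further extraction. *)
Definition limit_of (Phi : nat -> nat) (w : 'cV[R]_d -> 'cV[R]_N) :=
  [/\ sobolev Omega l w,
    forall psi : 'cV[R]_d -> 'M[R]_(N, d), Lp Omega 2%:E psi ->
      (fun m => \int[leb d]_(x in Omega) ip (broken_fun (ldg_gradv (@w_ (Phi m))) x) (psi x)) @ \oo -->
      \int[leb d]_(x in Omega) ip (wgrad Omega w x) (psi x),
    {ae leb d, forall x, Omega x -> broken_fun (@w_ (Phi m)) x @[m --> \oo] --> w x} &
    forall lam, sobolev Omega l lam ->
      exists lam_ : forall m, broken (disc (Phi m)) 'cV[R]_N,
      [/\ forall m i, Sp_cont Omega l (bcomp i (lam_ m)),
        (fun m => sobolev_norm Omega 1 (fun x => broken_fun (lam_ m) x - lam x)) @ \oo --> (0 : R) &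
        (fun m => c_formv (@w_ (Phi m)) (lam_ m)) @ \oo --> sobolev_form Omega l w lam]].

Lemma limit_of_subsequence Phi psi w : strictly_increasing psi -> limit_of Phi w ->
  limit_of (fun m => Phi (psi m)) w.
Proof.
move=> hp [sw cg cw ct]; split => //.
- by move=> P /cg; exact: (cvg_subsequence hp).
- by apply: filterS cw => x c Ox; exact: (cvg_subsequence hp (c Ox)).
- move=> lam /ct[lam_ [cl lw cc]]; exists (fun m => lam_ (psi m)); split.
  + by move=> m i; exact: cl.
  + exact: (cvg_subsequence hp lw).
  + exact: (cvg_subsequence hp cc).
Qed.

Lemma extract_limit sigma (B : R) : strictly_increasing sigma ->
  (forall m : nat, nrm (@w_ m) <= B) ->
  exists phi w, strictly_increasing phi /\ limit_of (fun m => sigma (phi m)) w.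
Proof.
move=> hsig wB.
have [|phi [w [hp sw cg cL ct]]] := @hcpt sigma (fun m => @w_ (sigma m)) hsig (fun m => @pw_ (sigma m)).
  by exists B => m; exact: wB.
have sW m i j := Sp_mx_sqint (hS (sigma (phi m))) oO bO i j (@pw_ (sigma (phi m))).
have sw0 i j := sobolev_sqint oO bO i j sw.
(* The exponent 2 is admissible in every dimension, since [2 < 6]. *)
have c2 i j := Lp_cvg2 oO bO i j sW sw0 (cL 2 (ltW (ltr1n _ 2)) (fun _ => ltr_nat _ 2 6)).
have [psi hq cae] := cvg_sq_ae_subsequence_fin mO (fun i m => sW m i 0) (fun i => sw0 i 0) (fun i => c2 i 0).
exists (fun m => phi (psi m)), w; split; first exact: strictly_increasing_comp.
split => //.
- by move=> P /cg; exact: (cvg_subsequence hq).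
- apply: filterS cae => x c Ox; apply: cvg_mx => i j; rewrite ord1; exact: c.
- move=> lam /ct[lam_ [cl lw cc]]; exists (fun m => lam_ (psi m)); split.
  + by move=> m i; exact: cl.
  + exact: (cvg_subsequence hq lw).
  + exact: (cvg_subsequence hq cc).
Qed.

(** The two cases are those in the definition of [l]. If [s'' A] extends to the closure of [D],
    compactness bounds it; otherwise [d = 1] or [l = 2], the entropy variables are uniformly
    bounded, and a continuous function of them is bounded too. *)
Lemma HA_bounded (B : R) : (forall m : nat, nrm (@w_ m) <= B) ->
  exists K : R, {ae leb d, forall x, Omega x -> forall m i j,
    `|(hess s (u (broken_fun (@w_ m) x)) *m A (u (broken_fun (@w_ m) x))) i j| <= K}.
Proof.
move=> wB.
have [[Bx [cB BE]]|nB] := pselect (exists B : 'cV[R]_N -> 'M[R]_N,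
       continuous_on_closure D B /\ forall rho, D rho -> B rho = hess s rho *m A rho).
  have [K HK] := D_closure_bounded hs cB; exists K; apply: nearW => x Ox m i j.
  have Du := sa_u_range hs (broken_fun (@w_ m) x).
  rewrite -BE//; apply: le_trans (ler_coord_mx_norm _ _ _) (HK _ _); exact: subset_closure.
have dl : d = 1%N \/ l = 2.
  rewrite hl /sobolev_index; have [d1|d1] := eqVneq d 1%N; first by left.
  by right; case: asboolP.
have [CS CS0 HS] := hsup dl.
have [K K0 HK] := @coef_bounded R N N N (fun z => hess s (u z) *m A (u z)) (CS * B) (fun i j => @HA_u_continuous i j).
exists K.
have H m : {ae leb d, forall x, Omega x -> forall i j, `|broken_fun (@w_ m) x i j| <= CS * B}.
  apply: Lpnorm_ess_sup; apply: le_trans (HS m _ (@pw_ m)) _.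
  by rewrite lee_fin ler_pM2l.
have H' : \forall x \ae leb d, forall m, Omega x -> forall i j, `|broken_fun (@w_ m) x i j| <= CS * B.
  by apply: ae_foralln => m; exact: H.
apply: filterS H' => x H' Ox m i j; apply: HK; apply: ler_mx_norm; last by move=> *; exact: H'.
apply: mulr_ge0; first exact: ltW.
have [n0 _ _ _] := hnrm 0; exact: le_trans (n0 _ (@pw_ 0%N)) (wB 0%N).
Qed.

End one_step.
Section scheme.
Variables (eps eta : R) (Nt : nat) (tau : nat -> R).
Hypotheses (heps : 0 < eps) (heta : 0 < eta) (htau : forall n, (n < Nt)%N -> 0 < tau n.+1).
Variable rho_init : forall m, broken (disc m) 'cV[R]_N.
Hypothesis hinit : forall m : nat, is_L2_projection Omega p rho0 (@rho_init m).
Variables (w_ : forall m, nat -> broken (disc m) 'cV[R]_N)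
  (sig_ : forall m, nat -> broken (disc m) 'M[R]_(N, d)).
Variable rho_ : nat -> nat -> 'cV[R]_d -> 'cV[R]_N.
Hypothesis hrho_ : forall m,
  rho_ m = density u (broken_fun (@rho_init m)) (fun n => broken_fun (@w_ m n)).
Hypothesis hscheme : forall m n, (n < Nt)%N ->
  dg_step Omega D A f s u eta eps (tau n.+1) p (rho_ m n) (@w_ m n.+1) (@sig_ m n.+1).

Lemma scheme_w_Sp m n : (n < Nt)%N -> Sp_mx p (@w_ m n.+1).
Proof. by move=> /(hscheme m)[]. Qed.

Lemma scheme_w_measurable m n : (n < Nt)%N -> measurable_fun Omega (broken_fun (@w_ m n.+1)).
Proof. by move=> /(hscheme m); exact: (measurable_W hs (hS m)). Qed.

Lemma rho_sqint m n i j : (n < Nt)%N -> sqint (fun x => rho_ m n x i j).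
Proof.
rewrite hrho_; case: n => [_|n nNt] /=.
  exact: (Sp_mx_sqint (hS m) oO bO i j (hinit m).1).
by apply: (sqint_u hs); apply: scheme_w_measurable; exact: ltnW.
Qed.

(** In the first step [rho0] takes the place of the projected datum, with which it shares all
    pairings against discrete functions; in later steps the previous density is already a value of
    [u]. *)
Lemma scheme_energy m n (Cs : R) : (n < Nt)%N -> (forall rho, D rho -> `|s rho| <= Cs) ->
  eps * tau n.+1 * c_formv (@w_ m n.+1) (@w_ m n.+1) +
  gamma * tau n.+1 * \int[leb d]_(x in Omega) ip (broken_fun (@sig_ m n.+1) x) (broken_fun (@sig_ m n.+1) x)
  <= (tau n.+1 * Cf + (Cs + Cs)) * fine (leb d Omega).
Proof.
move=> nNt HCs; have srho := fun i j => @rho_sqint m n i j nNt.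
case: n nNt srho => [|n] nNt srho.
  apply: (discrete_energy hs (hS m) heta (htau nNt) (hscheme m nNt) srho rho0_sqint (sa_rho0_range hs) _ HCs).
  by move=> lam pl; rewrite hrho_ /=; exact: (hinit m).2.
apply: (discrete_energy hs (hS m) heta (htau nNt) (hscheme m nNt) srho srho _ _ HCs) => //.
by apply: nearW => x _; rewrite hrho_; exact: (sa_u_range hs).
Qed.

Lemma scheme_bounded n : (n < Nt)%N -> exists B : R, forall m : nat,
  nrm (@w_ m n.+1) <= B /\
  \int[leb d]_(x in Omega) ip (broken_fun (@sig_ m n.+1) x) (broken_fun (@sig_ m n.+1) x) <= B.
Proof.
move=> nNt; have [Cs HCs] := s_bounded hs; have [CDG CDG0 HC] := hco.
set E := (tau n.+1 * Cf + (Cs + Cs)) * fine (leb d Omega).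
have t0 := htau nNt; have g0 := sa_gamma hs.
(* The energy controls the square of the DG norm, with weight [eps * tau * CDG]; the added 1 passes
   from a bound on a square to one on the norm. *)
pose B1 := E / (eps * tau n.+1 * CDG) + 1; pose B2 := E / (gamma * tau n.+1).
exists (Num.max B1 B2) => m.
have H := @scheme_energy m n Cs nNt HCs; have pw := @scheme_w_Sp m n nNt.
have [n0 _ _ _] := hnrm m; have N0 := n0 _ pw.
have I0 : 0 <= \int[leb d]_(x in Omega) ip (broken_fun (@sig_ m n.+1) x) (broken_fun (@sig_ m n.+1) x).
  by apply: Rintegral_ge0 => x _; exact: ip_ge0.
have c0 : 0 <= c_formv (@w_ m n.+1) (@w_ m n.+1).
  by apply: le_trans (HC m _ pw); rewrite mulr_ge0 ?sqr_ge0// ltW.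
have et0 : 0 < eps * tau n.+1 by exact: mulr_gt0.
have gt0 : 0 < gamma * tau n.+1 by exact: mulr_gt0.
rewrite !le_max; split; apply/orP.
  left; rewrite /B1.
  have X : nrm (@w_ m n.+1) ^+ 2 <= E / (eps * tau n.+1 * CDG).
    rewrite ler_pdivlMr ?mulr_gt0//; apply: le_trans H.
    rewrite [leLHS]mulrC -[eps * _ * _ * _]mulrA -[leLHS]addr0; apply: lerD; last by apply: mulr_ge0 => //; exact: ltW.
    apply: ler_wpM2l; [exact: ltW|exact: HC].
  exact: le_sqr_add1.
right; rewrite /B2 ler_pdivlMr// mulrC; apply: le_trans H.
by rewrite lerDr; apply: mulr_ge0 => //; exact: ltW.
Qed.

(** Each time level refines the subsequence of the preceding ones; [limit_of] survives refinement,
    so finitely many extractions end in one subsequence for all levels. *)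
Lemma extract_limits k : (k <= Nt)%N -> exists Phi w, strictly_increasing Phi /\
  forall n, (1 <= n <= k)%N -> limit_of (fun m => @w_ m n) Phi (w n).
Proof.
elim: k => [|k IH] kNt.
  by exists id, (fun _ _ => 0); split => // n; rewrite leqn0 => /andP[/lt0n_neq0/negbTE ->].
have [Phi [w [hP Hw]]] := IH (ltnW kNt).
have [B HB] := scheme_bounded kNt.
have [phi [w' [hp Hw']]] := extract_limit (w_ := fun m => @w_ m k.+1)
  (fun m => @scheme_w_Sp m k kNt) hP (fun m => (HB m).1).
exists (fun m => Phi (phi m)), (fun n => if n == k.+1 then w' else w n).
split; first exact: strictly_increasing_comp.
move=> n /andP[n1]; rewrite leq_eqVlt => /orP[/eqP ->|nk]; first by rewrite eqxx.
rewrite (ltn_eqF nk); apply: limit_of_subsequence => //; apply: Hw.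
by rewrite n1 -ltnS.
Qed.

Section limits.
Variables (Phi : nat -> nat) (w : nat -> 'cV[R]_d -> 'cV[R]_N).
Hypothesis hPhi : strictly_increasing Phi.
Hypothesis hw : forall n, (1 <= n <= Nt)%N -> limit_of (fun m => @w_ m n) Phi (w n).
Local Notation rho := (density u rho0 w).

Lemma limit_w_measurable n : (1 <= n <= Nt)%N -> measurable_fun Omega (w n).
Proof.
move=> /hw[sw _ _ _].
by apply: measurable_fun_matrix => // i' j'; exact: (sobolev_sqint oO bO i' j' sw).1.
Qed.

Lemma limit_comp_u_weak_derivative n i j : (1 <= n <= Nt)%N ->
  weak_derivative Omega (unit_index j) (component i (u \o w n))
    (fun x => (jac (w n x) *m wgrad Omega (w n) x) i j).
Proof.
move=> /hw[sw _ _ ct]; have [lam_ [cl lw _]] := ct _ sw.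
apply: (comp_u_weak_derivative hs i j (fun m => disc_mesh (hS (Phi m))) cl _ lw).
exact: (sobolevW l_ge1 sw).
Qed.

Lemma rho_measurable n : (n <= Nt)%N -> measurable_fun Omega (rho n).
Proof.
case: n => [_|n nNt]; first exact: rho0_measurable.
apply: measurable_fun_matrix => // i j; apply: (sqint_u hs i j _).1.
exact: limit_w_measurable.
Qed.

Lemma rho_range n : {ae leb d, forall x, Omega x -> D (rho n x)}.
Proof.
case: n => [|n]; first exact: (sa_rho0_range hs).
by apply: nearW => x _; exact: (sa_u_range hs).
Qed.

Lemma density_cvg n r : (1 <= n <= Nt)%N -> 1 <= r ->
  Lp_cvg Omega r%:E (fun m => rho_ (Phi m) n) (rho n).
Proof.
move=> n1 r1; have [Bu Bu0 HBu] := D_coord_bounded hs.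
have mw := limit_w_measurable n1; have [sw _ cw _] := hw n1.
case: n n1 mw sw cw => // n n1 mw sw cw.
apply: (Lp_cvg_bounded oO bO (M := Bu + Bu)) => //.
- exact: lt_le_trans r1.
- exact: addr_ge0.
- move=> m i j; rewrite hrho_ /=; apply: (sqint_u hs i j _).1.
  exact: scheme_w_measurable.
- by move=> i j; apply: (sqint_u hs i j _).1.
- apply: nearW => x _ m i j; rewrite ord1 hrho_ /=; apply: le_trans (ler_normB _ _) _.
  by apply: lerD; apply: HBu; exact: (sa_u_range hs).
- apply: filterS cw => x c Ox i j; rewrite ord1.
  rewrite (_ : (fun k => _) = (fun k => u (broken_fun (@w_ (Phi k) n.+1) x) i 0)); last first.
    by apply/funext => k; rewrite hrho_.
  exact: (cvg_comp_continuous (h := fun z => u z i 0) (u_coord_continuous hs (i := i)) (c Ox)).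
Qed.

(** At level 0 the projected datum pairs with a discrete function exactly as [rho0] does, so no
    convergence of the projections is involved; later levels use bounded almost everywhere
    convergence. *)
Lemma density_pairing_cvg n (lam_ : forall m, broken (disc (Phi m)) 'cV[R]_N) (lam : 'cV[R]_d -> 'cV[R]_N) :
  (n < Nt)%N -> (forall m, Sp_mx p (lam_ m)) -> (forall i j, sqint (fun x => lam x i j)) ->
  (forall i j, cvg_sq (fun m x => broken_fun (lam_ m) x i j) (fun x => lam x i j)) ->
  (fun m => \int[leb d]_(x in Omega) ip (rho_ (Phi m) n x) (broken_fun (lam_ m) x)) @ \oo -->
    \int[leb d]_(x in Omega) ip (rho n x) (lam x).
Proof.
move=> nNt pl sl cl.
have sl_ m i j := Sp_mx_sqint (hS (Phi m)) oO bO i j (pl m).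
case: n nNt => [|n] nNt.
  rewrite (_ : (fun m => _) = (fun m => \int[leb d]_(x in Omega) ip (rho0 x) (broken_fun (lam_ m) x))).
    apply: (cvg_Rintegral_ip oO bO (fun _ => rho0_sqint) rho0_sqint sl_ sl _ cl) => i j.
    exact: cvg_sq_cst.
  by apply/funext => m; rewrite hrho_ /=; exact: (hinit (Phi m)).2.
have n1 : (1 <= n.+1 <= Nt)%N by exact: ltnW.
have mw := limit_w_measurable n1; have [sw _ cw _] := hw n1.
have [Bu Bu0 HBu] := D_coord_bounded hs.
have srn i j : sqint (fun x => rho n.+1 x i j) by exact: (sqint_u hs).
apply: (cvg_Rintegral_ip oO bO _ srn sl_ sl _ cl) => [m i j|i j]; first exact: rho_sqint.
rewrite ord1; apply: (cvg_sq_bounded_ae mO muO (M := Bu)).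
- by move=> m; exact: (@rho_sqint (Phi m) n.+1 i 0 nNt).1.
- exact: (srn i 0).1.
- by apply: nearW => x m _; rewrite hrho_; apply: HBu; exact: (sa_u_range hs).
- apply: filterS cw => x c Ox.
  rewrite (_ : (fun k => _) = (fun k => u (broken_fun (@w_ (Phi k) n.+1) x) i 0)); last first.
    by apply/funext => k; rewrite hrho_.
  exact: (cvg_comp_continuous (h := fun z => u z i 0) (u_coord_continuous hs (i := i)) (c Ox)).
Qed.

Lemma limit_scheme n : (n < Nt)%N -> limit_step Omega A f u eps (tau n.+1) l (rho n) (w n.+1).
Proof.
move=> nNt; have n1 : (1 <= n.+1 <= Nt)%N by [].
have [sw cg cw ct] := hw n1.
have [B HB] := scheme_bounded nNt.
have [K HK] := HA_bounded (w_ := fun m => @w_ m n.+1) (fun m => @scheme_w_Sp m n nNt) (fun m => (HB m).1).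
apply: (@limit_stepP R d N T Omega D A f s u gamma Cf rho0 hs p l (fun m => disc (Phi m)) l_ge1
  (fun m => hS (Phi m)) (cvg_subsequence hPhi (ds_cvg0 hdisc)) (fun m => @hSp (Phi m)) eta eps (tau n.+1)
  (fun m => rho_ (Phi m) n) (rho n) (w n.+1) (fun m => @w_ (Phi m) n.+1) (fun m => @sig_ (Phi m) n.+1) B K) => //.
- by move=> m; exact: hscheme.
- by move=> i j; exact: limit_comp_u_weak_derivative.
- by move=> m; have [] := HB (Phi m).
- by apply: filterS HK => x H Ox m; exact: H.
- by move=> m i j; exact: rho_sqint.
- by move=> i j; apply: (D_valued_sqint hs); [apply: rho_measurable; exact: ltnW|exact: rho_range].
- by move=> lam_ lam; exact: density_pairing_cvg.
Qed.

Lemma limit_entropy n : (n < Nt)%N ->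
  eps * tau n.+1 * sobolev_norm Omega l (w n.+1) ^+ 2
        + \int[leb d]_(x in Omega) s (u (w n.+1 x))
        + gamma * tau n.+1 * fine (Lpnorm Omega 2%:E (wgrad Omega (u \o w n.+1))) ^+ 2
        <= \int[leb d]_(x in Omega) s (rho n x) + Cf * tau n.+1 * fine (leb d Omega).
Proof.
move=> nNt; have n1 : (1 <= n.+1 <= Nt)%N by [].
have [sw cg cw ct] := hw n1.
apply: (entropy_step hs (htau nNt) l_ge1 _ _ sw _ (limit_scheme nNt)).
- by apply: rho_measurable; exact: ltnW.
- exact: rho_range.
- by move=> i j; exact: limit_comp_u_weak_derivative.
Qed.

Lemma limit_entropy_sum k : (k <= Nt)%N ->
  eps * (\sum_(0 <= n < k) tau n.+1 * sobolev_norm Omega l (w n.+1) ^+ 2)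
  + \int[leb d]_(x in Omega) s (rho k x)
  + gamma * (\sum_(0 <= n < k) tau n.+1 * fine (Lpnorm Omega 2%:E (wgrad Omega (u \o w n.+1))) ^+ 2)
  <= \int[leb d]_(x in Omega) s (rho0 x) + Cf * (\sum_(0 <= n < k) tau n.+1) * fine (leb d Omega).
Proof.
elim: k => [_|k IH kNt]; first by rewrite !big_geq// !mulr0 mul0r !addr0 add0r.
have := limit_entropy kNt; have := IH (ltnW kNt).
rewrite !(big_nat_recr k)//= -[\int[_]_(x in _) s (rho k.+1 x)]/(\int[leb d]_(x in Omega) s (u (w k.+1 x))).
move=> H1 H2; exact: (entropy_telescope H1 H2).
Qed.

End limits.
End scheme.
End convergence.

Theorem theorem4p1 (R : realType) (d N : nat) (T : R)
    (Omega : set 'cV[R]_d) (D : set 'cV[R]_N) (A : 'cV[R]_N -> 'M[R]_N)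
    (f : 'cV[R]_N -> 'cV[R]_N) (s : 'cV[R]_N -> R) (u : 'cV[R]_N -> 'cV[R]_N)
    (gamma Cf : R) (rho0 : 'cV[R]_d -> 'cV[R]_N)
    (hstruct : structural_assumptions T Omega D A f s u gamma Cf rho0)
    (eps : R) (heps : 0 < eps)
    (Nt : nat) (t : nat -> R) (ht0 : t 0%N = 0) (htT : t Nt = T)
    (ht : forall n, (n < Nt)%N -> t n < t n.+1)
    (tau : nat -> R) (htau : forall n, tau n.+1 = t n.+1 - t n)
    (p : nat) (disc : nat -> discretization R d)
    (hdisc : discretization_sequence Omega p disc)
    (eta : R) (heta : 0 < eta)
    (l : nat) (hl : l = sobolev_index d D A s)
    (hDG : @DG_assumption R d N Omega p l disc)
    (rho_init : forall m, broken (disc m) 'cV[R]_N)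
    (hinit : forall m, is_L2_projection Omega p rho0 (rho_init m))
    (w_ : forall m, nat -> broken (disc m) 'cV[R]_N)
    (sig_ : forall m, nat -> broken (disc m) 'M[R]_(N, d))
    (rho_ : nat -> nat -> 'cV[R]_d -> 'cV[R]_N)
    (hrho_ : forall m,
       rho_ m = density u (broken_fun (rho_init m)) (fun n => broken_fun (w_ m n)))
    (hscheme : forall m n, (n < Nt)%N ->
       dg_step Omega D A f s u eta eps (tau n.+1) p
         (rho_ m n) (w_ m n.+1) (sig_ m n.+1)) :
  (forall v : 'cV[R]_d -> 'cV[R]_N, sobolev Omega 1 v ->
     (fun m => \int[leb d]_(x in Omega) ip (rho0 x - rho_ m 0%N x) (v x))
       @ \oo --> (0 : R)) /\
  exists (phi : nat -> nat) (w : nat -> 'cV[R]_d -> 'cV[R]_N),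
  let rho := density u rho0 w in
  [/\ strictly_increasing phi,
      forall n, (1 <= n <= Nt)%N ->
        [/\ sobolev Omega l (w n),
            sobolev Omega 1 (u \o w n) &
            forall r : R, 1 <= r ->
              Lp_cvg Omega r%:E (fun m => rho_ (phi m) n) (rho n)],
      forall n, (n < Nt)%N ->
        limit_step Omega A f u eps (tau n.+1) l (rho n) (w n.+1),
      forall n, (n < Nt)%N ->
        eps * tau n.+1 * sobolev_norm Omega l (w n.+1) ^+ 2
        + \int[leb d]_(x in Omega) s (u (w n.+1 x))
        + gamma * tau n.+1
            * fine (Lpnorm Omega 2%:E (wgrad Omega (u \o w n.+1))) ^+ 2
        <= \int[leb d]_(x in Omega) s (rho n x)
           + Cf * tau n.+1 * fine (leb d Omega) &
        eps * (\sum_(0 <= n < Nt)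
                 tau n.+1 * sobolev_norm Omega l (w n.+1) ^+ 2)
        + \int[leb d]_(x in Omega) s (u (w Nt x))
        + gamma * (\sum_(0 <= n < Nt)
                 tau n.+1
                 * fine (Lpnorm Omega 2%:E (wgrad Omega (u \o w n.+1))) ^+ 2)
        <= \int[leb d]_(x in Omega) s (rho0 x) + Cf * T * fine (leb d Omega)].
Proof.
have hS m := ds_disc hdisc m.
have [hSp [nrm [hnrm hco hsup hcpt]]] := hDG.
have tau0 n : (n < Nt)%N -> 0 < tau n.+1 by move=> /ht; rewrite htau subr_gt0.
have oO := sa_open hstruct; have bO := sa_Omega_bounded hstruct.
split.
  move=> v sv; under eq_fun do rewrite hrho_ /=.
  apply: (L2_projection_cvg oO bO hS (ds_cvg0 hdisc) (rho0_sqint hstruct) _ hinit) => i j.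
  exact: (sobolev_sqint oO bO i j sv).
have [Phi [w [hP hw]]] := extract_limits hstruct hdisc hnrm hco hcpt heps heta tau0 hinit hrho_ hscheme (leqnn Nt).
have l1 := l_ge1 hl.
exists Phi, w; split => //.
- move=> n n1; have [sw _ _ _] := hw n n1; split => //.
    apply: (comp_u_sobolev hstruct (sobolevW l1 sw)) => i j.
    exact: (limit_comp_u_weak_derivative hstruct hdisc hl hw i j n1).
  by move=> r r1; exact: (density_cvg hstruct hdisc hrho_ hscheme hw n1 r1).
- by move=> n nNt; exact: (limit_scheme hstruct hdisc hl hSp hnrm hco hsup heps heta tau0 hinit hrho_ hscheme hP hw nNt).
- by move=> n nNt; exact: (limit_entropy hstruct hdisc hl hSp hnrm hco hsup heps heta tau0 hinit hrho_ hscheme hP hw nNt).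
- have := limit_entropy_sum hstruct hdisc hl hSp hnrm hco hsup heps heta tau0 hinit hrho_ hscheme hP hw (leqnn Nt).
  have -> : \sum_(0 <= n < Nt) tau n.+1 = T.
    by under eq_bigr do rewrite htau; rewrite telescope_sumr// htT ht0 subr0.
  (* [T > 0] excludes an empty partition; only for positive [Nt] is the final density [u \o w Nt]
     and not [rho0]. *)
  have Nt0 : (0 < Nt)%N.
    by rewrite lt0n; apply/eqP => N0; have := sa_time hstruct; rewrite -htT N0 ht0 ltxx.
  by rewrite -[in X in density _ _ _ X](prednK Nt0) /= prednK.
Qed.
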